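(* Let $\mathbf k$ be an algebraically closed field, $V$ an $\mathbb N$-graded vertex $\mathbf k$-algebra with an $\mathrm{Aut}\,\mathcal O$-action and a compatible Möbius structure, $C$ a nodal curve over $\mathbf k$, and $\eta\colon\widetilde C\to C$ its normalization. Then the canonical PD-connection $\{\widetilde\Theta_n\}_{n\ge0}$ on $\mathcal V_{\widetilde C}$ induces, via the functor $\eta_*$, a logarithmic PD-connection $$\Theta_n\colon\mathcal V_C\to\mathcal V_C\otimes\mathcal P^n_{C/\mathbf k,\log}\qquad(n\ge0)$$ on $\mathcal V_C$. (Here ''induces'' means: $\widetilde\Theta_n$ restricts to a map $\widetilde{\mathcal V}_{\widetilde C}\to\widetilde{\mathcal V}_{\widetilde C}\otimes\mathcal P^n_{\widetilde C/\mathbf k,\log}$; one applies $\eta_*$ and restricts to $\mathcal V_C\subset\eta_*\widetilde{\mathcal V}_{\widetilde C}$.)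
   Context: **Vertex algebras.** A vertex $\mathbf k$-algebra is a $\mathbf k$-module $V$ with $\mathbf 1\in V$ and a linear map $Y(\cdot,z)\colon V\to\mathrm{End}(V)[[z,z^{-1}]]$, $Y(a,z)=\sum_{n\in\mathbb Z}a_{(n)}z^{-1-n}$, such that $a_{(n)}b=0$ for $n\gg0$; $\mathbf 1_{(n)}a=\delta_{n,-1}a$; $a_{(-1)}\mathbf 1=a$ and $a_{(n)}\mathbf 1=0$ for $n\ge0$; and the Jacobi identity holds, equivalently for all $r,s\in\mathbb Z$: $[a_{(r)},b_{(s)}]=\sum_{j\ge0}\binom rj(a_{(j)}b)_{(r+s-j)}$ and $(a_{(r)}b)_{(s)}=\sum_{j\ge0}(-1)^j\binom rj\big(a_{(r-j)}b_{(s+j)}-(-1)^rb_{(r+s-j)}a_{(j)}\big)$. Put $T^{(n)}a=a_{(-1-n)}\mathbf 1$, $e^{zT}=\sum_nz^nT^{(n)}$. $V$ is $\mathbb N$-graded if $V=\bigoplus_{s\ge0}V_s$, $\mathbf 1\in V_0$, and $a_{(n)}$ has degree $\deg a-1-n$ for homogeneous $a$. **$\mathrm{Aut}\,\mathcal O$-actions.** $\mathrm{Aut}\,\mathcal O$ is the group (functor) of continuous automorphisms $\rho(t)=a_1t+a_2t^2+\cdots$ ($a_1$ a unit) of $\mathbf k[[t]]$. An action on $V$ is a representation $\Pi\colon\mathrm{Aut}\,\mathcal O\to GL_{\mathbf k}(V)$ such that, with $\Pi(\rho_z)=e^{-zT}\Pi(\rho)e^{\rho(z)T}$ and $G_pV=\bigoplus_{s\le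 p}V_s$: (i) all coefficients of $z^n$ in $\Pi(\rho_z)$ preserve $G_\bullet V$; (ii) $\Pi(\rho_z)a-(\rho'(z))^{-\Delta}a\in G_{\Delta-1}V[[z]]$ for $a\in V_\Delta$; (iii) $\Pi(t\mapsto xt)a=x^{-\deg a}a$ for $x\in\mathbf k^\times$; (iv) $\Pi(\rho)Y(\Pi(\rho_z)^{-1}a,\rho(z))\Pi(\rho)^{-1}=Y(a,z)$. **Möbius structure.** Operators $L_{\pm1}^{(n)},L_0^{(n)}$ on $V$, $n\ge0$, with $L^{(0)}_i=1$, $L_{-1}^{(n)}=T^{(n)}$, $L_0^{(n)}$ acting on $V_s$ as $\binom{-2s}{n}$, $L_1^{(n)}$ of degree $-n$, $L_{1}^{(m)}L_1^{(n)}=\binom{m+n}nL_1^{(m+n)}$, $L_1^{(m)}L_{-1}^{(n)}=\sum_{i=0}^{\min(m,n)}\sum_{j=0}^i\binom{-m-n+2i}{j}(-1)^iL_{-1}^{(n-i)}L_0^{(i-j)}L_1^{(m-i)}$, $L_1^{(n)}\mathbf 1=\delta_{n,0}\mathbf 1$, and $e^{zL_1}Y(a,z_0)e^{-zL_1}=Y\big(e^{z(1-zz_0)L_1}(1-zz_0)^{-2L_0}a,\tfrac{z_0}{1-zz_0}\big)$, where $e^{zL_1}=\sum z^nL_1^{(n)}$, $(1+z)^{-2L_0}=\sum z^nL_0^{(n)}$. Compatible means that for $\gamma(z)=\frac1{1+z}-1$ one has $\Pi(\gamma)a=(-1)^{\deg a}\sum_iL_1^{(i)}a$. **Vertex algebra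 sheaves.** For a smooth curve $\widetilde C$ let $\pi\colon\mathscr{A}ut_{\widetilde C}\to\widetilde C$ be the $\mathrm{Aut}\,\mathcal O$-torsor of pairs (point, formal coordinate); $\mathcal V_{\widetilde C}=(V\otimes\pi_*\mathcal O_{\mathscr{A}ut_{\widetilde C}})^{\mathrm{Aut}\,\mathcal O}$; a coordinate $t$ on an open $U$ gives $\mathcal V_{\widetilde C}|_U\simeq_tV\otimes\mathcal O_U$. If $Q$ is a node of $C$ with preimages $Q_\pm$ and formal coordinates $s_\pm$ there, $\widetilde{\mathcal V}_{\widetilde C}\subset\mathcal V_{\widetilde C}$ is the subsheaf equal to $\mathcal V_{\widetilde C}$ away from the preimages of nodes and equal to $\bigoplus_{k\ge0}V_k\otimes s_\pm^k\mathbf k[[s_\pm]]$ on the formal neighbourhood of $Q_\pm$. The sheaf $\mathcal V_C\subset\eta_*\widetilde{\mathcal V}_{\widetilde C}$ agrees with it away from nodes, and on the formal neighbourhood $\mathrm{Spf}\,\mathbf k[[s_+,s_-]]/(s_+s_-)$ of $Q$ it is spanned by $\big(a\otimes s_+^{\deg a},(-1)^{\deg a}\sum_{i\ge0}L_1^{(i)}a\otimes s_-^{\deg a-i}\big)$ and $\big(b\otimes s_+^{\deg b+1}f(s_+),c\otimes s_-^{\deg c+1}g(s_-)\big)$ for homogeneous $a,b,c\in V$ and power series $f,g$. **Principal parts and the PD-connection on $\mathcal V_{\widetilde C}$.** $\mathcal P^n_{\widetilde C/\mathbf k}=(\mathcal O\otimes_{\mathbf k}\mathcal O)/\mathcal J^{n+1}$,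 $\mathcal J$ the kernel of multiplication; $\delta(a)=1\otimes a-a\otimes1$. For a coordinate $t$, $\widetilde\Theta_n(a\otimes f)=\sum_{0\le i\le j\le n}T^{(i)}a\otimes\partial_t^{(j-i)}f\otimes(\delta t)^j$, with $\partial_t^{(j)}$ divided-power derivatives; this is independent of $t$. **Logarithmic principal parts.** $\mathcal P^n_{C/\mathbf k,\log}$ equals $\mathcal P^n_{C/\mathbf k}$ away from nodes; on the formal neighbourhood of a node it is the $\mathbf k[[s_+,s_-]]/(s_+s_-)$-algebra generated by $\delta_{\log}s_\pm$ with relations $\delta_{\log}s_++\delta_{\log}s_-+\delta_{\log}s_+\,\delta_{\log}s_-=0$ and $(\delta_{\log}s_\pm)^{n+1}=0$, and $\delta s_\pm=s_\pm\delta_{\log}s_\pm$. $\mathcal P^n_{\widetilde C/\mathbf k,\log}$ is $\mathcal P^n_{\widetilde C/\mathbf k}$ away from the $Q_\pm$, and near $Q_\pm$ is generated by $\delta_{\log}s_\pm$ (with $(\delta_{\log}s_\pm)^{n+1}=0$, $\delta s_\pm=s_\pm\delta_{\log}s_\pm$). There are maps $d_0^n$ (left algebra structure) and $d_1^n(a)=a+\delta(a)$ from $\mathcal O$, projections $\varphi_{m,n}\colon\mathcal P^n_{\log}\to\mathcal P^m_{\log}$, and comultiplications $\delta^{m,n}\colon\mathcal P^{m+n}_{\log}\to\mathcal P^m_{\log}\otimes\mathcal P^n_{\log}$ given by $\delta(a)\mapsto\delta(a)\otimes1+1\otimes\delta(a)$, $\delta_{\log}(m)\mapsto\delta_{\log}(m)\otimes1+1\otimes\delta_{\log}(m)+\delta_{\log}(m)\otimes\delta_{\log}(m)$.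 **Logarithmic PD-connection** on $\mathcal E$: right $\mathcal O$-linear maps $\Theta_n\colon\mathcal E\to\mathcal E\otimes\mathcal P^n_{\log}$, $n\ge0$ ($\mathcal O$ acting on the target through $d_1^n$), with $\Theta_0=\mathrm{id}$, $(\mathrm{id}\otimes\varphi_{m,n})\Theta_n=\Theta_m$ for $n\ge m$, and $(\Theta_m\otimes\mathrm{id})\Theta_n=(\mathrm{id}\otimes\delta^{m,n})\Theta_{m+n}$. *)

(* Defs.v *)
From HB Require Import structures.
From mathcomp Require Import all_boot all_order all_algebra.
From mathcomp Require Import boolp classical_sets functions topology.

Set Implicit Arguments.
Unset Strict Implicit.
Unset Printing Implicit Defensive.

Import GRing.Theory.
Local Open Scope classical_set_scope.
Local Open Scope ring_scope.

(* Schemes, formal neighbourhoods and sheaves are not available in the library.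
   Since k is algebraically closed and every scheme below is reduced and of
   finite type, curves are treated as varieties in Serre's sense: the space of
   closed points with its sheaf of k-valued regular functions.  Sections over an
   open U are represented by total functions, of which only the values over U
   matter.  The point-wise representation extends to the pro-scheme of pairs
   (point, formal coordinate), which is reduced as well. *)

(* Finite sums of elements of G; every G below is stable under scaling by k. *)
Inductive zspan (M : zmodType) (G : set M) : set M :=
| zspan0 : zspan G 0
| zspanD x y : G x -> zspan G y -> zspan G (x + y).

(* binom(r, j) for r : int, with binom(-m-1, j) = (-1)^j binom(m+j, j). *)
Definition gbin (r : int) (j : nat) : int :=
  match r with
  | Posz m => 'C(m, j)%:Z
  | Negz m => (-1) ^+ j * 'C(m + j, j)%:Z
  end.

Definition eventually_sum (M : zmodType) (F : nat -> M) (v : M) : Prop :=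
  exists N0, forall N, (N0 <= N)%N -> \sum_(j < N) F j = v.

Section Series.
Variable k : fieldType.

Definition ser := nat -> k.

Definition scst (c : k) : ser := fun n => if n == 0%N then c else 0.
Definition sX : ser := fun n => (n == 1%N)%:R.
Definition sadd (f g : ser) : ser := fun n => f n + g n.
Definition smul (f g : ser) : ser :=
  fun n => \sum_(i < n.+1) f i * g (n - i)%N.
Definition sexp (f : ser) (m : nat) : ser := iter m (smul f) (scst 1).

(* f(rho(t)), for rho(0) = 0 *)
Definition scomp (f rho : ser) : ser :=
  fun n => \sum_(m < n.+1) f m * sexp rho m n.

(* 1/f for f(0) <> 0, from the geometric series in 1 - f/f(0) *)
Definition sinv (f : ser) : ser :=
  fun n => (f 0%N)^-1 *
    scomp (fun=> 1) (fun m => if m == 0%N then 0 else - (f m / f 0%N)) n.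

Definition szexp (f : ser) (m : int) : ser :=
  match m with Posz j => sexp f j | Negz j => sexp (sinv f) j.+1 end.

(* divided-power derivative f^(m)/m! *)
Definition shasse (m : nat) (f : ser) : ser :=
  fun n => 'C(n + m, m)%:R * f (n + m)%N.

(* t^m f(t) *)
Definition sshift (m : nat) (f : ser) : ser :=
  fun n => if (m <= n)%N then f (n - m)%N else 0.

(* The group of k-points of Aut O. *)
Definition AutO : set ser := [set rho | rho 0%N = 0 /\ rho 1%N <> 0].

(* Coefficient of z^l in rho(z)^m, for rho in AutO and l, m : int. *)
Definition laurpow (rho : ser) (m l : int) : k :=
  match (l - m)%R with
  | Posz j => szexp (fun n => rho n.+1) m j
  | Negz _ => 0
  end.

(* 1/(1+t) - 1 *)
Definition sgamma : ser := fun n => if n == 0%N then 0 else (-1) ^+ n.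

(* Syntax for the regular functions on Aut O, i.e. for the elements of the ring
   k[a_1, 1/a_1, a_2, a_3, ...]. *)
Inductive autfun :=
| AFconst of k
| AFcoef of nat          (* AFcoef n stands for a_(n+1) *)
| AFinv1
| AFadd of autfun & autfun
| AFmul of autfun & autfun.

(* Value at the k[[z]]-point whose n-th coefficient is the series c n. *)
Fixpoint afeval (c : nat -> ser) (e : autfun) : ser :=
  match e with
  | AFconst x => scst x
  | AFcoef n => c n.+1
  | AFinv1 => sinv (c 1%N)
  | AFadd e1 e2 => sadd (afeval c e1) (afeval c e2)
  | AFmul e1 e2 => smul (afeval c e1) (afeval c e2)
  end.

Definition afeval0 (rho : ser) (e : autfun) : k :=
  afeval (fun n => scst (rho n)) e 0%N.

(* Value at the k[[z]]-point rho_z(t) = rho(z+t) - rho(z). *)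
Definition afevalz (rho : ser) (e : autfun) : ser :=
  afeval (fun n => shasse n rho) e.

End Series.

Section Grading.
Variables (k : fieldType) (V : lmodType k) (gr : nat -> set V).

(* the sum of the gr s, s < n; thus G_p V is Glt p.+1 *)
Definition Glt (n : nat) : set V :=
  [set v | exists c : nat -> V, (forall s, gr s (c s)) /\ v = \sum_(s < n) c s].

Definition grZ (d : int) : set V :=
  match d with Posz s => gr s | Negz _ => [set 0] end.

Definition is_grading : Prop :=
  [/\ forall s, gr s 0,
      forall s (c : k) u v, gr s u -> gr s v -> gr s (c *: u + v),
      forall v, exists n, Glt n v
    & forall n (c : nat -> V), (forall s, gr s (c s)) ->
        \sum_(s < n) c s = 0 -> forall s, (s < n)%N -> c s = 0].
End Grading.

(* vprod a n b is a_(n) b. *)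
Record gradedVA (k : fieldType) (V : lmodType k) := GradedVA {
  vac : V;
  vprod : V -> int -> V -> V;
  vgr : nat -> set V;
  vprod_linl : forall n b, linear (fun a => vprod a n b);
  vprod_linr : forall a n, linear (vprod a n);
  vprod_trunc : forall a b, exists n0 : int, forall n, (n0 <= n)%R ->
    vprod a n b = 0;
  vac_l : forall n a, vprod vac n a = if n == -1 then a else 0;
  vac_r : forall a, vprod a (-1) vac = a;
  vac_r0 : forall a (n : nat), vprod a n%:Z vac = 0;
  vcomm : forall (a b c : V) (r s : int),
    eventually_sum
      (fun j : nat => vprod (vprod a j%:Z b) (r + s - j%:Z) c *~ gbin r j)
      (vprod a r (vprod b s c) - vprod b s (vprod a r c));
  vassoc : forall (a b c : V) (r s : int),
    eventually_sum
      (fun j : nat =>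
         (vprod a (r - j%:Z) (vprod b (s + j%:Z) c)
          - vprod b (r + s - j%:Z) (vprod a j%:Z c) *~ (-1) ^+ `|r|%N)
         *~ ((-1) ^+ j * gbin r j))
      (vprod (vprod a r b) s c);
  vgr_grading : is_grading vgr;
  vgr_vac : vgr 0%N vac;
  vgr_prod : forall (p q : nat) (n : int) a b, vgr p a -> vgr q b ->
    grZ vgr (p%:Z + q%:Z - 1 - n) (vprod a n b)
}.

Section VertexOps.
Variables (k : fieldType) (V : lmodType k) (A : gradedVA V).

(* T^(n) a = a_(-1-n) 1 *)
Definition Tdp (n : nat) (a : V) : V := vprod A a (-1 - n%:Z) (vac A).

Section Pi.
Variables Pi Pinv : ser k -> V -> V.

(* Coefficient of z^n in e^(-zT) Pi(rho) e^(rho(z)T) a. *)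
Definition Piz (rho : ser k) (n : nat) (a : V) : V :=
  \sum_(i < n.+1) (-1) ^+ i *:
    Tdp i (Pi rho (\sum_(m < (n - i).+1) sexp rho m (n - i)%N *: Tdp m a)).

(* Coefficient of z^n in its inverse e^(-rho(z)T) Pi(rho)^-1 e^(zT) a. *)
Definition Pizinv (rho : ser k) (n : nat) (a : V) : V :=
  \sum_(i < n.+1) \sum_(m < i.+1)
    ((-1) ^+ m * sexp rho m i) *: Tdp m (Pinv rho (Tdp (n - i)%N a)).
End Pi.

(* The group law is composition of automorphisms of k[[t]]: if rho, mu send t to
   rho(t), mu(t), then rho o mu sends t to mu(rho(t)).  "Representation of the
   group functor" is expressed by actAlg: the matrix coefficients are regular
   functions, and the value of the representation at the k[[z]]-point rho_z is
   e^(-zT) Pi(rho) e^(rho(z)T). *)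
Record autOAction := AutOAction {
  Pi : ser k -> V -> V;
  Pinv : ser k -> V -> V;
  act_lin : forall rho, AutO rho -> linear (Pi rho);
  act_invl : forall rho, AutO rho -> cancel (Pi rho) (Pinv rho);
  act_invr : forall rho, AutO rho -> cancel (Pinv rho) (Pi rho);
  act1 : forall a, Pi (sX k) a = a;
  actM : forall rho mu a, AutO rho -> AutO mu ->
    Pi (scomp mu rho) a = Pi rho (Pi mu a);
  actAlg : forall a, exists N (e : 'I_N -> autfun k) (v : 'I_N -> V),
    forall rho, AutO rho ->
      Pi rho a = \sum_i afeval0 rho (e i) *: v i /\
      forall n, Piz Pi rho n a = \sum_i afevalz rho (e i) n *: v i;
  act_filtered : forall rho n p a, AutO rho ->
    Glt (vgr A) p.+1 a -> Glt (vgr A) p.+1 (Piz Pi rho n a);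
  act_symbol : forall rho n (d : nat) a, AutO rho -> vgr A d a ->
    Glt (vgr A) d (Piz Pi rho n a - szexp (shasse 1 rho) (- d%:Z) n *: a);
  act_scale : forall (x : k) (d : nat) a, x != 0 -> vgr A d a ->
    Pi (fun n => if n == 1%N then x else 0) a = x^-1 ^+ d *: a;
  (* coefficient of z^l; only finitely many pairs (m, n) contribute *)
  act_conj : forall rho a b (l : int), AutO rho ->
    exists N0, forall N, (N0 <= N)%N ->
      Pi rho (\sum_(m < N) \sum_(i < N + N)
                let n := i%:Z - N%:Z in
                laurpow rho (-1 - n) (l - m%:Z) *:
                  vprod A (Pizinv Pinv rho m a) n (Pinv rho b))
      = vprod A a (-1 - l) b
}.

Record moebius := Moebius {
  L1 : nat -> V -> V;
  L0 : nat -> V -> V;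
  L1_lin : forall n, linear (L1 n);
  L0_lin : forall n, linear (L0 n);
  L1_0 : forall a, L1 0 a = a;
  L0_0 : forall a, L0 0 a = a;
  L0_gr : forall n (s : nat) a, vgr A s a ->
    L0 n a = a *~ gbin (- (2 * s)%:Z) n;
  L1_gr : forall n (s : nat) a, vgr A s a -> grZ (vgr A) (s%:Z - n%:Z) (L1 n a);
  L1_mul : forall m n a, L1 m (L1 n a) = L1 (m + n) a *+ 'C(m + n, n);
  L1_T : forall (m n : nat) a,
    L1 m (Tdp n a) =
    \sum_(i < (minn m n).+1) \sum_(j < i.+1)
      Tdp (n - i)%N (L0 (i - j)%N (L1 (m - i)%N a))
        *~ (gbin ((2 * i)%:Z - m%:Z - n%:Z) j * (-1) ^+ i);
  L1_vac : forall n, L1 n (vac A) = if n == 0%N then vac A else 0;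
  (* coefficient of z^p z_0^q; on the right hand side the (i,m,l)-th summand is
     the part of Y(z^i (1-zz_0)^i L_1^(i) (-zz_0)^m L_0^(m) a, z_0/(1-zz_0)) b
     with z^p = z^i z^m z^l and n = m + l - 1 - q *)
  L1_conj : forall (p : nat) (q : int) a b,
    \sum_(j < p.+1) (-1) ^+ j *:
        L1 (p - j)%N (vprod A a (-1 - q) (L1 j b)) =
    \sum_(i < p.+1) \sum_(m < p.+1) \sum_(l < p.+1 | (i + m + l)%N == p)
      let n := m%:Z + l%:Z - 1 - q in
      vprod A (L1 i (L0 m a)) n b *~ ((-1) ^+ (m + l) * gbin (i%:Z + n + 1) l)
}.

Definition compatible (R : autOAction) (L : moebius) : Prop :=
  forall (d : nat) a, vgr A d a ->
    Pi R (sgamma k) a = (-1) ^+ d *: \sum_(i < d.+1) L1 L i a.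

(* The series v (x) f(s) in V (x) k[[s]]. *)
Definition svec (f : ser k) (v : V) : nat -> V := fun n => f n *: v.

(* The direct sum of the V_d (x) s^d k[[s]]. *)
Definition lattice : set (nat -> V) :=
  zspan [set S | exists d a f, vgr A d a /\ S = svec (sshift d f) a].

(* The completion at a node, inside V (x) k[[s_+]] x V (x) k[[s_-]]. *)
Definition node_lattice (L : moebius) : set ((nat -> V) * (nat -> V)) :=
  zspan [set S |
    (exists d a, vgr A d a /\
       S = (svec (sshift d (scst 1)) a,
            (-1) ^+ d *: \sum_(i < d.+1)
               svec (sshift (d - i)%N (scst 1)) (L1 L i a))) \/
    (exists d b f e c g, [/\ vgr A d b, vgr A e c &
       S = (svec (sshift d.+1 f) b, svec (sshift e.+1 g) c)])].

End VertexOps.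

(* reg U f: the restriction of f to the open set U is regular *)
Record funSpace (k : fieldType) := FunSpace {
  fpt :> topologicalType;
  reg : set fpt -> set (fpt -> k)
}.

Section Varieties.
Variable (k : fieldType).

(* The k-subalgebra generated by G. *)
Inductive subalg (T : Type) (G : set (T -> k)) : set (T -> k) :=
| subalg_const c : subalg G (fun=> c)
| subalg_gen f : G f -> subalg G f
| subalg_add f g : subalg G f -> subalg G g -> subalg G (fun x => f x + g x)
| subalg_mul f g : subalg G f -> subalg G g -> subalg G (fun x => f x * g x).

Section Space.
Variable X : funSpace k.
Implicit Types (U W : set X) (f g : X -> k) (P : X).

Definition sheaf_of_functions : Prop :=
  [/\ forall U c, open U -> reg U (fun=> c),
      forall U f g, open U -> reg U f -> reg U g ->
        reg U (fun x => f x + g x) /\ reg U (fun x => f x * g x),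
      forall U f g, open U -> reg U f -> (forall x, U x -> f x = g x) ->
        reg U g,
      forall U W f, open U -> open W -> W `<=` U -> reg U f -> reg W f
    & forall U f, open U ->
        (forall x, U x -> exists W, [/\ open W, W x & reg W f]) -> reg U f].

(* (U, reg) is the maximal spectrum of the finitely generated algebra reg U. *)
Definition affine U : Prop :=
  [/\ open U,
      exists N (s : 'I_N -> X -> k), (forall i, reg U (s i)) /\
        forall f, reg U f -> exists2 g, subalg [set s i | i in [set: 'I_N]] g
          & forall x, U x -> f x = g x,
      forall chi : (X -> k) -> k,
        [/\ forall c, chi (fun=> c) = c,
            forall f g, reg U f -> reg U g ->
              chi (fun x => f x + g x) = chi f + chi g /\
              chi (fun x => f x * g x) = chi f * chi g
          & forall f g, reg U f -> (forall x, U x -> f x = g x) ->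
              chi f = chi g] ->
        exists! x, U x /\ forall f, reg U f -> chi f = f x,
      forall W, W `<=` U -> (open W <->
        forall x, W x -> exists f, [/\ reg U f, f x != 0 &
          forall y, U y -> f y != 0 -> W y])
    & forall W f, open W -> W `<=` U -> (reg W f <->
        forall x, W x -> exists N a b, [/\ open N, N x, reg U a, reg U b &
          forall y, N y -> b y != 0 /\ f y = a y / b y])].

Definition variety : Prop :=
  [/\ sheaf_of_functions,
      exists N (U : 'I_N -> set X), (forall i, affine (U i)) /\
        forall x, exists i, U i x
      (* the diagonal of X x X is closed *)
    & forall x y U W, x <> y -> affine U -> affine W -> U x -> W y ->
        exists N (f g : 'I_N -> X -> k),
          [/\ forall i, reg U (f i) /\ reg W (g i),
              \sum_i f i x * g i y != 0
            & forall z, U z -> W z -> \sum_i f i z * g i z = 0]].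

Definition germ P f : Prop := exists W, [/\ open W, W P & reg W f].

(* The n-th power of the maximal ideal of the local ring at P. *)
Definition maxpow P (n : nat) f : Prop :=
  exists W f', [/\ open W, W P, forall x, W x -> f x = f' x &
    zspan [set u : X -> k | exists g (h : 'I_n -> X -> k),
       [/\ germ P g, forall l, germ P (h l) /\ h l P = 0
         & u = fun x => g x * \prod_l h l x]] f'].

(* tau exhibits { (f_b) in k[[t]]^B | f_b(0) = f_b'(0) for all b, b' }
   as the completion of the local ring at P.  This ring is k[[t]] for B = unit
   and k[[s_+, s_-]]/(s_+ s_-) for B = bool (restrict a series to the two axes);
   its n-th power of the maximal ideal consists of the families all of whose
   members are divisible by t^n. *)
Definition completion_map (B : Type) P (tau : (X -> k) -> B -> ser k) : Prop :=
  [/\ forall c b, tau (fun=> c) b = scst c,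
      forall f g b, germ P f -> germ P g ->
        tau (fun x => f x + g x) b = sadd (tau f b) (tau g b) /\
        tau (fun x => f x * g x) b = smul (tau f b) (tau g b),
      forall f b b', germ P f -> tau f b 0%N = tau f b' 0%N,
      forall n f, germ P f ->
        ((forall b i, (i < n)%N -> tau f b i = 0) <-> maxpow P n f)
    & forall n (g : B -> ser k), (forall b b', g b 0%N = g b' 0%N) ->
        exists2 f, germ P f & forall b i, (i < n)%N -> tau f b i = g b i].

Definition smooth_point P : Prop := exists tau, @completion_map unit P tau.
Definition node P : Prop := exists tau, @completion_map bool P tau.

Definition nodal_curve : Prop :=
  variety /\ forall P, smooth_point P \/ node P.
Definition smooth_curve : Prop := variety /\ forall P, smooth_point P.

(* A formal coordinate at P, given by the expansion of germs in it; the second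
   condition makes tau unique as a function on X -> k. *)
Definition formal_coord P (tau : (X -> k) -> ser k) : Prop :=
  completion_map P (fun f (_ : unit) => tau f) /\
  forall f, ~ germ P f -> tau f = (fun=> 0).

(* t - t(P) is a uniformizer at P, and tau is the expansion in powers of it;
   thus tau f n is the divided-power derivative of f of order n at P with respect
   to t. *)
Definition centred (t : X -> k) P (tau : (X -> k) -> ser k) : Prop :=
  formal_coord P tau /\ tau t = sadd (scst (t P)) (sX k).

Definition coordinate U (t : X -> k) : Prop :=
  reg U t /\ forall P, U P -> exists tau, centred t P tau.

(* Points of the Aut O-torsor of pairs (point, formal coordinate). *)
Record autTorsor := AutTorsor {
  apt : X;
  acoord : (X -> k) -> ser k;
  acoordP : formal_coord apt acoord
}.

End Space.

Section Normalization.
Variables (X Y : funSpace k) (eta : Y -> X).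

Definition morphism_of_varieties : Prop :=
  forall U, open U -> open (eta @^-1` U) /\
    forall f, reg U f -> reg (eta @^-1` U) (f \o eta).

Definition finite_morphism : Prop :=
  forall U, affine U -> affine (eta @^-1` U) /\
    exists N (g : 'I_N -> Y -> k), (forall i, reg (eta @^-1` U) (g i)) /\
      forall f, reg (eta @^-1` U) f ->
        exists c : 'I_N -> X -> k, (forall i, reg U (c i)) /\
          forall y, U (eta y) -> f y = \sum_i c i (eta y) * g i y.

Definition iso_over (U : set X) : Prop :=
  [/\ forall x, U x -> exists! y, eta y = x,
      forall W, W `<=` U -> open (eta @^-1` W) -> open W
    & forall W f, W `<=` U -> open W ->
        reg (eta @^-1` W) (f \o eta) -> reg W f].

Definition normalization : Prop :=
  [/\ smooth_curve Y, morphism_of_varieties, finite_morphism &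
      exists U, [/\ open U, dense U, dense (eta @^-1` U) & iso_over U]].

(* For every node Q a labelling Q_+, Q_- of its preimages, with formal coordinates
   s_+, s_- there. *)
Record branches := Branches {
  brp : X -> Y;
  brm : X -> Y;
  scp : X -> (Y -> k) -> ser k;
  scm : X -> (Y -> k) -> ser k;
  br_fiber : forall Q, node Q ->
    brp Q <> brm Q /\ forall P, eta P = Q <-> P = brp Q \/ P = brm Q;
  br_coord : forall Q, node Q ->
    formal_coord (brp Q) (scp Q) /\ formal_coord (brm Q) (scm Q);
  (* the formal neighbourhood of Q is Spf k[[s_+, s_-]]/(s_+ s_-) *)
  br_formal : forall Q, node Q ->
    completion_map Q
      (fun f (b : bool) => if b then scp Q (f \o eta) else scm Q (f \o eta))
}.

Definition over_node (b : branches) (P : Y) (tau : (Y -> k) -> ser k) : Prop :=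
  exists2 Q, node Q &
    (P = brp b Q /\ tau = scp b Q) \/ (P = brm b Q /\ tau = scm b Q).

(* The open set Y minus the preimages of the nodes, intersected with U. *)
Definition off_nodes (U : set Y) : set Y := [set P | U P /\ ~ node (eta P)].

End Normalization.
End Varieties.

(* E is a sheaf of O_X-modules whose sections are M-valued functions on a space
   B over X.  Then E(W) (x)_k O(W) is realized by the functions
   (q, y) |-> sum_i g_i(y) sigma_i(q) on B x X, and E (x) P^n by these modulo
   J^(n+1), because E (x)_O (O (x)_k O) = E (x)_k O.  The sheaf P^n itself is the
   case E = O, B = X.  A section of the (sheafified) quotient is given by a
   coherent family of representatives, one for the germ at each point. *)
Section PrincipalParts.
Variables (k : fieldType) (X : funSpace k).

(* The kernel of multiplication O(W) (x) O(W) -> O(W). *)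
Definition Jker (W : set X) (F : X -> X -> k) : Prop :=
  exists N (f g : 'I_N -> X -> k),
    [/\ forall i, reg W (f i) /\ reg W (g i),
        F = (fun x y => \sum_i f i x * g i y)
      & forall x, W x -> F x x = 0].

Variables (B : Type) (pi : B -> X) (M : lmodType k).
Variable E : set X -> set (B -> M).

Definition tensO (W : set X) (Phi : B -> X -> M) : Prop :=
  exists N (sg : 'I_N -> B -> M) (g : 'I_N -> X -> k),
    (forall i, E W (sg i) /\ reg W (g i)) /\
    forall q y, W (pi q) -> W y -> Phi q y = \sum_i g i y *: sg i q.

(* Equality of the germs at P in E (x) P^n. *)
Definition modJ (n : nat) (P : X) (Phi Psi : B -> X -> M) : Prop :=
  exists W D, [/\ open W, W P,
    zspan [set D : B -> X -> M |
      exists sg g (F : 'I_n.+1 -> X -> X -> k),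
        [/\ E W sg, reg W g, forall l, Jker W (F l) &
            D = fun q y => (g y * \prod_l F l (pi q) y) *: sg q]] D
    & forall q y, W (pi q) -> W y -> Phi q y - Psi q y = D q y].

Definition pp_section (n : nat) (U : set X) (Phi : X -> B -> X -> M) : Prop :=
  forall P, U P -> exists W, [/\ open W, W P, W `<=` U, tensO W (Phi P) &
    forall R, W R -> modJ n R (Phi R) (Phi P)].

Definition pp_eq (n : nat) (U : set X) (Phi Psi : X -> B -> X -> M) : Prop :=
  forall P, U P -> modJ n P (Phi P) (Psi P).

(* Equality of the germs at P in E (x) P^m (x) P^n, the second tensor product
   being formed with the right structure of P^m and the left structure of P^n. *)
Definition modJJ (m n : nat) (P : X) (Phi Psi : B -> X -> X -> M) : Prop :=
  exists W D, [/\ open W, W P,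
    zspan [set D : B -> X -> X -> M |
      exists sg g h, [/\ E W sg, reg W g, reg W h &
        (exists2 F : 'I_m.+1 -> X -> X -> k, forall l, Jker W (F l) &
           D = fun q y z => (g y * h z * \prod_l F l (pi q) y) *: sg q) \/
        (exists2 F : 'I_n.+1 -> X -> X -> k, forall l, Jker W (F l) &
           D = fun q y z => (g y * h z * \prod_l F l y z) *: sg q)]] D
    & forall q y z, W (pi q) -> W y -> W z -> Phi q y z - Psi q y z = D q y z].

End PrincipalParts.

Section VertexSheaves.
Variables (k : fieldType) (V : lmodType k) (A : gradedVA V).
Variables (R : autOAction A) (L : moebius A).

Section OnSmoothCurve.
Variable X : funSpace k.

(* q' = q . rho, i.e. the coordinate of q' is rho(t) if that of q is t *)
Definition torsor_act (q : autTorsor X) (rho : ser k) (q' : autTorsor X) :=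
  apt q = apt q' /\ forall f, acoord q f = scomp (acoord q' f) rho.

(* Regular functions on the restriction of the torsor to W: if t is a coordinate
   on W, these form O(W)[b_1, 1/b_1, b_2, ...] with b_n(q) = acoord q t n. *)
Definition reg_torsor (W : set X) (h : autTorsor X -> k) : Prop :=
  exists a b, [/\
    subalg [set u | exists f n, reg W f /\ u = fun q => acoord q f n] a,
    subalg [set u | exists f n, reg W f /\ u = fun q => acoord q f n] b
  & forall q, W (apt q) -> b q != 0 /\ h q = a q / b q].

(* (V (x) pi_* O)^(Aut O) *)
Definition Vsheaf (U : set X) (sg : autTorsor X -> V) : Prop :=
  (forall q rho q', U (apt q) -> AutO rho -> torsor_act q rho q' ->
     sg q' = Pinv R rho (sg q)) /\
  forall P, U P -> exists W N (h : 'I_N -> autTorsor X -> k) (v : 'I_N -> V),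
    [/\ open W, W P, forall i, reg_torsor W (h i) &
        forall q, W (apt q) -> sg q = \sum_i h i q *: v i].

(* In the trivialization of the V-sheaf over W given by the coordinate t, the
   section sg is sum_i a_i (x) f_i. *)
Definition trivialized (W : set X) (t : X -> k) (sg : autTorsor X -> V)
    (N : nat) (a : 'I_N -> V) (f : 'I_N -> X -> k) : Prop :=
  (forall i, reg W (f i)) /\
  forall q, W (apt q) -> centred t (apt q) (acoord q) ->
    sg q = \sum_i f i (apt q) *: a i.

(* The expansion S in V (x) k[[s]] of sg at Q, in the trivialization given by the
   formal coordinate s at Q with expansion map tau.  If t is a coordinate near Q
   with t(Q) = 0 and t = mu(s), the trivializations are related by Pi(mu_s). *)
Definition expansion (Q : X) (tau : (X -> k) -> ser k)
    (sg : autTorsor X -> V) (S : nat -> V) : Prop :=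
  exists W t N (a : 'I_N -> V) (f : 'I_N -> X -> k),
    [/\ open W, W Q, coordinate W t /\ t Q = 0, trivialized W t sg a f &
        forall n, S n = \sum_(m < n.+1)
          Piz A (Pi R) (tau t) m (\sum_i tau (f i) (n - m)%N *: a i)].

(* The PD-connection: in any coordinate t,
     a (x) f |-> sum_(j <= n) sum_(i <= j) T^(i) a (x) d_t^(j-i) f (x) (dt)^j,
   where w j is the section with trivialization sum_(i <= j) T^(i) a (x) ... *)
Definition canonical_connection
    (Th : nat -> (autTorsor X -> V) -> X -> autTorsor X -> X -> V) : Prop :=
  forall n U sg, open U -> Vsheaf U sg ->
    pp_section (@apt _ X) Vsheaf n U (Th n sg) /\
    forall W t N (a : 'I_N -> V) (f : 'I_N -> X -> k),
      open W -> W `<=` U -> coordinate W t -> trivialized W t sg a f ->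
      exists2 w : nat -> autTorsor X -> V,
        (forall j, (j <= n)%N -> Vsheaf W (w j) /\
           forall q, W (apt q) -> centred t (apt q) (acoord q) ->
             w j q = \sum_(i < j.+1) \sum_l
                       acoord q (f l) (j - i)%N *: Tdp A i (a l)) &
        forall P, W P -> modJ (@apt _ X) Vsheaf n P (Th n sg P)
          (fun q y => \sum_(j < n.+1) (t y - t (apt q)) ^+ j *: w j q).

(* f, a function on a punctured neighbourhood of Q, has expansion s^(-N) A(s). *)
Definition polar_expansion (Q : X) (tau : (X -> k) -> ser k) (f : X -> k)
    (N : nat) (F : ser k) : Prop :=
  exists h g W, [/\ open W, W Q, reg W h /\ reg W g,
    forall x, W x -> x <> Q -> f x * h x = g x &
    tau h <> (fun=> 0) /\ smul (tau h) F = sshift N (tau g)].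

(* The section p of P^n on a punctured neighbourhood of Q is
   sum_(j <= n) c_j(s) (dlog s)^j on the formal neighbourhood, c_j in k[[s]].
   As 1 (x) s = s (1 + dlog s), a representative sum_i F_i (x) G_i with F_i, G_i in
   s^(-D) k[[s]] has c_j = sum_i F_i G_i^[j], [j] being multiplication of s^m by
   binom(m, j). *)
Definition log_expansion (Q : X) (tau : (X -> k) -> ser k) (n : nat)
    (p : X -> X -> X -> k) (c : nat -> ser k) : Prop :=
  exists W D N (f g : 'I_N -> X -> k) (F G : 'I_N -> ser k),
    [/\ open W, W Q,
        forall i, [/\ reg (W `\ Q) (f i), reg (W `\ Q) (g i),
                      polar_expansion Q tau (f i) D (F i) &
                      polar_expansion Q tau (g i) D (G i)],
        forall P, W P -> P <> Q ->
          modJ (M := k^o) id (@reg _ X) n P (p P)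
            (fun x y => \sum_i f i x * g i y)
      & forall j, (j <= n)%N -> forall r,
          \sum_i smul (F i)
              (fun m => (gbin (m%:Z - D%:Z) j)%:~R * G i m) r
          = sshift (D + D) (c j) r].

End OnSmoothCurve.

Section OnNodalCurve.
Variables (C Ct : funSpace k) (eta : Ct -> C) (br : branches eta).

Definition Vtilde (U : set Ct) (sg : autTorsor Ct -> V) : Prop :=
  Vsheaf U sg /\
  forall P tau, U P -> over_node br P tau ->
    exists2 S, expansion P tau sg S & lattice A S.

(* The sections over U, an open subset of C, as a subset of those of
   eta_* Vtilde. *)
Definition VC (U : set C) (sg : autTorsor Ct -> V) : Prop :=
  Vtilde (eta @^-1` U) sg /\
  forall Q, node Q -> U Q -> exists Sp Sm,
    [/\ expansion (brp br Q) (scp br Q) sg Sp,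
        expansion (brm br Q) (scm br Q) sg Sm & node_lattice L (Sp, Sm)].

(* Sheaves of logarithmic principal parts are torsion free, so their sections are
   the sections of P^n off the (preimages of the) nodes that satisfy the
   condition on the formal neighbourhoods.  Off the nodes C and its normalization
   are identified by eta. *)
Definition PCt_log (n : nat) (U : set Ct) (p : Ct -> Ct -> Ct -> k) : Prop :=
  pp_section (M := k^o) id (@reg _ Ct) n (off_nodes eta U) p /\
  forall P tau, U P -> over_node br P tau ->
    exists c, log_expansion P tau n p c.

(* At a node p must be sum_j (cp_j, d_j) (dlog s_+)^j with
   (cp_j, d_j) in k[[s_+, s_-]]/(s_+ s_-), where on the branch of s_- one has
   dlog s_+ = 1/(1 + dlog s_-) - 1. *)
Definition PC_log (n : nat) (U : set C) (p : Ct -> Ct -> Ct -> k) : Prop :=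
  pp_section (M := k^o) id (@reg _ Ct) n (off_nodes eta (eta @^-1` U)) p /\
  forall Q, node Q -> U Q -> exists cp cm d,
    [/\ log_expansion (brp br Q) (scp br Q) n p cp,
        log_expansion (brm br Q) (scm br Q) n p cm,
        forall j, (j <= n)%N -> d j 0%N = cp j 0%N
      & forall l, (l <= n)%N -> forall r,
          cm l r = \sum_(j < n.+1) sexp (sgamma k) j l * d j r].

Definition tens_sum (N : nat) (v : 'I_N -> autTorsor Ct -> V)
    (p : 'I_N -> Ct -> Ct -> Ct -> k) : Ct -> autTorsor Ct -> Ct -> V :=
  fun P q y => \sum_i p i P (apt q) y *: v i q.

(* E (x) Pl for a sheaf E of V-valued sections and a sheaf Pl of logarithmic
   principal parts on Y, where zeta is the map to Y from the normalization.  As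
   the logarithmic principal parts are locally free over O_Y, the tensor product
   is the subsheaf of the V-sheaf (x) P^n off the nodes consisting of the sections
   which locally on Y are finite sums of v (x) p. *)
Definition tens_log (Y : funSpace k) (zeta : Ct -> Y)
    (E : set Y -> set (autTorsor Ct -> V))
    (Pl : nat -> set Y -> set (Ct -> Ct -> Ct -> k))
    (n : nat) (U : set Y) (Phi : Ct -> autTorsor Ct -> Ct -> V) : Prop :=
  pp_section (@apt _ Ct) (@Vsheaf Ct) n (off_nodes eta (zeta @^-1` U)) Phi /\
  forall Q, U Q ->
    exists W N (v : 'I_N -> autTorsor Ct -> V) (p : 'I_N -> Ct -> Ct -> Ct -> k),
      [/\ open W, W Q, W `<=` U, forall i, E W (v i) /\ Pl n W (p i) &
          pp_eq (@apt _ Ct) (@Vsheaf Ct) n (off_nodes eta (zeta @^-1` W))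
            Phi (tens_sum v p)].

(* Logarithmic PD-connections on a sheaf E of O_C-modules of V-valued sections.
   In terms of representatives, d_1^n(f) is (q, y) |-> f(eta y), phi_{m,n} is
   reduction modulo J^(m+1) and id (x) delta^{m,n} is
   Phi |-> ((q, y, z) |-> Phi(q, z)): it sends 1 (x) a to 1 (x) 1 (x) a, hence
   delta(a) to delta(a) (x) 1 + 1 (x) delta(a) and 1 + dlog s to
   (1 + dlog s) (x) (1 + dlog s). *)
Definition log_PD_connection (E : set C -> set (autTorsor Ct -> V))
    (Th : nat -> (autTorsor Ct -> V) -> Ct -> autTorsor Ct -> Ct -> V) : Prop :=
  let eqs n (U : set C) :=
    pp_eq (@apt _ Ct) (@Vsheaf Ct) n (off_nodes eta (eta @^-1` U)) in
  [/\ (forall n U sg, open U -> E U sg -> tens_log eta E PC_log n U (Th n sg)) /\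
      (forall n U sg sg', open U -> E U sg -> E U sg' ->
         (forall q, U (eta (apt q)) -> sg q = sg' q) ->
         eqs n U (Th n sg) (Th n sg')),
      (forall n U sg sg', open U -> E U sg -> E U sg' ->
         eqs n U (Th n (fun q => sg q + sg' q))
                 (fun P q y => Th n sg P q y + Th n sg' P q y)) /\
      (forall n U sg f, open U -> E U sg -> reg U f ->
         eqs n U (Th n (fun q => f (eta (apt q)) *: sg q))
                 (fun P q y => f (eta y) *: Th n sg P q y)),
      (* Theta_0 = id *)
      forall U sg, open U -> E U sg -> eqs 0%N U (Th 0%N sg) (fun _ q _ => sg q),
      (* (id (x) phi_{m,n}) Theta_n = Theta_m *)
      forall m n U sg, (m <= n)%N -> open U -> E U sg ->
        eqs m U (Th n sg) (Th m sg)
      (* (Theta_m (x) id) Theta_n = (id (x) delta^{m,n}) Theta_{m+n} *)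
    & forall m n U sg N (v : 'I_N -> autTorsor Ct -> V)
          (p : 'I_N -> Ct -> Ct -> Ct -> k),
        open U -> E U sg -> (forall i, E U (v i) /\ PC_log n U (p i)) ->
        eqs n U (Th n sg) (tens_sum v p) ->
        forall P, U (eta P) -> ~ node (eta P) ->
          modJJ (@apt _ Ct) (@Vsheaf Ct) m n P
            (fun q y z => \sum_i p i P y z *: Th m (v i) P q y)
            (fun q y z => Th (m + n)%N sg P q z)].

End OnNodalCurve.
End VertexSheaves.

(* Main.v *)
(** In a coordinate t the connection sends a section sg to the sum over j of
    (t(y) - t(x))^j w_j(x), where w_j is the coefficient of z^j in the Taylor expansion
    of e^(zT) sg.  This series, the jet of sg, is independent of t because a change of
    coordinate rho acts through e^(-zT) Pi(rho) e^(rho(z) T), and a local section of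
    V (x) P^n is determined by its expansions at the points of the torsor up to order n;
    all identities of sections of V (x) P^n are therefore identities of jets.

    At the preimage of a node with coordinate r the same section is the sum over l of
    (dlog r)^l r^l w_l, and r^l w_l agrees with s^l e^(-zT) d^(l) e^(zT) of the
    expansion of sg up to terms which lie s times deeper in the lattice.  Such terms
    are harmless for the gluing at the node, so that it suffices to treat the operators
    s^l (d + T)^(l), for which the commutation rule of L_1 and T gives the claim, the two
    branches being related by dlog s_+ = gamma(dlog s_-).  Globally one takes r = a/b
    vanishing at one preimage of the node and r^(-1) vanishing at the other; since the
    normalization is finite, a neighbourhood of the fibre contains the preimage of a
    neighbourhood of the node. *)

Require Import Defs.
From HB Require Import structures.
From mathcomp Require Import all_boot all_order all_algebra.
From mathcomp Require Import boolp classical_sets functions topology.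
From mathcomp Require Import perm ring zify.

Set Implicit Arguments.
Unset Strict Implicit.
Unset Printing Implicit Defensive.

Import GRing.Theory.
Local Open Scope classical_set_scope.
Local Open Scope ring_scope.

(** * Formal power series and vector-valued series *)

Lemma triangle_sum (M : nmodType) N (G : nat -> nat -> M) :
  \sum_(m < N) \sum_(i < m.+1) G i (m - i)%N =
  \sum_(i < N) \sum_(j < N - i) G i j.
Proof.
elim: N => [|N IH]; first by rewrite !big_ord0.
rewrite big_ord_recr IH /= [in RHS]big_ord_recr /= subSnn big_ord1.
rewrite [X in _ + X]big_ord_recr /= subnn addrA; congr (_ + _).
rewrite -big_split /=; apply: eq_bigr => i _.
by rewrite subSn 1?ltnW // big_ord_recr.
Qed.

Lemma triangle_sum0 (M : nmodType) N (G : nat -> nat -> M) :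
  (forall i j, (N <= i + j)%N -> G i j = 0) ->
  \sum_(m < N) \sum_(i < m.+1) G i (m - i)%N =
  \sum_(i < N) \sum_(j < N) G i j.
Proof.
move=> G0; rewrite triangle_sum; apply: eq_bigr => i _.
rewrite (big_ord_widen_cond N xpredT (fun j => G i j)) ?leq_subr //=.
rewrite [RHS](bigID (fun j : 'I_N => (j < N - i)%N)) /=.
rewrite [X in _ = _ + X]big1 ?addr0 // => j; rewrite -leqNgt => h.
by apply: G0; rewrite -leq_subLR.
Qed.

Definition fps (R : Type) : Type := nat -> R.
Definition vser (V : Type) : Type := nat -> V.

HB.instance Definition _ (R : zmodType) := GRing.Zmodule.copy (fps R) (nat -> R).
HB.instance Definition _ (V : zmodType) := GRing.Zmodule.copy (vser V) (nat -> V).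

Section FpsDef.
Variable R : comNzRingType.

Definition fcst (c : R) : fps R := fun n => if n == 0%N then c else 0.
Definition fmul (f g : fps R) : fps R :=
  fun n => \sum_(i < n.+1) f i * g (n - i)%N.
Definition vmul (V : lmodType R) (f : fps R) (S : vser V) : vser V :=
  fun n => \sum_(i < n.+1) f i *: S (n - i)%N.

Lemma vmulA (V : lmodType R) f g (S : vser V) : vmul f (vmul g S) = vmul (fmul f g) S.
Proof.
apply: funext => n; rewrite /vmul /fmul.
pose G i j := (f i * g j) *: S (n - i - j)%N.
transitivity (\sum_(i < n.+1) \sum_(j < n.+1 - i) G i j).
  apply: eq_bigr => i _; rewrite subSn -1?ltnS // scaler_sumr.
  by apply: eq_bigr => j _; rewrite scalerA.
rewrite -triangle_sum; apply: eq_bigr => m _.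
rewrite scaler_suml; apply: eq_bigr => i _; rewrite /G.
by congr (_ *: S _); have := ltn_ord i; lia.
Qed.

Lemma vmul1 (V : lmodType R) (S : vser V) : vmul (fcst 1) S = S.
Proof.
apply: funext => n; rewrite /vmul big_ord_recl /= subn0 scale1r big1 ?addr0 //.
by move=> i _; rewrite scale0r.
Qed.

Lemma vmulDr (V : lmodType R) f : {morph @vmul V f : S S' / S + S'}.
Proof.
move=> S S'; apply: funext => n.
change (vmul f (S + S') n = vmul f S n + vmul f S' n); rewrite /vmul -big_split /=.
by apply: eq_bigr => i _; rewrite scalerDr.
Qed.

Lemma vmulDl (V : lmodType R) (S : vser V) : {morph (fun f => vmul f S) : f g / f + g}.
Proof.
move=> f g; apply: funext => n.
change (vmul (f + g) S n = vmul f S n + vmul g S n); rewrite /vmul -big_split /=.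
by apply: eq_bigr => i _; rewrite scalerDl.
Qed.

Lemma fmulC : commutative fmul.
Proof.
move=> f g; apply: funext => n; rewrite /fmul (reindex_inj rev_ord_inj) /=.
by apply: eq_bigr => i _; rewrite subSS subKn -1?ltnS // mulrC.
Qed.

Lemma fmulA : associative fmul.
Proof. by move=> f g h; exact: (@vmulA R^o). Qed.
Lemma fmul1 : left_id (fcst 1) fmul.
Proof. by move=> f; exact: (@vmul1 R^o). Qed.
Lemma fmulDl : left_distributive fmul +%R.
Proof. by move=> f g h; exact: (@vmulDl R^o). Qed.
Lemma fcst1_neq0 : fcst 1 != 0 :> fps R.
Proof.
by apply/eqP => /(congr1 (fun f : fps R => f 0%N)) /eqP; rewrite /fcst /= oner_eq0.
Qed.

HB.instance Definition _ :=
  GRing.Zmodule_isComNzRing.Build (fps R) fmulA fmulC fmul1 fmulDl fcst1_neq0.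
HB.instance Definition _ (V : lmodType R) :=
  GRing.Zmodule_isLmodule.Build (fps R) (vser V) (@vmulA V) (@vmul1 V)
    (@vmulDr V) (fun S f g => @vmulDl V S f g).

Lemma fcst_is_zmod_morphism : zmod_morphism fcst.
Proof.
by move=> a b; apply: funext => -[|n] //; change (0 = 0 - 0 :> R); rewrite subr0.
Qed.
Lemma fcst_is_monoid_morphism : monoid_morphism fcst.
Proof.
split=> // a b; apply: funext => n.
change (fcst (a * b) n = fmul (fcst a) (fcst b) n).
rewrite /fmul big_ord_recl /= subn0 big1 ?addr0; last by move=> i _; rewrite mul0r.
by case: n => //= n; rewrite mulr0.
Qed.
HB.instance Definition _ :=
  GRing.isZmodMorphism.Build R (fps R) fcst fcst_is_zmod_morphism.
HB.instance Definition _ :=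
  GRing.isMonoidMorphism.Build R (fps R) fcst fcst_is_monoid_morphism.

Implicit Types f g : fps R.

Lemma fpsD f g n : (f + g) n = f n + g n. Proof. by []. Qed.
Lemma fpsN f n : (- f) n = - f n. Proof. by []. Qed.
Lemma fps0 n : (0 : fps R) n = 0. Proof. by []. Qed.
Lemma fps1 n : (1 : fps R) n = (n == 0%N)%:R. Proof. by case: n. Qed.
Lemma fpsM f g n : (f * g) n = \sum_(i < n.+1) f i * g (n - i)%N.
Proof. by []. Qed.
Lemma fps_sum I (r : seq I) (Q : pred I) (F : I -> fps R) n :
  (\sum_(i <- r | Q i) F i) n = \sum_(i <- r | Q i) F i n.
Proof. by elim/big_rec2: _ => // i y f _ <-. Qed.
Lemma fpsM0 f g : (f * g) 0%N = f 0%N * g 0%N.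
Proof. by rewrite fpsM big_ord1. Qed.
Lemma fpsX0 f m : (f ^+ m) 0%N = f 0%N ^+ m.
Proof. by elim: m => [|m IH]; rewrite ?expr0 // !exprS fpsM0 IH. Qed.
Lemma fcstM c f n : (fcst c * f) n = c * f n.
Proof.
rewrite fpsM big_ord_recl /= subn0 big1 ?addr0 // => i _.
by rewrite mul0r.
Qed.
Lemma fpsMn f m n : (f *+ m) n = f n *+ m.
Proof. by elim: m => [|m IH]; rewrite ?mulr0n // !mulrS fpsD IH. Qed.

Section Vser.
Variable V : lmodType R.
Implicit Types S : vser V.

Lemma vserD S S' n : (S + S') n = S n + S' n. Proof. by []. Qed.
Lemma vserN S n : (- S) n = - S n. Proof. by []. Qed.
Lemma vser0 n : (0 : vser V) n = 0. Proof. by []. Qed.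
Lemma vserZ f S n : (f *: S) n = \sum_(i < n.+1) f i *: S (n - i)%N.
Proof. by []. Qed.
Lemma vser_sum I (r : seq I) (Q : pred I) (F : I -> vser V) n :
  (\sum_(i <- r | Q i) F i) n = \sum_(i <- r | Q i) F i n.
Proof. by elim/big_rec2: _ => // i y S _ <-. Qed.
Lemma fcstZ c S n : (fcst c *: S) n = c *: S n.
Proof.
rewrite vserZ big_ord_recl /= subn0 big1 ?addr0 // => i _.
by rewrite scale0r.
Qed.
Lemma vserMn S m n : (S *+ m) n = S n *+ m.
Proof. by elim: m => [|m IH]; rewrite ?mulr0n // !mulrS vserD IH. Qed.

Lemma ordZ a b f S : (forall i, (i < a)%N -> f i = 0) ->
  (forall i, (i < b)%N -> S i = 0) ->
  forall i, (i < a + b)%N -> (f *: S) i = 0.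
Proof.
move=> f0 S0 i hi; rewrite vserZ big1 // => j _.
have [h|h] := ltnP j a; first by rewrite f0 // scale0r.
by rewrite S0 ?scaler0 //; have := ltn_ord j; lia.
Qed.

Lemma vserZ_eq N f g S S' : (forall i, (i < N)%N -> f i = g i) ->
  (forall i, (i < N)%N -> S i = S' i) ->
  forall i, (i < N)%N -> (f *: S) i = (g *: S') i.
Proof.
move=> fg SS i hi; rewrite !vserZ; apply: eq_bigr => j _.
by rewrite fg ?SS //; have := ltn_ord j; lia.
Qed.
End Vser.

Lemma ordM a b f g : (forall i, (i < a)%N -> f i = 0) ->
  (forall i, (i < b)%N -> g i = 0) ->
  forall i, (i < a + b)%N -> (f * g) i = 0.
Proof. exact: (@ordZ R^o). Qed.

Lemma fpsM_eq N f f' g g' : (forall i, (i < N)%N -> f i = f' i) ->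
  (forall i, (i < N)%N -> g i = g' i) ->
  forall i, (i < N)%N -> (f * g) i = (f' * g') i.
Proof. exact: (@vserZ_eq R^o). Qed.

Lemma fpsX_eq N f f' m : (forall i, (i < N)%N -> f i = f' i) ->
  forall i, (i < N)%N -> (f ^+ m) i = (f' ^+ m) i.
Proof. by move=> h; elim: m => [//|m IH] i hi; rewrite !exprS; exact: (fpsM_eq h IH). Qed.

Lemma ordX f m : f 0%N = 0 -> forall i, (i < m)%N -> (f ^+ m) i = 0.
Proof.
move=> f0; elim: m => [//|m IH]; rewrite exprS -add1n; apply: ordM => //.
by case.
Qed.

Definition fX : fps R := fun n => (n == 1%N)%:R.

Lemma fXZ (V : lmodType R) (S : vser V) n :
  (fX *: S) n = if n is m.+1 then S m else 0.
Proof.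
rewrite vserZ; case: n => [|n]; first by rewrite big_ord1 scale0r.
rewrite big_ord_recl /= scale0r add0r big_ord_recl /= scale1r subSS subn0 big1 ?addr0 //.
by move=> i _; rewrite scale0r.
Qed.

Lemma fXM f n : (fX * f) n = if n is m.+1 then f m else 0.
Proof. exact: (@fXZ R^o). Qed.

Lemma fXnZ (V : lmodType R) (S : vser V) m n :
  (fX ^+ m *: S) n = if (m <= n)%N then S (n - m)%N else 0.
Proof.
elim: m n => [|m IH] n; first by rewrite expr0 scale1r subn0.
by rewrite exprS -scalerA fXZ; case: n => // n; rewrite IH subSS.
Qed.

Lemma fXnM f m n : (fX ^+ m * f) n = if (m <= n)%N then f (n - m)%N else 0.
Proof. exact: (@fXnZ R^o). Qed.

Lemma fXnE m n : (fX ^+ m) n = (n == m)%:R.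
Proof.
rewrite -[fX ^+ m]mulr1 fXnM fps1; case: leqP => h.
  by congr (_ %:R); lia.
by rewrite (_ : (n == m) = false) //; apply/eqP; lia.
Qed.

Lemma fXn_div m f : (forall i, (i < m)%N -> f i = 0) ->
  f = fX ^+ m * (fun n => f (m + n)%N).
Proof.
move=> f0; apply: funext => n; rewrite fXnM; case: leqP => h; last exact: f0.
by rewrite subnKC.
Qed.

End FpsDef.

Arguments fX {R}.

Lemma sum_widen0 (M : nmodType) n N (F : nat -> M) : (n <= N)%N ->
  (forall m, (n <= m)%N -> F m = 0) -> \sum_(m < n) F m = \sum_(m < N) F m.
Proof.
move=> nN F0; rewrite (big_ord_widen_cond N xpredT F) //=.
rewrite [RHS](bigID (fun j : 'I_N => (j < n)%N)) /= [X in _ = _ + X]big1 ?addr0 //.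
by move=> j; rewrite -leqNgt => h; apply: F0.
Qed.

Lemma hasse_conv (M : zmodType) (A : nat -> nat -> M) l n :
  \sum_(i < l.+1) \sum_(a < n.+1)
     A (a + i)%N (n - a + (l - i))%N *+ ('C(a + i, i) * 'C(n - a + (l - i), l - i)) =
  (\sum_(m < (n + l).+1) A m (n + l - m)%N) *+ 'C(n + l, l).
Proof.
pose B i m := A m (n + l - m)%N *+ ('C(m, i) * 'C(n + l - m, l - i)).
have shift i : (i <= l)%N -> \sum_(a < n.+1)
     A (a + i)%N (n - a + (l - i))%N *+ ('C(a + i, i) * 'C(n - a + (l - i), l - i)) =
     \sum_(m < (n + l).+1) B i m.
  move=> il; rewrite -(big_mkord xpredT (B i)) (@big_cat_nat _ _ _ i) //=; last lia.
  rewrite (@big_cat_nat _ _ _ (n.+1 + i) i) //=; [|lia|lia].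
  rewrite [X in X + _]big1_seq ?add0r; last first.
    by move=> m /=; rewrite mem_index_iota /B => h; rewrite bin_small ?mul0n //; lia.
  rewrite [X in _ + X]big1_seq ?addr0; last first.
    move=> m /=; rewrite mem_index_iota /B => h.
    by rewrite ['C(n + l - m, _)]bin_small ?muln0 //; lia.
  rewrite -[X in \sum_(X <= _ < _) _]add0n big_addn addnK big_mkord; apply: eq_bigr => a _.
  by rewrite /B (_ : n + l - (a + i) = n - a + (l - i))%N //; have := ltn_ord a; lia.
under eq_bigr => i _ do rewrite shift -1?ltnS //.
rewrite exchange_big /= -sumrMnl; apply: eq_bigr => m _.
rewrite /B sumrMnr binomial.Vandermonde subnKC //.
by have := ltn_ord m; lia.
Qed.

Section Comp.
Variable k : fieldType.
Implicit Types f g h mu nu : fps k.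

Lemma sexpE f m : sexp f m = f ^+ m.
Proof. by elim: m => [//|m IH]; rewrite exprS -IH. Qed.
Lemma sshiftE m f : sshift m f = fX ^+ m * f.
Proof. by apply: funext => n; rewrite fXnM. Qed.

Definition vcomp (V : lmodType k) (S : vser V) mu : vser V :=
  fun n => \sum_(m < n.+1) (mu ^+ m) n *: S m.

Lemma scompE f mu : scomp f mu = vcomp (f : vser k^o) mu.
Proof.
by apply: funext => n; apply: eq_bigr => m _; rewrite sexpE mulrC.
Qed.

Section VComp.
Variable V : lmodType k.
Implicit Types (S : vser V) (v : V).

Lemma svecZ f g v : f *: (svec g v : vser V) = svec (f * g) v.
Proof.
apply: funext => n; rewrite vserZ /svec fpsM scaler_suml.
by apply: eq_bigr => i _; rewrite scalerA.
Qed.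

Lemma vcompE N n S mu : mu 0%N = 0 -> (n < N)%N ->
  vcomp S mu n = \sum_(m < N) (mu ^+ m) n *: S m.
Proof.
move=> mu0 nN; rewrite /vcomp; apply: (@sum_widen0 _ _ _ (fun m => (mu ^+ m) n *: S m)) => // m h.
by rewrite ordX // scale0r.
Qed.

Lemma vcompE_svec N n S mu : mu 0%N = 0 -> (n < N)%N ->
  vcomp S mu n = (\sum_(m < N) (svec (mu ^+ m) (S m) : vser V)) n.
Proof. by move=> mu0 nN; rewrite (vcompE _ mu0 nN) vser_sum. Qed.

Lemma vcompD S S' mu : vcomp (S + S') mu = vcomp S mu + vcomp S' mu.
Proof.
apply: funext => n; rewrite vserD /vcomp -big_split /=.
by apply: eq_bigr => i _; rewrite vserD scalerDr.
Qed.

Lemma vcomp0 mu : vcomp (0 : vser V) mu = 0.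
Proof. by apply: funext => n; rewrite /vcomp big1 // => i _; rewrite scaler0. Qed.

Lemma vcomp_sum I (r : seq I) (Q : pred I) (F : I -> vser V) mu :
  vcomp (\sum_(i <- r | Q i) F i) mu = \sum_(i <- r | Q i) vcomp (F i) mu.
Proof. exact: (big_morph (fun S => vcomp S mu) (fun S S' => vcompD S S' mu) (vcomp0 mu)). Qed.

Lemma vcomp_svec f v mu : vcomp (svec f v : vser V) mu = svec (scomp f mu) v.
Proof.
apply: funext => n; rewrite /vcomp /svec scaler_suml.
by apply: eq_bigr => i _; rewrite sexpE scalerA mulrC.
Qed.

Lemma vcompX S : vcomp S fX = S.
Proof.
apply: funext => n; rewrite /vcomp big_ord_recr /= fXnE eqxx scale1r big1 ?add0r //.
by move=> i _; rewrite fXnE gtn_eqF ?scale0r.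
Qed.

Lemma vcomp_eq N S S' mu mu' : (forall i, (i < N)%N -> S i = S' i) ->
  (forall i, (i < N)%N -> mu i = mu' i) ->
  forall i, (i < N)%N -> vcomp S mu i = vcomp S' mu' i.
Proof.
move=> hS hmu i hi; apply: eq_bigr => m _.
by rewrite (fpsX_eq _ hmu) // hS //; have := ltn_ord m; lia.
Qed.

End VComp.

Lemma scomp_svec N n f mu : mu 0%N = 0 -> (n < N)%N ->
  scomp f mu n = (\sum_(m < N) fcst (f m) * mu ^+ m) n.
Proof.
move=> mu0 nN; rewrite scompE (vcompE _ mu0 nN) fps_sum.
by apply: eq_bigr => i _; rewrite fcstM mulrC.
Qed.

Lemma vcompZ (V : lmodType k) f (S : vser V) mu : mu 0%N = 0 ->
  vcomp (f *: S) mu = (scomp f mu : fps k) *: vcomp S mu.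
Proof.
move=> mu0; apply: funext => n.
rewrite (vserZ_eq (N := n.+1) (fun i => @scomp_svec n.+1 i f mu mu0)
  (fun i => @vcompE_svec _ n.+1 i S mu mu0)) //.
rewrite scaler_suml vser_sum.
transitivity (\sum_(i < n.+1) \sum_(j < n.+1) (f i * (mu ^+ (i + j)) n) *: S j).
  rewrite -(triangle_sum0 (G := fun i j => (f i * (mu ^+ (i + j)) n) *: S j)); last first.
    by move=> i j h; rewrite ordX // mulr0 scale0r.
  apply: eq_bigr => m _; rewrite vserZ scaler_sumr.
  apply: eq_bigr => i _; rewrite scalerA mulrC subnKC //.
  by rewrite -ltnS.
apply: eq_bigr => i _; rewrite scaler_sumr vser_sum; apply: eq_bigr => j _.
by rewrite svecZ /svec -mulrA fcstM -exprD.
Qed.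

Lemma scompM f g mu : mu 0%N = 0 -> scomp (f * g) mu = (scomp f mu : fps k) * scomp g mu.
Proof.
by move=> mu0; rewrite !scompE -[vcomp (f : vser k^o) mu]scompE; exact: (@vcompZ k^o).
Qed.
Lemma scompD f g mu : scomp (f + g) mu = (scomp f mu : fps k) + scomp g mu.
Proof. by rewrite !scompE; exact: (@vcompD k^o). Qed.
Lemma scomp0 mu : scomp (0 : fps k) mu = 0 :> fps k.
Proof. by rewrite scompE; exact: (@vcomp0 k^o). Qed.
Lemma scompN f mu : scomp (- f) mu = - (scomp f mu : fps k).
Proof. by apply/eqP; rewrite -subr_eq0 opprK -scompD addNr scomp0. Qed.
Lemma scomp_c c mu : scomp (fcst c) mu = fcst c.
Proof.
apply: funext => n; rewrite /scomp big_ord_recl /= big1 ?addr0; last first.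
  by move=> i _; rewrite mul0r.
by case: n => [|n]; rewrite /fcst /scst /= ?mulr1 ?mulr0.
Qed.
Lemma scomp_X mu : mu 0%N = 0 -> scomp fX mu = mu.
Proof.
move=> mu0; apply: funext => -[|n].
  by rewrite /scomp big_ord1 /fX mul0r mu0.
rewrite scompE /vcomp !big_ord_recl scaler0 add0r expr1 big1 ?addr0; last first.
  by move=> i _; rewrite scaler0.
exact: mulr1.
Qed.
Lemma scompX f mu m : mu 0%N = 0 -> scomp (f ^+ m) mu = (scomp f mu : fps k) ^+ m.
Proof.
move=> mu0; elim: m => [|m IH]; first exact: scomp_c.
by rewrite !exprS scompM // IH.
Qed.
Lemma scomp_n0 f mu : scomp f mu 0%N = f 0%N.
Proof. by rewrite /scomp big_ord1 mulr1. Qed.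
Lemma scomp_n1 f mu : mu 0%N = 0 -> scomp f mu 1%N = f 1%N * mu 1%N.
Proof.
move=> mu0; rewrite scompE /vcomp !big_ord_recl big_ord0 addr0 expr0 expr1 fps1.
by rewrite scale0r add0r mulrC.
Qed.
Lemma scompfX f : scomp f fX = f.
Proof. by rewrite scompE vcompX. Qed.

Lemma vcompA (V : lmodType k) (S : vser V) mu nu : mu 0%N = 0 -> nu 0%N = 0 ->
  vcomp (vcomp S mu) nu = vcomp S (scomp mu nu).
Proof.
move=> mu0 nu0; apply: funext => n.
transitivity (\sum_(m < n.+1) \sum_(j < n.+1) ((nu ^+ m) n * (mu ^+ j) m) *: S j).
  apply: eq_bigr => m _; rewrite (vcompE (N := n.+1)) // scaler_sumr.
  by apply: eq_bigr => j _; rewrite scalerA.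
rewrite exchange_big /=; apply: eq_bigr => j _.
rewrite -scaler_suml -scompX //; congr (_ *: _).
by apply: eq_bigr => m _; rewrite sexpE mulrC.
Qed.

Lemma scompA f mu nu : mu 0%N = 0 -> nu 0%N = 0 ->
  scomp (scomp f mu) nu = scomp f (scomp mu nu).
Proof. by move=> mu0 nu0; rewrite [LHS]scompE [RHS]scompE (scompE f mu); exact: (@vcompA k^o). Qed.

Lemma sinvM f : f 0%N != 0 -> (sinv f : fps k) * f = 1.
Proof.
move=> f0; set g : fps k := fun m => if m == 0%N then 0 else - (f m / f 0%N).
set E : fps k := scomp (fun=> 1) g.
have -> : sinv f = fcst (f 0%N)^-1 * E by apply: funext => n; rewrite fcstM.
have hf : fcst (f 0%N)^-1 * f = 1 - g.
  apply: funext => n; rewrite fcstM fpsD fpsN fps1 /g.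
  by case: n => [|n] /=; rewrite ?mulVf ?subr0 // sub0r opprK mulrC.
rewrite -mulrA [E * f]mulrC mulrA hf.
have hX : (1 - fX) * (fun=> 1) = 1 :> fps k.
  apply: funext => n; rewrite mulrBl fpsD fpsN mul1r fXM fps1.
  by case: n => [|n]; rewrite ?subr0 ?subrr.
have g0 : g 0%N = 0 by [].
rewrite -[g in 1 - g](scomp_X g0) -[1](scomp_c 1 g) -scompN -scompD -scompM //.
by rewrite -[fcst 1]/(1 : fps k) hX.
Qed.

Lemma sinv_uniq f g : g * f = 1 -> g = sinv f.
Proof.
move=> gf; have f0 : f 0%N != 0.
  apply/eqP => f0; have := congr1 (fun h : fps k => h 0%N) gf.
  by rewrite fpsM0 f0 mulr0 fps1 => /esym/eqP; rewrite oner_eq0.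
by rewrite -[g]mulr1 -(sinvM f0) mulrCA gf mulr1.
Qed.

Lemma sinv0 f : (sinv f) 0%N = (f 0%N)^-1.
Proof. by rewrite /sinv scomp_n0 mulr1. Qed.

Lemma AutO_comp mu nu : AutO mu -> AutO nu -> AutO (scomp mu nu).
Proof.
move=> [m0 m1] [n0 n1]; split; first by rewrite scomp_n0.
by rewrite scomp_n1 //; apply/eqP; rewrite mulf_neq0 //; apply/eqP.
Qed.

Lemma exprD_order g e n m : g 0%N = 0 -> (forall i, (i < n.+1)%N -> e i = 0) ->
  forall i, (i < n + m.+1)%N -> ((g + e) ^+ m.+1 - g ^+ m.+1) i = 0.
Proof.
move=> g0 e0; elim: m => [|m IH].
  by rewrite !expr1 addrC addKr => i; rewrite addn1; exact: e0.
have -> : (g + e) ^+ m.+2 - g ^+ m.+2 =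
  ((g + e) ^+ m.+1 - g ^+ m.+1) * (g + e) + g ^+ m.+1 * e by rewrite !exprSr; ring.
move=> i hi; rewrite fpsD (ordM (a := n + m.+1) (b := 1) IH); last first.
- by lia.
- by case=> // _; rewrite fpsD g0 e0 // addr0.
rewrite (ordM (a := m.+1) (b := n.+1) _ e0) ?addr0 //; last by lia.
exact: ordX.
Qed.

Lemma scomp_rinv mu : AutO mu -> exists2 nu, AutO nu & scomp mu nu = fX.
Proof.
move=> [mu0 mu1]; have {}mu1 : mu 1%N != 0 by apply/eqP.
pose ap := fix ap n : fps k := if n is m.+1 then
  ap m + fcst ((fX m.+1 - scomp mu (ap m) m.+1) / mu 1%N) * fX ^+ m.+1 else 0.
have low c m i : (i < m)%N -> (fcst c * fX ^+ m : fps k) i = 0.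
  by move=> h; rewrite fcstM fXnE (ltn_eqF h) mulr0.
have ap0 n : ap n 0%N = 0.
  by elim: n => //= n IH; rewrite fpsD IH add0r low.
have apS n i : (i <= n)%N -> ap n.+1 i = ap n i.
  by move=> h; rewrite /= fpsD low // addr0.
have apE n m i : (i <= n)%N -> (n <= m)%N -> ap m i = ap n i.
  move=> ni; elim: m => [|m IH]; first by rewrite leqn0 => /eqP->.
  rewrite leq_eqVlt => /orP[/eqP->//|]; rewrite ltnS => nm.
  by rewrite apS ?IH //; exact: leq_trans nm.
have apP n : forall i, (i <= n)%N -> scomp mu (ap n) i = fX i.
  elim: n => [|n IH] i; first by rewrite leqn0 => /eqP->; rewrite scomp_n0 mu0.
  rewrite leq_eqVlt => /orP[/eqP->|]; last first.
    rewrite ltnS => h; rewrite -IH // scompE [in RHS]scompE.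
    by apply: (@vcomp_eq k^o n.+1) => // j hj; rewrite apS.
  set e := fcst ((fX n.+1 - scomp mu (ap n) n.+1) / mu 1%N) * fX ^+ n.+1.
  have diff m : ((ap n + e) ^+ m) n.+1 = (ap n ^+ m) n.+1 + (m == 1)%:R * e n.+1.
    case: m => [|m]; first by rewrite mul0r addr0.
    case: m => [|m]; first by rewrite !expr1 mul1r fpsD.
    rewrite mul0r addr0; apply/eqP; rewrite -subr_eq0; apply/eqP.
    apply: (@exprD_order (ap n) e n m.+1) => //; last by lia.
    by move=> j hj; exact: low.
  rewrite -[ap n.+1]/(ap n + e) scompE (vcompE (N := n.+2)) //; last first.
    by rewrite fpsD ap0 /e low // addr0.
  under eq_bigr => m _ do rewrite diff scalerDl.
  rewrite big_split /= -(vcompE (N := n.+2)) // -scompE.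
  rewrite (bigD1 (Ordinal (isT : 1 < n.+2)%N)) //= mul1r big1 ?addr0; last first.
    move=> j; rewrite -val_eqE /= => /negbTE ->.
    by rewrite mul0r scale0r.
  rewrite /e fcstM fXnE eqxx mulr1.
  rewrite [_ *: _]mulfVK // addrC subrK //.
exists (fun n => ap n n).
  split; first exact: ap0.
  have h1 := apP 1%N 1%N isT; move: h1; rewrite scomp_n1 ?ap0 // => h1 h2.
  by move: h1; rewrite (h2 : ap 1%N 1%N = 0) mulr0 => /esym/eqP; rewrite oner_eq0.
apply: funext => n; rewrite -(apP n n) // scompE [in RHS]scompE.
apply: (@vcomp_eq k^o n.+1) => // j; rewrite ltnS => hj.
by rewrite [RHS](@apE j n j).
Qed.

Lemma scomp_inv mu : AutO mu ->
  exists nu, [/\ AutO nu, scomp mu nu = fX & scomp nu mu = fX].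
Proof.
move=> Hmu; have [nu Hnu mn] := scomp_rinv Hmu; exists nu; split=> //.
have [ka Hka nk] := scomp_rinv Hnu.
suff -> : mu = ka by [].
rewrite -[mu]scompfX -nk -scompA ?mn; [|by case: Hnu|by case: Hka].
by rewrite scomp_X //; case: Hka.
Qed.

Definition vhasse (V : zmodType) l (S : vser V) : vser V :=
  fun n => S (n + l)%N *+ 'C(n + l, l).

Lemma shasseE l f : shasse l f = vhasse l f.
Proof. by apply: funext => n; rewrite /shasse mulr_natl. Qed.

Lemma vhasseZ (V : lmodType k) l f (S : vser V) :
  vhasse l (f *: S) = \sum_(i < l.+1) (shasse i f : fps k) *: vhasse (l - i) S.
Proof.
apply: funext => n; rewrite /vhasse vserZ.
rewrite -(hasse_conv (fun i j => f i *: S j)) vser_sum; apply: eq_bigr => i _.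
rewrite vserZ; apply: eq_bigr => a _.
by rewrite /shasse /vhasse mulr_natl -scalerMnl -scalerMnr -mulrnA mulnC.
Qed.

Lemma vhasseD (V : zmodType) l (S S' : vser V) : vhasse l (S + S') = vhasse l S + vhasse l S'.
Proof. by apply: funext => n; exact: mulrnDl. Qed.
Lemma vhasse0 (V : zmodType) l : vhasse l (0 : vser V) = 0.
Proof. by apply: funext => n; exact: mul0rn. Qed.
Lemma vhasse_sum (V : zmodType) l I (r : seq I) (Q : pred I) (F : I -> vser V) :
  vhasse l (\sum_(i <- r | Q i) F i) = \sum_(i <- r | Q i) vhasse l (F i).
Proof. exact: (big_morph _ (@vhasseD V l) (@vhasse0 V l)). Qed.
Lemma vhasse_svec (V : lmodType k) l f (v : V) :
  vhasse l (svec f v : vser V) = svec (shasse l f) v.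
Proof. by apply: funext => n; rewrite /vhasse /svec /shasse mulr_natl scalerMnl. Qed.

(* f(s + z) as a series in z whose coefficients are series in s *)
Definition Tz f : fps (fps k) := fun l => shasse l f.

Lemma TzM f g : Tz (f * g) = Tz f * Tz g.
Proof.
apply: funext => l; rewrite /Tz fpsM shasseE.
rewrite -[f * g]/((f : fps k) *: (g : vser k^o)) (@vhasseZ k^o).
by apply: eq_bigr => i _; rewrite -shasseE.
Qed.
Lemma Tz_c c : Tz (fcst c) = fcst (fcst c).
Proof.
apply: funext => l; apply: funext => n; rewrite /Tz /shasse /fcst.
by case: l => [|l]; rewrite ?addn0 ?bin0 ?mul1r // addnS mulr0.
Qed.
Lemma TzX f m : Tz (f ^+ m) = Tz f ^+ m.
Proof. by elim: m => [|m IH]; rewrite ?exprS ?TzM ?IH //; exact: Tz_c. Qed.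

(* coefficient of z^l in (mu(s + z) - mu(s))^j *)
Definition kap mu j l : fps k := ((Tz mu - fcst (mu : fps k)) ^+ j) l.

Lemma kap_gt mu j l : (l < j)%N -> kap mu j l = 0.
Proof.
move=> lj; rewrite /kap ordX // fpsD fpsN /fcst /= /Tz; apply/eqP; rewrite subr_eq0; apply/eqP.
by apply: funext => n; rewrite /shasse addn0 bin0 mul1r.
Qed.

Lemma shasse_kap mu l m :
  shasse l (mu ^+ m) = \sum_(j < m.+1) (mu ^+ (m - j) * kap mu j l) *+ 'C(m, j) :> fps k.
Proof.
rewrite -[LHS]/(Tz (mu ^+ m) l) TzX -[Tz mu](subrK (fcst (mu : fps k))) addrC.
rewrite exprDn fps_sum; apply: eq_bigr => j _.
by rewrite fpsMn -rmorphXn fcstM.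
Qed.

Lemma kapE mu j l :
  kap mu j l = \sum_(i < j.+1)
    (-1) ^+ (j - i) * (mu ^+ (j - i) * shasse l (mu ^+ i)) *+ 'C(j, i) :> fps k.
Proof.
rewrite /kap addrC exprDn fps_sum; apply: eq_bigr => i _.
rewrite fpsMn -TzX -rmorphN -rmorphXn fcstM.
by rewrite (exprNn mu) -mulrA.
Qed.

Lemma vhasse_comp (V : lmodType k) l (S : vser V) mu : mu 0%N = 0 ->
  vhasse l (vcomp S mu) = \sum_(j < l.+1) kap mu j l *: vcomp (vhasse j S) mu.
Proof.
move=> mu0; apply: funext => n; set N := (n + l).+1.
pose G j i := ((mu ^+ i * kap mu j l) n *+ 'C(i + j, j)) *: S (i + j)%N.
transitivity (\sum_(j < N) \sum_(i < N - j) G j i).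
  rewrite -triangle_sum /vhasse (vcompE (N := N)) // -sumrMnl.
  apply: eq_bigr => m _; rewrite scalerMnl.
  have -> : (mu ^+ m) (n + l)%N *+ 'C(n + l, l) = shasse l (mu ^+ m) n.
    by rewrite /shasse mulr_natl.
  rewrite shasse_kap fps_sum scaler_suml; apply: eq_bigr => j _.
  by rewrite /G subnK ?fpsMn // -ltnS.
rewrite vser_sum [RHS](sum_widen0 (N := N) (F := fun j => (kap mu j l *: vcomp (vhasse j S) mu) n)).
- apply: eq_bigr => j _; have [jl|lj] := leqP j l; last first.
    by rewrite /G !kap_gt // scale0r vser0 big1 // => i _; rewrite mulr0 mul0rn scale0r.
  have E i : (i < n.+1)%N -> vcomp (vhasse j S) mu i =
      (\sum_(m < N - j) (svec (mu ^+ m) (vhasse j S m) : vser V)) i.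
    move=> h; apply: vcompE_svec => //; rewrite /N.
    by clear -jl h; move: (nat_of_ord j) jl h => j'; lia.
  rewrite (vserZ_eq (fun i _ => erefl (kap mu j l i)) E) //.
  rewrite scaler_sumr vser_sum; apply: eq_bigr => i _.
  by rewrite svecZ /svec /G /vhasse mulrC -scalerMnl -scalerMnr.
- by rewrite /N; lia.
- by move=> j lj; rewrite kap_gt // scale0r.
Qed.

End Comp.

(** * Exponentials of the translation operator *)

Section LinearProp.
Variables (k : fieldType) (U V : lmodType k) (f : U -> V).
Hypothesis lf : linear f.
Lemma linD : {morph f : u v / u + v}.
Proof. by move=> u v; have := lf 1 u v; rewrite !scale1r. Qed.
Lemma lin0 : f 0 = 0.
Proof. by apply: (addIr (f 0)); rewrite -linD !add0r. Qed.
Lemma linZ c v : f (c *: v) = c *: f v.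
Proof. by have := lf c v 0; rewrite !addr0 lin0 addr0. Qed.
Lemma lin_sum I (r : seq I) (Q : pred I) (F : I -> U) :
  f (\sum_(i <- r | Q i) F i) = \sum_(i <- r | Q i) f (F i).
Proof. exact: (big_morph _ linD lin0). Qed.
Lemma linMn v n : f (v *+ n) = f v *+ n.
Proof. by elim: n => [|n IH]; rewrite ?mulr0n ?lin0 // !mulrS linD IH. Qed.
Lemma linMz v z : f (v *~ z) = f v *~ z.
Proof. by rewrite -!scaler_int linZ. Qed.
End LinearProp.

Section VertexSeries.
Variables (k : fieldType) (V : lmodType k).
Implicit Types (f g h mu nu : fps k) (S : vser V) (v a : V).

Definition vmap (phi : V -> V) (S : vser V) : vser V := fun n => phi (S n).

Section Vmap.
Variable phi : V -> V.
Hypothesis lphi : linear phi.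
Lemma vmapD S S' : vmap phi (S + S') = vmap phi S + vmap phi S'.
Proof. by apply: funext => n; rewrite /vmap vserD linD. Qed.
Lemma vmap0 : vmap phi 0 = 0.
Proof. by apply: funext => n; rewrite /vmap vser0 lin0. Qed.
Lemma vmap_sum I (r : seq I) (Q : pred I) (F : I -> vser V) :
  vmap phi (\sum_(i <- r | Q i) F i) = \sum_(i <- r | Q i) vmap phi (F i).
Proof. exact: (big_morph _ vmapD vmap0). Qed.
Lemma vmapZ f S : vmap phi (f *: S) = f *: vmap phi S.
Proof.
apply: funext => n; rewrite /vmap !vserZ lin_sum //.
by apply: eq_bigr => i _; rewrite linZ.
Qed.
Lemma vmap_svec f v : vmap phi (svec f v) = svec f (phi v).
Proof. by apply: funext => n; rewrite /vmap /svec linZ. Qed.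
Lemma vmap_comp S mu : vmap phi (vcomp S mu) = vcomp (vmap phi S) mu.
Proof.
apply: funext => n; rewrite /vmap /vcomp lin_sum //.
by apply: eq_bigr => i _; rewrite linZ.
Qed.
Lemma vmap_hasse l S : vmap phi (vhasse l S) = vhasse l (vmap phi S).
Proof. by apply: funext => n; rewrite /vmap /vhasse linMn. Qed.
End Vmap.

Variable A : gradedVA V.
Local Notation T := (Tdp A).

Lemma Tdp_linear n : linear (T n).
Proof. exact: vprod_linl. Qed.
Lemma Tdp0 v : T 0 v = v.
Proof. by rewrite /Tdp subr0 vac_r. Qed.

Lemma TdpM m n v : T m (T n v) = T (m + n)%N v *+ 'C(m + n, m).
Proof.
have [N0 H] := vassoc A v (vac A) (vac A) (-1 - n%:Z) (-1 - m%:Z).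
have {H} := H (maxn N0 m.+1) (leq_maxl _ _); rewrite /Tdp => <-.
have lm : (m < maxn N0 m.+1)%N by rewrite leq_max ltnSn orbT.
rewrite (bigD1 (Ordinal lm)) //= big1 ?addr0; last first.
  move=> j; rewrite -val_eqE /= => jm; rewrite vac_l ifF; last by apply/eqP; lia.
  by rewrite vac_r0 !(lin0 (vprod_linr _ _ _)) mul0rz subr0 mul0rz.
rewrite vac_l ifT; last by apply/eqP; lia.
rewrite vac_r0 (lin0 (vprod_linr _ _ _)) mul0rz subr0.
have -> : -1 - n%:Z = Negz n by lia.
rewrite /gbin mulrA -expr2 sqrr_sign mul1r addnC.
have -> : Negz n - m%:Z = -1 - (n + m)%:Z by lia.
by rewrite pmulrn (addnC n).
Qed.

Lemma Tdp_gr n d v : vgr A d v -> vgr A (d + n)%N (T n v).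
Proof.
move=> h; have := vgr_prod (-1 - n%:Z) h (vgr_vac A); rewrite -/(T n v).
by have -> : d%:Z + 0%:Z - 1 - (-1 - n%:Z) = (d + n)%:Z by lia.
Qed.

(* e^{g T} S, for g(0) = 0 *)
Definition vexpT g S : vser V :=
  fun n => \sum_(m < n.+1) (g ^+ m *: vmap (T m) S) n.

Lemma vexpTE N n g S : g 0%N = 0 -> (n < N)%N ->
  vexpT g S n = (\sum_(m < N) g ^+ m *: vmap (T m) S) n.
Proof.
move=> g0 nN; rewrite vser_sum.
apply: (@sum_widen0 _ _ _ (fun m => (g ^+ m *: vmap (T m) S) n)) => // m h.
by apply: (ordZ (a := m) (b := 0)) => //; [exact: ordX | rewrite addn0].
Qed.

Lemma vexpT_X S n : vexpT fX S n = \sum_(m < n.+1) T m (S (n - m)%N).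
Proof. by apply: eq_bigr => m _; rewrite fXnZ -ltnS ltn_ord. Qed.

Lemma vexpT_NX S n : vexpT (- fX) S n = \sum_(m < n.+1) (-1) ^+ m *: T m (S (n - m)%N).
Proof.
apply: eq_bigr => m _; rewrite (exprNn fX).
have -> : (-1) ^+ m = fcst ((-1) ^+ m) :> fps k by rewrite rmorphXn rmorphN rmorph1.
by rewrite -scalerA fcstZ fXnZ -ltnS ltn_ord.
Qed.

Lemma vexpTD g S S' : vexpT g (S + S') = vexpT g S + vexpT g S'.
Proof.
apply: funext => n; rewrite vserD /vexpT -big_split; apply: eq_bigr => m _.
by rewrite vmapD ?scalerDr //; exact: Tdp_linear.
Qed.
Lemma vexpT0 g : vexpT g 0 = 0.
Proof.
apply: funext => n; rewrite /vexpT big1 // => m _.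
by rewrite vmap0 ?scaler0 //; exact: Tdp_linear.
Qed.
Lemma vexpT_sum g I (r : seq I) (Q : pred I) (F : I -> vser V) :
  vexpT g (\sum_(i <- r | Q i) F i) = \sum_(i <- r | Q i) vexpT g (F i).
Proof. exact: (big_morph _ (vexpTD g) (vexpT0 g)). Qed.

Lemma vexpTZ f g S : g 0%N = 0 -> vexpT g (f *: S) = f *: vexpT g S.
Proof.
move=> g0; apply: funext => n.
rewrite (vserZ_eq (N := n.+1) (fun i _ => erefl (f i))
  (fun i => @vexpTE n.+1 i g S g0)) // (vexpTE _ g0 (ltnSn n)).
rewrite scaler_sumr !vser_sum; apply: eq_bigr => m _.
by rewrite vmapZ; [rewrite !scalerA mulrC | exact: Tdp_linear].
Qed.

Lemma vexpT_eq N g S S' : g 0%N = 0 -> (forall i, (i < N)%N -> S i = S' i) ->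
  forall i, (i < N)%N -> vexpT g S i = vexpT g S' i.
Proof.
move=> g0 SS i hi; apply: eq_bigr => m _.
apply: (@vserZ_eq _ _ N) => // j hj.
by rewrite /vmap SS.
Qed.

Lemma vexpT_exp g h S : g 0%N = 0 -> h 0%N = 0 ->
  vexpT g (vexpT h S) = vexpT (g + h) S.
Proof.
move=> g0 h0; apply: funext => n; have nN := ltnSn n.
have gh0 : (g + h) 0%N = 0 by rewrite fpsD g0 h0 addr0.
rewrite (vexpT_eq (N := n.+1) g0 (fun i => @vexpTE n.+1 i h S h0)) //.
rewrite vexpT_sum vser_sum (vexpTE _ gh0 nN) vser_sum.
pose G i j := ((g ^+ i * h ^+ j) *: vmap (T (i + j)) S) n *+ 'C(i + j, i).
transitivity (\sum_(i < n.+1) \sum_(j < n.+1) G i j).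
  rewrite [RHS]exchange_big /=; apply: eq_bigr => j _.
  rewrite vexpTZ // (vserZ_eq (N := n.+1) (fun i _ => erefl ((h ^+ j) i))
    (fun i => @vexpTE n.+1 i g _ g0)) // scaler_sumr vser_sum.
  apply: eq_bigr => i _; rewrite scalerA mulrC /G -vserMn scalerMnr.
  suff -> : vmap (T i) (vmap (T j) S) = vmap (T (i + j)) S *+ 'C(i + j, i) by [].
  by apply: funext => l; rewrite vserMn /vmap TdpM.
rewrite -(@triangle_sum0 _ n.+1 G); last first.
  move=> i j ij; rewrite /G (ordZ (a := i + j) (b := 0)) ?mul0rn //.
    by apply: ordM; exact: ordX.
  by rewrite addn0.
apply: eq_bigr => m _; rewrite addrC exprDn scaler_suml vser_sum.
apply: eq_bigr => i _; rewrite /G subnKC 1?mulrC -?scalerMnl ?vserMn //.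
by rewrite -ltnS.
Qed.

Lemma vexpT00 S : vexpT 0 S = S.
Proof.
apply: funext => n; rewrite /vexpT big_ord_recl expr0 scale1r /vmap Tdp0.
by rewrite big1 ?addr0 // => i _; rewrite expr0n scale0r.
Qed.

Lemma vexpTK g S : g 0%N = 0 -> vexpT (- g) (vexpT g S) = S.
Proof. by move=> g0; rewrite vexpT_exp ?addNr ?vexpT00 // fpsN g0 oppr0. Qed.
Lemma vexpTNK g S : g 0%N = 0 -> vexpT g (vexpT (- g) S) = S.
Proof. by move=> g0; rewrite vexpT_exp ?subrr ?vexpT00 // fpsN g0 oppr0. Qed.

Lemma vexpT_comp g S mu : g 0%N = 0 -> mu 0%N = 0 ->
  vcomp (vexpT g S) mu = vexpT (scomp g mu) (vcomp S mu).
Proof.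
move=> g0 mu0; apply: funext => n; have nN := ltnSn n.
rewrite (vcomp_eq (N := n.+1) (fun i => @vexpTE n.+1 i g S g0)
  (fun i _ => erefl (mu i))) // vcomp_sum vser_sum.
rewrite (@vexpTE n.+1) ?scomp_n0 // vser_sum; apply: eq_bigr => m _.
rewrite vcompZ // scompX // vmap_comp //; exact: Tdp_linear.
Qed.

Lemma vhasse_expT l S : vhasse l (vexpT fX S) =
  vexpT fX (\sum_(i < l.+1) vmap (T i) (vhasse (l - i) S)).
Proof.
apply: funext => n; rewrite vexpT_sum vser_sum /vhasse vexpT_X.
rewrite -(hasse_conv (fun m j => T m (S j))); apply: eq_bigr => i _.
rewrite vexpT_X; apply: eq_bigr => a _.
by rewrite /vmap /vhasse !(linMn (Tdp_linear _)) TdpM -mulrnA -['C(a + i, i)]bin_sub ?leq_addl // addnK.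
Qed.

End VertexSeries.

(** * Binomial series and the change of coordinate at a node *)

Section Binomial.
Variable k : fieldType.

(* (1 + x)^z *)
Definition bser (z : int) : fps k := fun l => (gbin z l)%:~R.

Lemma gbinS (z : int) l : gbin (z + 1) l.+1 = gbin z l.+1 + gbin z l.
Proof.
case: z => [m|[|m]].
- by rewrite -[_ + 1]/(Posz (m + 1)) addn1 /gbin binS PoszD.
- by rewrite (_ : Negz 0 + 1 = 0%:Z) //= !add0n !binn !mulr1 bin0n /= exprS mulN1r addNr.
- have -> : Negz m.+1 + 1 = Negz m by lia.
  rewrite /gbin (_ : 'C(m.+1 + l.+1, l.+1) = 'C(m + l.+1, l.+1) + 'C(m.+1 + l, l))%N.
    by rewrite PoszD exprS; ring.
  by rewrite addSn binS addnS -addSn.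
Qed.

Lemma gbin0 z : gbin z 0 = 1.
Proof. by case: z => m; rewrite /gbin ?bin0 // mulr1. Qed.

Lemma bserS z : bser (z + 1) = bser z * (1 + fX).
Proof.
apply: funext => -[|l]; rewrite mulrDr mulr1 fpsD mulrC fXM /bser.
  by rewrite !gbin0 addr0.
by rewrite gbinS intrD.
Qed.

Lemma bser0 : bser 0 = 1.
Proof. by apply: funext => -[|l]; rewrite fps1 /bser //= bin0n. Qed.

Lemma fX1_inj (f g : fps k) : f * (1 + fX) = g * (1 + fX) -> f = g.
Proof.
have h : (1 + fX : fps k) 0%N != 0 by rewrite fpsD addr0 oner_eq0.
have K e : e = e * (1 + fX) * (sinv (1 + fX) : fps k).
  by rewrite -mulrA [(1 + fX) * _]mulrC sinvM // mulr1.
by move=> E; rewrite (K f) E -K.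
Qed.

Lemma bserD a b : bser (a + b) = bser a * bser b.
Proof.
elim/int_rec: b => [|n IH|n IH]; first by rewrite addr0 bser0 mulr1.
  have -> : a + n.+1%:Z = a + n%:Z + 1 by lia.
  by rewrite bserS IH -addn1 PoszD bserS mulrA.
apply: fX1_inj; rewrite -bserS -mulrA -bserS.
have -> : a + - n.+1%:Z + 1 = a - n%:Z by lia.
by have -> : - n.+1%:Z + 1 = - n%:Z by lia.
Qed.

Lemma bserMn z n : bser (z *+ n) = bser z ^+ n.
Proof. by elim: n => [|n IH]; rewrite ?mulr0n ?bser0 // exprS mulrS bserD IH. Qed.

Local Notation gam := (sgamma k : fps k).

Lemma sgamma1 : 1 + gam = bser (-1).
Proof.
apply: funext => n; rewrite fpsD fps1 /sgamma /bser /= add0n binn mulr1.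
by case: n => [|n] /=; rewrite ?addr0 // add0r rmorphXn rmorphN1.
Qed.

Lemma sgammaX : gam * (1 + fX) = - fX.
Proof.
apply: (addrI (1 + fX)); rewrite -{1}[1 + fX]mul1r -mulrDl sgamma1 -bserS.
by rewrite addNr bser0 addrK.
Qed.

Lemma sgammaE : gam = - fX * bser (-1).
Proof. by apply: fX1_inj; rewrite sgammaX -mulrA -bserS addNr bser0 mulr1. Qed.

Lemma scomp_gamma : scomp gam gam = fX.
Proof.
have h : bser (-1) * (1 + fX) = 1 by rewrite -bserS addNr bser0.
have := congr1 (fun f => scomp f gam : fps k) h.
have s1 : scomp (1 : fps k) gam = 1 :> fps k := scomp_c 1 gam.
rewrite -sgamma1 scompM // !scompD scomp_X // s1 sgamma1 => E.
move: h; rewrite mulrC => h; apply: (addrI (1 : fps k)).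
by rewrite (sinv_uniq E) (sinv_uniq h).
Qed.

Lemma sgamma_orth n (i j : nat) : (j < n)%N ->
  \sum_(l < n) (gam ^+ i) l * (gam ^+ l) j = (j == i)%:R.
Proof.
move=> jn; rewrite -fXnE -scomp_gamma -scompX // scompE (vcompE _ _ jn) //.
by apply: eq_bigr => l _; rewrite mulrC.
Qed.

Lemma sum_gamma_bin l m D : (m <= l)%N ->
  \sum_(i < l.+1 - m) (gam ^+ (m + i)) l *+ 'C(D, i) =
  (-1) ^+ m * bser (- (D + m)%:Z) (l - m)%N.
Proof.
move=> ml.
have E : gam ^+ m * (1 + gam) ^+ D = fX ^+ m * (fcst ((-1) ^+ m) * bser (- (D + m)%:Z)).
  have -> : bser (- (D + m)%:Z) = bser (-1) ^+ (D + m).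
    by rewrite -bserMn; congr bser; rewrite mulNrn natz.
  rewrite sgamma1 {1}sgammaE !exprMn (exprNn fX) exprD.
  have -> : fcst ((-1) ^+ m) = (-1) ^+ m :> fps k by rewrite rmorphXn rmorphN1.
  by ring.
have := congr1 (fun f : fps k => f l) E; rewrite fXnM ml fcstM => <-.
rewrite exprDn mulr_sumr fps_sum.
pose F i := (gam ^+ (m + i)) l *+ 'C(D, i).
rewrite (sum_widen0 (N := maxn (l.+1 - m) D.+1) (F := F)) ?leq_maxl //; last first.
  by move=> i hi; rewrite /F ordX ?mul0rn //; lia.
rewrite -(sum_widen0 (n := D.+1) (F := F)) ?leq_maxr //; last first.
  by move=> i hi; rewrite /F bin_small.
by apply: eq_bigr => i _; rewrite /F expr1n mul1r mulrnAr -exprD fpsMn.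
Qed.

End Binomial.

(** * Lattices at a node *)

Section Zspan.
Variables (M : zmodType).
Implicit Types G : set M.

Lemma zspan_gen G x : G x -> zspan G x.
Proof. by move=> Gx; rewrite -[x]addr0; apply: zspanD => //; exact: zspan0. Qed.
Lemma zspan_add G x y : zspan G x -> zspan G y -> zspan G (x + y).
Proof.
move=> hx hy; elim: hx => [|u v Gu _ IH]; first by rewrite add0r.
by rewrite -addrA; exact: zspanD.
Qed.
Lemma zspan_sum G I (r : seq I) (Q : pred I) (F : I -> M) :
  (forall i, Q i -> zspan G (F i)) -> zspan G (\sum_(i <- r | Q i) F i).
Proof.
move=> h; elim/big_rec: _ => [|i x Qi hx]; first exact: zspan0.
exact: zspan_add (h i Qi) hx.
Qed.
End Zspan.

Lemma zspan_map (M N : zmodType) (G : set M) (H : set N) (phi : M -> N) : phi 0 = 0 -> {morph phi : x y / x + y} ->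
  (forall x, G x -> zspan H (phi x)) -> forall x, zspan G x -> zspan H (phi x).
Proof.
move=> phi0 phiD GH x; elim=> [|u v Gu _ IH]; first by rewrite phi0; exact: zspan0.
by rewrite phiD; apply: zspan_add => //; exact: GH.
Qed.

Section Lattice.
Variables (k : fieldType) (V : lmodType k) (A : gradedVA V).
Implicit Types (f g h mu nu : fps k) (S : vser V) (v a : V).
Local Notation T := (Tdp A).
Local Notation gam := (sgamma k : fps k).

Lemma vgr0 d : vgr A d 0.
Proof. by case: (vgr_grading A). Qed.
Lemma vgr_comb d c u v : vgr A d u -> vgr A d v -> vgr A d (c *: u + v).
Proof. by case: (vgr_grading A) => _ h _ _; exact: h. Qed.
Lemma vgrZ d c u : vgr A d u -> vgr A d (c *: u).
Proof. by move=> h; rewrite -[c *: u]addr0; apply: vgr_comb => //; exact: vgr0. Qed.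

Definition lat e : set (vser V) :=
  zspan [set S | exists d a f, vgr A d a /\ S = svec (fX ^+ (d + e) * f) a].

Lemma latticeE S : lattice A S <-> lat 0 S.
Proof.
split; apply: (@zspan_map _ _ _ _ id) => // _ [d [a [f [ha ->]]]];
  apply: zspan_gen; exists d, a, f.
- by rewrite addn0 -sshiftE.
- by rewrite addn0 sshiftE.
Qed.

Lemma lat_gen e d a f : vgr A d a -> lat e (svec (fX ^+ (d + e) * f) a).
Proof. by move=> h; apply: zspan_gen; exists d, a, f. Qed.

Lemma lat_gen1 d a f : vgr A d a -> lat 1 (svec (sshift d.+1 f) a).
Proof. by rewrite sshiftE -[d.+1]addn1; exact: lat_gen. Qed.

Lemma lat_add e S S' : lat e S -> lat e S' -> lat e (S + S').
Proof. exact: zspan_add. Qed.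
Lemma lat_sum e I (r : seq I) (Q : pred I) (F : I -> vser V) :
  (forall i, Q i -> lat e (F i)) -> lat e (\sum_(i <- r | Q i) F i).
Proof. exact: zspan_sum. Qed.

Lemma lat_map e e' (phi : vser V -> vser V) : phi 0 = 0 -> {morph phi : x y / x + y} ->
  (forall d a f, vgr A d a -> lat e' (phi (svec (fX ^+ (d + e) * f) a))) ->
  forall S, lat e S -> lat e' (phi S).
Proof.
move=> p0 pD H S; apply: zspan_map => // _ [d [a [f [ha ->]]]].
exact: H.
Qed.

Lemma latZ e f S : lat e S -> lat e (f *: S).
Proof.
apply: lat_map => [|x y|d a g ha]; rewrite ?scaler0 ?scalerDr //.
by rewrite svecZ mulrCA; exact: lat_gen.
Qed.
Lemma latN e S : lat e S -> lat e (- S).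
Proof. by move=> h; rewrite -scaleN1r; exact: latZ. Qed.
Lemma latX e S : lat e S -> lat e.+1 (fX *: S).
Proof.
apply: lat_map => [|x y|d a g ha]; rewrite ?scaler0 ?scalerDr //.
by rewrite svecZ mulrA -exprS -addnS; exact: lat_gen.
Qed.
Lemma lat1_lat0 S : lat 1 S -> lat 0 S.
Proof.
apply: (@lat_map 1 0 id) => // d a f ha.
by rewrite addn1 exprSr -mulrA -[d]addn0; exact: lat_gen.
Qed.
Lemma latZ1 f S : f 0%N = 0 -> lat 0 S -> lat 1 (f *: S).
Proof.
move=> f0 h; rewrite [f](@fXn_div _ 1) ?expr1; last by case.
by rewrite -scalerA; apply: latX; exact: latZ.
Qed.

(* s^l times the coefficient of z^l in e^{zT} S(s + z) *)
Definition lg l S : vser V :=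
  fX ^+ l *: \sum_(i < l.+1) vmap (T i) (vhasse (l - i) S).

Lemma lgE l S : lg l S = fX ^+ l *: vexpT A (- fX) (vhasse l (vexpT A fX S)).
Proof. by rewrite vhasse_expT vexpTK. Qed.

Lemma lgD l S S' : lg l (S + S') = lg l S + lg l S'.
Proof.
rewrite /lg -scalerDr -big_split; congr (_ *: _); apply: eq_bigr => i _.
by rewrite vhasseD vmapD //; exact: Tdp_linear.
Qed.
Lemma lg0 l : lg l 0 = 0.
Proof.
rewrite /lg big1 ?scaler0 // => i _.
by rewrite vhasse0 vmap0 //; exact: Tdp_linear.
Qed.
Lemma lg_sum l I (r : seq I) (Q : pred I) (F : I -> vser V) :
  lg l (\sum_(i <- r | Q i) F i) = \sum_(i <- r | Q i) lg l (F i).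
Proof. exact: (big_morph _ (lgD l) (lg0 l)). Qed.

Lemma lg_svec l f v :
  lg l (svec f v) = \sum_(i < l.+1) (svec (fX ^+ l * shasse (l - i) f) (T i v) : vser V).
Proof.
rewrite /lg scaler_sumr; apply: eq_bigr => i _.
by rewrite vhasse_svec vmap_svec ?svecZ //; exact: Tdp_linear.
Qed.

Lemma shasse_ord l i d f : (i <= l)%N ->
  exists g, fX ^+ l * (shasse (l - i) (fX ^+ d * f) : fps k) = fX ^+ (d + i) * g.
Proof.
move=> il; eexists; apply: fXn_div => j hj.
apply: (ordM (a := l) (b := d - (l - i))); last by lia.
  by move=> m hm; rewrite fXnE (ltn_eqF hm).
by move=> m hm; rewrite /shasse fXnM ifF ?mulr0 //; apply/negbTE; rewrite -ltnNge; lia.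
Qed.

Lemma lat_lg e l S : lat e S -> lat e (lg l S).
Proof.
apply: lat_map => [|x y|d a f ha]; rewrite ?lg0 ?lgD // lg_svec.
apply: lat_sum => i _; have [|g ->] := @shasse_ord l i (d + e) f; first by rewrite -ltnS.
by rewrite addnAC; apply: lat_gen; exact: Tdp_gr.
Qed.

Variable L : moebius A.

Definition nodegen d a : vser V * vser V :=
  (svec (fX ^+ d) a, fcst ((-1) ^+ d) *: \sum_(i < d.+1) (svec (fX ^+ (d - i)) (L1 L i a) : vser V)).

Lemma nodegenE d a : nodegen d a =
  (svec (sshift d (scst 1)) a,
   (-1) ^+ d *: \sum_(i < d.+1) svec (sshift (d - i)%N (scst 1)) (L1 L i a)) :> (nat -> V) * (nat -> V).
Proof.
congr pair; first by rewrite sshiftE mulr1.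
apply: funext => n; rewrite fcstZ vser_sum.
change ((-1) ^+ d *: \sum_(i < d.+1) svec (fX ^+ (d - i)) (L1 L i a) n =
  (-1) ^+ d *: (\sum_(i < d.+1) svec (sshift (d - i) (scst 1)) (L1 L i a)) n).
rewrite fct_sumE; congr (_ *: _); apply: eq_bigr => i _.
by rewrite sshiftE mulr1.
Qed.

Lemma node_gen1 d a : vgr A d a -> node_lattice L (nodegen d a).
Proof. by move=> ha; apply: zspan_gen; left; exists d, a; rewrite nodegenE. Qed.

Lemma L1_grN d i a : vgr A d a -> (d < i)%N -> L1 L i a = 0.
Proof.
move=> ha h; have := L1_gr L i ha.
by have -> : d%:Z - i%:Z = Negz (i - d).-1 by lia.
Qed.
Lemma L1_grP d i a : vgr A d a -> (i <= d)%N -> vgr A (d - i) (L1 L i a).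
Proof.
move=> ha h; have := L1_gr L i ha.
by have -> : d%:Z - i%:Z = (d - i)%N%:Z by lia.
Qed.

Lemma L1_Tdp d a p i : vgr A d a -> L1 L p (T i a) =
  \sum_(r < (minn p i).+1) ((-1) ^+ r * (bser k (p%:Z - i%:Z - (2 * d)%:Z)) r) *:
     T (i - r) (L1 L (p - r) a).
Proof.
move=> ha; rewrite L1_T; apply: eq_bigr => r _.
have rp : (r <= p)%N by have := ltn_ord r; rewrite ltnS leq_min => /andP[].
have [h|h] := leqP (p - r) d; last first.
  rewrite (L1_grN ha h) (lin0 (Tdp_linear A _)) scaler0 big1 // => j _.
  by rewrite (lin0 (L0_lin L _)) (lin0 (Tdp_linear A _)) mul0rz.
under eq_bigr => j _.
  rewrite (L0_gr L _ (L1_grP ha h)) (linMz (Tdp_linear A _)).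
  rewrite -mulrzA -scaler_int; over.
rewrite -scaler_suml; congr (_ *: _).
have -> : p%:Z - i%:Z - (2 * d)%:Z =
  ((2 * r)%:Z - p%:Z - i%:Z) + - (2 * (d - (p - r)))%N%:Z by lia.
rewrite bserD fpsM mulr_sumr; apply: eq_bigr => j _.
by rewrite /bser !intrM rmorph_sign; ring.
Qed.

Lemma shasse_fXn j d : shasse j (fX ^+ d : fps k) = (if (j <= d)%N then fX ^+ (d - j) else 0) *+ 'C(d, j) :> fps k.
Proof.
apply: funext => n; rewrite fpsMn /shasse fXnE; case: leqP => h.
  rewrite fXnE; have -> : (n == d - j)%N = (n + j == d)%N by apply/eqP/eqP; lia.
  by case: eqP => [<-|]; rewrite ?mulr1 ?mulr0 ?mul0rn.
by rewrite (_ : (n + j == d)%N = false) ?mulr0 ?mul0rn //; apply/eqP; lia.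
Qed.

Lemma svecMn f v n : (svec f (v *+ n) : vser V) = (svec f v : vser V) *+ n.
Proof. by apply: funext => m; rewrite vserMn /svec -scalerMnr. Qed.
Lemma svecfMn f v n : (svec (f *+ n) v : vser V) = (svec f v : vser V) *+ n.
Proof. by apply: funext => m; rewrite vserMn /svec fpsMn scalerMnl. Qed.
Lemma svecZr f c v : (svec f (c *: v) : vser V) = fcst c *: (svec f v : vser V).
Proof. by apply: funext => m; rewrite fcstZ /svec !scalerA mulrC. Qed.
Lemma svec0r f : (svec f 0 : vser V) = 0.
Proof. by apply: funext => m; rewrite /svec scaler0. Qed.

Lemma lg_fXn l d v : lg l (svec (fX ^+ d) v) =
  \sum_(i < l.+1) (svec (fX ^+ (d + i)) (T i v) : vser V) *+ 'C(d, l - i).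
Proof.
rewrite lg_svec; apply: eq_bigr => i _; rewrite -svecfMn shasse_fXn.
suff -> : fX ^+ l * ((if (l - i <= d)%N then fX ^+ (d - (l - i)) else 0) *+ 'C(d, l - i))
  = fX ^+ (d + i) *+ 'C(d, l - i) :> fps k by [].
rewrite mulrnAr; have [h|h] := leqP (l - i) d; last by rewrite bin_small.
by rewrite -exprD; congr (_ ^+ _ *+ _); have := ltn_ord i; lia.
Qed.

Lemma lgZc l c S : lg l (fcst c *: S) = fcst c *: lg l S.
Proof.
rewrite /lg scalerA mulrC -scalerA; congr (_ *: _); rewrite scaler_sumr.
apply: eq_bigr => i _; rewrite -vmapZ; last exact: Tdp_linear.
suff -> : vhasse (l - i) (fcst c *: S) = fcst c *: vhasse (l - i) S by [].
by apply: funext => n; rewrite fcstZ /vhasse fcstZ scalerMnr.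
Qed.

Lemma lg_nodegen l d a : vgr A d a ->
  (lg l (nodegen d a).1,
   \sum_(j < l.+1) fcst ((gam ^+ j) l) *: lg j (nodegen d a).2) =
  \sum_(i < l.+1) nodegen (d + i) (T i a *+ 'C(d, l - i)).
Proof.
move=> ha.
pose Y m i : vser V := svec (fX ^+ (d - i + m)) (T m (L1 L i a)).
pose H r m i := fcst ((-1) ^+ (d + m) * 'C(d, l - (m + r))%:R *
  bser k (i%:Z - m%:Z - (2 * d)%:Z) r) *: Y m i.
have Y0 m i : (d < i)%N -> Y m i = 0.
  by move=> h; rewrite /Y (L1_grN ha h) (lin0 (Tdp_linear A _)) svec0r.
apply/eqP; rewrite -pair_eqE; apply/andP; split; apply/eqP.
  rewrite /= lg_fXn; elim/big_ind2: _ => // [x1 x2 y1 y2 -> ->//|i _].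
  by rewrite /= svecMn.
transitivity (\sum_(m < l.+1) \sum_(i < d.+1)
    (fcst ((-1) ^+ (d + m) * bser k (- (d - i + m)%N%:Z) (l - m)%N)) *: Y m i).
  rewrite /=; under eq_bigr => j _.
    rewrite lgZc lg_sum scaler_sumr scaler_sumr.
    under eq_bigr => i _ do rewrite lg_fXn scaler_sumr scaler_sumr.
    rewrite exchange_big /=.
    over.
  rewrite /=.
  pose G m j : vser V := \sum_(i < d.+1)
    (fcst ((gam ^+ (m + j)) l *+ 'C(d - i, j) * (-1) ^+ d) *: Y m i).
  transitivity (\sum_(j < l.+1) \sum_(m < j.+1) G m (j - m)%N).
    apply: eq_bigr => j _; apply: eq_bigr => m _; apply: eq_bigr => i _.
    rewrite subnKC -1?ltnS // rmorphM rmorphMn -scalerA -!scalerMnr -scalerMnl.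
    by [].
  rewrite triangle_sum; apply: eq_bigr => m _; rewrite exchange_big /=.
  apply: eq_bigr => i _; rewrite -scaler_suml -rmorph_sum -mulr_suml.
  rewrite sum_gamma_bin -1?ltnS // mulrC mulrA -exprD.
  by [].
have -> : (\sum_(i < l.+1) nodegen (d + i) (T i a *+ 'C(d, l - i))).2 =
  \sum_(i < l.+1) (nodegen (d + i) (T i a *+ 'C(d, l - i))).2.
  by elim/big_rec2: _ => // i y x _ <-.
transitivity (\sum_(i < l.+1) \sum_(r < i.+1) \sum_(j < d.+1) H r (i - r)%N j).
  rewrite [RHS](eq_bigr (fun i : 'I_l.+1 =>
    \sum_(m < i.+1) \sum_(j < d.+1) H (i - m)%N m j)); last first.
    move=> i _; rewrite (reindex_inj rev_ord_inj) /=; apply: eq_bigr => m _.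
    by rewrite subSS subKn // -ltnS.
  rewrite (triangle_sum _ (fun m r => \sum_(j < d.+1) H r m j)).
  apply: eq_bigr => m _; rewrite exchange_big; apply: eq_bigr => i _.
  rewrite /H -scaler_suml -rmorph_sum; congr (fcst _ *: _).
  under eq_bigr => r _ do rewrite -mulrA.
  rewrite -mulr_sumr; congr (_ * _).
  have -> : - (d - i + m)%N%:Z = (i%:Z - m%:Z - (2 * d)%:Z) + d%:Z.
    by have := ltn_ord i; lia.
  rewrite bserD fpsM subSn -1?ltnS //; apply: eq_bigr => r _.
  by rewrite mulrC subnDA.
apply: eq_bigr => i _; rewrite /=.
pose G r j := if (r <= i)%N then H r (i - r)%N j else 0.
transitivity (\sum_(p < (d + i).+1) \sum_(r < p.+1) G r (p - r)%N).
  rewrite triangle_sum -(sum_widen0 (n := i.+1) (N := (d + i).+1)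
    (F := fun r => \sum_(j < (d + i).+1 - r) G r j)).
  - apply: eq_bigr => r _; rewrite /G -ltnS ltn_ord.
    rewrite (sum_widen0 (n := d.+1) (N := (d + i).+1 - r) (F := H r (i - r)%N)) //.
      by have := ltn_ord r; lia.
    by move=> j h; rewrite /H Y0 // scaler0.
  - by rewrite ltnS leq_addl.
  - by move=> r h; rewrite big1 // => j _; rewrite /G leqNgt h.
rewrite scaler_sumr; apply: eq_bigr => p _.
rewrite linMn; last exact: L1_lin.
rewrite (L1_Tdp _ _ ha).
transitivity (\sum_(r < (minn p i).+1) H r (i - r)%N (p - r)%N).
  have [pi|ip] := leqP p i.
    by apply: eq_bigr => r _; rewrite /G ifT //; have := ltn_ord r; lia.
  rewrite -(sum_widen0 (n := i.+1) (F := fun r => G r (p - r)%N)).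
  - by apply: eq_bigr => r _; rewrite /G -ltnS ltn_ord.
  - by rewrite ltnS ltnW.
  - by move=> r h; rewrite /G leqNgt h.
rewrite svecMn -scalerMnr.
have svD f : {morph (fun v => svec f v : vser V) : u v / u + v}.
  by move=> u v; apply: funext => n; rewrite vserD /svec scalerDr.
rewrite (big_morph _ (svD _) (svec0r _)) scaler_sumr -sumrMnl.
apply: eq_bigr => r _.
have [h|h] := leqP (p - r) d; last first.
  by rewrite /H Y0 // (L1_grN ha h) (lin0 (Tdp_linear A _)) !scaler0 svec0r scaler0 mul0rn.
have rp : (r <= minn p i)%N by rewrite -ltnS.
rewrite svecZr scalerA -rmorphM /H /Y.
have -> : (d - (p - r) + (i - r) = d + i - p)%N by move: rp; rewrite leq_min; lia.
rewrite scalerMnl -rmorphMn; congr (fcst _ *: _).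
have -> : (p - r)%N%:Z - (i - r)%N%:Z - (2 * d)%:Z = p%:Z - i%:Z - (2 * d)%:Z.
  by move: rp; rewrite leq_min; lia.
have ir : (i - r + r = i)%N by move: rp; rewrite leq_min; lia.
have -> : (-1) ^+ (d + i) = (-1) ^+ (d + (i - r)) * (-1) ^+ r :> k.
  by rewrite -exprD -addnA ir.
rewrite ir -[RHS]mulr_natr -!mulrA.
congr (_ * _).
by rewrite [RHS]mulrA -expr2 sqrr_sign mul1r mulrC.
Qed.

Lemma node_lat1 Sp Sm : lat 1 Sp -> lat 1 Sm -> node_lattice L (Sp, Sm).
Proof.
move=> hp hm.
have -> : (Sp, Sm) = (Sp, 0) + (0, Sm) :> (nat -> V) * (nat -> V).
  by congr pair; [exact: (esym (addr0 Sp)) | exact: (esym (add0r Sm))].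
have z f : svec f 0 = 0 :> (nat -> V) by exact: svec0r.
apply: zspan_add.
  move: Sp hp; apply: (@zspan_map _ _ _ _ (fun S : nat -> V => (S, 0 : nat -> V))) => //.
    by move=> x y; congr pair; exact: (esym (addr0 (0 : nat -> V))).
  move=> _ [d [a [f [ha ->]]]]; apply: zspan_gen; right.
  exists d, a, f, 0%N, 0, 0; split=> //; first exact: vgr0.
  by rewrite z sshiftE addn1.
move: Sm hm; apply: (@zspan_map _ _ _ _ (fun S : nat -> V => (0 : nat -> V, S))) => //.
  by move=> x y; congr pair; exact: (esym (addr0 (0 : nat -> V))).
move=> _ [d [a [f [ha ->]]]]; apply: zspan_gen; right.
exists 0%N, 0, 0, d, a, f; split=> //; first exact: vgr0.
by rewrite z sshiftE addn1.
Qed.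

(* The gluing at the node is horizontal for the logarithmic connection. *)
Lemma node_lg l Sp Sm : node_lattice L (Sp, Sm) ->
  node_lattice L (lg l Sp, \sum_(j < l.+1) fcst ((gam ^+ j) l) *: lg j Sm).
Proof.
pose phi (X : (nat -> V) * (nat -> V)) : (nat -> V) * (nat -> V) :=
  (lg l X.1, \sum_(j < l.+1) fcst ((gam ^+ j) l) *: lg j X.2).
rewrite -[(lg l Sp, _)]/(phi (Sp, Sm)); move: (Sp, Sm).
apply: zspan_map => [||X].
- rewrite /phi lg0; congr pair; rewrite big1 // => j _.
  by rewrite lg0 scaler0.
- move=> X Y; rewrite /phi; congr pair; first exact: lgD.
  transitivity (\sum_(j < l.+1) (fcst ((gam ^+ j) l) *: lg j X.2 +
      fcst ((gam ^+ j) l) *: lg j Y.2)); last exact: big_split.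
  by apply: eq_bigr => j _; rewrite -scalerDr -lgD.
case=> [[d [a [ha ->]]]|[d [b [f [e [c [g [hb hc ->]]]]]]]].
  rewrite -nodegenE /phi lg_nodegen //; apply: zspan_sum => i _.
  apply: node_gen1; rewrite -scaler_nat; apply: vgrZ; exact: Tdp_gr.
rewrite /phi /=; apply: node_lat1.
  by apply: lat_lg; exact: lat_gen1.
apply: lat_sum => j _; apply: latZ; apply: lat_lg; exact: lat_gen1.
Qed.

End Lattice.

(** * Germs and completions *)

Section Germs.
Variables (k : fieldType) (X : funSpace k).
Hypothesis hX : variety X.
Implicit Types (P : X) (f g : X -> k) (U W : set X).

Lemma nearP P (A : set X) : (\forall y \near P, A y) <-> exists W, [/\ open W, W P & W `<=` A].
Proof.
rewrite /prop_near1 nbhsE; split.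
  by move=> [W [oW WP] WA]; exists W.
by move=> [W [oW WP WA]]; exists W.
Qed.

Lemma open_near W P : open W -> W P -> \forall y \near P, W y.
Proof. by move=> oW WP; apply/nearP; exists W; split. Qed.

Lemma openN W : (forall P, W P -> \forall y \near P, W y) -> open W.
Proof. by move=> h; rewrite openE => P /h. Qed.

Lemma germ_of W P f : open W -> W P -> reg W f -> germ P f.
Proof. by exists W. Qed.

Lemma reg_germ W f : open W -> (forall P, W P -> germ P f) -> reg W f.
Proof.
case: hX => -[_ _ _ _ glue] _ _ oW h; apply: glue => // x /h [U [oU Ux rU]].
Qed.

Lemma germ_near P f : germ P f -> \forall y \near P, germ y f.
Proof. by move=> [W [oW WP rW]]; apply/nearP; exists W; split=> // y Wy; exists W. Qed.

Lemma germ_ext P f g : germ P f -> (\forall y \near P, f y = g y) -> germ P g.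
Proof.
case: hX => -[_ _ ext res _] _ _ [W [oW WP rW]] /nearP [W' [oW' WP' h]].
have oI := openI oW oW'.
have rI : reg (W `&` W') f by apply: (res W) => // x [].
by exists (W `&` W'); split=> //; apply: (ext _ _ _ oI rI) => x [_ /h].
Qed.

Lemma reg_res U W f : open U -> open W -> W `<=` U -> reg U f -> reg W f.
Proof. by case: hX => -[_ _ _ res _] _ _; exact: res. Qed.

Lemma germ_c P (c : k) : germ P (fun=> c).
Proof.
by case: hX => -[h _ _ _ _] _ _; exists setT; split=> //; [exact: openT | exact/h/openT].
Qed.

Lemma germDM P f g : germ P f -> germ P g ->
  germ P (fun x => f x + g x) /\ germ P (fun x => f x * g x).
Proof.
case: hX => -[_ dm _ res _] _ _ [W [oW WP rW]] [W' [oW' WP' rW']].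
have oI := openI oW oW'.
have [r1 r2] : reg (W `&` W') f /\ reg (W `&` W') g.
  by split; [apply: (res W)|apply: (res W')] => // x [].
by have [? ?] := dm _ _ _ oI r1 r2; split; exists (W `&` W').
Qed.
Lemma germD P f g : germ P f -> germ P g -> germ P (fun x => f x + g x).
Proof. by move=> hf hg; case: (germDM hf hg). Qed.
Lemma germM P f g : germ P f -> germ P g -> germ P (fun x => f x * g x).
Proof. by move=> hf hg; case: (germDM hf hg). Qed.
Lemma germZ P c f : germ P f -> germ P (fun x => c * f x).
Proof. by move=> hf; apply: germM => //; exact: germ_c. Qed.
Lemma germN P f : germ P f -> germ P (fun x => - f x).
Proof. by move=> /(germZ (-1)) h; apply: (germ_ext h); apply: nearW => x; rewrite mulN1r. Qed.
Lemma germB P f g : germ P f -> germ P g -> germ P (fun x => f x - g x).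
Proof. by move=> hf hg; apply: germD => //; exact: germN. Qed.
Lemma germX P f n : germ P f -> germ P (fun x => f x ^+ n).
Proof.
move=> hf; elim: n => [|n IH]; first exact: germ_c.
by apply: (germ_ext (germM hf IH)); apply: nearW => x; rewrite exprS.
Qed.
Lemma germ_sum P I (r : seq I) (Q : pred I) (F : I -> X -> k) :
  (forall i, Q i -> germ P (F i)) -> germ P (fun x => \sum_(i <- r | Q i) F i x).
Proof.
move=> h; elim: r => [|i r IH].
  by apply: (germ_ext (germ_c P 0)); apply: nearW => x; rewrite big_nil.
case Qi: (Q i); last first.
  by apply: (germ_ext IH); apply: nearW => x; rewrite big_cons Qi.
by apply: (germ_ext (germD (h _ Qi) IH)); apply: nearW => x; rewrite big_cons Qi.
Qed.
Lemma germ_prod P I (r : seq I) (Q : pred I) (F : I -> X -> k) :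
  (forall i, Q i -> germ P (F i)) -> germ P (fun x => \prod_(i <- r | Q i) F i x).
Proof.
move=> h; elim: r => [|i r IH].
  by apply: (germ_ext (germ_c P 1)); apply: nearW => x; rewrite big_nil.
case Qi: (Q i); last first.
  by apply: (germ_ext IH); apply: nearW => x; rewrite big_cons Qi.
by apply: (germ_ext (germM (h _ Qi) IH)); apply: nearW => x; rewrite big_cons Qi.
Qed.
Lemma germ_det P n (m : 'I_n -> 'I_n -> X -> k) : (forall i j, germ P (m i j)) ->
  germ P (fun x => \det (\matrix_(i, j) m i j x)).
Proof.
move=> h.
have := @germ_sum P _ (index_enum 'S_n) xpredT
  (fun s x => (-1) ^+ s * \prod_(i < n) m i (s i) x).
move=> /(_ _)/germ_ext; apply.
  by move=> s _; apply: germZ; apply: germ_prod => i _; exact: h.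
apply: nearW => x; rewrite /determinant; apply: eq_bigr => s _; congr (_ * _).
by apply: eq_bigr => i _; rewrite mxE.
Qed.

Lemma affine_at P : exists U, affine U /\ U P.
Proof. by case: hX => _ [N [U [aU cov]]] _; have [i ?] := cov P; exists (U i). Qed.

Lemma germ_frac U P f : affine U -> U P -> germ P f ->
  exists a b, [/\ reg U a, reg U b, b P != 0 & \forall y \near P, f y = a y / b y].
Proof.
move=> [oU _ _ _ hfr] UP [W [oW WP rW]].
have oI := openI oW oU.
have rI : reg (W `&` U) f by apply: (reg_res oW) => // x [].
have [N [a [b [oN NP ra rb h]]]] :=
  (hfr _ f oI (@subIsetr _ W U)).1 rI P (conj WP UP).
exists a, b; split=> //; first by case: (h P NP).
by apply/nearP; exists N; split=> // y /h [].
Qed.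

Lemma affine_neq0 U f : affine U -> reg U f -> open [set y | U y /\ f y != 0].
Proof.
move=> [oU _ _ htop _] rf; apply/htop; first by move=> y [].
by move=> x [Ux fx]; exists f.
Qed.

Lemma near_neq0 P f : germ P f -> f P != 0 -> \forall y \near P, f y != 0.
Proof.
have [U [aU UP]] := affine_at P.
move=> /(germ_frac aU UP) [a [b [ra rb bP h]]] fP.
have aP : a P != 0.
  apply: contraNneq fP => aP; have /nearP [W [_ WP hW]] := h.
  by rewrite (hW P WP) aP mul0r.
have na := open_near (affine_neq0 aU ra) (conj UP aP).
have nb := open_near (affine_neq0 aU rb) (conj UP bP).
near=> y.
have -> : f y = a y / b y by near: y.
rewrite mulf_neq0 ?invr_eq0 //.
- by have [] : U y /\ a y != 0 by near: y.
- by have [] : U y /\ b y != 0 by near: y.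
Unshelve. all: by end_near.
Qed.

Lemma near_pt P (A : set X) : (\forall y \near P, A y) -> A P.
Proof. by move=> /nearP [W [_ WP h]]; exact: h. Qed.

Lemma germ_inv P f : germ P f -> f P != 0 -> germ P (fun x => (f x)^-1).
Proof.
have [U [aU UP]] := affine_at P; have [oU _ _ _ hfr] := aU.
move=> gf fP; have [a [b [ra rb bP h]]] := germ_frac aU UP gf.
have nf := near_neq0 gf fP.
have nb := open_near (affine_neq0 aU rb) (conj UP bP).
have /nearP [W [oW WP hW]] : \forall y \near P,
    [/\ U y, b y != 0, f y != 0 & f y = a y / b y].
  near=> y; have [Uy by0] : U y /\ b y != 0 by near: y.
  by split=> //; near: y.
exists W; split=> //; apply/hfr => // [y /hW [] //|x Wx].
exists W, b, a; split=> // y Wy; have [_ by0 fy0 E] := hW y Wy.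
have ay0 : a y != 0 by apply: contraNneq fy0 => ay; rewrite E ay mul0r.
by split=> //; rewrite E invf_div.
Unshelve. all: by end_near.
Qed.

Lemma germ_div P f g : germ P f -> germ P g -> g P != 0 -> germ P (fun x => f x / g x).
Proof. by move=> hf hg g0; apply: germM => //; exact: germ_inv. Qed.

Lemma affine_sep U (x y : X) : affine U -> U x -> U y -> x <> y ->
  exists2 f, reg U f & f x != f y.
Proof.
move=> [oU _ hchi _ _] Ux Uy xy; apply: contrapT => no.
have [z [_ hu]] : exists! z, U z /\ forall f, reg U f -> f x = f z.
  by apply: (hchi (fun f => f x)); split=> // f g rf h; exact: h.
apply: xy; rewrite -(hu x) // -(hu y) //; split=> // f rf.
by apply/eqP/negPn/negP => fxy; apply: no; exists f.
Qed.

Lemma near_neq (x y : X) : x <> y -> \forall z \near x, z <> y.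
Proof.
move=> xy; have [U [aU Ux]] := affine_at x; have [oU _ _ _ _] := aU.
have [Uy|nUy] := pselect (U y); last first.
  by near=> z => zy; apply: nUy; rewrite -zy; near: z; exact: open_near.
have [f rf fxy] := affine_sep aU Ux Uy xy.
have gf : germ x (fun z => f z - f y).
  by apply: germB; [exact: germ_of rf | exact: germ_c].
near=> z => zy.
have : f z - f y != 0 by near: z; apply: near_neq0 => //; rewrite subr_eq0.
by rewrite zy subrr eqxx.
Unshelve. all: by end_near.
Qed.

Lemma germ_ind U P N (s : 'I_N -> X -> k) (Q : (X -> k) -> Prop) :
  affine U -> U P -> (forall i, reg U (s i)) ->
  (forall f, reg U f -> exists2 g, subalg [set s i | i in [set: 'I_N]] g
     & forall x, U x -> f x = g x) ->
  (forall c, Q (fun=> c)) -> (forall i, Q (s i)) ->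
  (forall f g, germ P f -> germ P g -> Q f -> Q g -> Q (fun x => f x + g x)) ->
  (forall f g, germ P f -> germ P g -> Q f -> Q g -> Q (fun x => f x * g x)) ->
  (forall f, germ P f -> f P != 0 -> Q f -> Q (fun x => (f x)^-1)) ->
  (forall f g, germ P f -> Q f -> (\forall y \near P, f y = g y) -> Q g) ->
  forall f, germ P f -> Q f.
Proof.
move=> aU UP rs gen Qc Qs QD QM QV Qe; have [oU _ _ _ _] := aU.
have Qr f : reg U f -> Q f.
  move=> /gen [g sg fg].
  suff [gg Qg] : germ P g /\ Q g.
    apply: Qe gg Qg _; near=> y; rewrite fg //; near: y; exact: open_near.
  elim: sg => [c|_ [i _ <-]|g1 g2 _ [? ?] _ [? ?]|g1 g2 _ [? ?] _ [? ?]].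
  - by split=> //; exact: germ_c.
  - by split=> //; exact: germ_of (rs i).
  - by split; [exact: germD | exact: QD].
  - by split; [exact: germM | exact: QM].
move=> f gf; have [a [b [ra rb bP h]]] := germ_frac aU UP gf.
have [ga gb] : germ P a /\ germ P b by split; exact: germ_of oU UP _.
have gbi := germ_inv gb bP.
apply: (Qe (fun x => a x * (b x)^-1)); first exact: germM.
- apply: QM => //; [exact: Qr | apply: QV => //; exact: Qr].
- by near=> y; apply/esym; near: y.
Unshelve. all: by end_near.
Qed.

Lemma affine_gen U : affine U -> exists N (s : 'I_N -> X -> k),
  (forall i, reg U (s i)) /\ (forall f, reg U f ->
    exists2 g, subalg [set s i | i in [set: 'I_N]] g & forall x, U x -> f x = g x).
Proof. by case. Qed.

Lemma nakayama P n (m : 'I_n -> 'I_n -> X -> k) :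
  (forall i j, germ P (m i j)) -> (forall i j, m i j P = 0) ->
  exists q : 'I_n -> 'I_n -> X -> k, (forall i j, germ P (q i j)) /\
    \forall x \near P, forall h l,
      \sum_i q h i x * ((i == l)%:R - m i l x) = (h == l)%:R.
Proof.
move=> gm m0.
pose M x : 'M[k]_n := \matrix_(i, j) ((i == j)%:R - m i j x).
have gM i j : germ P (fun x => (i == j)%:R - m i j x).
  by apply: germB => //; exact: germ_c.
have gd : germ P (fun x => \det (M x)) by exact: germ_det.
have MP : M P = 1%:M.
  by apply/matrixP => i j; rewrite !mxE m0 subr0.
have dP : \det (M P) != 0 by rewrite MP det1 oner_eq0.
exists (fun h i x => (\det (M x))^-1 * \adj (M x) h i); split.
  move=> h i; apply: germM; first exact: germ_inv gd dP.
  have g2 := @germ_det P n.-1 (fun a b => fun x => (lift i a == lift h b)%:R - m (lift i a) (lift h b) x)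
    (fun a b => gM _ _).
  apply: (germ_ext (germZ ((-1) ^+ (i + h)) g2)); apply: nearW => x.
  rewrite mxE /cofactor; congr (_ * \det _); apply/matrixP => a b.
  by rewrite !mxE.
near=> x => h l.
have dx : \det (M x) != 0 by near: x; exact: near_neq0.
have := congr1 (fun A : 'M_n => A h l) (mul_adj_mx (M x)).
rewrite !mxE => E; transitivity ((\det (M x))^-1 * ((\det (M x)) *+ (h == l))).
  rewrite -E mulr_sumr; apply: eq_bigr => i _; rewrite [M x i l]mxE mulrA //.
by rewrite mulrnAr mulVf.
Unshelve. all: by end_near.
Qed.

End Germs.

Section Completion.
Variables (k : fieldType) (X : funSpace k).
Hypothesis hX : variety X.
Implicit Types (P : X) (f g : X -> k) (U W : set X).

Section Cm.
Variables (B : Type) (P : X) (tau : (X -> k) -> B -> ser k).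
Hypothesis H : completion_map P tau.
Implicit Type b : B.

Let t f b : fps k := tau f b.

Lemma cm_c c b : t (fun=> c) b = fcst c. Proof. by case: H. Qed.
Lemma cmD f g b : germ P f -> germ P g -> t (fun x => f x + g x) b = t f b + t g b.
Proof. by case: H => _ h _ _ _ gf gg; case: (h f g b gf gg). Qed.
Lemma cmM f g b : germ P f -> germ P g -> t (fun x => f x * g x) b = t f b * t g b.
Proof. by case: H => _ h _ _ _ gf gg; case: (h f g b gf gg). Qed.
Lemma cmZ c f b : germ P f -> t (fun x => c * f x) b = fcst c * t f b.
Proof. by move=> gf; rewrite cmM ?cm_c //; exact: (germ_c hX). Qed.
Lemma cmN f b : germ P f -> t (fun x => -1 * f x) b = - t f b.
Proof. by move=> gf; rewrite cmZ // rmorphN1 mulN1r. Qed.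

Lemma cm_ord n f : germ P f ->
  ((forall b i, (i < n)%N -> t f b i = 0) <-> maxpow P n f).
Proof. by case: H => _ _ _ h _; exact: h. Qed.

Lemma cm_near0 f b : germ P f -> (\forall x \near P, f x = 0) -> t f b = 0.
Proof.
move=> gf /nearP [W [oW WP h]]; apply: funext => i.
apply: (@cm_ord i.+1 f gf).2 => //.
by exists W, 0; split=> //; exact: zspan0.
Qed.

Lemma cm_ext f g b : germ P f -> (\forall x \near P, f x = g x) -> t f b = t g b.
Proof.
move=> gf fg; have gg := germ_ext hX gf fg.
apply/eqP; rewrite -subr_eq0; apply/eqP; rewrite -cmN // -cmD //; last exact: (germZ hX).
apply: cm_near0; first by apply: (germD hX) => //; exact: (germZ hX).
by near=> x; rewrite (near fg x) // mulN1r subrr.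
Unshelve. all: by end_near.
Qed.

Lemma cmB f g b : germ P f -> germ P g -> t (fun x => f x - g x) b = t f b - t g b.
Proof.
move=> gf gg; rewrite -cmN // -cmD //; last exact: (germZ hX).
apply: cm_ext; first exact: (germB hX).
by apply: nearW => x; rewrite mulN1r.
Qed.

Lemma cm_sum I (r : seq I) (Q : pred I) (F : I -> X -> k) b :
  (forall i, Q i -> germ P (F i)) ->
  t (fun x => \sum_(i <- r | Q i) F i x) b = \sum_(i <- r | Q i) t (F i) b.
Proof.
move=> h; elim: r => [|i r IH].
  rewrite big_nil; have := cm_c 0 b; rewrite rmorph0 => <-; apply: cm_ext.
    by apply: (germ_sum hX).
  by apply: nearW => x; rewrite big_nil.
rewrite big_cons -IH; case Qi: (Q i).
  rewrite -cmD; [|exact: h|exact: (germ_sum hX)].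
  apply: cm_ext; first exact: (germ_sum hX).
  by apply: nearW => x; rewrite big_cons Qi.
apply: cm_ext; first exact: (germ_sum hX).
by apply: nearW => x; rewrite big_cons Qi.
Qed.

Lemma cmX f n b : germ P f -> t (fun x => f x ^+ n) b = t f b ^+ n.
Proof.
move=> gf; elim: n => [|n IH]; first exact: (cm_c 1).
rewrite exprS -IH -cmM //; last exact: (germX hX).
apply: cm_ext; first exact: (germX hX).
by apply: nearW => x; rewrite exprS.
Qed.

Lemma cm_inv f b : germ P f -> f P != 0 -> t (fun x => (f x)^-1) b * t f b = 1.
Proof.
move=> gf fP; have gi := germ_inv hX gf fP.
rewrite -cmM // -[1]/(fcst 1) -(cm_c 1 b); apply: cm_ext; first exact: (germM hX).
by near=> x; rewrite mulVf //; near: x; exact: (near_neq0 hX).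
Unshelve. all: by end_near.
Qed.

Lemma maxpow_prod n f (h : 'I_n -> X -> k) : germ P f ->
  (forall l, germ P (h l) /\ h l P = 0) -> maxpow P n (fun x => f x * \prod_l h l x).
Proof.
move=> gf hh; exists setT, (fun x => f x * \prod_l h l x); split=> //; first exact: openT.
by apply: zspan_gen; exists f, h.
Qed.

Lemma cm0 f b : germ P f -> t f b 0%N = f P.
Proof.
move=> gf; have gg : germ P (fun x => f x - f P) by apply: (germB hX) => //; exact: (germ_c hX).
have mp : maxpow P 1 (fun x => 1 * \prod_(l < 1) (f x - f P)).
  apply: (@maxpow_prod 1 (fun=> 1) (fun _ x => f x - f P)); first exact: (germ_c hX).
  by move=> _; rewrite subrr.
have g1 : germ P (fun x => 1 * \prod_(l < 1) (f x - f P)).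
  by apply: (germ_ext hX gg); apply: nearW => x; rewrite big_ord1 mul1r.
have := (cm_ord 1 g1).2 mp b 0%N isT.
rewrite -(@cm_ext (fun x => f x - f P)) //; last first.
  by apply: nearW => x; rewrite big_ord1 mul1r.
rewrite cmB //; last exact: (germ_c hX).
by rewrite cm_c fpsD fpsN => /eqP; rewrite subr_eq0 => /eqP.
Qed.

Lemma cmD1 f g b : germ P f -> germ P g ->
  t (fun x => f x * g x) b 1%N = f P * t g b 1%N + g P * t f b 1%N.
Proof.
move=> gf gg; rewrite cmM // fpsM !big_ord_recl big_ord0 /= addr0 subn0 subnn !cm0 //.
by rewrite [X in _ + X]mulrC.
Qed.
End Cm.

Section Fc.
Variables (P : X) (tau : (X -> k) -> ser k).
Hypothesis H : formal_coord P tau.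
Let t f : fps k := tau f.
Lemma fc_c c : t (fun=> c) = fcst c. Proof. exact: (cm_c H.1 c tt). Qed.
Lemma fcD f g : germ P f -> germ P g -> t (fun x => f x + g x) = t f + t g.
Proof. exact: (@cmD _ _ _ H.1 f g tt). Qed.
Lemma fcM f g : germ P f -> germ P g -> t (fun x => f x * g x) = t f * t g.
Proof. exact: (@cmM _ _ _ H.1 f g tt). Qed.
Lemma fcB f g : germ P f -> germ P g -> t (fun x => f x - g x) = t f - t g.
Proof. exact: (@cmB _ _ _ H.1 f g tt). Qed.
Lemma fcZ c f : germ P f -> t (fun x => c * f x) = fcst c * t f.
Proof. exact: (@cmZ _ _ _ H.1 c f tt). Qed.
Lemma fcX f n : germ P f -> t (fun x => f x ^+ n) = t f ^+ n.
Proof. exact: (@cmX _ _ _ H.1 f n tt). Qed.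
Lemma fc_sum I (r : seq I) (Q : pred I) (F : I -> X -> k) :
  (forall i, Q i -> germ P (F i)) ->
  t (fun x => \sum_(i <- r | Q i) F i x) = \sum_(i <- r | Q i) t (F i).
Proof. exact: (@cm_sum _ _ _ H.1 I r Q F tt). Qed.
Lemma fc_inv f : germ P f -> f P != 0 -> t (fun x => (f x)^-1) * t f = 1.
Proof. exact: (@cm_inv _ _ _ H.1 f tt). Qed.
Lemma fc_ext f g : germ P f -> (\forall x \near P, f x = g x) -> t f = t g.
Proof. exact: (@cm_ext _ _ _ H.1 f g tt). Qed.
Lemma fc0 f : germ P f -> t f 0%N = f P.
Proof. exact: (@cm0 _ _ _ H.1 f tt). Qed.
Lemma fc_ord n f : germ P f -> ((forall i, (i < n)%N -> t f i = 0) <-> maxpow P n f).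
Proof.
move=> gf; rewrite -(cm_ord H.1 n gf).
by split=> [h _|h]; [exact: h | exact: h tt].
Qed.
Lemma fc_surj n (g : fps k) : exists2 f, germ P f & forall i, (i < n)%N -> t f i = g i.
Proof.
case: H => -[_ _ _ _ sj] _; have [f gf hf] := sj n (fun=> g) (fun _ _ => erefl).
by exists f => // i; exact: hf tt i.
Qed.
Lemma fcN f : ~ germ P f -> t f = 0. Proof. by case: H => _; exact. Qed.
End Fc.

Lemma fc_change P tau tau' s f : formal_coord P tau -> germ P s -> centred s P tau' ->
  tau f = scomp (tau' f) ((tau s : fps k) - fcst (s P)).
Proof.
move=> H gs [H' tS]; set mu := (tau s : fps k) - _.
have mu0 : mu 0%N = 0 by rewrite /mu fpsD fpsN (fc0 H gs) subrr.
have [gf|ngf] := pselect (germ P f); last first.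
  rewrite (fcN H ngf) -[X in scomp X _]/(tau' f : fps k) (fcN H' ngf).
  by rewrite scomp0.
apply: funext => n; rewrite (@scomp_svec _ n.+1) //.
have gsi i : germ P (fun x => (s x - s P) ^+ i).
  by apply: (germX hX); apply: (germB hX) => //; exact: (germ_c hX).
pose F x := f x - \sum_(i < n.+1) (tau' f i * (s x - s P) ^+ i).
have gF : germ P F.
  by apply: (germB hX) => //; apply: (germ_sum hX) => // i _; exact: (germZ hX).
have tF (t : (X -> k) -> ser k) : formal_coord P t ->
    t F = (t f : fps k) - \sum_(i < n.+1) fcst (tau' f i) * ((t s : fps k) - fcst (s P)) ^+ i.
  move=> Ht; rewrite /F (fcB Ht) //; last by apply: (germ_sum hX) => // i _; exact: (germZ hX).
  congr (_ - _); rewrite (fc_sum Ht); last by move=> i _; exact: (germZ hX).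
  apply: eq_bigr => i _; rewrite (fcZ Ht) // (fcX Ht).
    by rewrite (fcB Ht) // ?(fc_c Ht) //; exact: (germ_c hX).
  by apply: (germB hX) => //; exact: (germ_c hX).
have h' : forall i, (i < n.+1)%N -> (tau' F : fps k) i = 0.
  move=> i hi; rewrite (tF _ H') fpsD fpsN fps_sum (bigD1 (Ordinal hi)) //=.
  have -> : (tau' s : fps k) - fcst (s P) = fX.
    by rewrite tS -[sadd _ _]/(fcst (s P) + fX) addrAC subrr add0r.
  rewrite fcstM fXnE eqxx mulr1 big1 ?addr0 ?subrr // => j.
  by rewrite -val_eqE /= fcstM fXnE eq_sym => /negbTE ->; rewrite mulr0.
have := (fc_ord H n.+1 gF).2 ((fc_ord H' n.+1 gF).1 h') n (ltnSn n).
rewrite (tF _ H) fpsD fpsN => /eqP; rewrite subr_eq0 => /eqP -> //.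
Qed.

Lemma fc_recenter P tau s : formal_coord P tau -> germ P s -> (tau s : fps k) 1%N != 0 ->
  exists tau', centred s P tau'.
Proof.
move=> H gs s1; pose mu := (tau s : fps k) - fcst (s P).
have Hmu : AutO mu.
  split; first by rewrite /mu fpsD fpsN (fc0 H gs) subrr.
  by rewrite /mu fpsD fpsN subr0; apply/eqP.
have [nu [Hnu mn nm]] := scomp_inv Hmu.
have [nu0 _] := Hnu; have [mu0 _] := Hmu.
exists (fun f => scomp (tau f) nu); split; last first.
  rewrite -[sadd _ _]/(fcst (s P) + fX) -mn /mu scompD scompN scomp_c addrC subrK //.
split; last by move=> f /(fcN H) h; rewrite -[X in scomp X _]/(tau f : fps k) h scomp0.
have ordc (f e : fps k) n : e 0%N = 0 -> (forall i, (i < n)%N -> f i = 0) ->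
    forall i, (i < n)%N -> (scomp f e : fps k) i = 0.
  move=> e0 f0 i hi; rewrite /scomp big1 // => m _; rewrite f0 ?mul0r //.
  by have := ltn_ord m; lia.
split=> [c _|f g _ gf gg|//|n f gf|n g _].
- by rewrite -[X in scomp X _]/(tau _ : fps k) (fc_c H) scomp_c.
- rewrite -[X in scomp X _ = _ /\ _]/(tau _ : fps k) (fcD H) // scompD; split=> //.
  by rewrite -[X in scomp X _ = _]/(tau _ : fps k) (fcM H) // scompM.
- apply: (iff_trans _ (fc_ord H n gf)); split=> [h i hi|h _ i hi]; last exact: ordc nu0 h i hi.
  have -> : tau f = scomp (scomp (tau f) nu) mu by rewrite scompA // nm scompfX.
  by apply: ordc hi => // j; exact: h tt j.
have [f gf hf] := fc_surj H n (scomp (g tt) mu); exists f => // -[] i hi.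
have {1}-> : g tt = scomp (scomp (g tt) mu) nu by rewrite scompA // mn scompfX.
rewrite !scompE; apply: (@vcomp_eq _ k^o n) => // j hj.
by rewrite -scompE; exact: hf.
Qed.

Lemma formal_of_smooth P : smooth_point P -> exists tau, formal_coord P tau.
Proof.
move=> [t H]; exists (fun f => if pselect (germ P f) is left _ then t f tt else fun=> 0).
split; last by move=> f nf; case: pselect.
case: (H) => h1 h2 h3 h4 h5; split=> [c b|f g b gf gg|//|n f gf|n g hg].
- by case: pselect => [?|n]; [exact: h1 | case: n; exact: (germ_c hX)].
- have [? ?] := germDM hX gf gg.
  by case: pselect => // _; case: pselect => // _; case: pselect => // _; case: pselect => // _; exact: h2.
- apply: (iff_trans _ (h4 n f gf)); case: pselect => // _.
  by split=> [h [] i|h [] i]; exact: h tt i.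
- have [f gf hf] := h5 n g hg; exists f => // -[] i hi.
  by case: pselect => // _; exact: hf.
Qed.
End Completion.

(** * The diagonal ideal and coordinates *)

Section Jn.
Variables (k : fieldType) (X : funSpace k).
Hypothesis hX : variety X.
Implicit Types (P : X) (f g : X -> k) (F G : X -> X -> k) (U W : set X).

Definition near2 P (A : X -> X -> Prop) :=
  exists W, [/\ open W, W P & forall x y, W x -> W y -> A x y].

(* F is the germ at (P, P) of an element of the n-th power of the diagonal ideal. *)
Inductive Jn P : nat -> (X -> X -> k) -> Prop :=
| Jn_gen f g : germ P f -> germ P g -> Jn P 0 (fun x y => f x * g y)
| Jn_del n f F : germ P f -> Jn P n F -> Jn P n.+1 (fun x y => (f y - f x) * F x y)
| Jn_add n F G : Jn P n F -> Jn P n G -> Jn P n (fun x y => F x y + G x y)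
| Jn_loc n F G : Jn P n F -> near2 P (fun x y => F x y = G x y) -> Jn P n G.

Lemma near2W P (A : X -> X -> Prop) : (forall x y, A x y) -> near2 P A.
Proof. by move=> h; exists setT; split=> //; exact: openT. Qed.
Lemma near2_near P (R : X -> Prop) (A : X -> X -> Prop) : (\forall x \near P, R x) ->
  (forall x y, R x -> R y -> A x y) -> near2 P A.
Proof. by move=> /nearP [W [oW WP h]] H; exists W; split=> // x y /h ? /h; exact: H. Qed.

Lemma Jn_eq P n F G : Jn P n F -> (forall x y, F x y = G x y) -> Jn P n G.
Proof. by move=> h E; apply: (Jn_loc h); exact: near2W. Qed.

Lemma Jn_mul P n F f g : germ P f -> germ P g -> Jn P n F ->
  Jn P n (fun x y => f x * g y * F x y).
Proof.
move=> gf gg; elim=> {n F} [f1 g1 gf1 gg1|n f1 F gf1 hF IH|n F G _ IH1 _ IH2|n F G _ IH [W [oW WP h]]].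
- have := Jn_gen (germM hX gf gf1) (germM hX gg gg1).
  by move/Jn_eq; apply=> x y; ring.
- by have := Jn_del gf1 IH; move/Jn_eq; apply=> x y; ring.
- by have := Jn_add IH1 IH2; move/Jn_eq; apply=> x y; ring.
- by apply: (Jn_loc IH); exists W; split=> // x y Wx Wy; rewrite h.
Qed.
Lemma Jn_mulx P n F f : germ P f -> Jn P n F -> Jn P n (fun x y => f x * F x y).
Proof.
move=> gf h; have := Jn_mul gf (germ_c hX P 1) h.
by move/Jn_eq; apply=> x y; rewrite mulr1.
Qed.
Lemma JnM P m n F G : Jn P m F -> Jn P n G -> Jn P (m + n) (fun x y => F x y * G x y).
Proof.
move=> hF hG; elim: hF => {m F} [f g gf gg|m f F gf hF IH|m F F' _ IH1 _ IH2|m F F' _ IH [W [oW WP h]]].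
- exact: Jn_mul.
- by have := Jn_del gf IH; move/Jn_eq; apply=> x y; ring.
- by have := Jn_add IH1 IH2; move/Jn_eq; apply=> x y; ring.
- by apply: (Jn_loc IH); exists W; split=> // x y Wx Wy; rewrite h.
Qed.

Lemma JnZ P n F c : Jn P n F -> Jn P n (fun x y => c * F x y).
Proof. by apply: Jn_mulx; exact: germ_c. Qed.
Lemma JnB P n F G : Jn P n F -> Jn P n G -> Jn P n (fun x y => F x y - G x y).
Proof.
move=> hF hG; have := Jn_add hF (JnZ (-1) hG).
by move/Jn_eq; apply=> x y; rewrite mulN1r.
Qed.
Lemma Jn0 P n : Jn P n (fun _ _ => 0).
Proof.
elim: n => [|n IH].
  have := Jn_gen (germ_c hX P 0) (germ_c hX P 0).
  by move/Jn_eq; apply=> x y; rewrite mulr0.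
by have := Jn_del (germ_c hX P 0) IH; move/Jn_eq; apply=> x y; rewrite mulr0.
Qed.
Lemma Jn_sum P n I (r : seq I) (F : I -> X -> X -> k) :
  (forall i, Jn P n (F i)) -> Jn P n (fun x y => \sum_(i <- r) F i x y).
Proof.
move=> h; elim: r => [|i r IH].
  by apply: (Jn_eq (Jn0 P n)) => x y; rewrite big_nil.
by apply: (Jn_eq (Jn_add (h i) IH)) => x y; rewrite big_cons.
Qed.

Lemma Jn_delta P f : germ P f -> Jn P 1 (fun x y => f y - f x).
Proof.
move=> gf; have := Jn_del gf (Jn_gen (germ_c hX P 1) (germ_c hX P 1)).
by move/Jn_eq; apply=> x y; rewrite !mulr1.
Qed.
Lemma Jn_near P n F : Jn P n F -> \forall x \near P, Jn x n F.
Proof.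
elim=> {n F} [f g gf gg|n f F gf _ IH|n F G _ IH1 _ IH2|n F G _ IH [W [oW WP h]]].
- near=> x; apply: Jn_gen; near: x; exact: germ_near.
- near=> x; apply: Jn_del; near: x => //; exact: germ_near.
- by near=> x; apply: Jn_add; near: x.
- near=> x; apply: (Jn_loc (F := F)); first by near: x.
  by exists W; split=> //; near: x; exact: open_near.
Unshelve. all: by end_near.
Qed.

Lemma Jn_germ P n F : Jn P n F -> germ P (F P).
Proof.
elim=> {n F} [f g gf gg|n f F gf _ IH|n F G _ IH1 _ IH2|n F G _ IH [W [oW WP h]]].
- exact: (germZ hX).
- by apply: (germM hX) => //; apply: (germB hX) => //; exact: germ_c.
- exact: (germD hX).
- by apply: (germ_ext hX IH); near=> y; apply: h => //; near: y; exact: open_near.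
Unshelve. all: by end_near.
Qed.

Lemma Jn_ord B P (tau : (X -> k) -> B -> ser k) n F : completion_map P tau -> Jn P n F ->
  forall b i, (i < n)%N -> tau (F P) b i = 0.
Proof.
move=> H; elim=> {n F} [//|n f F gf hF IH|n F G hF IH1 hG IH2|n F G hF IH [W [oW WP h]]] b.
- have gd : germ P (fun y => f y - f P) by apply: (germB hX) => //; exact: germ_c.
  rewrite [tau _ b](cmM H b gd (Jn_germ hF)) -add1n; apply: ordM; last exact: IH.
  by case=> // _; rewrite (cm0 hX H b gd) subrr.
- by move=> i hi; rewrite [tau _ b](cmD H b (Jn_germ hF) (Jn_germ hG)) fpsD IH1 ?IH2 ?addr0.
- move=> i hi; rewrite -(IH b i hi); congr (_ i); apply/esym.
  apply: (cm_ext hX H b (Jn_germ hF)).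
  by near=> y; apply: h => //; near: y; exact: open_near.
Unshelve. all: by end_near.
Qed.

Section Etale.
Variables (P : X) (U : set X) (N : nat) (s : 'I_N -> X -> k).
Hypotheses (aU : affine U) (UP : U P) (rs : forall i, reg U (s i)).
Hypothesis gen : forall f, reg U f -> exists2 g, subalg [set s i | i in [set: 'I_N]] g
   & forall x, U x -> f x = g x.

Lemma gs i : germ P (s i).
Proof. by have [oU _ _ _ _] := aU; exact: germ_of (rs i). Qed.

Lemma diff_gen f : germ P f -> exists e : 'I_N -> X -> k, (forall i, germ P (e i)) /\
  Jn P 2 (fun x y => f y - f x - \sum_i e i x * (s i y - s i x)).
Proof.
move: f; apply: (germ_ind hX aU UP rs gen) => [c|i|f1 f2 g1 g2 [e1 [ge1 h1]] [e2 [ge2 h2]]|f1 f2 g1 g2 [e1 [ge1 h1]] [e2 [ge2 h2]]|f1 g1 fP [e1 [ge1 h1]]|f1 f2 g1 [e1 [ge1 h1]] /nearP [W [oW WP hW]]].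
- exists (fun _ _ => 0); split=> [i|]; first exact: germ_c.
  by apply: (Jn_eq (Jn0 P 2)) => x y; rewrite subrr big1 ?subr0 // => i _; rewrite mul0r.
- exists (fun j _ => (j == i)%:R); split=> [j|]; first exact: germ_c.
  apply: (Jn_eq (Jn0 P 2)) => x y; rewrite (bigD1 i) //= eqxx mul1r big1 ?addr0 ?subrr //.
  by move=> j /negbTE ->; rewrite mul0r.
- exists (fun i x => e1 i x + e2 i x); split=> [i|]; first exact: (germD hX).
  apply: (Jn_eq (Jn_add h1 h2)) => x y; rewrite [X in _ = _ - X](eq_bigr (fun i => e1 i x * (s i y - s i x) + e2 i x * (s i y - s i x))).
    by rewrite big_split /=; ring.
  by move=> i _; rewrite mulrDl.
- exists (fun i x => f1 x * e2 i x + f2 x * e1 i x); split=> [i|].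
    by apply: (germD hX); apply: (germM hX).
  have := Jn_add (Jn_add (Jn_mulx g1 h2) (Jn_mulx g2 h1)) (JnM (Jn_delta g1) (Jn_delta g2)).
  move/Jn_eq; apply=> x y.
  rewrite [X in _ = _ - X](eq_bigr (fun i => f1 x * (e2 i x * (s i y - s i x)) + f2 x * (e1 i x * (s i y - s i x)))).
    by rewrite big_split /= -!mulr_sumr; ring.
  by move=> i _; ring.
- have gi := germ_inv hX g1 fP; have gi2 := germM hX gi gi.
  exists (fun i x => - ((f1 x)^-1 * (f1 x)^-1) * e1 i x); split=> [i|].
    by apply: (germM hX) => //; exact: (germN hX).
  have := Jn_add (Jn_mulx (germN hX gi2) h1) (JnZ (-1) (Jn_mulx gi (JnM (Jn_delta g1) (Jn_delta gi)))).
  move/Jn_loc; apply; apply: (near2_near (near_neq0 hX g1 fP)) => x y fx fy.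
  rewrite [X in _ = _ - X](eq_bigr (fun i => - ((f1 x)^-1 * (f1 x)^-1) * (e1 i x * (s i y - s i x)))).
    by rewrite -mulr_sumr; field; rewrite fx fy.
  by move=> i _; rewrite mulrA.
- exists e1; split=> //; apply: (Jn_loc h1).
  by exists W; split=> // x y Wx Wy; rewrite !hW.
Qed.

Lemma diff_max f : germ P f -> exists e : 'I_N -> X -> k, (forall i, germ P (e i)) /\
  \forall y \near P, f y - f P = \sum_i e i y * (s i y - s i P).
Proof.
move: f; apply: (germ_ind hX aU UP rs gen) => [c|i|f1 f2 g1 g2 [e1 [ge1 h1]] [e2 [ge2 h2]]|f1 f2 g1 g2 [e1 [ge1 h1]] [e2 [ge2 h2]]|f1 g1 fP [e1 [ge1 h1]]|f1 f2 g1 [e1 [ge1 h1]] h].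
- exists (fun _ _ => 0); split=> [i|]; first exact: germ_c.
  by apply: nearW => y; rewrite subrr big1 // => i _; rewrite mul0r.
- exists (fun j _ => (j == i)%:R); split=> [j|]; first exact: germ_c.
  apply: nearW => y; rewrite (bigD1 i) //= eqxx mul1r big1 ?addr0 //.
  by move=> j /negbTE ->; rewrite mul0r.
- exists (fun i x => e1 i x + e2 i x); split=> [i|]; first exact: (germD hX).
  near=> y; under eq_bigr do rewrite mulrDl.
  by rewrite big_split /= -(near h1 y) // -(near h2 y) //; ring.
- exists (fun i x => f1 x * e2 i x + f2 P * e1 i x); split=> [i|].
    by apply: (germD hX); [apply: (germM hX) | apply: (germZ hX)].
  near=> y; under eq_bigr do rewrite mulrDl -!mulrA.
  by rewrite big_split /= -!mulr_sumr -(near h1 y) // -(near h2 y) //; ring.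
- have gi := germ_inv hX g1 fP.
  exists (fun i x => - (f1 P)^-1 * ((f1 x)^-1 * e1 i x)); split=> [i|].
    by apply: (germZ hX); apply: (germM hX).
  near=> y; have fy : f1 y != 0 by near: y; exact: near_neq0.
  under eq_bigr do rewrite -!mulrA.
  by rewrite -!mulr_sumr -(near h1 y) //; field; rewrite fP fy.
- exists e1; split=> //; near=> y; rewrite -(near h y) // -(near h1 y) //.
  by rewrite (near_pt h).
Unshelve. all: by end_near.
Qed.

Lemma maxpow2 f : maxpow P 2 f -> exists a : 'I_N -> X -> k,
  (forall i, germ P (a i) /\ a i P = 0) /\
  \forall y \near P, f y = \sum_i a i y * (s i y - s i P).
Proof.
move=> [W [f' [oW WP ff' hz]]].
suff [a [ha h]] : exists a : 'I_N -> X -> k, (forall i, germ P (a i) /\ a i P = 0) /\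
  \forall y \near P, f' y = \sum_i a i y * (s i y - s i P).
  exists a; split=> //; near=> y; rewrite ff'; first by near: y.
  by near: y; exact: open_near.
elim: hz => [|u v [g [h [gg hh ->]]] _ [a [ha hv]]].
  exists (fun _ _ => 0); split=> [i|]; first by split=> //; exact: germ_c.
  by apply: nearW => y; rewrite big1 // => i _; rewrite mul0r.
have [g0 h0] := hh ord0; have [g1 h1] := hh ord_max.
have [e [ge he]] := diff_max g1.
exists (fun i y => g y * h ord0 y * e i y + a i y); split=> [i|].
  split; last by rewrite h0 mulr0 mul0r add0r; case: (ha i).
  by apply: (germD hX); [apply: (germM hX) => //; exact: (germM hX) | case: (ha i)].
near=> y; under eq_bigr do rewrite mulrDl -mulrA.
rewrite big_split /= -mulr_sumr -(near he y) // -(near hv y) //.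
rewrite h1 subr0 -[(_ + v) y]/(g y * (\prod_l h l y) + v y).
by rewrite !big_ord_recl big_ord0 mulr1 mulrA; congr (_ * h _ _ + _); apply: val_inj.
Unshelve. all: by end_near.
Qed.

Variables (m : nat) (u : 'I_m -> X -> k).
Hypothesis gu : forall l, germ P (u l).
Hypothesis hu : forall f, germ P f -> exists c : 'I_m -> k,
  maxpow P 2 (fun x => f x - f P - \sum_l c l * (u l x - u l P)).

Lemma gens_rel : exists (c : 'I_N -> 'I_m -> k) (a : 'I_N -> 'I_N -> X -> k),
  (forall i j, germ P (a i j) /\ a i j P = 0) /\
  \forall y \near P, forall i, s i y - s i P - \sum_l c i l * (u l y - u l P) =
    \sum_j a i j y * (s j y - s j P).
Proof.
have H i : exists ca : ('I_m -> k) * ('I_N -> X -> k),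
    (forall j, germ P (ca.2 j) /\ ca.2 j P = 0) /\
    \forall y \near P, s i y - s i P - \sum_l ca.1 l * (u l y - u l P) =
    \sum_j ca.2 j y * (s j y - s j P).
  have [c hc] := hu (gs i); have [a [ha h]] := maxpow2 hc.
  by exists (c, a).
have [F hF] := choice H; exists (fun i => (F i).1), (fun i => (F i).2); split.
  by move=> i j; case: (hF i) => h _; exact: h.
by apply: filter_forall => i; case: (hF i).
Qed.

Lemma max_gen f : germ P f -> exists b : 'I_m -> X -> k, (forall l, germ P (b l)) /\
  \forall y \near P, f y - f P = \sum_l b l y * (u l y - u l P).
Proof.
have [c [a [ha hca]]] := gens_rel.
have [q [gq hq]] := nakayama hX (fun i j => (ha i j).1) (fun i j => (ha i j).2).
move=> /diff_max [e [ge he]].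
exists (fun l y => \sum_h \sum_i e h y * q h i y * c i l); split.
  move=> l; apply: (germ_sum hX) => h _; apply: (germ_sum hX) => i _.
  by apply: (germM hX); [exact: (germM hX) | exact: germ_c].
near=> y; rewrite (near he y) //.
have hy := near hca y _; have hqy := near hq y _.
transitivity (\sum_h \sum_i e h y * q h i y * \sum_l c i l * (u l y - u l P)); last first.
  under eq_bigr do under eq_bigr do rewrite mulr_sumr.
  rewrite [RHS](eq_bigr (fun l => \sum_h \sum_i e h y * q h i y * c i l * (u l y - u l P))); last first.
    by move=> l _; rewrite mulr_suml; apply: eq_bigr => h _; rewrite mulr_suml.
  rewrite [RHS]exchange_big; apply: eq_bigr => h _.
  rewrite exchange_big; apply: eq_bigr => l _; apply: eq_bigr => i _.
  by rewrite !mulrA.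
apply: eq_bigr => h _; under eq_bigr => i _ do rewrite -mulrA.
rewrite -mulr_sumr; congr (_ * _).
transitivity (\sum_l (h == l)%:R * (s l y - s l P)).
  by rewrite (bigD1 h) //= eqxx mul1r big1 ?addr0 // => j; rewrite eq_sym => /negbTE ->; rewrite mul0r.
under eq_bigr => l _ do rewrite -(hqy _ h l) // mulr_suml.
rewrite exchange_big; apply: eq_bigr => i _ /=.
under eq_bigr => l _ do rewrite -mulrA mulrBl.
rewrite -mulr_sumr; congr (_ * _); rewrite sumrB -hy //.
rewrite (bigD1 i) //= eqxx mul1r big1 ?addr0.
  by rewrite opprB addrC subrK.
by move=> j; rewrite eq_sym => /negbTE ->; rewrite mul0r.
Unshelve. all: by end_near.
Qed.

Lemma etale f : germ P f -> exists b : 'I_m -> X -> k, (forall l, germ P (b l)) /\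
  Jn P 2 (fun x y => f y - f x - \sum_l b l x * (u l y - u l x)).
Proof.
have [c [a [ha hca]]] := gens_rel.
have H (p : 'I_N * 'I_N) : exists e : 'I_N -> X -> k, (forall l, germ P (e l)) /\
    Jn P 2 (fun x y => a p.1 p.2 y - a p.1 p.2 x - \sum_l e l x * (s l y - s l x)).
  by apply: diff_gen; case: (ha p.1 p.2).
have [E hE] := choice H.
pose M i l x := a i l x + \sum_j (s j x - s j P) * E (i, j) l x.
have gsP j : germ P (fun x => s j x - s j P).
  by apply: (germB hX); [exact: gs | exact: germ_c].
have gM i l : germ P (M i l).
  apply: (germD hX); first by case: (ha i l).
  apply: (germ_sum hX) => j _; apply: (germM hX) => //.
  by case: (hE (i, j)).
have M0 i l : M i l P = 0.
  rewrite /M (ha i l).2 add0r big1 // => j _; by rewrite subrr mul0r.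
have [q [gq hq]] := nakayama hX gM M0.
have JD i : Jn P 2 (fun x y => s i y - s i x - \sum_l c i l * (u l y - u l x)
    - \sum_l M i l x * (s l y - s l x)).
  have : Jn P 2 (fun x y => \sum_j ((a i j y - a i j x) * (s j y - s j x)
      + (s j x - s j P) * (a i j y - a i j x - \sum_l E (i, j) l x * (s l y - s l x)))).
    apply: Jn_sum => j; apply: Jn_add.
      by apply: (@JnM _ 1 1); apply: Jn_delta; [case: (ha i j) | exact: gs].
    by apply: Jn_mulx => //; case: (hE (i, j)).
  move/Jn_loc; apply; apply: (near2_near hca) => x y hx hy.
  transitivity (\sum_j a i j y * (s j y - s j P) - \sum_j a i j x * (s j x - s j P)
     - \sum_l M i l x * (s l y - s l x)); last first.
    rewrite -hx -hy.
    rewrite [X in _ = _ - X - _](eq_bigr (fun l => c i l * (u l y - u l P) - c i l * (u l x - u l P))); last by move=> l _; ring.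
    by rewrite sumrB; ring.
  rewrite [X in _ = _ - X](eq_bigr (fun l => a i l x * (s l y - s l x) +
    \sum_j (s j x - s j P) * (E (i, j) l x * (s l y - s l x)))); last first.
    move=> l _; rewrite /M mulrDl mulr_suml; congr (_ + _).
    by apply: eq_bigr => j _; rewrite mulrA.
  rewrite [X in _ = _ - X]big_split /= exchange_big /= opprD addrA -!sumrB.
  apply: eq_bigr => j _; rewrite -mulr_sumr; ring.
move=> /diff_gen [e [ge he]].
exists (fun l x => \sum_h \sum_i e h x * q h i x * c i l); split.
  move=> l; apply: (germ_sum hX) => h _; apply: (germ_sum hX) => i _.
  by apply: (germM hX); [exact: (germM hX) | exact: germ_c].
have J2 : Jn P 2 (fun x y => \sum_h \sum_i (e h x * q h i x) *
  (s i y - s i x - \sum_l c i l * (u l y - u l x) - \sum_l M i l x * (s l y - s l x))).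
  apply: Jn_sum => h; apply: Jn_sum => i; apply: Jn_mulx => //; exact: (germM hX).
have := Jn_add he J2; move/Jn_loc; apply; apply: (near2_near hq) => x y hx _.
suff -> : \sum_l (\sum_h \sum_i e h x * q h i x * c i l) * (u l y - u l x) =
   \sum_h e h x * (s h y - s h x) - \sum_h \sum_i (e h x * q h i x) *
  (s i y - s i x - \sum_l c i l * (u l y - u l x) - \sum_l M i l x * (s l y - s l x)) by ring.
transitivity (\sum_h \sum_i e h x * q h i x * \sum_l c i l * (u l y - u l x)).
  under [RHS]eq_bigr do under eq_bigr do rewrite mulr_sumr.
  rewrite (eq_bigr (fun l => \sum_h \sum_i e h x * q h i x * c i l * (u l y - u l x))); last first.
    by move=> l _; rewrite mulr_suml; apply: eq_bigr => h _; rewrite mulr_suml.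
  rewrite exchange_big; apply: eq_bigr => h _.
  rewrite exchange_big; apply: eq_bigr => i _; apply: eq_bigr => l _.
  by rewrite !mulrA.
rewrite -sumrB; apply: eq_bigr => h _.
have -> : s h y - s h x = \sum_i q h i x * (s i y - s i x - \sum_l M i l x * (s l y - s l x)).
  transitivity (\sum_l (h == l)%:R * (s l y - s l x)).
    by rewrite (bigD1 h) //= eqxx mul1r big1 ?addr0 // => j; rewrite eq_sym => /negbTE ->; rewrite mul0r.
  under eq_bigr => l _ do rewrite -(hx h l) // mulr_suml.
  rewrite exchange_big; apply: eq_bigr => i _ /=.
  under eq_bigr => l _ do rewrite -mulrA mulrBl.
  rewrite -mulr_sumr; congr (_ * _); rewrite sumrB; congr (_ - _).
  rewrite (bigD1 i) //= eqxx mul1r big1 ?addr0 // => j.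
  by rewrite eq_sym => /negbTE ->; rewrite mul0r.
rewrite mulr_sumr -sumrB; apply: eq_bigr => i _; ring.
Qed.

End Etale.

Lemma cm_lin1 (B : Type) P (tau : (X -> k) -> B -> ser k) f m (u : 'I_m -> X -> k) (e : 'I_m -> k) b :
  completion_map P tau -> germ P f -> (forall l, germ P (u l)) ->
  tau (fun y => f y - f P - \sum_l e l * (u l y - u l P)) b 1%N =
  tau f b 1%N - \sum_l e l * tau (u l) b 1%N.
Proof.
move=> H gf gu.
have gB g : germ P g -> germ P (fun y => g y - g P) by move=> gg; apply: (germB hX) => //; exact: germ_c.
have tB g : germ P g -> (tau (fun y => g y - g P) b : fps k) 1%N = tau g b 1%N.
  by move=> gg; rewrite (cmB hX H b gg (germ_c hX P _)) (cm_c H) fpsD fpsN subr0.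
have gS : germ P (fun y => \sum_l e l * (u l y - u l P)).
  by apply: (germ_sum hX) => l _; apply: (germZ hX); exact: gB.
rewrite [tau _ b](cmB hX H b (gB _ gf) gS) fpsD fpsN tB //; congr (_ - _).
rewrite (cm_sum hX H); last by move=> l _; apply: (germZ hX); exact: gB.
rewrite fps_sum; apply: eq_bigr => l _.
by rewrite (cmZ hX H _ b (gB _ (gu l))) fcstM tB.
Qed.

Definition der_gen m (u : 'I_m -> X -> k) P' :=
  forall (B : Type) (tau : (X -> k) -> B -> ser k) f, completion_map P' tau -> germ P' f ->
  exists c : 'I_m -> k, forall b, tau f b 1%N = \sum_l c l * tau (u l) b 1%N.

Lemma der_near P m (u : 'I_m -> X -> k) : (forall l, germ P (u l)) ->
  (forall f, germ P f -> exists c : 'I_m -> k,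
    maxpow P 2 (fun x => f x - f P - \sum_l c l * (u l x - u l P))) ->
  \forall P' \near P, der_gen u P'.
Proof.
move=> gu hu; have [U [aU UP]] := affine_at hX P.
have [N [s [rs gen]]] := affine_gen aU.
have H i : exists b : 'I_m -> X -> k, (forall l, germ P (b l)) /\
    Jn P 2 (fun x y => s i y - s i x - \sum_l b l x * (u l y - u l x)).
  exact: (etale aU UP rs gen hu (gs aU UP rs i)).
have [b hb] := choice H.
have nJ : \forall P' \near P, forall i, Jn P' 2 (fun x y => s i y - s i x - \sum_l b i l x * (u l y - u l x)).
  by apply: filter_forall => i; apply: Jn_near; case: (hb i).
have nu : \forall P' \near P, forall l, germ P' (u l).
  by apply: filter_forall => l; exact: germ_near.
have nU : \forall P' \near P, U P' by have [oU _ _ _ _] := aU; exact: open_near.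
near=> P' => B tau f HP' gf.
have UP' : U P' by near: P'.
have hJ : forall i, Jn P' 2 (fun x y => s i y - s i x - \sum_l b i l x * (u l y - u l x)).
  by near: P'.
have gu' : forall l, germ P' (u l) by near: P'.
have [e [ge he]] := diff_gen aU UP' rs gen gf.
exists (fun l => \sum_i e i P' * b i l P') => c.
have := Jn_ord HP' he c (isT : 1 < 2)%N.
rewrite (cm_lin1 _ c HP' gf (gs aU UP' rs)) => /eqP; rewrite subr_eq0 => /eqP ->.
under [RHS]eq_bigr do rewrite mulr_suml.
rewrite exchange_big; apply: eq_bigr => i _ /=.
under [RHS]eq_bigr do rewrite -mulrA.
rewrite -mulr_sumr; congr (_ * _); apply/eqP; rewrite -subr_eq0; apply/eqP.
have := Jn_ord HP' (hJ i) c (isT : 1 < 2)%N.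
by rewrite (cm_lin1 _ c HP' (gs aU UP' rs i) gu').
Unshelve. all: by end_near.
Qed.

Lemma uniformizer_hu P tau t : formal_coord P tau -> germ P t -> (tau t : fps k) 1%N != 0 ->
  forall f, germ P f -> exists c : 'I_1 -> k,
    maxpow P 2 (fun x => f x - f P - \sum_l c l * (t x - t P)).
Proof.
move=> H gt t1 f gf; exists (fun=> tau f 1%N / tau t 1%N).
have gg : germ P (fun x => f x - f P - \sum_(l < 1) (tau f 1%N / tau t 1%N) * (t x - t P)).
  apply: (germB hX); first by apply: (germB hX) => //; exact: germ_c.
  by apply: (germ_sum hX) => l _; apply: (germZ hX); apply: (germB hX) => //; exact: germ_c.
apply/(fc_ord H 2 gg) => -[_|[_|//]].
  by rewrite (fc0 hX H gg) /= big1 ?subrr ?subr0 // => l _; rewrite ?subrr mulr0.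
rewrite (@cm_lin1 _ _ _ f 1 (fun=> t) _ tt H.1 gf (fun=> gt)) big_ord1.
by rewrite divfK ?subrr.
Qed.

Lemma coord_near P tau t : (forall P', smooth_point P') -> formal_coord P tau ->
  germ P t -> (tau t : fps k) 1%N != 0 ->
  \forall P' \near P, germ P' t /\ exists tau', centred t P' tau'.
Proof.
move=> sm H gt t1.
have dn := der_near (fun=> gt) (uniformizer_hu H gt t1).
have gn := germ_near gt.
near=> P'; have gt' : germ P' t by near: P'.
split=> //; have [tau' H'] := formal_of_smooth hX (sm P').
apply: (fc_recenter hX H' gt'); apply/eqP => t0.
have [f gf hf] := fc_surj H' 2 fX.
have hd : der_gen (fun _ : 'I_1 => t) P' by near: P'.
have [c hc] := hd unit (fun f _ => tau' f) f H'.1 gf.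
have := hf 1%N isT; rewrite [LHS](hc tt) big_ord1 [tau' t 1%N]t0 mulr0 /fX /=.
by move/esym/eqP; rewrite oner_eq0.
Unshelve. all: by end_near.
Qed.

Lemma smooth_near P : smooth_point P -> \forall P' \near P, ~ node P'.
Proof.
move=> /(formal_of_smooth hX) [tau H].
have [t gt ht] := fc_surj H 2 fX.
have t1 : (tau t : fps k) 1%N != 0 by rewrite [_ 1%N]ht // oner_eq0.
have dn := der_near (fun=> gt) (uniformizer_hu H gt t1).
near=> P' => -[tau' H'].
have sj b0 : exists2 f, germ P' f & forall b, tau' f b 1%N = (b == b0)%:R.
  case: (H') => _ _ _ _ /(_ 2%N (fun b => fcst (b == b0)%:R * fX)) [|f gf hf].
    by move=> b b'; rewrite !fcstM !mulr0.
  by exists f => // b; rewrite hf // fcstM mulr1.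
have [f1 g1 h1] := sj true; have [f2 g2 h2] := sj false.
have hd : der_gen (fun _ : 'I_1 => t) P' by near: P'.
have [c1 e1] := hd bool tau' f1 H' g1.
have [c2 e2] := hd bool tau' f2 H' g2.
move: (e1 true) (e1 false) (e2 false); rewrite h1 h1 h2 !big_ord1 /= => a1 a2 a3.
have /eqP := a2; rewrite eq_sym mulf_eq0 => /orP[/eqP c0|/eqP c0].
  by move: a1; rewrite c0 mul0r => /eqP; rewrite oner_eq0.
by move: a3; rewrite c0 mulr0 => /eqP; rewrite oner_eq0.
Unshelve. all: by end_near.
Qed.

Lemma Jlead P n F t : (forall f, germ P f -> exists2 b, germ P b &
    Jn P 2 (fun x y => f y - f x - b x * (t y - t x))) -> germ P t ->
  Jn P n F -> exists2 b, germ P b & Jn P n.+1 (fun x y => F x y - b x * (t y - t x) ^+ n).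
Proof.
move=> et gt; elim=> {n F} [f g gf gg|n f F gf hF [b gb hb]|n F G _ [b gb hb] _ [c gc hc]|n F G _ [b gb hb] [W [oW WP h]]].
- exists (fun x => f x * g x); first exact: (germM hX).
  by apply: (Jn_eq (Jn_mulx gf (Jn_delta gg))) => x y; ring.
- have [b1 gb1 hb1] := et f gf.
  exists (fun x => b1 x * b x); first exact: (germM hX).
  have := Jn_add (JnM hb1 hF) (JnM (Jn_mulx gb1 (Jn_delta gt)) hb).
  by rewrite add2n; move/Jn_eq; apply=> x y; rewrite exprS; ring.
- exists (fun x => b x + c x); first exact: (germD hX).
  by apply: (Jn_eq (Jn_add hb hc)) => x y; ring.
- exists b => //; apply: (Jn_loc hb); exists W; split=> // x y Wx Wy.
  by rewrite h.
Qed.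
End Jn.

Section Coord.
Variables (k : fieldType) (X : funSpace k).
Hypothesis hS : smooth_curve X.
Let hX : variety X := hS.1.
Implicit Types (P x : X) (f g t : X -> k) (U : set X).

Lemma coord_sec W t : coordinate W t -> exists qs : X -> autTorsor X,
  forall x, W x -> apt (qs x) = x /\ centred t x (acoord (qs x)).
Proof.
move=> [rt ht].
have H x : exists q : autTorsor X, W x -> apt q = x /\ centred t x (acoord q).
  have [Wx|nWx] := pselect (W x).
    by have [tau c] := ht x Wx; exists (AutTorsor c.1).
  have [tau c] := formal_of_smooth hX (hS.2 x).
  by exists (AutTorsor c).
by have [qs h] := choice H; exists qs.
Qed.

Lemma centredE t x tau : centred t x tau -> (tau t : fps k) - fcst (t x) = fX.
Proof. by move=> [_ ->]; rewrite -[sadd _ _]/(fcst (t x) + fX) addrAC subrr add0r. Qed.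

Lemma fc_sub P tau t : formal_coord P tau -> germ P t ->
  tau (fun y => t y - t P) = (tau t : fps k) - fcst (t P).
Proof. by move=> H gt; rewrite (fcB hX H gt (germ_c hX P _)) (fc_c H). Qed.

Lemma germ_sub P t c : germ P t -> germ P (fun y => t y - c).
Proof. by move=> gt; apply: (germB hX) => //; exact: germ_c. Qed.

Lemma fc_poly P tau t (e : nat -> k) n : formal_coord P tau -> germ P t ->
  tau (fun y => \sum_(j < n) e j * (t y - t P) ^+ j) =
  \sum_(j < n) fcst (e j) * ((tau t : fps k) - fcst (t P)) ^+ j.
Proof.
move=> H gt; have gi i : germ P (fun y => (t y - t P) ^+ i).
  by apply: (germX hX); exact: germ_sub.
rewrite (fc_sum hX H); last by move=> i _; exact: (germZ hX).
apply: eq_bigr => i _; rewrite (fcZ hX H) // (fcX hX H) ?fc_sub //; exact: germ_sub.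
Qed.

Variables (W : set X) (t : X -> k) (qs : X -> autTorsor X).
Hypotheses (oW : open W) (ht : coordinate W t).
Hypothesis hqs : forall x, W x -> apt (qs x) = x /\ centred t x (acoord (qs x)).

Definition hd f (n : nat) (x : X) : k := acoord (qs x) f n.

Lemma coord_germ P : W P -> germ P t.
Proof. by move=> WP; case: ht => rt _; exact: germ_of rt. Qed.

Lemma qs_c P : W P -> centred t P (acoord (qs P)).
Proof. by move=> /hqs []. Qed.

Lemma etale_coord P f : W P -> germ P f -> exists2 b, germ P b &
    Jn P 2 (fun x y => f y - f x - b x * (t y - t x)).
Proof.
move=> WP gf; have [U [aU UP]] := affine_at hX P.
have [N [s [rs gen]]] := affine_gen aU.
have c := qs_c WP.
have t1 : (acoord (qs P) t : fps k) 1%N != 0 by rewrite c.2 /sadd /scst /sX add0r oner_eq0.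
have [b [gb hb]] := etale hX aU UP rs gen (uniformizer_hu hX c.1 (coord_germ WP) t1) gf.
exists (b ord0) => //; apply: (Jn_eq hb) => x y.
by rewrite big_ord1.
Qed.

Lemma taylor_ex P n f : W P -> germ P f -> exists h : nat -> X -> k,
  (forall j, germ P (h j)) /\
  Jn P n.+1 (fun x y => f y - \sum_(j < n.+1) h j x * (t y - t x) ^+ j).
Proof.
move=> WP gf; elim: n => [|n [h [gh hh]]].
  exists (fun=> f); split=> //; apply: (Jn_eq (Jn_delta hX gf)) => x y.
  by rewrite big_ord1 mulr1.
have [b gb hb] := Jlead hX (fun f gf => etale_coord WP gf) (coord_germ WP) hh.
exists (fun j => if j == n.+1 then b else h j); split=> [j|]; first by case: ifP.
apply: (Jn_eq hb) => x y; rewrite [in RHS]big_ord_recr /= eqxx opprD addrA.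
congr (_ - _ - _); apply: eq_bigr => j _.
by rewrite ifN // ltn_eqF // ltnS ltnW.
Qed.

Lemma hd_near P n f (h : nat -> X -> k) : W P -> germ P f -> (forall j, germ P (h j)) ->
  Jn P n.+1 (fun x y => f y - \sum_(j < n.+1) h j x * (t y - t x) ^+ j) ->
  \forall x \near P, forall j, (j < n.+1)%N -> hd f j x = h j x.
Proof.
move=> WP gf gh /Jn_near hJ; have gn := germ_near gf; have Wn := open_near oW WP.
near=> x => j jn; have Wx : W x by near: x.
have gfx : germ x f by near: x.
have c := qs_c Wx.
have Jx : Jn x n.+1 (fun x y => f y - \sum_(j < n.+1) h j x * (t y - t x) ^+ j) by near: x.
have := Jn_ord hX c.1.1 Jx tt jn.
rewrite (fcB hX c.1 gfx); last first.
  apply: (germ_sum hX) => i _; apply: (germZ hX); apply: (germX hX); apply: germ_sub; exact: coord_germ.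
rewrite (fc_poly (fun j => h j x) n.+1 c.1 (coord_germ Wx)) (centredE c) fpsD fpsN => /eqP.
rewrite subr_eq0 /hd => /eqP ->; rewrite fps_sum (bigD1 (Ordinal jn)) //=.
rewrite fcstM fXnE eqxx mulr1 big1 ?addr0 // => i; rewrite -val_eqE /= => /negbTE ij.
by rewrite fcstM fXnE eq_sym ij mulr0.
Unshelve. all: by end_near.
Qed.

Lemma hd_germ P n f : W P -> germ P f -> germ P (hd f n).
Proof.
move=> WP gf; have [h [gh hh]] := taylor_ex n WP gf.
have := hd_near WP gf gh hh => E; apply: (germ_ext hX (gh n)).
by near=> x; apply/esym; apply: (near E x).
Unshelve. all: by end_near.
Qed.

Lemma taylor P n f : W P -> germ P f ->
  Jn P n.+1 (fun x y => f y - \sum_(j < n.+1) hd f j x * (t y - t x) ^+ j).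
Proof.
move=> WP gf; have [h [gh hh]] := taylor_ex n WP gf.
apply: (Jn_loc hh); apply: (near2_near (hd_near WP gf gh hh)) => x y E _.
by congr (_ - _); apply: eq_bigr => j _; rewrite E.
Qed.

Lemma hd_reg n f : reg W f -> reg W (hd f n).
Proof.
move=> rf; apply: (reg_germ hX oW) => P WP; apply: hd_germ => //.
exact: germ_of rf.
Qed.

Lemma hd_mul P f g n : W P -> germ P f -> germ P g ->
  \forall x \near P, hd (fun y => f y * g y) n x = \sum_(i < n.+1) hd f i x * hd g (n - i) x.
Proof.
move=> WP gf gg; have fn := germ_near gf; have gn := germ_near gg; have Wn := open_near oW WP.
near=> x; rewrite /hd (fcM (qs_c _).1) //; near: x => //.
Unshelve. all: by end_near.
Qed.
Lemma hd_add P f g n : W P -> germ P f -> germ P g ->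
  \forall x \near P, hd (fun y => f y + g y) n x = hd f n x + hd g n x.
Proof.
move=> WP gf gg; have fn := germ_near gf; have gn := germ_near gg; have Wn := open_near oW WP.
near=> x; rewrite /hd (fcD (qs_c _).1) //; near: x => //.
Unshelve. all: by end_near.
Qed.
Lemma hd_ext P f g n : W P -> germ P f -> (\forall x \near P, f x = g x) ->
  \forall x \near P, hd f n x = hd g n x.
Proof.
move=> WP gf /near_join fg; have fn := germ_near gf; have Wn := open_near oW WP.
near=> x; congr (_ n); apply: (fc_ext hX (qs_c _).1); near: x => //.
Unshelve. all: by end_near.
Qed.

Lemma hd_ord P n f : W P -> maxpow P n f -> germ P f /\
  forall m i, (i + m < n)%N -> acoord (qs P) (hd f m) i = 0.
Proof.
move=> WP; have c := (qs_c WP).1.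
pose Q n f := germ P f /\ forall m i, (i + m < n)%N -> acoord (qs P) (hd f m) i = 0.
have Qmul N h g : germ P h -> h P = 0 -> Q N g -> Q N.+1 (fun x => h x * g x).
  move=> gh hP [gg hg]; split=> [|m i im]; first exact: (germM hX).
  rewrite (fc_ext hX c (hd_germ _ _ _) (hd_mul m WP gh gg)) //; last exact: (germM hX).
  have gm i0 : germ P (fun x => hd h i0 x * hd g (m - i0) x).
    by apply: (germM hX); exact: hd_germ.
  rewrite (fc_sum hX c) // fps_sum big1 // => j _.
  rewrite (fcM c); [|exact: hd_germ..].
  have [j0|j0] := posnP j.
    apply: (ordM (a := 1) (b := i)); last by rewrite add1n.
      case=> // _; rewrite (fc0 hX c) ?j0; last exact: hd_germ.
      by rewrite /hd (fc0 hX c gh).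
    by move=> l li; apply: hg; rewrite j0; lia.
  apply: (ordM (a := 0) (b := i.+1)) => // l li; apply: hg.
  by move: (nat_of_ord j) j0 (ltn_ord j) => j'; lia.
have Qprod N : forall g (h : 'I_N -> X -> k), germ P g -> (forall l, germ P (h l) /\ h l P = 0) ->
    Q N (fun x => g x * \prod_l h l x).
  elim: N => [|N IH] g h gg hh.
    by split=> //; apply: (germM hX) => //; apply: (germ_prod hX) => -[].
  have := Qmul _ _ _ (hh ord0).1 (hh ord0).2 (IH g (fun l => h (lift ord0 l)) gg (fun l => hh _)).
  suff -> : (fun x => h ord0 x * (g x * \prod_l h (lift ord0 l) x)) =
    (fun x => g x * \prod_l h l x) by [].
  by apply: funext => x; rewrite [in RHS]big_ord_recl mulrCA.
have Qadd N f1 f2 : Q N f1 -> Q N f2 -> Q N (fun x => f1 x + f2 x).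
  move=> [g1 h1] [g2 h2]; split=> [|m i im]; first exact: (germD hX).
  rewrite (fc_ext hX c (hd_germ _ _ _) (hd_add m WP g1 g2)) //; last exact: (germD hX).
  by rewrite (fcD c) ?fpsD ?h1 ?h2 ?addr0 //; exact: hd_germ.
have Qext N f1 f2 : Q N f1 -> (\forall x \near P, f1 x = f2 x) -> Q N f2.
  move=> [g1 h1] E; split=> [|m i im]; first exact: (germ_ext hX g1).
  rewrite -(h1 m i im); congr (_ i); apply/esym.
  by apply: (fc_ext hX c); [exact: hd_germ | exact: hd_ext].
have Q0 N : Q N (fun=> 0).
  split=> [|m i _]; first exact: germ_c.
  have E : \forall x \near P, 0 = hd (fun=> 0) m x.
    have Wn := open_near oW WP; near=> x; rewrite /hd.
    rewrite (fc_c (qs_c _).1) ?rmorph0 //; near: x => //.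
  by rewrite -(fc_ext hX c (germ_c hX P 0) E) (fc_c c) rmorph0.
move=> [W' [f' [oW' WP' E hz]]].
apply: (Qext _ f'); last by near=> x; apply/esym/E; near: x; exact: open_near.
elim: hz => [|u v [g [h [gg hh ->]]] _ IH]; first exact: Q0.
by apply: Qadd => //; exact: Qprod.
Unshelve. all: by end_near.
Qed.

Lemma hd_comp P f n : W P -> germ P f ->
  acoord (qs P) (hd f n) = shasse n (acoord (qs P) f).
Proof.
move=> WP gf; have c := qs_c WP; apply: funext => m.
set N := (n + m).+1; pose a j := acoord (qs P) f j.
pose p y := \sum_(j < N) a j * (t y - t P) ^+ j.
have gp : germ P p.
  by apply: (germ_sum hX) => j _; apply: (germZ hX); apply: (germX hX); apply: germ_sub; exact: coord_germ.
have [gg hg] : germ P (fun x => f x - p x) /\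
  forall m i, (i + m < N)%N -> acoord (qs P) (hd (fun x => f x - p x) m) i = 0.
  apply: hd_ord => //; apply/(fc_ord c.1); first exact: (germB hX).
  move=> i iN; rewrite (fcB hX c.1 gf gp) /p (fc_poly a N c.1 (coord_germ WP)) (centredE c).
  rewrite fpsD fpsN fps_sum (bigD1 (Ordinal iN)) //= fcstM fXnE eqxx mulr1 big1 ?addr0 ?subrr //.
  by move=> j; rewrite -val_eqE /= => /negbTE ij; rewrite fcstM fXnE eq_sym ij mulr0.
have E : \forall x \near P, hd f n x = hd (fun x => f x - p x) n x + hd p n x.
  have h1 := hd_add n WP gg gp.
  have h2 : \forall x \near P, hd f n x = hd (fun y => f y - p y + p y) n x.
    by apply: hd_ext => //; apply: nearW => x; rewrite subrK.
  by near=> x; rewrite (near h2 x) // (near h1 x).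
rewrite (fc_ext hX c.1 (hd_germ n WP gf) E) (fcD c.1) ?fpsD; [|exact: hd_germ..].
rewrite hg ?add0r; last by rewrite /N; lia.
have E2 : \forall x \near P, hd p n x = \sum_(j < N) a j * 'C(j, n)%:R * (t x - t P) ^+ (j - n).
  have Wn := open_near oW WP.
  near=> x; have Wx : W x by near: x.
  have cx := qs_c Wx; rewrite /hd /p.
  have gi i : germ x (fun y => (t y - t P) ^+ i).
    by apply: (germX hX); apply: germ_sub; exact: coord_germ.
  rewrite (fc_sum hX cx.1); last by move=> j _; exact: (germZ hX).
  rewrite fps_sum; apply: eq_bigr => j _.
  rewrite (fcZ hX cx.1) // fcstM (fcX hX cx.1); last by apply: germ_sub; exact: coord_germ.
  rewrite (fcB hX cx.1 (coord_germ Wx) (germ_c hX x _)) (fc_c cx.1) cx.2.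
  rewrite -[sadd _ _]/(fcst (t x) + fX) addrAC -rmorphB exprDn fps_sum -mulrA; congr (_ * _).
  have [nj|jn] := leqP n j; last first.
    rewrite bin_small // mul0r big1 // => i _; rewrite fpsMn -rmorphXn fcstM fXnE.
    rewrite (_ : (n == i)%N = false) ?mulr0 ?mul0rn //.
    by apply/eqP; have := ltn_ord i; lia.
  have nj' : (n < j.+1)%N by [].
  rewrite (bigD1 (Ordinal nj')) //= fpsMn -rmorphXn fcstM fXnE eqxx mulr1 big1 ?addr0.
    by rewrite mulr_natl.
  move=> i; rewrite -val_eqE /= => /negbTE ij.
  by rewrite fpsMn -rmorphXn fcstM fXnE eq_sym ij mulr0 mul0rn.
have gi i : germ P (fun y => (t y - t P) ^+ i).
  by apply: (germX hX); apply: germ_sub; exact: coord_germ.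
rewrite (fc_ext hX c.1 (hd_germ n WP gp) E2) (fc_sum hX c.1); last first.
  by move=> j _; exact: (germZ hX).
have mN : (n + m < N)%N by rewrite /N.
rewrite fps_sum (bigD1 (Ordinal mN)) //= (fcZ hX c.1) // fcstM (fcX hX c.1); last by apply: germ_sub; exact: coord_germ.
rewrite fc_sub ?(centredE c) //; [|exact: c.1|exact: coord_germ].
rewrite fXnE addKn eqxx mulr1 big1 ?addr0.
  by rewrite /shasse /a mulrC addnC.
move=> j; rewrite -val_eqE /= => jm.
rewrite (fcZ hX c.1) // fcstM (fcX hX c.1); last by apply: germ_sub; exact: coord_germ.
rewrite fc_sub ?(centredE c) //; [|exact: c.1|exact: coord_germ].
rewrite fXnE; have [nj|jn] := leqP n j; last by rewrite bin_small // mulr0 mul0r.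
by rewrite (_ : (m == j - n)%N = false) ?mulr0 //; apply/eqP; move/eqP: jm; lia.
Unshelve. all: by end_near.
Qed.

End Coord.

(** * Nodes are isolated *)

Section NodeIsolated.
Variables (k : fieldType) (X : funSpace k).
Hypothesis hX : variety X.
Implicit Types (P Q : X) (f g : X -> k) (U : set X).

Lemma affine_inj U N (s : 'I_N -> X -> k) P Q : affine U -> U P -> U Q ->
  (forall f, reg U f -> exists2 g, subalg [set s i | i in [set: 'I_N]] g
     & forall x, U x -> f x = g x) ->
  (forall i, s i P = s i Q) -> P = Q.
Proof.
move=> aU UP UQ gen sPQ; apply: contrapT => PQ.
have [f rf /eqP fPQ] := affine_sep aU UP UQ PQ; apply: fPQ.
have [g sg fg] := gen f rf; rewrite !fg //.
by elim: sg => [//|_ [i _ <-]//|g1 g2 _ -> _ ->//|g1 g2 _ -> _ ->].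
Qed.

Variables (Q : X) (tau : (X -> k) -> bool -> ser k) (u : 'I_2 -> X -> k).
Hypothesis H : completion_map Q tau.
Hypothesis gu : forall l, germ Q (u l).
Hypothesis tu : forall l b i, (i < 2)%N -> tau (u l) b i = ((l == ord0) == b)%:R * fX i.

Lemma node_u0 l : u l Q = 0.
Proof.
by rewrite -(cm0 hX H true (gu l)) tu // mulr0.
Qed.

Lemma sum2 (M : nmodType) (F : 'I_2 -> M) : \sum_l F l = F ord0 + F ord_max.
Proof.
by rewrite !big_ord_recl big_ord0 addr0; congr (_ + F _); exact: val_inj.
Qed.

Lemma node_hu f : germ Q f -> exists c : 'I_2 -> k,
  maxpow Q 2 (fun x => f x - f Q - \sum_l c l * (u l x - u l Q)).
Proof.
move=> gf; exists (fun l => tau f (l == ord0) 1%N).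
have gg : germ Q (fun x => f x - f Q - \sum_l tau f (l == ord0) 1%N * (u l x - u l Q)).
  apply: (germB hX); first by apply: (germB hX) => //; exact: germ_c.
  by apply: (germ_sum hX) => l _; apply: (germZ hX); apply: (germB hX) => //; exact: germ_c.
apply/(cm_ord H 2 gg) => b -[_|[_|//]].
  rewrite (cm0 hX H b gg) /= subrr sub0r big1 ?oppr0 // => l _.
  by rewrite subrr mulr0.
rewrite (cm_lin1 hX _ b H gf gu) sum2 !tu //= mulr1 mulr1.
by case: b; rewrite ?mulr1 ?mulr0 ?addr0 ?add0r subrr.
Qed.

Lemma node_maxpow3 f : maxpow Q 3 f -> germ Q f ->
  exists m : 'I_2 -> 'I_2 -> X -> k, (forall l j, germ Q (m l j) /\ m l j Q = 0) /\
  Jn Q 2 (fun x y => f y - f x - \sum_l (\sum_j m l j x * u j x) * (u l y - u l x)).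
Proof.
have [U [aU UQ]] := affine_at hX Q; have [N [s [rs gen]]] := affine_gen aU.
pose R (f : X -> X -> k) := exists m : 'I_2 -> 'I_2 -> X -> k, (forall l j, germ Q (m l j) /\ m l j Q = 0) /\
  Jn Q 2 (fun x y => f x y - \sum_l (\sum_j m l j x * u j x) * (u l y - u l x)).
have Radd (f1 f2 : X -> X -> k) : R f1 -> R f2 -> R (fun x y => f1 x y + f2 x y).
  move=> [m1 [g1 h1]] [m2 [g2 h2]]; exists (fun l j x => m1 l j x + m2 l j x); split.
    move=> l j; have [? e1] := g1 l j; have [? e2] := g2 l j.
    by split; [exact: (germD hX) | rewrite e1 e2 addr0].
  apply: (Jn_eq (Jn_add h1 h2)) => x y; rewrite addrACA -opprD; congr (_ - _).
  rewrite -big_split /=; apply: eq_bigr => l _; rewrite -mulrDl; congr (_ * _).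
  by rewrite -big_split /=; apply: eq_bigr => j _; rewrite mulrDl.
have RJ (f1 f2 : X -> X -> k) : R f1 -> Jn Q 2 (fun x y => f2 x y - f1 x y) -> R f2.
  move=> [m1 [g1 h1]] h2; exists m1; split=> //.
  by apply: (Jn_eq (Jn_add h2 h1)) => x y; rewrite addrA subrK.
have R0 : R (fun _ _ => 0).
  exists (fun _ _ _ => 0); split=> [l j|]; first by split=> //; exact: germ_c.
  apply: (Jn_eq (Jn0 hX Q 2)) => x y; rewrite big1 ?subrr // => l _.
  by rewrite big1 ?mul0r // => j _; rewrite mul0r.
have Rterm z ha hb phi : germ Q z -> germ Q ha -> ha Q = 0 -> germ Q hb -> hb Q = 0 ->
    germ Q phi -> R (fun x y => z x * ha x * hb x * (phi y - phi x)).
  move=> gz ga a0 gb b0 gphi.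
  have [c [gc hc]] := max_gen hX aU UQ rs gen node_hu ga.
  have [e [ge he]] := etale hX aU UQ rs gen node_hu gphi.
  exists (fun l j x => z x * hb x * c j x * e l x); split.
    by move=> l j; split; [do 3 ?apply: (germM hX) | rewrite b0 mulr0 !mul0r].
  have gw : germ Q (fun x => z x * ha x * hb x) by do 2 ?apply: (germM hX).
  apply: (Jn_loc (Jn_mulx hX gw he)); apply: (near2_near hc) => x y hx _.
  rewrite mulrBr; congr (_ - _); rewrite mulr_sumr; apply: eq_bigr => l _.
  rewrite mulrA; congr (_ * _).
  rewrite (eq_bigr (fun j => z x * hb x * e l x * (c j x * (u j x - u j Q)))).
    by rewrite -mulr_sumr -hx a0; ring.
  by move=> j _; rewrite node_u0; ring.
have Rprod g h0 h1 h2 : germ Q g -> germ Q h0 -> h0 Q = 0 -> germ Q h1 -> h1 Q = 0 ->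
    germ Q h2 -> h2 Q = 0 ->
    R (fun x y => g y * (h0 y * (h1 y * h2 y)) - g x * (h0 x * (h1 x * h2 x))).
  move=> gg g0 z0 g1 z1 g2 z2; have gh := germM hX gg g0.
  apply: (RJ _ _ (Radd _ _ (Rterm g h0 h1 h2 gg g0 z0 g1 z1 g2)
     (Radd _ _ (Rterm g h0 h2 h1 gg g0 z0 g2 z2 g1)
        (Rterm (fun=> 1) h1 h2 (fun x => g x * h0 x) (germ_c hX Q 1) g1 z1 g2 z2 gh)))).
  have J11 f1 f2 : germ Q f1 -> germ Q f2 -> Jn Q 2 (fun x y => (f1 y - f1 x) * (f2 y - f2 x)).
    by move=> gf1 gf2; apply: (@JnM _ _ hX _ 1 1); apply: Jn_delta.
  have := Jn_add (J11 _ _ (germM hX gh g1) g2) (Jn_mulx hX g2 (J11 _ _ gh g1)).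
  by move/Jn_eq; apply=> x y; ring.
move=> [W [f' [oW WQ ff' hz]]] gf.
apply: (RJ (fun x y => f' y - f' x)); last first.
  apply: (Jn_loc (Jn0 hX Q 2)); exists W; split=> // x y Wx Wy.
  by rewrite !ff' // subrr.
elim: hz => [|a v [g [h [gg hh ->]]] _ IH].
  apply: (RJ _ _ R0); apply: (Jn_eq (Jn0 hX Q 2)) => x y.
  by rewrite -[_ - _ - _]/(0 - 0 - 0 : k) !subrr.
have [[h0 h1] h2] := (hh ord0, hh (lift ord0 ord0), hh (lift ord0 (lift ord0 ord0))).
apply: (RJ _ _ (Radd _ _ (Rprod _ _ _ _ gg h0.1 h0.2 h1.1 h1.2 h2.1 h2.2) IH)).
apply: (Jn_eq (Jn0 hX Q 2)) => x y.
have E z : ((fun x => g x * \prod_l h l x) + v) z =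
    g z * (h ord0 z * (h (lift ord0 ord0) z * h (lift ord0 (lift ord0 ord0)) z)) + v z.
  by rewrite -[LHS]/(g z * \prod_l h l z + v z) !big_ord_recl big_ord0 mulr1.
by rewrite !E; ring.
Qed.

Lemma node_sep : \forall P \near Q, node P -> P = Q.
Proof.
have [U [aU UQ]] := affine_at hX Q; have [N [s [rs gen]]] := affine_gen aU.
have [oU _ _ _ _] := aU.
have guv : germ Q (fun x => u ord0 x * u ord_max x) by exact: (germM hX).
have mp : maxpow Q 3 (fun x => u ord0 x * u ord_max x).
  apply/(cm_ord H 3 guv) => b i hi; rewrite [tau _ b](cmM H b (gu _) (gu _)).
  have o1 l j : (j < 1)%N -> tau (u l) b j = 0.
    by case: j => // _; rewrite tu // mulr0.
  have o2 l : ((l == ord0) == b) = false -> forall j, (j < 2)%N -> tau (u l) b j = 0.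
    by move=> e j hj; rewrite tu // e mul0r.
  by case: b o1 o2 => o1 o2; [apply: (ordM (a := 1) (b := 2)) | apply: (ordM (a := 2) (b := 1))];
    do 1 ?[exact: o1 | exact: o2].
have [m [hm J2]] := node_maxpow3 mp guv.
pose n (l : 'I_2) := u (rev_ord l).
have J3 : Jn Q 2 (fun x y => \sum_l (n l x - \sum_j m l j x * u j x) * (u l y - u l x)).
  have := JnB hX J2 (JnM hX (Jn_delta hX (gu ord0)) (Jn_delta hX (gu ord_max))).
  move/Jn_eq; apply=> x y; rewrite !sum2 /n.
  have -> : rev_ord ord0 = ord_max :> 'I_2 by exact: val_inj.
  have -> : rev_ord ord_max = ord0 :> 'I_2 by exact: val_inj.
  by ring.
pose M (i j : 'I_2) := m (rev_ord i) j.
have [q [gq hq]] := nakayama hX (fun i j => (hm (rev_ord i) j).1) (fun i j => (hm (rev_ord i) j).2).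
have dn := der_near hX gu node_hu.
have nJ := Jn_near J3.
have nu : \forall P \near Q, forall l, germ P (u l).
  by apply: filter_forall => l; exact: germ_near.
have hs : \forall y \near Q, forall i, u ord0 y = 0 -> u ord_max y = 0 -> s i y = s i Q.
  apply: filter_forall => i.
  have [b [gb hb]] := max_gen hX aU UQ rs gen node_hu (gs aU UQ rs i).
  near=> y => u0 u1; apply/eqP; rewrite -subr_eq0 (near hb y) //.
  by rewrite sum2 u0 u1 !node_u0 subrr !mulr0 addr0.
have nU := open_near oU UQ.
near=> P => -[tau' H'].
have hd : der_gen u P by near: P.
have J4 : Jn P 2 (fun x y => \sum_l (n l x - \sum_j m l j x * u j x) * (u l y - u l x)).
  by near: P.
have gP : forall l, germ P (u l) by near: P.
have qP : forall h l, \sum_i q h i P * ((i == l)%:R - m (rev_ord i) l P) = (h == l)%:R by near: P.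
pose c l := n l P - \sum_j m l j P * u j P.
pose bo (i : 'I_2) := i == ord0.
have c0 b : \sum_l c l * tau' (u l) b 1%N = 0.
  have := Jn_ord hX H' J4 b (isT : 1 < 2)%N.
  rewrite (cm_sum hX H'); last first.
    by move=> l _; apply: (germZ hX); apply: (germB hX) => //; exact: germ_c.
  rewrite fps_sum => E; rewrite -[RHS]E; apply: eq_bigr => l _.
  rewrite (cmZ hX H'); last by apply: (germB hX) => //; exact: germ_c.
  by rewrite fcstM (cmB hX H' b (gP l) (germ_c hX P _)) (cm_c H') fpsD fpsN subr0.
have sj (j : 'I_2) : exists d : 'I_2 -> k, forall b,
    (b == bo j)%:R = \sum_l d l * tau' (u l) b 1%N.
  case: (H') => _ _ _ _ /(_ 2%N (fun b => fcst (b == bo j)%:R * fX)) [|f gf hf].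
    by move=> b b'; rewrite !fcstM !mulr0.
  have [d hdd] := hd bool tau' f H' gf; exists d => b.
  by rewrite -hdd hf // fcstM mulr1.
have [d hdd] := choice sj.
pose D : 'M[k]_2 := \matrix_(l, i) tau' (u l) (bo i) 1%N.
pose K : 'M[k]_2 := \matrix_(j, l) d j l.
have KD : K *m D = 1%:M.
  apply/matrixP => j i; rewrite !mxE; under eq_bigr do rewrite !mxE.
  rewrite -hdd; congr (_ %:R); rewrite /bo.
  by case: j i => -[|[|//]] ? [[|[|//]] ?].
have cD : (\row_l c l) *m D = 0.
  apply/rowP => i; rewrite !mxE -[RHS](c0 (bo i)).
  by apply: eq_bigr => l _; rewrite !mxE.
have cz l : c l = 0.
  have : (\row_l c l) = 0 :> 'rV_2.
    by rewrite -[LHS]mulmx1 -(mulmx1C KD) mulmxA cD mul0mx.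
  by move/rowP/(_ l); rewrite !mxE.
have uz h : u h P = 0.
  transitivity (\sum_l (h == l)%:R * u l P).
    by rewrite (bigD1 h) //= eqxx mul1r big1 ?addr0 // => j; rewrite eq_sym => /negbTE ->; rewrite mul0r.
  under eq_bigr => l _ do rewrite -(qP h l) mulr_suml.
  rewrite exchange_big big1 // => i _ /=.
  under eq_bigr => l _ do rewrite -mulrA mulrBl.
  rewrite -mulr_sumr sumrB -[RHS](mulr0 (q h i P)); congr (_ * _).
  rewrite -[RHS](cz (rev_ord i)) /c /n rev_ordK; congr (_ - _).
  by rewrite (bigD1 i) //= eqxx mul1r big1 ?addr0 // => j; rewrite eq_sym => /negbTE ->; rewrite mul0r.
have hsP : forall i, u ord0 P = 0 -> u ord_max P = 0 -> s i P = s i Q by near: P.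
have UP : U P by near: P.
by apply: (affine_inj aU UP UQ gen) => i; exact: hsP.
Unshelve. all: by end_near.
Qed.

End NodeIsolated.

Lemma node_isolated (k : fieldType) (X : funSpace k) (Q : X) : variety X -> node Q ->
  \forall P \near Q, node P -> P = Q.
Proof.
move=> hX [tau H].
have sj (l : 'I_2) : exists f, germ Q f /\ forall b i, (i < 2)%N ->
    tau f b i = ((l == ord0) == b)%:R * fX i.
  case: (H) => _ _ _ _ /(_ 2%N (fun b => fcst ((l == ord0) == b)%:R * fX)) [|f gf hf].
    by move=> b b'; rewrite !fcstM !mulr0.
  by exists f; split=> // b i hi; rewrite hf // fcstM.
have [u hu] := choice sj.
exact: (node_sep hX H (fun l => (hu l).1) (fun l => (hu l).2)).
Qed.

(** * Sections of the V-sheaf and their jets *)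

Section Concat.
Variables (T : Type) (N M : nat) (x : 'I_N -> T) (y : 'I_M -> T).
Definition ocat (i : 'I_(N + M)) : T :=
  match fintype.split i with inl j => x j | inr j => y j end.
Lemma ocat_sum (G : nmodType) (F : T -> G) :
  \sum_i F (ocat i) = \sum_i F (x i) + \sum_i F (y i).
Proof.
rewrite big_split_ord /=; congr (_ + _); apply: eq_bigr => i _; rewrite /ocat.
  by case: fintype.splitP => j /= E; [congr (F (x _)); apply: val_inj | have := ltn_ord i; rewrite E ltnNge leq_addr].
case: fintype.splitP => j /= E; last by congr (F (y _)); apply: val_inj; apply/eqP; rewrite -(eqn_add2l N) E.
by have := ltn_ord j; rewrite -E ltnNge leq_addr.
Qed.
Lemma ocatP (Q : T -> Prop) : (forall i, Q (x i)) -> (forall i, Q (y i)) -> forall i, Q (ocat i).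
Proof. by move=> hx hy i; rewrite /ocat; case: fintype.split. Qed.
End Concat.

Section VGerm.
Variables (k : fieldType) (V : lmodType k) (X : funSpace k).
Hypothesis hX : variety X.
Implicit Types (P x : X) (f g t : X -> k) (c v : V).

(* F is a V-valued germ at P, and S its expansion under tau. *)
Definition HE P (tau : (X -> k) -> ser k) (F : X -> V) (S : vser V) :=
  exists N (gc : 'I_N -> (X -> k) * V), [/\ forall i, germ P (gc i).1,
    \forall y \near P, F y = \sum_i (gc i).1 y *: (gc i).2
  & S = \sum_i (svec (tau (gc i).1) (gc i).2 : vser V)].

Section HE.
Variables (P : X) (tau : (X -> k) -> ser k).
Hypothesis H : formal_coord P tau.

Lemma HE_zero N (gc : 'I_N -> (X -> k) * V) : (forall i, germ P (gc i).1) ->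
  (\forall y \near P, \sum_i (gc i).1 y *: (gc i).2 = 0) ->
  \sum_i (svec (tau (gc i).1) (gc i).2 : vser V) = 0.
Proof.
elim: N gc => [|N IH] gc gg E; first by rewrite big_ord0.
pose w := widen_ord (leqnSn N); rewrite big_ord_recr /=.
have gg' i : germ P (gc (w i)).1 by exact: gg.
have [[d dE]|nd] := pselect (exists d : 'I_N -> k, (gc ord_max).2 = \sum_i d i *: (gc (w i)).2).
  pose gd i := (fun y => (gc (w i)).1 y + d i * (gc ord_max).1 y, (gc (w i)).2).
  have ggd i : germ P (gd i).1 by apply: (germD hX) => //; exact: (germZ hX).
  have Ed : \forall y \near P, \sum_i (gd i).1 y *: (gd i).2 = 0.
    near=> y; rewrite -[RHS](near E y) // big_ord_recr /= dE scaler_sumr -big_split /=.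
    by apply: eq_bigr => i _; rewrite scalerDl scalerA mulrC.
  have := IH gd ggd Ed.
  move=> hS; rewrite -[RHS]hS dE.
  have -> : (svec (tau (gc ord_max).1) (\sum_i d i *: (gc (w i)).2) : vser V) =
      \sum_i (svec (tau (gc ord_max).1) (d i *: (gc (w i)).2) : vser V).
    apply: funext => n; rewrite vser_sum /svec scaler_sumr //.
  rewrite -big_split /=; apply: eq_bigr => i _; apply: funext => n.
  rewrite vserD /svec (fcD H) ?(fcZ hX H) ?fpsD ?fcstM //; last exact: (germZ hX).
  by rewrite scalerDl !scalerA [d i * _]mulrC.
have E0 : \forall y \near P, (gc ord_max).1 y = 0.
  near=> y; apply/eqP/negPn/negP => gy; apply: nd.
  exists (fun i => - ((gc ord_max).1 y)^-1 * (gc (w i)).1 y).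
  have : \sum_i (gc i).1 y *: (gc i).2 = 0 by near: y.
  rewrite big_ord_recr /=.
  move/(congr1 (fun v => ((gc ord_max).1 y)^-1 *: v)).
  rewrite scaler0 scalerDr scalerA mulVf // scale1r addrC => /eqP; rewrite addr_eq0 => /eqP ->.
  rewrite -scaleNr scaler_sumr; apply: eq_bigr => i _; by rewrite scalerA.
rewrite IH //; last first.
  near=> y; rewrite -[RHS](near E y) // big_ord_recr /= (near E0 y) // scale0r addr0 //.
rewrite add0r; apply: funext => n; rewrite /svec.
have -> : tau (gc ord_max).1 = 0 :> fps k by exact: (@cm_near0 _ _ _ _ _ H.1 _ tt (gg ord_max) E0).
by rewrite fps0 scale0r.
Unshelve. all: by end_near.
Qed.

Lemma HE_ext F G S : HE P tau F S -> (\forall y \near P, F y = G y) -> HE P tau G S.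
Proof.
move=> [N [gc [h1 h2 h3]]] E; exists N, gc; split=> //.
by near=> y; rewrite -(near E y) // (near h2 y).
Unshelve. all: by end_near.
Qed.

Lemma HE_g g c : germ P g -> HE P tau (fun y => g y *: c) (svec (tau g) c).
Proof.
move=> gg; exists 1%N, (fun=> (g, c)); split=> //; last by rewrite big_ord1.
by apply: nearW => y; rewrite big_ord1.
Qed.

Lemma HE0 : HE P tau (fun=> 0) 0.
Proof.
exists 0%N, (fun i => (fun=> 0, 0)); split=> [[]//||]; last by rewrite big_ord0.
by apply: nearW => y; rewrite big_ord0.
Qed.

Lemma HED F G S S' : HE P tau F S -> HE P tau G S' -> HE P tau (fun y => F y + G y) (S + S').
Proof.
move=> [N [gc [h1 h2 ->]]] [M [gc' [h1' h2' ->]]].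
exists (N + M)%N, (ocat gc gc'); split.
- exact: (ocatP (Q := fun p => germ P p.1)).
- near=> y; rewrite (near h2 y) // (near h2' y) //.
  by rewrite (ocat_sum gc gc' (fun p : (X -> k) * V => p.1 y *: p.2)).
- by rewrite (ocat_sum gc gc' (fun p : (X -> k) * V => svec (tau p.1) p.2 : vser V)).
Unshelve. all: by end_near.
Qed.

Lemma HE_sum N (F : 'I_N -> X -> V) (S : 'I_N -> vser V) : (forall i, HE P tau (F i) (S i)) ->
  HE P tau (fun y => \sum_i F i y) (\sum_i S i).
Proof.
elim: N F S => [|N IH] F S h.
  by rewrite big_ord0; apply: (HE_ext HE0); apply: nearW => y; rewrite big_ord0.
rewrite big_ord_recl; apply: (HE_ext (HED (h ord0) (IH _ _ (fun i => h (lift ord0 i))))).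
by apply: nearW => y; rewrite big_ord_recl.
Qed.

Lemma HEZ f F S : germ P f -> HE P tau F S -> HE P tau (fun y => f y *: F y) ((tau f : fps k) *: S).
Proof.
move=> gf [N [gc [h1 h2 ->]]].
have h i : HE P tau (fun y => (f y * (gc i).1 y) *: (gc i).2)
   ((tau f : fps k) *: (svec (tau (gc i).1) (gc i).2 : vser V)).
  rewrite svecZ -(fcM H) //; apply: HE_g; exact: (germM hX).
rewrite scaler_sumr; apply: (HE_ext (HE_sum h)).
near=> y; rewrite (near h2 y) // scaler_sumr; apply: eq_bigr => i _.
by rewrite scalerA.
Unshelve. all: by end_near.
Qed.

Lemma HE_uniq F S S' : HE P tau F S -> HE P tau F S' -> S = S'.
Proof.
move=> h1 h2; have hN := HED h1 (HEZ (germ_c hX P (-1)) h2).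
have E : (tau (fun=> -1) : fps k) = -1 by rewrite (fc_c H) rmorphN1.
apply/eqP; rewrite -subr_eq0; apply/eqP.
move: hN; rewrite E scaleN1r => -[N [gc [g1 g2 ->]]]; apply: HE_zero => //.
by near=> y; rewrite -(near g2 y) // scaleN1r subrr.
Unshelve. all: by end_near.
Qed.

Lemma HE_val F S : HE P tau F S -> S 0%N = F P.
Proof.
move=> [N [gc [h1 h2 ->]]]; rewrite (near_pt h2) vser_sum; apply: eq_bigr => i _.
by rewrite /svec (fc0 hX H (h1 i)).
Qed.

End HE.

Lemma HE_change P tau tau' s F S : formal_coord P tau -> germ P s -> centred s P tau' ->
  HE P tau' F S -> HE P tau F (vcomp S ((tau s : fps k) - fcst (s P))).
Proof.
move=> H gs c [N [gc [h1 h2 ->]]]; exists N, gc; split=> //.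
rewrite vcomp_sum; apply: eq_bigr => i _.
by rewrite vcomp_svec -(fc_change hX _ H gs c).
Qed.
End VGerm.

Section Torsor.
Variables (k : fieldType) (X : funSpace k).
Hypothesis hS : smooth_curve X.
Let hX : variety X := hS.1.
Implicit Types (P x : X) (f g t : X -> k) (U W : set X) (q : autTorsor X).

Lemma autTorsor_eq q q' : apt q = apt q' -> acoord q = acoord q' -> q = q'.
Proof.
case: q q' => [x tau h] [x' tau' h'] /= Ex Et; subst x' tau'.
by congr AutTorsor; exact: Prop_irrelevance.
Qed.

(* The expansion at q of t - t(apt q). *)
Definition muq q t : fps k := fun n => if n == 0%N then 0 else acoord q t n.

Lemma muq0 q t : muq q t 0%N = 0. Proof. by []. Qed.

Lemma muqE q t : germ (apt q) t -> muq q t = (acoord q t : fps k) - fcst (t (apt q)).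
Proof.
move=> gt; apply: funext => -[|n]; rewrite fpsD fpsN /muq /= ?subr0 //.
by rewrite (fc0 hX (acoordP q) gt) subrr.
Qed.

Section OneCoord.
Variables (W : set X) (t : X -> k) (qs : X -> autTorsor X).
Hypotheses (oW : open W) (ht : coordinate W t).
Hypothesis hqs : forall x, W x -> apt (qs x) = x /\ centred t x (acoord (qs x)).

Lemma acoord_change q f : W (apt q) ->
  acoord q f = scomp (acoord (qs (apt q)) f) (muq q t).
Proof.
move=> Wq; have [_ c] := hqs Wq; have gt := coord_germ oW ht Wq.
by rewrite muqE //; exact: fc_change (acoordP q) gt c.
Qed.

Lemma muq_AutO q : W (apt q) -> AutO (muq q t).
Proof.
move=> Wq; split=> // m1.
have [f gf hf] := fc_surj (acoordP q) 2 fX.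
have := hf 1%N isT; rewrite acoord_change // scomp_n1 // m1 mulr0 /fX /=.
by move/esym/eqP; rewrite oner_eq0.
Qed.

Lemma qs_uniq q : W (apt q) -> centred t (apt q) (acoord q) -> q = qs (apt q).
Proof.
move=> Wq c; have [e _] := hqs Wq; apply: autTorsor_eq => //.
have g := coord_germ oW ht Wq.
by apply: funext => f; rewrite acoord_change // muqE // (centredE c) scompfX.
Qed.

Lemma muq_qs x : W x -> muq (qs x) t = fX.
Proof.
move=> Wx; have [e c] := hqs Wx.
have g : germ (apt (qs x)) t by rewrite e; exact: (coord_germ oW ht Wx).
by rewrite muqE // e (centredE c).
Qed.

Lemma torsor_qs q : W (apt q) -> torsor_act q (muq q t) (qs (apt q)).
Proof.
by move=> Wq; have [e _] := hqs Wq; split=> // f; exact: acoord_change.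
Qed.
End OneCoord.

Lemma reg_torsor_c W (c : k) : reg_torsor W (fun _ : autTorsor X => c).
Proof.
exists (fun=> c), (fun=> 1); split; [exact: subalg_const | exact: subalg_const|].
by move=> q _; rewrite oner_eq0 divr1.
Qed.
Lemma reg_torsor_g W f n : reg W f -> reg_torsor W (fun q : autTorsor X => acoord q f n).
Proof.
move=> rf; exists (fun q => acoord q f n), (fun=> 1); split; last first.
- by move=> q _; rewrite oner_eq0 divr1.
- exact: subalg_const.
- by apply: subalg_gen; exists f, n.
Qed.
Lemma reg_torsorD W (h1 h2 : autTorsor X -> k) : reg_torsor W h1 -> reg_torsor W h2 ->
  reg_torsor W (fun q => h1 q + h2 q).
Proof.
move=> [a [b [sa sb H]]] [a' [b' [sa' sb' H']]].
exists (fun q => a q * b' q + a' q * b q), (fun q => b q * b' q); split.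
- by apply: subalg_add; apply: subalg_mul.
- exact: subalg_mul.
- move=> q Wq; have [b0 ->] := H q Wq; have [b0' ->] := H' q Wq.
  by rewrite mulf_neq0 //; split=> //; field; rewrite b0 b0'.
Qed.
Lemma reg_torsorM W (h1 h2 : autTorsor X -> k) : reg_torsor W h1 -> reg_torsor W h2 ->
  reg_torsor W (fun q => h1 q * h2 q).
Proof.
move=> [a [b [sa sb H]]] [a' [b' [sa' sb' H']]].
exists (fun q => a q * a' q), (fun q => b q * b' q); split; try exact: subalg_mul.
move=> q Wq; have [b0 ->] := H q Wq; have [b0' ->] := H' q Wq.
by rewrite mulf_neq0 //; split=> //; field; rewrite b0 b0'.
Qed.
Lemma reg_torsor_inv W f n : reg W f ->
  (forall q : autTorsor X, W (apt q) -> acoord q f n != 0) ->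
  reg_torsor W (fun q : autTorsor X => (acoord q f n)^-1).
Proof.
move=> rf h; exists (fun=> 1), (fun q => acoord q f n); split.
- exact: subalg_const.
- by apply: subalg_gen; exists f, n.
- by move=> q Wq; rewrite h // mul1r.
Qed.

Lemma reg_torsor_af W t e : open W -> coordinate W t ->
  reg_torsor W (fun q : autTorsor X => afeval0 (muq q t) e).
Proof.
move=> oW ht; have [qs hqs] := coord_sec hS ht; have [rt _] := ht.
elim: e => [c|n||e1 IH1 e2 IH2|e1 IH1 e2 IH2].
- exact: reg_torsor_c.
- exact: reg_torsor_g.
- have -> : (fun q : autTorsor X => afeval0 (muq q t) (AFinv1 k)) = (fun q => (acoord q t 1%N)^-1).
    by apply: funext => q; rewrite /afeval0 /= sinv0.
  apply: reg_torsor_inv => // q Wq; have [_ m1] := muq_AutO oW ht hqs Wq.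
  exact/eqP.
- exact: reg_torsorD.
- have -> : (fun q : autTorsor X => afeval0 (muq q t) (AFmul e1 e2)) =
    (fun q => afeval0 (muq q t) e1 * afeval0 (muq q t) e2).
    by apply: funext => q; exact: fpsM0.
  exact: reg_torsorM.
Qed.
End Torsor.

Section Sections.
Variables (k : fieldType) (V : lmodType k) (A : gradedVA V) (R : autOAction A).
Variable X : funSpace k.
Hypothesis hS : smooth_curve X.
Let hX : variety X := hS.1.
Implicit Types (P x : X) (f g t : X -> k) (U W : set X) (q : autTorsor X).
Implicit Types (sg : autTorsor X -> V).

Lemma Pi_id v : Pi R fX v = v.
Proof. exact: act1. Qed.

Lemma Pi_comp mu rho v : AutO mu -> AutO rho -> Pi R mu (Pi R rho v) = Pi R (scomp rho mu) v.
Proof. by move=> hm hr; rewrite actM. Qed.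

Definition RT W sg := exists N (h : 'I_N -> autTorsor X -> k) (v : 'I_N -> V),
  (forall i, reg_torsor W (h i)) /\ forall q, W (apt q) -> sg q = \sum_i h i q *: v i.

Lemma RT_ext W sg sg' : RT W sg -> (forall q, W (apt q) -> sg q = sg' q) -> RT W sg'.
Proof.
by move=> [N [h [v [hh E]]]] E'; exists N, h, v; split=> // q Wq; rewrite -E' // E.
Qed.
Lemma RT_gen W h v : reg_torsor W h -> RT W (fun q => h q *: v).
Proof.
by move=> hh; exists 1%N, (fun=> h), (fun=> v); split=> // q _; rewrite big_ord1.
Qed.
Lemma RT0 W : RT W (fun=> 0).
Proof.
exists 0%N, (fun _ _ => 0), (fun=> 0); split=> [[]//|q _].
by rewrite big_ord0.
Qed.
Lemma RTD W sg sg' : RT W sg -> RT W sg' -> RT W (fun q => sg q + sg' q).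
Proof.
move=> [N [h [v [hh E]]]] [M [h' [v' [hh' E']]]].
pose z := ocat (fun i => (h i, v i)) (fun i => (h' i, v' i)).
exists (N + M)%N, (fun i => (z i).1), (fun i => (z i).2); split.
  exact: (@ocatP _ _ _ _ _ (fun p => reg_torsor W p.1)).
move=> q Wq; rewrite E // E' //.
by rewrite (ocat_sum _ _ (fun p : (autTorsor X -> k) * V => p.1 q *: p.2)).
Qed.
Lemma RT_sum W N (F : 'I_N -> autTorsor X -> V) : (forall i, RT W (F i)) ->
  RT W (fun q => \sum_i F i q).
Proof.
elim: N F => [|N IH] F h.
  by apply: (RT_ext (RT0 W)) => q _; rewrite big_ord0.
apply: (RT_ext (RTD (h ord0) (IH _ (fun i => h (lift ord0 i))))) => q _.
by rewrite big_ord_recl.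
Qed.
Lemma RTZ W h sg : reg_torsor W h -> RT W sg -> RT W (fun q => h q *: sg q).
Proof.
move=> hh [N [h' [v [hh' E]]]]; exists N, (fun i q => h q * h' i q), v; split.
  by move=> i; exact: reg_torsorM.
move=> q Wq; rewrite E // scaler_sumr; apply: eq_bigr => i _.
by rewrite scalerA.
Qed.

Lemma RT_near W sg P : open W -> W P -> RT W sg -> exists W N (h : 'I_N -> autTorsor X -> k) (v : 'I_N -> V),
    [/\ open W, W P, forall i, reg_torsor W (h i) &
        forall q, W (apt q) -> sg q = \sum_i h i q *: v i].
Proof. by move=> oW WP [N [h [v [hh E]]]]; exists W, N, h, v. Qed.

Lemma Vsheaf_res U W sg : W `<=` U -> Vsheaf R U sg -> Vsheaf R W sg.
Proof.
move=> WU [h1 h2]; split=> [q rho q' Wq|P WP]; first exact: h1 (WU _ Wq).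
exact: h2 (WU _ WP).
Qed.

Lemma Vsheaf_glue U sg : (forall P, U P -> exists W, [/\ open W, W P & Vsheaf R W sg]) ->
  Vsheaf R U sg.
Proof.
move=> h; split=> [q rho q' Uq|P /h [W [_ WP [_ hW]]]]; last exact: hW.
by have [W [_ Wq [hW _]]] := h _ Uq; exact: hW.
Qed.

Lemma Vsheaf_ext U sg sg' : (forall q, U (apt q) -> sg q = sg' q) -> open U ->
  Vsheaf R U sg -> Vsheaf R U sg'.
Proof.
move=> E oU [h1 h2]; split=> [q rho q' Uq hr ta|P UP].
  by rewrite -!E // -?ta.1 //; exact: h1 ta.
have [W [N [h [v [oW WP hh hE]]]]] := h2 P UP.
have oI := openI oW oU.
exists (W `&` U), N, h, v; split=> // [i|q [Wq Uq]]; last by rewrite -E // hE.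
have [a [b [sa sb H]]] := hh i.
have res a' : subalg [set u | exists f n, reg W f /\ u = fun q : autTorsor X => acoord q f n] a' ->
   subalg [set u | exists f n, reg (W `&` U) f /\ u = fun q : autTorsor X => acoord q f n] a'.
  elim=> [c|_ [f [n [rf ->]]]|f g _ ? _ ?|f g _ ? _ ?].
  - exact: subalg_const.
  - by apply: subalg_gen; exists f, n; split=> //; apply: (reg_res hX oW) => // x [].
  - exact: subalg_add.
  - exact: subalg_mul.
by exists a, b; split; [exact: res | exact: res | move=> q [Wq _]; exact: H].
Qed.

Lemma mksec W t N (a : 'I_N -> V) (f : 'I_N -> X -> k) : open W -> coordinate W t ->
  (forall i, reg W (f i)) ->
  let sg q := Pi R (muq q t) (\sum_i f i (apt q) *: a i) in
  Vsheaf R W sg /\ trivialized W t sg a f.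
Proof.
move=> oW ht rf sg; have [qs hqs] := coord_sec hS ht.
split; last first.
  split=> // q Wq c; rewrite /sg (qs_uniq hS oW ht hqs Wq c).
  by rewrite (muq_qs hS oW ht hqs Wq) Pi_id.
split=> [q rho q' Wq hr [e ta]|P WP].
  rewrite /sg -e.
  have Wq' : W (apt q') by rewrite -e.
  have -> : muq q t = scomp (muq q' t) rho.
    rewrite !(muqE hS) -?e; [|exact: (coord_germ oW ht Wq)|exact: (coord_germ oW ht Wq)].
    by rewrite ta scompD scompN scomp_c.
  rewrite actM ?act_invl //; exact: (muq_AutO hS oW ht hqs Wq').
apply: (RT_near oW WP); rewrite /sg.
have H i : RT W (fun q => f i (apt q) *: Pi R (muq q t) (a i)).
  have rfi : reg_torsor W (fun q : autTorsor X => acoord q (f i) 0%N) by exact: reg_torsor_g.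
  have [M [e [v hv]]] := actAlg R (a i).
  have h2 : RT W (fun q => \sum_j afeval0 (muq q t) (e j) *: v j).
    by apply: RT_sum => j; apply: RT_gen; exact: (reg_torsor_af hS).
  apply: (RT_ext (RTZ rfi h2)) => q Wq.
  rewrite (fc0 hX (acoordP q)); last exact: (germ_of oW Wq (rf i)).
  by rewrite (hv _ (muq_AutO hS oW ht hqs Wq)).1.
apply: (RT_ext (RT_sum H)) => q Wq.
have lP := act_lin R (muq_AutO hS oW ht hqs Wq).
by rewrite (lin_sum lP); apply: eq_bigr => i _; rewrite (linZ lP).
Qed.

Section WithCoord.
Variables (W : set X) (t : X -> k) (qs : X -> autTorsor X).
Hypotheses (oW : open W) (ht : coordinate W t).
Hypothesis hqs : forall x, W x -> apt (qs x) = x /\ centred t x (acoord (qs x)).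

Lemma sg_Pi U sg q : Vsheaf R U sg -> U (apt q) -> W (apt q) ->
  sg q = Pi R (muq q t) (sg (qs (apt q))).
Proof.
move=> [h _] Uq Wq; have hm := muq_AutO hS oW ht hqs Wq.
by rewrite (h q _ _ Uq hm (torsor_qs hS oW ht hqs Wq)) act_invr.
Qed.

Lemma triv_qs sg N (a : 'I_N -> V) (f : 'I_N -> X -> k) : trivialized W t sg a f <->
  (forall i, reg W (f i)) /\ forall x, W x -> sg (qs x) = \sum_i f i x *: a i.
Proof.
split=> [[h1 h2]|[h1 h2]]; split=> //.
  move=> x Wx; have [e c] := hqs Wx.
  by rewrite h2 e.
move=> q Wq c; rewrite [in LHS](qs_uniq hS oW ht hqs Wq c) h2 //.
Qed.

Lemma triv_ex U sg P : open U -> Vsheaf R U sg -> U P -> W P ->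
  exists W' N (a : 'I_N -> V) (f : 'I_N -> X -> k),
    [/\ open W', W' P, W' `<=` W, W' `<=` U & trivialized W' t sg a f].
Proof.
move=> oU [_ h] UP WP; have [W1 [N [hh [v [oW1 W1P rt E]]]]] := h P UP.
pose W' := W1 `&` W `&` U.
have oW' : open W' by apply: openI => //; exact: openI.
exists W', N, v, (fun i x => hh i (qs x)); split=> //; first by move=> x [[]].
  by move=> x [].
have ht' : coordinate W' t.
  split; first by apply: (reg_res hX oW) ht.1 => // x [[]].
  by move=> x [[_ Wx] _]; exact: ht.2.
split; last first.
  move=> q W'q c; have [[W1q Wq] Uq] := W'q.
  by rewrite E // [in LHS](qs_uniq hS oW ht hqs Wq c).
move=> i; apply: (reg_germ hX oW') => x [[W1x Wx] _].
have [a [b [sa sb H]]] := rt i.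
have gsub (u : autTorsor X -> k) : subalg [set u | exists f n, reg W1 f /\
    u = fun q : autTorsor X => acoord q f n] u -> germ x (fun y => u (qs y)).
  elim=> [c|_ [f [n [rf ->]]]|f g _ ? _ ?|f g _ ? _ ?].
  - exact: germ_c.
  - by apply: (hd_germ hS oW ht hqs) => //; exact: (germ_of oW1 W1x rf).
  - exact: (germD hX).
  - exact: (germM hX).
have [e _] := hqs Wx.
have bx : b (qs x) != 0 by apply: (H (qs x) _).1; rewrite e.
apply: (germ_ext hX (germ_div hX (gsub _ sa) (gsub _ sb) bx)).
have n1 := open_near oW1 W1x; have n2 := open_near oW Wx.
near=> y; have Wy : W y by near: y.
have [ey _] := hqs Wy; rewrite (H (qs y) _).2 // ey; near: y => //.
Unshelve. all: by end_near.
Qed.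
End WithCoord.
End Sections.

Section Jets.
Variables (k : fieldType) (V : lmodType k) (A : gradedVA V) (R : autOAction A).
Variable X : funSpace k.
Hypothesis hS : smooth_curve X.
Let hX : variety X := hS.1.
Implicit Types (P x : X) (f g t r : X -> k) (U W : set X) (q : autTorsor X).
Implicit Types (sg : autTorsor X -> V) (mu rho : fps k) (b v : V).

Lemma Piz_vexp rho b : AutO rho -> (fun n => Piz A (Pi R) rho n b) =
  vexpT A (- fX) (vmap (Pi R rho) (vexpT A rho (svec (1 : fps k) b))).
Proof.
move=> hr; apply: funext => n; rewrite vexpT_NX /Piz; apply: eq_bigr => i _.
congr (_ *: Tdp A i _); rewrite /vmap; congr (Pi R rho _).
by apply: eq_bigr => m _; rewrite sexpE (vmap_svec (Tdp_linear A m)) svecZ mulr1.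
Qed.

Lemma Piz_linear rho n : AutO rho -> linear (fun b => Piz A (Pi R) rho n b).
Proof.
move=> hr c u v /=; rewrite /Piz scaler_sumr -big_split /=; apply: eq_bigr => i _.
have l1 : linear (fun b => Tdp A i (Pi R rho (\sum_(m < (n - i).+1) sexp rho m (n - i)%N *: Tdp A m b))).
  move=> d w w' /=; rewrite -Tdp_linear -(act_lin R hr); congr (Tdp A i (Pi R rho _)).
  rewrite scaler_sumr -big_split /=; apply: eq_bigr => m _.
  by rewrite Tdp_linear scalerDr !scalerA mulrC.
by rewrite l1 scalerDr !scalerA mulrC.
Qed.

Lemma piz_change mu rho b : AutO mu -> AutO rho ->
  vexpT A mu (vcomp (fun n => Piz A (Pi R) rho n b) mu) =
  vmap (Pi R rho) (vexpT A (scomp rho mu) (svec (1 : fps k) b)).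
Proof.
move=> [m0 _] hr; have [r0 _] := hr.
have sN : scomp (- fX : fps k) mu = - mu :> fps k by rewrite scompN scomp_X.
have X0 : (- fX : fps k) 0%N = 0 by rewrite fpsN /fX oppr0.
rewrite Piz_vexp // vexpT_comp // sN vexpTNK // -vmap_comp; last exact: act_lin.
rewrite vexpT_comp // vcomp_svec.
by have -> : scomp (1 : fps k) mu = 1 :> fps k := scomp_c 1 mu.
Qed.

Lemma coord_res W W' t : open W -> open W' -> W' `<=` W -> coordinate W t -> coordinate W' t.
Proof.
move=> oW oW' s [rt h]; split; first exact: (reg_res hX oW).
by move=> P /s; exact: h.
Qed.
Lemma triv_res W W' t sg N (a : 'I_N -> V) (f : 'I_N -> X -> k) : open W -> open W' -> W' `<=` W ->
  trivialized W t sg a f -> trivialized W' t sg a f.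
Proof.
move=> oW oW' s [rf h]; split; first by move=> i; exact: (reg_res hX oW).
by move=> q /s; exact: h.
Qed.

Lemma coord_ex P U : open U -> U P ->
  exists W t, [/\ open W, W P, W `<=` U, coordinate W t & t P = 0].
Proof.
move=> oU UP; have [tau H] := formal_of_smooth hX (hS.2 P).
have [s gs hs] := fc_surj H 2 fX.
have s1 : (tau s : fps k) 1%N != 0 by rewrite [_ 1%N]hs // oner_eq0.
pose t y := s y - s P.
have gt : germ P t by exact: (germ_sub hS).
have t1 : (tau t : fps k) 1%N != 0.
  by rewrite /t (fcB hX H gs (germ_c hX P _)) (fc_c H) fpsD fpsN subr0.
have /nearP [W [oW WP hW]] := coord_near hX hS.2 H gt t1.
have oI := openI oW oU.
have sU : W `&` U `<=` U by move=> x [].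
exists (W `&` U), t; split=> //; last by rewrite /t subrr.
split; first by apply: (reg_germ hX oI) => x [/hW []].
by move=> x [/hW []].
Qed.

Section Master.
Variables (W : set X) (t : X -> k) (qs : X -> autTorsor X).
Hypotheses (oW : open W) (ht : coordinate W t).
Hypothesis hqs : forall x, W x -> apt (qs x) = x /\ centred t x (acoord (qs x)).
Variable r : X -> k.
Hypothesis hr : coordinate W r.
Variable q : autTorsor X.
Hypothesis Wq : W (apt q).

Lemma afHE e : germ (apt q) (fun x => afeval0 (muq (qs x) r) e) /\
  acoord q (fun x => afeval0 (muq (qs x) r) e) =
  scomp (afevalz (muq (qs (apt q)) r) e) (muq q t).
Proof.
have [eP c] := hqs Wq; have [rr _] := hr; have gr := germ_of oW Wq rr.
have H := acoordP q.
have hdE n : germ (apt q) (fun x => muq (qs x) r n.+1) /\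
    acoord q (fun x => muq (qs x) r n.+1) = scomp (shasse n.+1 (muq (qs (apt q)) r)) (muq q t).
  have gh := hd_germ hS oW ht hqs n.+1 Wq gr; split=> //.
  rewrite (acoord_change hS oW ht hqs _ Wq) -[(fun x => _)]/(hd qs r n.+1).
  rewrite (hd_comp hS oW ht hqs n.+1 Wq gr); congr (scomp _ _).
  by apply: funext => m; rewrite /shasse /muq addnS.
elim: e => [x|n||e1 [g1 E1] e2 [g2 E2]|e1 [g1 E1] e2 [g2 E2]].
- split; first exact: germ_c.
  by rewrite (fc_c H) -[scst x]/(fcst x) scomp_c.
- exact: hdE.
- have [gh Eh] := hdE 0%N.
  have inv1 x : afeval0 (muq (qs x) r) (AFinv1 k) = (muq (qs x) r 1%N)^-1.
    by rewrite /afeval0 /= sinv0.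
  have h0 : muq (qs (apt q)) r 1%N != 0.
    have Wq' : W (apt (qs (apt q))) by rewrite eP.
    have [qr hqr] := coord_sec hS hr.
    by have [_ /eqP] := muq_AutO hS oW hr hqr Wq'.
  have -> : (fun x => afeval0 (muq (qs x) r) (AFinv1 k)) = (fun x => (muq (qs x) r 1%N)^-1).
    by apply: funext => x; exact: inv1.
  split; first exact: (germ_inv hX gh h0).
  have s0 : (shasse 1 (muq (qs (apt q)) r) : fps k) 0%N != 0 by rewrite /shasse add0n binn mul1r.
  have m0 : muq q t 0%N = 0 by [].
  rewrite /afevalz /=.
  transitivity (sinv (scomp (shasse 1 (muq (qs (apt q)) r)) (muq q t))).
    by apply: sinv_uniq; rewrite -Eh; exact: (fc_inv hX H gh h0).
  apply/esym/sinv_uniq; rewrite -scompM // sinvM //.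
  exact: scomp_c.
- split; first exact: (germD hX).
  by rewrite (fcD H g1 g2) [X in X + _]E1 [X in _ + X]E2 -scompD.
- have -> : (fun x => afeval0 (muq (qs x) r) (AFmul e1 e2)) =
    (fun x => afeval0 (muq (qs x) r) e1 * afeval0 (muq (qs x) r) e2).
    by apply: funext => x; exact: fpsM0.
  split; first exact: (germM hX).
  by rewrite (fcM H g1 g2) [X in X * _]E1 [X in _ * X]E2 -scompM.
Qed.

Lemma PiHE b : HE (apt q) (acoord q) (fun x => Pi R (muq (qs x) r) b)
  (vcomp (fun n => Piz A (Pi R) (muq (qs (apt q)) r) n b) (muq q t)).
Proof.
have [N [e [v he]]] := actAlg R b.
have [qr hqr] := coord_sec hS hr.
have aut x : W x -> AutO (muq (qs x) r).
  move=> Wx; apply: (muq_AutO hS oW hr hqr); by have [-> _] := hqs Wx.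
exists N, (fun i => (fun x => afeval0 (muq (qs x) r) (e i), v i)); split.
- by move=> i; case: (afHE (e i)).
- have Wn := open_near oW Wq; near=> x.
  rewrite (he _ (aut x _)).1 //; near: x => //.
have -> : (fun n => Piz A (Pi R) (muq (qs (apt q)) r) n b) =
  \sum_i (svec (afevalz (muq (qs (apt q)) r) (e i)) (v i) : vser V).
  by apply: funext => n; rewrite (he _ (aut _ Wq)).2 vser_sum.
rewrite vcomp_sum; apply: eq_bigr => i _; rewrite vcomp_svec.
by case: (afHE (e i)) => _ ->.
Unshelve. all: by end_near.
Qed.

Variables (U : set X) (sg : autTorsor X -> V).
Hypotheses (oU : open U) (hsg : Vsheaf R U sg) (Uq : U (apt q)).
Variable qr : X -> autTorsor X.
Hypothesis hqr : forall x, W x -> apt (qr x) = x /\ centred r x (acoord (qr x)).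

Lemma master S S' : HE (apt q) (acoord q) (fun x => sg (qs x)) S ->
  HE (apt q) (acoord q) (fun x => sg (qr x)) S' ->
  vmap (Pi R (muq q t)) (vexpT A (muq q t) S) = vmap (Pi R (muq q r)) (vexpT A (muq q r) S').
Proof.
move=> hS1 hS2; have [N [gb [g1 g2 ->]]] := hS2.
have H := acoordP q.
set rho := muq (qs (apt q)) r; set mu := muq q t.
have aut x : W x -> AutO (muq (qs x) r).
  move=> Wx; apply: (muq_AutO hS oW hr hqr); by have [-> _] := hqs Wx.
have hmu : AutO mu by exact: (muq_AutO hS oW ht hqs Wq).
have hrho : AutO rho by exact: aut.
have E : S = \sum_i (acoord q (gb i).1 : fps k) *:
    vcomp (fun n => Piz A (Pi R) rho n (gb i).2) mu.
  apply: (HE_uniq hX H hS1).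
  apply: (HE_ext (HE_sum (fun i => HEZ hX H (g1 i) (PiHE (gb i).2)))).
  have Wn := open_near oW Wq; have Un := open_near oU Uq.
  near=> x; have Wx : W x by near: x.
  have [ex cx] := hqs Wx.
  have Wx' : W (apt (qs x)) by rewrite ex.
  have Ux' : U (apt (qs x)) by rewrite ex; near: x.
  have lP := act_lin R (aut x Wx).
  rewrite (sg_Pi hS oW hr hqr hsg Ux' Wx') ex (near g2 x) // (lin_sum lP).
  by apply: eq_bigr => i _; rewrite (linZ lP).
have nu : muq q r = scomp rho mu.
  have gr : germ (apt q) r by exact: (coord_germ oW hr Wq).
  have [eP cP] := hqs Wq.
  have gr' : germ (apt (qs (apt q))) r by rewrite eP.
  rewrite /rho (muqE hS gr) (muqE hS gr') scompD scompN scomp_c eP.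
  by rewrite (acoord_change hS oW ht hqs _ Wq).
have lmu := act_lin R hmu; have lrho := act_lin R hrho.
have nu0 : muq q r 0%N = 0 by [].
rewrite E !vexpT_sum !vmap_sum //; last by apply: act_lin; rewrite nu; exact: AutO_comp.
apply: eq_bigr => i _; rewrite vexpTZ // vmapZ // (piz_change _ hmu hrho) -nu.
have -> : svec (acoord q (gb i).1) (gb i).2 = (acoord q (gb i).1 : fps k) *: (svec (1 : fps k) (gb i).2 : vser V).
  by rewrite svecZ mulr1.
rewrite vexpTZ // vmapZ; last by apply: act_lin; rewrite nu; exact: AutO_comp.
congr (_ *: _); apply: funext => n; rewrite /vmap (Pi_comp R _ hmu hrho) nu //.
Unshelve. all: by end_near.
Qed.
End Master.

Definition JetF q t N (a : 'I_N -> V) (f : 'I_N -> X -> k) : vser V :=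
  vmap (Pi R (muq q t)) (vexpT A (muq q t) (\sum_i (svec (acoord q (f i)) (a i) : vser V))).

(* e^(zT) applied to the expansion of sg at q.  By the lemma master it does not
   depend on the coordinate t, and the canonical connection is its truncation. *)
Definition Jet sg q : vser V :=
  xget (0 : vser V) [set H | exists W t N (a : 'I_N -> V) (f : 'I_N -> X -> k),
    [/\ open W, W (apt q), coordinate W t, trivialized W t sg a f & H = JetF q t a f]].

Lemma triv_HE W t qs sg N (a : 'I_N -> V) (f : 'I_N -> X -> k) q : open W -> coordinate W t ->
  (forall x, W x -> apt (qs x) = x /\ centred t x (acoord (qs x))) -> W (apt q) ->
  trivialized W t sg a f -> HE (apt q) (acoord q) (fun x => sg (qs x))
    (\sum_i (svec (acoord q (f i)) (a i) : vser V)).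
Proof.
move=> oW ht hqs Wq /(triv_qs hS oW ht hqs sg a f) [rf E].
exists N, (fun i => (f i, a i)); split=> //.
  by move=> i; exact: (germ_of oW Wq (rf i)).
have Wn := open_near oW Wq; near=> x; rewrite E //; near: x => //.
Unshelve. all: by end_near.
Qed.

Lemma JetF_uniq U sg q W t W' t' N (a : 'I_N -> V) (f : 'I_N -> X -> k)
    N' (a' : 'I_N' -> V) (f' : 'I_N' -> X -> k) :
  open U -> Vsheaf R U sg -> U (apt q) ->
  open W -> W (apt q) -> coordinate W t -> trivialized W t sg a f ->
  open W' -> W' (apt q) -> coordinate W' t' -> trivialized W' t' sg a' f' ->
  JetF q t a f = JetF q t' a' f'.
Proof.
move=> oU hsg Uq oW Wq ht tr oW' Wq' ht' tr'.
have oI := openI oW oW'.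
have s1 : W `&` W' `<=` W by move=> x [].
have s2 : W `&` W' `<=` W' by move=> x [].
have Iq : (W `&` W') (apt q) by [].
have h1 := coord_res oW oI s1 ht; have h2 := coord_res oW' oI s2 ht'.
have [qs hqs] := coord_sec hS h1; have [qr hqr] := coord_sec hS h2.
apply: (master oI h1 hqs h2 Iq oU hsg Uq hqr).
  exact: (triv_HE oI h1 hqs Iq (triv_res oW oI s1 tr)).
exact: (triv_HE oI h2 hqr Iq (triv_res oW' oI s2 tr')).
Qed.

Lemma frame U sg P : open U -> Vsheaf R U sg -> U P ->
  exists W t N (a : 'I_N -> V) (f : 'I_N -> X -> k),
    [/\ open W, W P, W `<=` U, coordinate W t & trivialized W t sg a f /\ t P = 0].
Proof.
move=> oU hsg UP; have [W [t [oW WP WU ht t0]]] := coord_ex oU UP.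
have [qs hqs] := coord_sec hS ht.
have [W' [N [a [f [oW' W'P W'W W'U tr]]]]] := triv_ex hS oW ht hqs oU hsg UP WP.
exists W', t, N, a, f; split=> //; exact: (coord_res oW).
Qed.

Lemma JetE U sg q W t N (a : 'I_N -> V) (f : 'I_N -> X -> k) :
  open U -> Vsheaf R U sg -> U (apt q) ->
  open W -> W (apt q) -> coordinate W t -> trivialized W t sg a f ->
  Jet sg q = JetF q t a f.
Proof.
move=> oU hsg Uq oW Wq ht tr; rewrite /Jet; set D := [set H | _].
have : D (JetF q t a f) by exists W, t, N, a, f.
move/(xgetI 0) => [W' [t' [N' [a' [f' [oW' W'q ht' tr' ->]]]]]].
exact: (JetF_uniq oU hsg Uq oW' W'q ht' tr' oW Wq ht tr).
Qed.

Lemma Jet_HE U sg q W t qs : open U -> Vsheaf R U sg -> U (apt q) ->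
  open W -> W (apt q) -> coordinate W t ->
  (forall x, W x -> apt (qs x) = x /\ centred t x (acoord (qs x))) ->
  exists2 S, HE (apt q) (acoord q) (fun x => sg (qs x)) S &
    Jet sg q = vmap (Pi R (muq q t)) (vexpT A (muq q t) S).
Proof.
move=> oU hsg Uq oW Wq ht hqs.
have [W' [N [a [f [oW' W'P W'W W'U tr]]]]] := triv_ex hS oW ht hqs oU hsg Uq Wq.
have ht' := coord_res oW oW' W'W ht.
exists (\sum_i (svec (acoord q (f i)) (a i) : vser V)).
  by apply: (triv_HE oW' ht' _ W'P tr) => x /W'W; exact: hqs.
exact: (JetE oU hsg Uq oW' W'P ht' tr).
Qed.

Lemma Jet_of_HE U sg q W t qs S : open U -> Vsheaf R U sg -> U (apt q) ->
  open W -> W (apt q) -> coordinate W t ->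
  (forall x, W x -> apt (qs x) = x /\ centred t x (acoord (qs x))) ->
  HE (apt q) (acoord q) (fun x => sg (qs x)) S ->
  Jet sg q = vmap (Pi R (muq q t)) (vexpT A (muq q t) S).
Proof.
move=> oU hsg Uq oW Wq ht hqs hS1; have [S' hS' ->] := Jet_HE oU hsg Uq oW Wq ht hqs.
by rewrite (HE_uniq hX (acoordP q) hS1 hS').
Qed.

End Jets.

(** * Principal parts *)

Section PP.
Variables (k : fieldType) (X : funSpace k).
Hypothesis hS : smooth_curve X.
Let hX : variety X := hS.1.
Variables (B : Type) (pi : B -> X) (M : lmodType k) (E : set X -> set (B -> M)).
Hypothesis EZ : forall W f sg, open W -> reg W f -> E W sg -> E W (fun q => f (pi q) *: sg q).
Hypothesis Eres : forall U W sg, open U -> open W -> W `<=` U -> E U sg -> E W sg.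
Implicit Types (P x : X) (f g t r : X -> k) (U W : set X).
Implicit Types (sg : B -> M).

Definition pgens n W : set (B -> X -> M) :=
  [set D | exists sg g (F : 'I_n -> X -> X -> k),
        [/\ E W sg, reg W g, forall l, Jker W (F l) &
            D = fun q y => (g y * \prod_l F l (pi q) y) *: sg q]].

Lemma reg_c W (c : k) : open W -> reg W (fun=> c).
Proof. by move=> oW; apply: (reg_germ hX oW) => P _; exact: germ_c. Qed.
Lemma regM W f g : open W -> reg W f -> reg W g -> reg W (fun x => f x * g x).
Proof.
move=> oW rf rg; apply: (reg_germ hX oW) => P WP.
by apply: (germM hX); [exact: (germ_of oW WP rf) | exact: (germ_of oW WP rg)].
Qed.
Lemma Jker_delta W f : open W -> reg W f ->
  exists2 F, Jker W F & forall x y, F x y = f y - f x.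
Proof.
move=> oW rf.
pose a (i : 'I_2) : X -> k := if i == ord0 then fun=> 1 else (fun x => -1 * f x).
pose b (i : 'I_2) : X -> k := if i == ord0 then f else fun=> 1.
have E0 x y : \sum_i a i x * b i y = f y - f x.
  by rewrite !big_ord_recl big_ord0 /a /b /= mul1r mulr1 mulN1r addr0.
exists (fun x y => \sum_i a i x * b i y) => //.
exists 2%N, a, b; split=> // [i|x _]; last by rewrite E0 subrr.
rewrite /a /b; case: ifP => _; split=> //; try exact: reg_c.
by apply: regM => //; exact: reg_c.
Qed.

Lemma JnE P n G : Jn P n G -> exists W0, [/\ open W0, W0 P &
  forall W sg, open W -> W `<=` W0 -> E W sg -> exists2 D, zspan (pgens n W) D &
    forall q y, W (pi q) -> W y -> G (pi q) y *: sg q = D q y].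
Proof.
elim=> {n G} [f g [W1 [oW1 W1P r1]] [W2 [oW2 W2P r2]]|n f G [W1 [oW1 W1P r1]] _ [W2 [oW2 W2P IH]]|n F G _ [W1 [oW1 W1P IH1]] _ [W2 [oW2 W2P IH2]]|n F G _ [W1 [oW1 W1P IH]] [W2 [oW2 W2P h]]];
  exists (W1 `&` W2); (split; [exact: openI | by [] | move=> W sg oW s Es]);
  have s1 : W `<=` W1 by [move=> x /s []]; have s2 : W `<=` W2 by [move=> x /s []].
- exists (fun q y => (g y * \prod_(l < 0) (fun _ _ => 0 : k) (pi q) y) *: (f (pi q) *: sg q)).
    apply: zspan_gen; exists (fun q => f (pi q) *: sg q), g, (fun _ _ _ => 0); split=> //.
    - by apply: EZ => //; exact: (reg_res hX oW1).
    - exact: (reg_res hX oW2).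
    - by case.
  by move=> q y Wq Wy; rewrite big_ord0 mulr1 scalerA mulrC.
- have [D zD hD] := IH W sg oW s2 Es.
  have [F0 JF0 EF0] := Jker_delta oW (reg_res hX oW1 oW s1 r1).
  exists (fun q y => F0 (pi q) y *: D q y); last first.
    by move=> q y Wq Wy; rewrite -hD // scalerA EF0.
  move: D zD {hD}; apply: zspan_map.
  - by apply: funext => q; apply: funext => y; rewrite -[RHS]/(0 : M) scaler0.
  - move=> D1 D2; apply: funext => q; apply: funext => y.
    by rewrite -[RHS]/(F0 (pi q) y *: D1 q y + F0 (pi q) y *: D2 q y) -scalerDr.
  - move=> _ [sg' [g [F [h1 h2 h3 ->]]]]; apply: zspan_gen.
    exists sg', g, (fun l => if unlift ord0 l is Some j then F j else F0); split=> //.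
      by move=> l; case: unliftP.
    apply: funext => q; apply: funext => y.
    rewrite big_ord_recl unlift_none scalerA mulrCA; congr (_ * (_ * _) *: _).
    by apply: eq_bigr => i _; rewrite liftK.
- have [D1 z1 h1] := IH1 W sg oW s1 Es; have [D2 z2 h2] := IH2 W sg oW s2 Es.
  exists (D1 + D2); first exact: zspan_add.
  by move=> q y Wq Wy; rewrite scalerDl h1 // h2.
- have [D zD hD] := IH W sg oW s1 Es; exists D => // q y Wq Wy.
  by rewrite -h ?hD //; [exact: s2 | exact: s2].
Qed.

Lemma tens_gen W sg g : E W sg -> reg W g -> tensO pi E W (fun q y => g y *: sg q).
Proof.
by move=> h1 h2; exists 1%N, (fun=> sg), (fun=> g); split=> // q y _ _; rewrite big_ord1.
Qed.
Lemma tens_ext W Phi Psi : tensO pi E W Phi ->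
  (forall q y, W (pi q) -> W y -> Phi q y = Psi q y) -> tensO pi E W Psi.
Proof.
move=> [N [sg [g [h1 h2]]]] h; exists N, sg, g; split=> // q y Wq Wy.
by rewrite -h // h2.
Qed.
Lemma tens0 W : tensO pi E W (fun _ _ => 0).
Proof.
exists 0%N, (fun _ _ => 0), (fun _ _ => 0); split=> [[]//|q y _ _].
by rewrite big_ord0.
Qed.
Lemma tensD W Phi Psi : tensO pi E W Phi -> tensO pi E W Psi ->
  tensO pi E W (fun q y => Phi q y + Psi q y).
Proof.
move=> [N [sg [g [h1 h2]]]] [N' [sg' [g' [h1' h2']]]].
pose z := ocat (fun i => (g i, sg i)) (fun i => (g' i, sg' i)).
exists (N + N')%N, (fun i => (z i).2), (fun i => (z i).1); split.
  exact: (@ocatP _ _ _ _ _ (fun p => E W p.2 /\ reg W p.1)).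
move=> q y Wq Wy; rewrite h2 // h2' //.
by rewrite (ocat_sum _ _ (fun p : (X -> k) * (B -> M) => p.1 y *: p.2 q)).
Qed.
Lemma tensO_sum W N (F : 'I_N -> B -> X -> M) : (forall i, tensO pi E W (F i)) ->
  tensO pi E W (fun q y => \sum_i F i q y).
Proof.
elim: N F => [|N IH] F h.
  by apply: (tens_ext (tens0 W)) => q y _ _; rewrite big_ord0.
apply: (tens_ext (tensD (h ord0) (IH _ (fun i => h (lift ord0 i))))) => q y _ _.
by rewrite big_ord_recl.
Qed.
Lemma tens_mulx W f Phi : open W -> reg W f -> tensO pi E W Phi ->
  tensO pi E W (fun q y => f (pi q) *: Phi q y).
Proof.
move=> oW rf [N [sg [g [h1 h2]]]]; exists N, (fun i q => f (pi q) *: sg i q), g; split.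
  by move=> i; have [? ?] := h1 i; split=> //; exact: EZ.
move=> q y Wq Wy; rewrite h2 // scaler_sumr; apply: eq_bigr => i _.
by rewrite !scalerA mulrC.
Qed.
Lemma tens_muly W f Phi : open W -> reg W f -> tensO pi E W Phi ->
  tensO pi E W (fun q y => f y *: Phi q y).
Proof.
move=> oW rf [N [sg [g [h1 h2]]]]; exists N, sg, (fun i y => f y * g i y); split.
  by move=> i; have [? ?] := h1 i; split=> //; exact: regM.
move=> q y Wq Wy; rewrite h2 // scaler_sumr; apply: eq_bigr => i _.
by rewrite !scalerA.
Qed.
Lemma tensZ W (c : k) Phi : open W -> tensO pi E W Phi -> tensO pi E W (fun q y => c *: Phi q y).
Proof. by move=> oW; apply: (tens_mulx oW (reg_c c oW)). Qed.
Lemma tens_delta W t n Phi : open W -> reg W t -> tensO pi E W Phi ->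
  tensO pi E W (fun q y => (t y - t (pi q)) ^+ n *: Phi q y).
Proof.
move=> oW rt h; elim: n => [|n IH].
  by apply: (tens_ext h) => q y _ _; rewrite expr0 scale1r.
apply: (tens_ext (tensD (tens_muly oW rt IH) (tensZ (-1) oW (tens_mulx oW rt IH)))) => q y _ _.
by rewrite exprS -scalerA scalerBl scaleN1r.
Qed.
Lemma tens_res U W Phi : open U -> open W -> W `<=` U -> tensO pi E U Phi -> tensO pi E W Phi.
Proof.
move=> oU oW s [N [sg [g [h1 h2]]]]; exists N, sg, g; split.
  by move=> i; have [? ?] := h1 i; split; [exact: (Eres oU) | exact: (reg_res hX oU)].
by move=> q y /s Uq /s Uy; exact: h2.
Qed.
Lemma tensB W Phi Psi : open W -> tensO pi E W Phi -> tensO pi E W Psi ->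
  tensO pi E W (fun q y => Phi q y - Psi q y).
Proof.
move=> oW h1 h2; apply: (tens_ext (tensD h1 (tensZ (-1) oW h2))) => q y _ _.
by rewrite scaleN1r.
Qed.

Lemma modJ_of_coefs n P W W0 t qs N (g : 'I_N -> X -> k) (sg : 'I_N -> B -> M) Phi Psi :
  open W -> W P -> open W0 -> W0 P -> coordinate W0 t ->
  (forall x, W0 x -> apt (qs x) = x /\ centred t x (acoord (qs x))) ->
  (forall i, E W (sg i) /\ reg W (g i)) ->
  (forall q, W (pi q) -> W0 (pi q) -> forall j, (j < n.+1)%N ->
     \sum_i hd qs (g i) j (pi q) *: sg i q = 0) ->
  (forall q y, W (pi q) -> W y -> Phi q y - Psi q y = \sum_i g i y *: sg i q) ->
  modJ pi E n P Phi Psi.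
Proof.
move=> oW WP oW0 W0P ht hqs Eg hz hD.
have H i : exists W1, [/\ open W1, W1 P & forall W' sg, open W' -> W' `<=` W1 -> E W' sg ->
    exists2 D, zspan (pgens n.+1 W') D & forall q y, W' (pi q) -> W' y ->
    (g i y - \sum_(j < n.+1) hd qs (g i) j (pi q) * (t y - t (pi q)) ^+ j) *: sg q = D q y].
  have gP := germ_of oW WP (Eg i).2.
  exact: (JnE (taylor hS oW0 ht hqs n W0P gP)).
have [W1 hW1] := choice H.
have /nearP [W2 [oW2 W2P hW2]] : \forall x \near P, W x /\ W0 x /\ forall i, W1 i x.
  near=> x; split; first by near: x; exact: open_near.
  split; first by near: x; exact: open_near.
  near: x; apply: filter_forall => i; have [o1 p1 _] := hW1 i; exact: open_near.
have EW2 i : E W2 (sg i) by apply: (Eres oW) => //; [move=> x /hW2 [] | case: (Eg i)].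
have sW1 i : W2 `<=` W1 i by move=> x /hW2 [_ [_]].
have H2 i : exists D, zspan (pgens n.+1 W2) D /\ forall q y, W2 (pi q) -> W2 y ->
    (g i y - \sum_(j < n.+1) hd qs (g i) j (pi q) * (t y - t (pi q)) ^+ j) *: sg i q = D q y.
  have [_ _ h] := hW1 i; have [D ? ?] := h W2 (sg i) oW2 (sW1 i) (EW2 i).
  by exists D.
have [D hDD] := choice H2.
exists W2, (\sum_i D i); split=> //.
  by apply: zspan_sum => i _; case: (hDD i).
move=> q y Wq Wy; have [W'q [W0q _]] := hW2 _ Wq; have [W'y _] := hW2 _ Wy.
rewrite hD //; have -> : (\sum_i D i) q y = \sum_i D i q y.
  by elim/big_rec2: _ => // i u v _ <-.
transitivity (\sum_i ((g i y - \sum_(j < n.+1) hd qs (g i) j (pi q) * (t y - t (pi q)) ^+ j) *: sg i q)).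
  under [RHS]eq_bigr do rewrite scalerBl.
  rewrite sumrB [X in _ - X](_ : _ = 0) ?subr0 //.
  under eq_bigr do rewrite scaler_suml.
  rewrite exchange_big big1 // => j _ /=.
  under eq_bigr do rewrite mulrC -scalerA.
  by rewrite -scaler_sumr hz // scaler0.
by apply: eq_bigr => i _; case: (hDD i) => _ ->.
Unshelve. all: by end_near.
Qed.
End PP.

Section JetTheory.
Variables (k : fieldType) (V : lmodType k) (A : gradedVA V) (R : autOAction A).
Variable X : funSpace k.
Hypothesis hS : smooth_curve X.
Let hX : variety X := hS.1.
Implicit Types (P x : X) (f g t r : X -> k) (U W : set X) (q : autTorsor X).
Implicit Types (sg : autTorsor X -> V) (mu rho : fps k) (b v : V).
Local Notation E := (Vsheaf R (X := X)).
Local Notation ap := (@apt k X).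

Lemma reg_torsor_res U W (h : autTorsor X -> k) : open U -> open W -> W `<=` U ->
  reg_torsor U h -> reg_torsor W h.
Proof.
move=> oU oW s [a [b [sa sb H]]].
have res a' : subalg [set u | exists f n, reg U f /\ u = fun q : autTorsor X => acoord q f n] a' ->
   subalg [set u | exists f n, reg W f /\ u = fun q : autTorsor X => acoord q f n] a'.
  elim=> [c|_ [f [n [rf ->]]]|f g _ ? _ ?|f g _ ? _ ?].
  - exact: subalg_const.
  - by apply: subalg_gen; exists f, n; split=> //; exact: (reg_res hX oU).
  - exact: subalg_add.
  - exact: subalg_mul.
by exists a, b; split; [exact: res | exact: res | move=> q /s; exact: H].
Qed.

Lemma RT_res U W sg : open U -> open W -> W `<=` U -> RT U sg -> RT W sg.
Proof.
move=> oU oW s [N [h [v [h1 h2]]]]; exists N, h, v; split.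
  by move=> i; exact: (reg_torsor_res oU).
by move=> q /s; exact: h2.
Qed.

Lemma Pinv_lin rho : AutO rho -> linear (Pinv R rho).
Proof.
move=> hr c u v /=; apply: (can_inj (act_invl R hr)).
by rewrite act_lin // !act_invr.
Qed.

Lemma Vsheaf_comb W f sg sg' : open W -> reg W f -> E W sg -> E W sg' ->
  E W (fun q => f (apt q) *: sg q + sg' q).
Proof.
move=> oW rf [h1 h2] [h1' h2']; split=> [q rho q' Wq hr ta|P WP].
  by rewrite (h1 q rho q') // (h1' q rho q') // -ta.1 Pinv_lin.
have [W1 [N [h [v [oW1 W1P hh hE]]]]] := h2 P WP.
have [W2 [N' [h' [v' [oW2 W2P hh' hE']]]]] := h2' P WP.
pose W' := W1 `&` W2 `&` W.
have oW' : open W' by do 2 ?apply: openI.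
have r1 : RT W' sg by apply: (RT_res oW1) => //; [move=> x [[]] | exists N, h, v].
have r2 : RT W' sg' by apply: (RT_res oW2) => //; [move=> x [[]] | exists N', h', v'].
have sW : W' `<=` W by move=> x [].
have rf' : reg_torsor W' (fun q => acoord q f 0%N) by apply: reg_torsor_g; exact: (reg_res hX oW).
apply: (RT_near (W := W')) => //.
apply: (RT_ext (RTD (RTZ rf' r1) r2)) => q W'q.
by rewrite (fc0 hX (acoordP q)) //; exact: (germ_of oW (sW _ W'q) rf).
Qed.
Lemma Vsheaf0 W : open W -> E W (fun=> 0).
Proof.
move=> oW; split=> [q rho q' Wq hr ta|P WP]; first by rewrite (lin0 (Pinv_lin hr)).
by apply: (RT_near oW WP); exact: RT0.
Qed.
Lemma VsheafZ W f sg : open W -> reg W f -> E W sg -> E W (fun q => f (apt q) *: sg q).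
Proof.
move=> oW rf h; apply: Vsheaf_ext (Vsheaf_comb oW rf h (Vsheaf0 oW)) => // q _.
by rewrite addr0.
Qed.
Lemma VsheafD W sg sg' : open W -> E W sg -> E W sg' -> E W (fun q => sg q + sg' q).
Proof.
move=> oW h h'; apply: Vsheaf_ext (Vsheaf_comb oW (reg_c hS 1 oW) h h') => // q _.
by rewrite scale1r.
Qed.
Lemma Vsheaf_sum W N (F : 'I_N -> autTorsor X -> V) : open W -> (forall i, E W (F i)) ->
  E W (fun q => \sum_i F i q).
Proof.
move=> oW; elim: N F => [|N IH] F h.
  by apply: Vsheaf_ext (Vsheaf0 oW) => // q _; rewrite big_ord0.
apply: Vsheaf_ext (VsheafD oW (h ord0) (IH _ (fun i => h (lift ord0 i)))) => // q _.
by rewrite big_ord_recl.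
Qed.
Lemma Vsheaf_sub U W sg : open U -> open W -> W `<=` U -> E U sg -> E W sg.
Proof. by move=> _ _; exact: Vsheaf_res. Qed.

Lemma Jet_frame U sg q : open U -> E U sg -> U (apt q) -> exists W t qs,
  [/\ open W, W (apt q), W `<=` U, coordinate W t &
    forall x, W x -> apt (qs x) = x /\ centred t x (acoord (qs x))].
Proof.
move=> oU _ Uq; have [W [t [oW WP WU ht _]]] := coord_ex hS oU Uq.
by have [qs hqs] := coord_sec hS ht; exists W, t, qs.
Qed.

Lemma aut_lin W t q : open W -> coordinate W t -> W (apt q) -> linear (Pi R (muq q t)).
Proof.
move=> oW ht Wq; have [qs hqs] := coord_sec hS ht.
by apply: act_lin; exact: (muq_AutO hS oW ht hqs Wq).
Qed.

Lemma Jet_ext U sg sg' q : open U -> E U sg -> E U sg' -> U (apt q) ->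
  (forall q, U (apt q) -> sg q = sg' q) -> Jet R sg q = Jet R sg' q.
Proof.
move=> oU h h' Uq Eq; have [W [t [qs [oW Wq WU ht hqs]]]] := Jet_frame oU h Uq.
have [S hS1 ->] := Jet_HE hS oU h Uq oW Wq ht hqs.
apply/esym; apply: (Jet_of_HE hS oU h' Uq oW Wq ht hqs).
apply: (HE_ext hS1); have Wn := open_near oW Wq; near=> x.
have Wx : W x by near: x.
by apply: Eq; have [-> _] := hqs x Wx; exact: WU.
Unshelve. all: by end_near.
Qed.

Lemma JetD U sg sg' q : open U -> E U sg -> E U sg' -> U (apt q) ->
  Jet R (fun q => sg q + sg' q) q = Jet R sg q + Jet R sg' q.
Proof.
move=> oU h h' Uq; have [W [t [qs [oW Wq WU ht hqs]]]] := Jet_frame oU h Uq.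
have [S hS1 ->] := Jet_HE hS oU h Uq oW Wq ht hqs.
have [S' hS2 ->] := Jet_HE hS oU h' Uq oW Wq ht hqs.
rewrite (Jet_of_HE hS oU (VsheafD oU h h') Uq oW Wq ht hqs (HED hS1 hS2)).
by rewrite vexpTD vmapD //; exact: (aut_lin oW ht Wq).
Qed.

Lemma JetZ U f sg q : open U -> reg U f -> E U sg -> U (apt q) ->
  Jet R (fun q => f (apt q) *: sg q) q = (acoord q f : fps k) *: Jet R sg q.
Proof.
move=> oU rf h Uq; have [W [t [qs [oW Wq WU ht hqs]]]] := Jet_frame oU h Uq.
have [S hS1 ->] := Jet_HE hS oU h Uq oW Wq ht hqs.
have hh : HE (apt q) (acoord q) (fun x => f (apt (qs x)) *: sg (qs x)) ((acoord q f : fps k) *: S).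
  apply: (HE_ext (HEZ hX (acoordP q) (germ_of oU Uq rf) hS1)).
  have Wn := open_near oW Wq; near=> x; have Wx : W x by near: x.
  by have [-> _] := hqs x Wx.
rewrite (Jet_of_HE hS oU (VsheafZ oU rf h) Uq oW Wq ht hqs hh).
by rewrite vexpTZ // vmapZ //; exact: (aut_lin oW ht Wq).
Unshelve. all: by end_near.
Qed.

Lemma Jet_0 U q : open U -> U (apt q) -> Jet R (fun=> 0) q = 0.
Proof.
move=> oU Uq; have h := Vsheaf0 oU.
have := JetZ oU (reg_c hS 0 oU) h Uq.
rewrite (fc_c (acoordP q)) rmorph0 scale0r => <-.
by congr (Jet R _ q); apply: funext => q'; rewrite scaler0.
Qed.

Lemma Jet_sum U N (F : 'I_N -> autTorsor X -> V) q : open U -> (forall i, E U (F i)) -> U (apt q) ->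
  Jet R (fun q => \sum_i F i q) q = \sum_i Jet R (F i) q.
Proof.
move=> oU; elim: N F => [|N IH] F h Uq.
  rewrite big_ord0 -(Jet_0 oU Uq); congr (Jet R _ q).
  by apply: funext => q'; rewrite big_ord0.
rewrite big_ord_recl -IH // -(JetD oU) //; last by apply: Vsheaf_sum => // i; exact: h.
by congr (Jet R _ q); apply: funext => q'; rewrite big_ord_recl.
Qed.

Section WithCoord.
Variables (W : set X) (t : X -> k) (qs : X -> autTorsor X).
Hypotheses (oW : open W) (ht : coordinate W t).
Hypothesis hqs : forall x, W x -> apt (qs x) = x /\ centred t x (acoord (qs x)).
Variables (U : set X) (sg : autTorsor X -> V).
Hypotheses (oU : open U) (hsg : E U sg) (WU : W `<=` U).

Lemma Jet_qs x S : W x -> HE x (acoord (qs x)) (fun y => sg (qs y)) S ->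
  Jet R sg (qs x) = vexpT A fX S.
Proof.
move=> Wx; have [e c] := hqs Wx; rewrite -{1}e => h.
have Wx' : W (apt (qs x)) by rewrite e.
rewrite (Jet_of_HE hS oU hsg (WU Wx') oW Wx' ht hqs h) (muq_qs hS oW ht hqs Wx).
by apply: funext => n; rewrite /vmap Pi_id.
Qed.

Lemma HE_qs x : W x -> exists S, HE x (acoord (qs x)) (fun y => sg (qs y)) S.
Proof.
move=> Wx; have [e c] := hqs Wx; rewrite -{1}e.
have Wx' : W (apt (qs x)) by rewrite e.
by have [S ? _] := Jet_HE hS oU hsg (WU Wx') oW Wx' ht hqs; exists S.
Qed.

Lemma Jet_equiv q : W (apt q) ->
  Jet R sg q = vmap (Pi R (muq q t)) (vcomp (Jet R sg (qs (apt q))) (muq q t)).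
Proof.
move=> Wq; have [S hS1] := HE_qs Wq; have [e c] := hqs Wq.
have gq := coord_germ oW ht Wq.
rewrite (Jet_qs Wq hS1) vexpT_comp // scomp_X //.
apply: (Jet_of_HE hS oU hsg (WU Wq) oW Wq ht hqs).
by rewrite (muqE hS gq); exact: (HE_change hX (acoordP q) gq c hS1).
Qed.

Lemma Jet_val q : W (apt q) -> Jet R sg q 0%N = sg q.
Proof.
move=> Wq; have [S hS1] := HE_qs Wq; have [e c] := hqs Wq.
rewrite (Jet_equiv Wq) (Jet_qs Wq hS1) /vmap /vcomp big_ord1 scale1r vexpT_X big_ord1 Tdp0.
rewrite subnn (HE_val hX c.1 hS1); apply/esym.
exact: (sg_Pi hS oW ht hqs hsg (WU Wq) Wq).
Qed.

(* the coefficient of (t(y) - t(x))^j in the connection *)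
Definition wsec j q : V := Pi R (muq q t) (Jet R sg (qs (apt q)) j).

Lemma wsec_qs j x : W x -> wsec j (qs x) = Jet R sg (qs x) j.
Proof.
by move=> Wx; have [e _] := hqs Wx; rewrite /wsec (muq_qs hS oW ht hqs Wx) Pi_id e.
Qed.

Lemma wsec_loc P : W P -> exists W' N (fa : 'I_N -> (X -> k) * V),
  [/\ open W', W' P, W' `<=` W, forall i, reg W' (fa i).1 &
   forall x, W' x -> HE x (acoord (qs x)) (fun y => sg (qs y))
     (\sum_i (svec (acoord (qs x) (fa i).1) (fa i).2 : vser V))].
Proof.
move=> WP; have [W' [N [a [f [oW' W'P W'W W'U tr]]]]] := triv_ex hS oW ht hqs oU hsg (WU WP) WP.
have hqs' x : W' x -> apt (qs x) = x /\ centred t x (acoord (qs x)) by move/W'W; exact: hqs.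
exists W', N, (fun i => (f i, a i)); split=> //; first by move=> i; have [rf _] := tr; exact: rf.
move=> x W'x; have [e _] := hqs' x W'x.
have W'x' : W' (apt (qs x)) by rewrite e.
by have := triv_HE hS oW' (coord_res hS oW oW' W'W ht) hqs' W'x' tr; rewrite e.
Qed.

Lemma Jet_coef x j N (fa : 'I_N -> (X -> k) * V) : W x ->
  HE x (acoord (qs x)) (fun y => sg (qs y))
     (\sum_i (svec (acoord (qs x) (fa i).1) (fa i).2 : vser V)) ->
  Jet R sg (qs x) j = \sum_(i < j.+1) \sum_l hd qs (fa l).1 (j - i)%N x *: Tdp A i (fa l).2.
Proof.
move=> Wx h; rewrite (Jet_qs Wx h) vexpT_X; apply: eq_bigr => i _.
rewrite vser_sum (lin_sum (Tdp_linear A i)); apply: eq_bigr => l _.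
by rewrite /svec (linZ (Tdp_linear A i)).
Qed.

Lemma wsec_V j : E W (wsec j).
Proof.
apply: (Vsheaf_glue (U := W)) => P WP.
have [W' [N [fa [oW' W'P W'W rf h]]]] := wsec_loc WP.
exists W'; split=> //; have ht' := coord_res hS oW oW' W'W ht.
pose F (i : 'I_j.+1) q := Pi R (muq q t) (\sum_l hd qs (fa l).1 (j - i)%N (apt q) *: Tdp A i (fa l).2).
have hF i : E W' (F i).
  have rfi l : reg W' (hd qs (fa l).1 (j - i)%N).
    by apply: (hd_reg hS oW' ht') => // x /W'W; exact: hqs.
  by have [h1 _] := mksec R hS (fun l => Tdp A i (fa l).2) oW' ht' rfi.
apply: Vsheaf_ext (Vsheaf_sum oW' hF) => // q W'q.
rewrite /wsec (Jet_coef j (W'W _ W'q) (h _ W'q)).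
by rewrite (lin_sum (aut_lin oW ht (W'W _ W'q))).
Qed.

Lemma Jet_wsec j x : W x -> Jet R (wsec j) (qs x) = vhasse j (Jet R sg (qs x)).
Proof.
move=> Wx; have [W' [N [fa [oW' W'P W'W rf h]]]] := wsec_loc Wx.
have [e c] := hqs Wx; set S := \sum_i (svec (acoord (qs x) (fa i).1) (fa i).2 : vser V).
have hS1 : HE x (acoord (qs x)) (fun y => sg (qs y)) S := h x W'P.
have hw : HE x (acoord (qs x)) (fun y => wsec j (qs y)) (\sum_(i < j.+1) vmap (Tdp A i) (vhasse (j - i) S)).
  have H (i : 'I_j.+1) : HE x (acoord (qs x))
      (fun y => \sum_l hd qs (fa l).1 (j - i)%N y *: Tdp A i (fa l).2) (vmap (Tdp A i) (vhasse (j - i) S)).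
    rewrite /S vhasse_sum vmap_sum; last exact: Tdp_linear.
    apply: HE_sum => l.
    rewrite vhasse_svec vmap_svec; last exact: Tdp_linear.
    have gf := germ_of oW' W'P (rf l).
    rewrite -(hd_comp hS oW ht hqs (j - i) Wx gf); apply: HE_g.
    exact: (hd_germ hS oW ht hqs).
  apply: (HE_ext (HE_sum H)).
  have Wn := open_near oW' W'P; near=> y; have W'y : W' y by near: y.
  by rewrite (wsec_qs _ (W'W _ W'y)) (Jet_coef j (W'W _ W'y) (h _ W'y)).
have Wx' : W (apt (qs x)) by rewrite e.
rewrite -{1}e in hw.
rewrite (Jet_of_HE hS oW (wsec_V j) Wx' oW Wx' ht hqs hw) (muq_qs hS oW ht hqs Wx).
rewrite (Jet_qs Wx hS1) vhasse_expT; apply: funext => n; by rewrite /vmap Pi_id.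
Unshelve. all: by end_near.
Qed.
End WithCoord.

Lemma Jet0E U sg q : open U -> E U sg -> U (apt q) -> Jet R sg q 0%N = sg q.
Proof.
move=> oU h Uq; have [W [t [qs [oW Wq WU ht hqs]]]] := Jet_frame oU h Uq.
exact: (Jet_val oW ht hqs oU h WU Wq).
Qed.

Lemma tens_HE W Phi N (s : 'I_N -> autTorsor X -> V) (g : 'I_N -> X -> k) q : open W -> W (apt q) ->
  (forall i, E W (s i) /\ reg W (g i)) ->
  (forall q y, W (apt q) -> W y -> Phi q y = \sum_i g i y *: s i q) ->
  HE (apt q) (acoord q) (Phi q) (\sum_i (svec (acoord q (g i)) (s i q) : vser V)).
Proof.
move=> oW Wq h hP; exists N, (fun i => (g i, s i q)); split=> //.
  by move=> i; exact: (germ_of oW Wq (h i).2).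
have Wn := open_near oW Wq; near=> y; rewrite hP //; near: y => //.
Unshelve. all: by end_near.
Qed.

(* Phi is a local representative whose expansion at every q is J q up to order n. *)
Definition jrep (n : nat) P (Phi : autTorsor X -> X -> V) (J : autTorsor X -> vser V) :=
  exists W, [/\ open W, W P, tensO ap E W Phi & forall q, W (apt q) ->
    exists2 S, HE (apt q) (acoord q) (Phi q) S & forall j, (j <= n)%N -> S j = J q j].

Lemma jrep_res n P W Phi J : open W -> W P -> jrep n P Phi J -> exists W', [/\ open W', W' P, W' `<=` W,
   tensO ap E W' Phi & forall q, W' (apt q) ->
    exists2 S, HE (apt q) (acoord q) (Phi q) S & forall j, (j <= n)%N -> S j = J q j].
Proof.
move=> oW WP [W' [oW' W'P h1 h2]]; have oI := openI oW' oW.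
exists (W' `&` W); split=> //; last by move=> q [/h2].
by apply: (tens_res hS Vsheaf_sub oW' oI) h1 => x [].
Qed.

Lemma tens_crit n P W0 t qs W Phi Psi : open W0 -> W0 P -> coordinate W0 t ->
  (forall x, W0 x -> apt (qs x) = x /\ centred t x (acoord (qs x))) ->
  open W -> W P -> tensO ap E W Phi -> tensO ap E W Psi ->
  (forall x, W0 x -> W x -> exists S1 S2, [/\ HE x (acoord (qs x)) (Phi (qs x)) S1,
     HE x (acoord (qs x)) (Psi (qs x)) S2 & forall j, (j <= n)%N -> S1 j = S2 j]) ->
  modJ ap E n P Phi Psi.
Proof.
move=> oW0 W0P ht hqs oW WP t1 t2 hj.
have [N [sg [g [hg hD]]]] := tensB hS VsheafZ oW t1 t2.
apply: (modJ_of_coefs hS VsheafZ Vsheaf_sub oW WP oW0 W0P ht hqs hg _ hD).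
move=> q Wq W0q j jn; have [e c] := hqs _ W0q.
have Wq' : W (apt (qs (apt q))) by rewrite e.
have lin := aut_lin oW0 ht W0q.
transitivity (Pi R (muq q t) (\sum_i hd qs (g i) j (apt q) *: sg i (qs (apt q)))).
  rewrite (lin_sum lin); apply: eq_bigr => i _; rewrite (linZ lin); congr (_ *: _).
  exact: (sg_Pi hS oW0 ht hqs (hg i).1 Wq W0q).
suff -> : \sum_i hd qs (g i) j (apt q) *: sg i (qs (apt q)) = 0 by rewrite (lin0 lin).
have [S1 [S2 [H1 H2 E12]]] := hj _ W0q Wq; rewrite -{1}e in H1; rewrite -{1}e in H2.
have HD := HED H1 (HEZ hX (acoordP (qs (apt q))) (germ_c hX _ (-1)) H2).
have HD' : HE (apt (qs (apt q))) (acoord (qs (apt q)))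
    (fun y => Phi (qs (apt q)) y - Psi (qs (apt q)) y) (S1 + (acoord (qs (apt q)) (fun=> -1) : fps k) *: S2).
  by apply: (HE_ext HD); apply: nearW => y; rewrite scaleN1r.
have := HE_uniq hX (acoordP (qs (apt q))) HD' (tens_HE oW Wq' hg hD).
move/(congr1 (fun S : vser V => S j)); rewrite vserD vser_sum (fc_c (acoordP _)) rmorphN1 scaleN1r vserN.
rewrite E12 // subrr => h; rewrite [RHS]h; apply: eq_bigr => i _.
by [].
Qed.

Lemma jrep_crit n P Phi Psi J J' U : open U -> U P ->
  (forall q, U (apt q) -> forall j, (j <= n)%N -> J q j = J' q j) ->
  jrep n P Phi J -> jrep n P Psi J' -> modJ ap E n P Phi Psi.
Proof.
move=> oU UP EJ /(jrep_res oU UP) [W1 [oW1 W1P W1U t1 h1]] [W2 [oW2 W2P t2 h2]].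
have [W0 [t [oW0 W0P _ ht _]]] := coord_ex hS oU UP.
have [qs hqs] := coord_sec hS ht.
have oI := openI oW1 oW2.
have s1 : W1 `&` W2 `<=` W1 by move=> x [].
have s2 : W1 `&` W2 `<=` W2 by move=> x [].
apply: (tens_crit oW0 W0P ht hqs oI (conj W1P W2P) (tens_res hS Vsheaf_sub oW1 oI s1 t1)
  (tens_res hS Vsheaf_sub oW2 oI s2 t2)) => x W0x [W1x W2x].
have [e c] := hqs _ W0x; rewrite -e in W1x W2x.
have [S1 H1 E1] := h1 _ W1x; have [S2 H2 E2] := h2 _ W2x; rewrite e in H1 H2.
exists S1, S2; split=> // j jn; rewrite E1 // E2 // EJ //; exact: (W1U _ W1x).
Qed.

Lemma modJ_HE n P Phi Psi : modJ ap E n P Phi Psi -> exists W, [/\ open W, W P & forall q, W (apt q) ->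
   exists2 S, HE (apt q) (acoord q) (fun y => Phi q y - Psi q y) S &
   forall j, (j <= n)%N -> S j = 0].
Proof.
move=> [W [D [oW WP hz hD]]]; exists W; split=> // q Wq; have H := acoordP q.
have [S hS1 S0] : exists2 S, HE (apt q) (acoord q) (D q) S & forall j, (j <= n)%N -> S j = 0.
  elim: hz {hD} => [|_ D' [sg [g [F [h1 h2 h3 ->]]]] _ [S' hS' S'0]].
    by exists 0; [exact: HE0 | move=> j _; exact: vser0].
  have gF l : germ (apt q) (F l (apt q)) /\ F l (apt q) (apt q) = 0.
    have [N [f [f' [ff E0 F0]]]] := h3 l; split; last exact: F0.
    rewrite E0; apply: (germ_sum hX) => i _; apply: (germZ hX).
    exact: (germ_of oW Wq (ff i).2).
  have gg := germ_of oW Wq h2.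
  have gG : germ (apt q) (fun y => g y * \prod_l F l (apt q) y).
    by apply: (germM hX) => //; apply: (germ_prod hX) => l _; case: (gF l).
  have mp := maxpow_prod gg gF.
  have o := (fc_ord H n.+1 gG).2 mp.
  exists ((svec (acoord q (fun y => g y * \prod_l F l (apt q) y)) (sg q) : vser V) + S').
    by apply: (HED _ hS'); exact: HE_g.
  by move=> j jn; rewrite vserD S'0 // addr0 /svec (o j) ?scale0r.
exists S => //; apply: (HE_ext hS1).
have Wn := open_near oW Wq; near=> y; rewrite hD //; near: y => //.
Unshelve. all: by end_near.
Qed.

Lemma jrep_ex n U sg P : open U -> E U sg -> U P -> exists Phi, jrep n P Phi (Jet R sg).
Proof.
move=> oU hsg UP; have [W [t [oW WP WU ht _]]] := coord_ex hS oU UP.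
have [qs hqs] := coord_sec hS ht; have [rt _] := ht.
pose w := wsec t qs sg.
have hw j : E W (w j) by exact: (wsec_V oW ht hqs oU hsg WU).
exists (fun q y => \sum_(j < n.+1) (t y - t (apt q)) ^+ j *: w j q), W; split=> //.
  apply: tensO_sum => j.
  have tw : tensO ap E W (fun q _ => w j q).
    by apply: (tens_ext (tens_gen ap (hw j) (reg_c hS 1 oW))) => q y _ _; rewrite scale1r.
  exact: (tens_delta hS VsheafZ j oW rt tw).
move=> q Wq; have H := acoordP q; have gt := germ_of oW Wq rt.
have gj j : germ (apt q) (fun y => (t y - t (apt q)) ^+ j).
  by apply: (germX hX); exact: (germ_sub hS).
have E1 j : (acoord q (fun y => (t y - t (apt q)) ^+ j) : fps k) = muq q t ^+ j.
  by rewrite (fcX hX H) ?(fc_sub hS H gt) ?(muqE hS gt) //; exact: (germ_sub hS).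
exists (\sum_(j < n.+1) (svec (acoord q (fun y => (t y - t (apt q)) ^+ j)) (w j q) : vser V)).
  by apply: HE_sum => j; exact: HE_g.
move=> i ile; rewrite (Jet_equiv oW ht hqs oU hsg WU Wq) /vmap (vcompE (N := n.+1)) //.
rewrite (lin_sum (aut_lin oW ht Wq)) vser_sum; apply: eq_bigr => j _.
by rewrite (linZ (aut_lin oW ht Wq)) /svec E1.
Qed.

Definition Th n sg P : autTorsor X -> X -> V :=
  if pselect (exists Phi, jrep n P Phi (Jet R sg)) is left e then projT1 (cid e) else fun _ _ => 0.

Lemma ThP n U sg P : open U -> E U sg -> U P -> jrep n P (Th n sg P) (Jet R sg).
Proof.
move=> oU hsg UP; rewrite /Th; case: pselect => [e|no]; first by case: cid.
by case: no; exact: jrep_ex hsg UP.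
Qed.

Lemma Th_section n U sg : open U -> E U sg -> pp_section ap E n U (Th n sg).
Proof.
move=> oU hsg P UP; have h := ThP n oU hsg UP.
have [W [oW WP WU t1 h1]] := jrep_res oU UP h.
exists W; split=> // x Wx; apply: (jrep_crit oU (WU _ Wx) (fun q _ j _ => erefl)).
  exact: (ThP n oU hsg (WU _ Wx)).
by exists W.
Qed.

End JetTheory.

(** * Finite morphisms *)

Section FiniteMor.
Variables (k : closedFieldType) (X Y : funSpace k) (eta : Y -> X).
Hypotheses (hX : variety X) (hY : variety Y).
Hypotheses (hm : morphism_of_varieties eta) (hf : finite_morphism eta).
Implicit Types (f g h s : Y -> k) (u : X -> k).

Lemma exists_notin (l : seq k) : exists c, c \notin l.
Proof.
have p1 : size (\prod_(a <- l) ('X - a%:P) + 1 : {poly k}) != 1%N \/ l = [::].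
  case: l => [|a l]; [by right | left].
  by rewrite size_polyDl size_prod_XsubC ?size_poly1.
case: p1 => [p1|->]; last by exists 0.
have /closed_rootP [z hz] := p1.
exists z; apply/negP => zl; move: hz; rewrite /root hornerD hornerC horner_prod.
rewrite (big_rem z) //= hornerXsubC subrr mul0r add0r.
by rewrite oner_eq0.
Qed.

Lemma reg_eta W u : open W -> reg W u -> reg (eta @^-1` W) (u \o eta).
Proof. by move=> oW; case: (hm oW) => _; exact. Qed.
Lemma open_eta W : open W -> open (eta @^-1` W).
Proof. by move=> oW; case: (hm oW). Qed.

Section AtQ.
Variables (Q : X) (U : set X).
Hypotheses (aU : affine U) (UQ : U Q).
Let U' := eta @^-1` U.
Let oU : open U. Proof. by case: aU. Qed.
Let oU' : open U'. Proof. exact: open_eta. Qed.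
Let aU' : affine U'. Proof. by case: (hf aU). Qed.

Let rC (c : k) : reg U' (fun=> c).
Proof. by apply: (reg_germ hY oU') => P _; exact: germ_c. Qed.
Let rD f g : reg U' f -> reg U' g -> reg U' (fun y => f y + g y).
Proof.
move=> rf rg; apply: (reg_germ hY oU') => P WP.
by apply: (germD hY); [exact: (germ_of oU' WP rf) | exact: (germ_of oU' WP rg)].
Qed.
Let rM f g : reg U' f -> reg U' g -> reg U' (fun y => f y * g y).
Proof.
move=> rf rg; apply: (reg_germ hY oU') => P WP.
by apply: (germM hY); [exact: (germ_of oU' WP rf) | exact: (germ_of oU' WP rg)].
Qed.
Let rB f g : reg U' f -> reg U' g -> reg U' (fun y => f y - g y).
Proof.
move=> rf rg; apply: (reg_germ hY oU') => P WP.
by apply: (germB hY); [exact: (germ_of oU' WP rf) | exact: (germ_of oU' WP rg)].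
Qed.
Let rX f n : reg U' f -> reg U' (fun y => f y ^+ n).
Proof. by move=> rf; apply: (reg_germ hY oU') => P WP; apply: (germX hY); exact: (germ_of oU' WP rf). Qed.
Let rE f g : reg U' f -> (forall y, U' y -> f y = g y) -> reg U' g.
Proof. by case: hY => -[_ _ ext _ _] _ _; exact: ext. Qed.

(* the ideal generated by G in the coordinate ring of U' *)
Inductive idl (G : set (Y -> k)) : (Y -> k) -> Prop :=
| idl0 : idl G (fun=> 0)
| idl_add g h f : G g -> reg U' h -> idl G f -> idl G (fun y => h y * g y + f y)
| idl_ext f g : idl G f -> (forall y, U' y -> f y = g y) -> idl G g.

Lemma idl_gen G g : G g -> idl G g.
Proof. by move=> Gg; apply: (idl_ext (idl_add Gg (rC 1) (idl0 G))) => y _; rewrite mul1r addr0. Qed.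
Lemma idlD G f g : idl G f -> idl G g -> idl G (fun y => f y + g y).
Proof.
move=> hf0 hg; elim: hf0 => [|g0 h0 f0 G0 r0 _ IH|f0 f1 _ IH E].
- by apply: (idl_ext hg) => y _; rewrite add0r.
- by apply: (idl_ext (idl_add G0 r0 IH)) => y _; rewrite addrA.
- by apply: (idl_ext IH) => y Uy; rewrite E.
Qed.
Lemma idlM G h f : reg U' h -> idl G f -> idl G (fun y => h y * f y).
Proof.
move=> rh; elim=> [|g0 h0 f0 G0 r0 _ IH|f0 f1 _ IH E].
- by apply: (idl_ext (idl0 G)) => y _; rewrite mulr0.
- by apply: (idl_ext (idl_add G0 (rM rh r0) IH)) => y _; rewrite mulrDr mulrA.
- by apply: (idl_ext IH) => y Uy; rewrite E.
Qed.
Lemma idlB G f g : idl G f -> idl G g -> idl G (fun y => f y - g y).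
Proof.
move=> h1 h2; apply: (idl_ext (idlD h1 (idlM (rC (-1)) h2))) => y _.
by rewrite mulN1r.
Qed.
Lemma idl_sum G N (F : 'I_N -> Y -> k) : (forall i, idl G (F i)) -> idl G (fun y => \sum_i F i y).
Proof.
elim: N F => [|N IH] F h; first by apply: (idl_ext (idl0 G)) => y _; rewrite big_ord0.
apply: (idl_ext (idlD (h ord0) (IH _ (fun i => h (lift ord0 i))))) => y _.
by rewrite big_ord_recl.
Qed.
Lemma idl_split G g f : idl (G `|` [set g]) f -> exists2 a, reg U' a & idl G (fun y => f y - a y * g y).
Proof.
elim=> [|g0 h0 f0 [G0|->] r0 _ [a ra ha]|f0 f1 _ [a ra ha] E].
- by exists (fun=> 0) => //; apply: (idl_ext (idl0 G)) => y _; rewrite mul0r subrr.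
- by exists a => //; apply: (idl_ext (idl_add G0 r0 ha)) => y _; rewrite addrA.
- exists (fun y => h0 y + a y); first exact: rD.
  by apply: (idl_ext ha) => y _; ring.
- by exists a => //; apply: (idl_ext ha) => y Uy; rewrite E.
Qed.

Definition mQ : set (Y -> k) := [set f | exists2 u, reg U u & u Q = 0 /\ f = u \o eta].

Lemma modgen : exists N (g : 'I_N -> Y -> k), (forall i, reg U' (g i)) /\
  forall f, reg U' f -> exists c : 'I_N -> X -> k, (forall i, reg U (c i)) /\
    forall y, U' y -> f y = \sum_i c i (eta y) * g i y.
Proof. by case: (hf aU). Qed.

Lemma idl_poly G s : mQ `<=` G -> reg U' s -> exists2 p : {poly k}, p != 0 & idl G (fun y => p.[s y]).
Proof.
move=> mG rs; have [N [g [rg gen]]] := modgen.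
have H (i : 'I_N.+1) : exists v : 'I_N -> k, idl G (fun y => s y ^+ i - \sum_j v j * g j y).
  have [c [rc hc]] := gen _ (rX i rs); exists (fun j => c j Q).
  have h j : idl G (fun y => g j y * (c j (eta y) - c j Q)).
    apply: idlM => //; apply: idl_gen; apply: mG; exists (fun x => c j x - c j Q); last first.
      by rewrite subrr.
    apply: (reg_germ hX oU) => P UP; apply: (germB hX); last exact: germ_c.
    exact: (germ_of oU UP (rc j)).
  apply: (idl_ext (idl_sum h)) => y Uy; rewrite hc // -sumrB.
  by apply: eq_bigr => j _; rewrite mulrBr mulrC [g j y * _]mulrC.
have [v hv] := choice H.
pose M : 'M[k]_(N.+1, N) := \matrix_(i, j) v i j.
have : kermx M != 0.
  by rewrite kermx_eq0 /row_free; apply/negP => /eqP rk; have := rank_leq_col M; rewrite rk ltnn.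
move/rowV0Pn => [c /sub_kermxP cM c0].
exists (\poly_(i < N.+1) c 0 (inord i)).
  apply: contraNneq c0 => p0; apply/eqP/rowP => i; rewrite mxE.
  have := congr1 (fun q : {poly k} => q`_i) p0; rewrite coef_poly ltn_ord coef0.
  by rewrite inord_val.
have h (i : 'I_N.+1) : idl G (fun y => c 0 i * (s y ^+ i - \sum_j v i j * g j y)).
  by apply: idlM => //; exact: rC.
apply: (idl_ext (idl_sum h)) => y Uy; rewrite horner_poly.
under eq_bigr do rewrite mulrBr.
rewrite sumrB [X in _ - X](_ : _ = 0) ?subr0; last first.
  under eq_bigr do rewrite mulr_sumr.
  rewrite exchange_big big1 // => j _ /=.
  under eq_bigr do rewrite mulrA.
  rewrite -mulr_suml; have := congr1 (fun A : 'rV_N => A 0 j) cM; rewrite !mxE.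
  by under eq_bigr do rewrite mxE; move=> ->; rewrite mul0r.
by apply: eq_bigr => i _; rewrite inord_val.
Qed.

Lemma idl_step G s : mQ `<=` G -> reg U' s -> ~ idl G (fun=> 1) ->
  exists c, ~ idl (G `|` [set (fun y => s y - c)]) (fun=> 1).
Proof.
move=> mG rs pG; apply: contrapT => no.
have {}no c : exists2 a, reg U' a & idl G (fun y => 1 - a y * (s y - c)).
  by apply: idl_split; apply: contrapT => h; apply: no; exists c.
have [p p0 hp] := idl_poly mG rs.
have [r Er] := closed_field_poly_normal p.
have l0 : lead_coef p != 0 by rewrite lead_coef_eq0.
have {hp} : idl G (fun y => \prod_(z <- r) (s y - z)).
  apply: (idl_ext (idlM (rC (lead_coef p)^-1) hp)) => y _.
  rewrite {2}Er hornerZ mulrA mulVf // mul1r horner_prod.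
  by apply: eq_bigr => z _; rewrite hornerXsubC.
elim: r {Er} => [|z r IH] h.
  by apply: pG; apply: (idl_ext h) => y _; rewrite big_nil.
apply: IH; have [a ra ha] := no z.
have rp : reg U' (fun y => \prod_(z <- r) (s y - z)).
  apply: (reg_germ hY oU') => P WP; apply: (germ_prod hY) => i _.
  by apply: (germB hY); [exact: (germ_of oU' WP rs) | exact: germ_c].
apply: (idl_ext (idlD (idlM rp ha) (idlM ra h))) => y _.
by rewrite big_cons; ring.
Qed.

Lemma ideal_fibre_point G : mQ `<=` G -> (forall f, G f -> reg U' f) -> ~ idl G (fun=> 1) ->
  exists y, eta y = Q /\ forall f, G f -> f y = 0.
Proof.
move=> mG rG pG; have [K [s [rs gen]]] := affine_gen aU'.
have [G' [GG' pG' hG']] : exists G', [/\ G `<=` G', ~ idl G' (fun=> 1) &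
    forall j, exists c, G' (fun y => s j y - c)].
  suff H (l : seq 'I_K) : exists G', [/\ G `<=` G', ~ idl G' (fun=> 1) &
      forall j, j \in l -> exists c, G' (fun y => s j y - c)].
    have [G' [h1 h2 h3]] := H (enum 'I_K); exists G'; split=> // j; apply: h3.
    exact: mem_enum.
  elim: l => [|i l [G' [h1 h2 h3]]]; first by exists G; split.
  have mG' : mQ `<=` G' by move=> f /mG; exact: h1.
  have [c hc] := idl_step mG' (rs i) h2.
  exists (G' `|` [set (fun y => s i y - c)]); split=> //; first by move=> f /h1; left.
  move=> j; rewrite inE => /orP[/eqP->|/h3 [d hd]]; first by exists c; right.
  by exists d; left.
have ex f : reg U' f -> exists c, idl G' (fun y => f y - c).
  move=> /gen [g sg fg].
  suff [rg [c hc]] : reg U' g /\ exists c, idl G' (fun y => g y - c).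
    by exists c; apply: (idl_ext hc) => y Uy; rewrite fg.
  elim: sg {fg} => [c|_ [i _ <-]|g1 g2 _ [r1 [c1 h1]] _ [r2 [c2 h2]]|g1 g2 _ [r1 [c1 h1]] _ [r2 [c2 h2]]].
  - split; first exact: rC.
    by exists c; apply: (idl_ext (idl0 G')) => y _; rewrite subrr.
  - by split=> //; have [c hc] := hG' i; exists c; exact: idl_gen.
  - split; first exact: rD.
    by exists (c1 + c2); apply: (idl_ext (idlD h1 h2)) => y _; ring.
  - split; first exact: rM.
    exists (c1 * c2); apply: (idl_ext (idlD (idlM r1 h2) (idlM (rC c2) h1))) => y _.
    by ring.
have un f c d : idl G' (fun y => f y - c) -> idl G' (fun y => f y - d) -> c = d.
  move=> h1 h2; have [//|] := eqVneq c d; rewrite -subr_eq0 => cd; case: pG'.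
  apply: (idl_ext (idlM (rC (c - d)^-1) (idlB h2 h1))) => y _.
  by rewrite (_ : f y - d - (f y - c) = c - d) ?mulVf //; ring.
pose chi f := if pselect (exists c, idl G' (fun y => f y - c)) is left e then projT1 (cid e) else 0.
have chiP f : reg U' f -> idl G' (fun y => f y - chi f).
  by move=> rf; rewrite /chi; case: pselect => [e|[]]; [case: cid | exact: ex].
have chiE f c : reg U' f -> idl G' (fun y => f y - c) -> chi f = c.
  by move=> rf h; exact: un (chiP f rf) h.
have [_ _ hchi _ _] := aU'.
have [|y [[Uy hy] _]] := hchi chi.
  split=> [c|f g rf rg|f g rf fg].
  - apply: chiE; first exact: rC.
    by apply: (idl_ext (idl0 G')) => y _; rewrite subrr.
  - have [hf0 hg] := (chiP f rf, chiP g rg); split; apply: chiE; try exact: rD; try exact: rM.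
      by apply: (idl_ext (idlD hf0 hg)) => y _; ring.
    by apply: (idl_ext (idlD (idlM rf hg) (idlM (rC (chi g)) hf0))) => y _; ring.
  - apply: chiE => //; have hg := chiP g (rE rf fg).
    by apply: (idl_ext hg) => y Uy; rewrite fg.
have G0 f : G f -> f y = 0.
  move=> Gf; rewrite -(hy f (rG f Gf)); apply: chiE; first exact: rG.
  by apply: (idl_ext (idl_gen (GG' _ Gf))) => z _; rewrite subr0.
exists y; split=> //; apply: contrapT => ne.
have [u ru uQ] := affine_sep aU Uy UQ ne.
have : u (eta y) - u Q = 0.
  apply: (G0 (fun y => u (eta y) - u Q)); apply: mG.
  exists (fun x => u x - u Q); last by rewrite subrr.
  apply: (reg_germ hX oU) => P UP; apply: (germB hX); last exact: germ_c.
  exact: (germ_of oU UP ru).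
by move/eqP; rewrite subr_eq0 (negbTE uQ).
Qed.

Lemma fib_closed0 N : open N -> (forall y, eta y = Q -> N y) ->
  \forall x \near Q, forall y, eta y = x -> N y.
Proof.
move=> oN fN; have [n [g [rg gen]]] := modgen.
pose G : set (Y -> k) := mQ `|` [set f | reg U' f /\ forall y, U' y -> ~ N y -> f y = 0].
have mG : mQ `<=` G by left.
have rG f : G f -> reg U' f.
  by move=> [[u ru [_ ->]]|[]//]; exact: reg_eta.
have : idl G (fun=> 1).
  apply: contrapT => /(ideal_fibre_point mG rG) [y [ey hy]].
  have Ny := fN y ey; have Uy : U' y by rewrite /U' /= ey.
  have [_ _ _ htop _] := aU'.
  have oI := openI oN oU'.
  have [f [rf fy hfN]] := (htop _ (@subIsetr _ N U')).1 oI y (conj Ny Uy).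
  move/eqP: fy; apply; apply: hy; right; split=> // z Uz Nz.
  by apply/eqP/negPn/negP => fz; apply: Nz; case: (hfN z Uz fz).
suff key f : idl G f -> exists a : 'I_n -> 'I_n -> X -> k,
    (forall i j, germ Q (a i j) /\ a i j Q = 0) /\
    \forall x \near Q, forall y, eta y = x -> ~ N y -> forall i,
      f y * g i y = \sum_j a i j x * g j y.
  move/key => [a [ha hE]].
  have [q [gq hq]] := nakayama hX (fun i j => (ha i j).1) (fun i j => (ha i j).2).
  have [c [rc hc]] := gen _ (rC 1).
  have nU := open_near oU UQ.
  near=> x => y ey; apply: contrapT => Ny.
  have Uy : U' y by rewrite /U' /= ey; near: x.
  have hqx : forall (h l : 'I_n), \sum_i q h i x * ((i == l)%:R - a i l x) = (h == l)%:R by near: x.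
  have hEx : forall y, eta y = x -> ~ N y -> forall i, 1 * g i y = \sum_j a i j x * g j y by near: x.
  have gz (h : 'I_n) : g h y = 0.
    transitivity (\sum_l (h == l)%:R * g l y).
      by rewrite (bigD1 h) //= eqxx mul1r big1 ?addr0 // => j; rewrite eq_sym => /negbTE ->; rewrite mul0r.
    under eq_bigr => l _ do rewrite -(hqx h l) mulr_suml.
    rewrite exchange_big big1 // => i _ /=.
    under eq_bigr => l _ do rewrite -mulrA mulrBl.
    rewrite -mulr_sumr sumrB -hEx // mul1r (bigD1 i) //= eqxx mul1r big1 ?addr0 ?subrr ?mulr0 //.
    by move=> j; rewrite eq_sym => /negbTE ->; rewrite mul0r.
  have := hc y Uy; rewrite big1 => [/eqP|i _]; last by rewrite gz mulr0.
  by rewrite oner_eq0.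
elim=> [|g0 h f0 G0 rh _ [a [ha hE]]|f0 f1 _ [a [ha hE]] E].
- exists (fun _ _ _ => 0); split=> [i j|]; first by split=> //; exact: germ_c.
  by apply: nearW => x y _ _ i; rewrite mul0r big1 // => j _; rewrite mul0r.
- case: G0 => [[u ru [uQ ->]]|[r0 h0]]; last first.
    exists a; split=> //; have nU := open_near oU UQ; near=> x => y ey Ny i.
    have hEx : forall y, eta y = x -> ~ N y -> forall i, f0 y * g i y = \sum_j a i j x * g j y by near: x.
    by rewrite h0 ?mulr0 ?add0r ?hEx //; rewrite /U' /= ey; near: x.
  have [C hC] := choice (fun i => gen _ (rM rh (rg i))).
  exists (fun i j x => u x * C i j x + a i j x); split=> [i j|].
    have gu := germ_of oU UQ ru; have gC := germ_of oU UQ ((hC i).1 j).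
    split; last by rewrite uQ mul0r add0r; case: (ha i j).
    by apply: (germD hX); [exact: (germM hX) | case: (ha i j)].
  have nU := open_near oU UQ; near=> x => y ey Ny i.
  have hEx : forall y, eta y = x -> ~ N y -> forall i, f0 y * g i y = \sum_j a i j x * g j y by near: x.
  have Uy : U' y by rewrite /U' /= ey; near: x.
  under eq_bigr do rewrite mulrDl -mulrA.
  rewrite big_split /= -hEx // -mulr_sumr -ey -(hC i).2 //=.
  by ring.
- exists a; split=> //; have nU := open_near oU UQ; near=> x => y ey Ny i.
  have hEx : forall y, eta y = x -> ~ N y -> forall i, f0 y * g i y = \sum_j a i j x * g j y by near: x.
  by rewrite -E ?hEx //; rewrite /U' /= ey; near: x.
Unshelve. all: by end_near.
Qed.

Lemma fib_bound : exists n, forall m (p : 'I_m -> Y), injective p -> (forall i, eta (p i) = Q) -> (m <= n)%N.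
Proof.
have [n [g [rg gen]]] := modgen; exists n => m p ip hp.
have Up i : U' (p i) by rewrite /U' /= hp.
have sep (ij : 'I_m * 'I_m) : exists f, reg U' f /\ (ij.1 != ij.2 -> f (p ij.1) = 1 /\ f (p ij.2) = 0).
  have [e|ne] := eqVneq ij.1 ij.2; first by exists (fun=> 0); split=> //; exact: rC.
  have [f rf fn] := affine_sep aU' (Up ij.1) (Up ij.2) (fun e => elimN eqP ne (ip _ _ e)).
  have fn' : f (p ij.1) - f (p ij.2) != 0 by rewrite subr_eq0.
  exists (fun y => (f (p ij.1) - f (p ij.2))^-1 * (f y - f (p ij.2))); split.
    by apply: rM => //; apply: rB.
  by move=> _; rewrite mulVf // subrr mulr0.
have [F hF] := choice sep.
pose e i y := \prod_(j | i != j) F (i, j) y.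
have re i : reg U' (e i).
  apply: (reg_germ hY oU') => P WP; apply: (germ_prod hY) => j _.
  exact: (germ_of oU' WP (hF (i, j)).1).
have eE i j : e i (p j) = (i == j)%:R.
  rewrite /e; have [<-|ij] := eqVneq i j.
    by rewrite big1 // => l il; case: ((hF (i, l)).2 il).
  by rewrite (bigD1 j) //= ((hF (i, j)).2 ij).2 mul0r.
have [C hC] := choice (fun i => gen _ (re i)).
have E : (\matrix_(i < m, l < n) C i l Q) *m (\matrix_(l < n, j < m) g l (p j)) = 1%:M :> 'M[k]_m.
  apply/matrixP => i j; rewrite !mxE -eE (hC i).2 //.
  by apply: eq_bigr => l _; rewrite !mxE hp.
rewrite -(mxrank1 k m) -E; apply: leq_trans (mxrankM_maxl _ _) _.
exact: rank_leq_col.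
Qed.
End AtQ.

Lemma fib_closed (Q : X) N : open N -> (forall y, eta y = Q -> N y) ->
  \forall x \near Q, forall y, eta y = x -> N y.
Proof. by have [U [aU UQ]] := affine_at hX Q; exact: fib_closed0 aU UQ N. Qed.

Lemma fib_finite (Q : X) : exists l : seq Y, forall y, eta y = Q -> y \in l.
Proof.
have [U [aU UQ]] := affine_at hX Q; have [n hn] := fib_bound aU UQ.
apply: contrapT => no.
have H m : exists l : seq Y, [/\ size l = m, uniq l & forall y, y \in l -> eta y = Q].
  elim: m => [|m [l [sl ul hl]]]; first by exists [::].
  have [y [ey yl]] : exists y, eta y = Q /\ y \notin l.
    apply: contrapT => h; apply: no; exists l => y ey.
    by apply/negPn/negP => yl; apply: h; exists y.
  exists (y :: l); split; [by rewrite /= sl | by rewrite /= yl|].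
  by move=> z; rewrite inE => /orP[/eqP->|/hl].
have [l [sl ul hl]] := H n.+1.
case: l sl ul hl => [//|y0 l] sl ul hl.
suff: (n < n)%N by rewrite ltnn.
apply: (hn n.+1 (fun i => nth y0 (y0 :: l) i)) => [i j /eqP|i].
  by rewrite nth_uniq ?sl // => /eqP; exact: val_inj.
by apply: hl; apply: mem_nth; rewrite sl.
Qed.

Lemma unif_seq U' (tauY : Y -> (Y -> k) -> ser k) (l : seq Y) : affine U' ->
  (forall y, formal_coord y (tauY y)) -> (forall y, y \in l -> U' y) ->
  exists2 u, reg U' u & forall y, y \in l -> tauY y u 1%N != 0.
Proof.
move=> aU' H; have [oU' _ _ _ _] := aU'.
elim: l => [|y l IH] hl.
  by exists (fun=> 0) => //; apply: (reg_germ hY oU') => P _; exact: germ_c.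
have [u ru hu] := IH (fun z zl => hl z (mem_behead (s := y :: l) zl)).
have Uy : U' y by apply: hl; exact: mem_head.
have [uy|uy] := eqVneq (tauY y u 1%N) 0; last first.
  by exists u => // z; rewrite inE => /orP[/eqP->//|/hu].
have [f rf fy] : exists2 f, reg U' f & tauY y f 1%N != 0.
  have [v gv hv] := fc_surj (H y) 2 fX.
  have v1 : (tauY y v : fps k) 1%N != 0 by rewrite [_ 1%N]hv // oner_eq0.
  have [a [b [ra rb bP hab]]] := germ_frac hY aU' Uy gv.
  have [ga gb] : germ y a /\ germ y b by split; exact: (germ_of oU' Uy).
  apply: contrapT => no.
  have z g : reg U' g -> tauY y g 1%N = 0.
    by move=> rg; apply/eqP/negPn/negP => h; apply: no; exists g.
  have E : \forall x \near y, a x = v x * b x.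
    have nb := near_neq0 hY gb bP.
    near=> x; rewrite (near hab x) // divfK //; near: x => //.
  have := z _ ra; rewrite (fc_ext hY (H y) ga E) (cmD1 hY (H y).1 tt gv gb).
  rewrite (z _ rb) mulr0 add0r => /eqP; rewrite mulf_eq0 (negbTE bP) /=.
  by rewrite (negbTE v1).
have [c] := exists_notin (0 :: [seq - tauY z u 1%N / tauY z f 1%N | z <- l]).
rewrite inE negb_or => /andP[c0 cl].
have rcf : reg U' (fun x => u x + c * f x).
  apply: (reg_germ hY oU') => P UP; apply: (germD hY); first exact: (germ_of oU' UP ru).
  by apply: (germZ hY); exact: (germ_of oU' UP rf).
exists (fun x => u x + c * f x) => // z zl.
have Uz : U' z by exact: hl.
have gu := germ_of oU' Uz ru; have gf := germ_of oU' Uz rf.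
rewrite [tauY z _](fcD (H z) gu (germZ hY c gf)) fpsD (fcZ hY (H z)) // fcstM.
move: zl; rewrite inE => /orP[/eqP->|zl].
  by rewrite uy add0r mulf_neq0.
have [fz|fz] := eqVneq (tauY z f 1%N) 0; first by rewrite fz mulr0 addr0 hu.
apply: contra cl => /eqP E; apply/mapP; exists z => //.
apply: (mulIf fz); rewrite divfK //; apply/eqP.
by rewrite -addr_eq0 addrC E.
Unshelve. all: by end_near.
Qed.
End FiniteMor.

(** * Logarithmic expansions *)

Lemma pow_low (S : comNzRingType) (D : fps S) l : D 0%N = 0 -> (D ^+ l) l = D 1%N ^+ l.
Proof.
move=> D0; have E : D = fX ^+ 1 * (fun n => D (1 + n)%N).
  by apply: fXn_div => i; rewrite ltnS leqn0 => /eqP->.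
by rewrite {1}E expr1 exprMn fXnM leqnn subnn fpsX0.
Qed.

Section Alg.
Variables (S : comNzRingType) (x h hi : S).
Hypothesis hV : hi * h = 1.
Lemma lcf_alg1 c j l : (j <= l)%N -> x ^+ l * c = x ^+ (l - j) * c * hi ^+ j * (x * h) ^+ j.
Proof.
move=> jl; rewrite -[in LHS](subnK jl) exprD exprMn.
transitivity (x ^+ (l - j) * x ^+ j * c * (hi * h) ^+ j); first by rewrite hV expr1n mulr1.
by rewrite exprMn; ring.
Qed.
Lemma lcf_alg2 s n i j l b : (i <= j <= n)%N ->
  x ^+ (n - j) * x ^+ l * hi ^+ j * ((-1) ^+ (j - i) * ((x * h) ^+ (j - i) * s) *+ b) =
  ((-1) ^+ (j - i) *+ b) * (x ^+ (n - i) * hi ^+ i * (x ^+ l * s)).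
Proof.
move=> /andP[ij jn].
have -> : (n - i = (n - j) + (j - i))%N by lia.
have -> : hi ^+ j = hi ^+ i * hi ^+ (j - i) by rewrite -exprD subnKC.
have e : hi ^+ (j - i) * h ^+ (j - i) = 1 by rewrite -exprMn hV expr1n.
rewrite mulrnAr mulrnAl; congr (_ *+ _); rewrite exprMn exprD.
transitivity ((-1) ^+ (j - i) * (x ^+ (n - j) * x ^+ (j - i) * hi ^+ i * (x ^+ l * s)) *
  (hi ^+ (j - i) * h ^+ (j - i))); last by rewrite e mulr1.
ring.
Qed.
End Alg.

Section LogCoef.
Variables (k : fieldType) (mu : fps k).
Hypothesis hmu : AutO mu.
Definition unitpart : fps k := fun n => mu n.+1.
Let H := unitpart.
Let muE : mu = fX * H.
Proof. by apply: funext => -[|n]; rewrite fXM //; case: hmu. Qed.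
Let H0 : H 0%N != 0. Proof. by apply/eqP; case: hmu. Qed.
Let HV : (sinv H : fps k) * H = 1. Proof. exact: sinvM. Qed.

(* the coefficient of (dlog s)^l in (dlog mu)^j, where dlog mu is mu(s + z)/mu(s) - 1
   and z is s dlog s *)
Definition lcf j l : fps k := if (j <= l)%N then fX ^+ (l - j) * kap mu j l * (sinv H : fps k) ^+ j else 0.

Lemma lcfP j l : fX ^+ l * kap mu j l = lcf j l * mu ^+ j.
Proof.
rewrite /lcf; case: leqP => h; last by rewrite kap_gt // mulr0 mul0r.
by rewrite [mu ^+ j](congr1 (fun f : fps k => f ^+ j) muE); exact: (lcf_alg1 fX HV).
Qed.

Lemma lcf0 j l : lcf j l 0%N = (j == l)%:R.
Proof.
rewrite /lcf; case: ltngtP => h //.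
  by rewrite !fpsM0 fpsX0 [fX 0%N]/(0) expr0n subn_eq0 leqNgt h !mul0r.
rewrite h subnn expr0 mul1r fpsM0 fpsX0 /kap pow_low; last first.
  by rewrite -[LHS]/(shasse 0 mu - mu) /shasse; apply: funext => n; rewrite fpsD fpsN bin0 mul1r addn0 subrr.
rewrite fpsX0 (_ : (Tz mu - fcst (mu : fps k)) 1%N 0%N = H 0%N).
  by rewrite -exprMn sinv0 divff ?expr1n.
by rewrite fpsD fpsN /fcst /= subr0 /Tz /shasse /H /unitpart mul1r.
Qed.

Lemma lcf_sum n j l : (j <= n)%N -> fX ^+ n * lcf j l = \sum_(i < n.+1)
  fcst ((-1) ^+ (j - i) *+ 'C(j, i)) * (fX ^+ (n - i) * (sinv H : fps k) ^+ i * (fX ^+ l * (shasse l (mu ^+ i) : fps k))).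
Proof.
move=> jn; rewrite -(sum_widen0 (n := j.+1) (F := fun i => fcst ((-1) ^+ (j - i) *+ 'C(j, i)) *
  (fX ^+ (n - i) * (sinv H : fps k) ^+ i * (fX ^+ l * (shasse l (mu ^+ i) : fps k))))); last 2 first.
- by [].
- by move=> m jm; rewrite bin_small // mulr0n rmorph0 mul0r.
transitivity (fX ^+ (n - j) * fX ^+ l * (sinv H : fps k) ^+ j * kap mu j l).
  rewrite /lcf; case: leqP => h; last by rewrite kap_gt // !mulr0.
  by rewrite -exprD (_ : (n - j + l = n + (l - j))%N) ?exprD; [ring | lia].
rewrite kapE mulr_sumr; apply: eq_bigr => -[i /= ij] _.
rewrite rmorphMn rmorphXn rmorphN1 [mu ^+ (j - i)](congr1 (fun f : fps k => f ^+ (j - i)) muE); apply: (lcf_alg2 fX HV).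
by rewrite -ltnS ij.
Qed.
End LogCoef.

Section Expand.
Variables (k : fieldType) (V : lmodType k) (A : gradedVA V) (R : autOAction A).
Variable X : funSpace k.
Hypothesis hS : smooth_curve X.
Let hX : variety X := hS.1.
Implicit Types (P x : X) (U W : set X) (q : autTorsor X).
Implicit Types (sg : autTorsor X -> V) (mu rho : fps k) (b v : V).
Local Notation E := (Vsheaf R (X := X)).
Local Notation ap := (@apt k X).

Lemma piz_sum rho N (a : 'I_N -> V) (F : 'I_N -> fps k) n : AutO rho ->
  \sum_(m < n.+1) Piz A (Pi R) rho m (\sum_i F i (n - m)%N *: a i) =
  vexpT A (- fX) (vmap (Pi R rho) (vexpT A rho (\sum_i (svec (F i) (a i) : vser V)))) n.
Proof.
move=> hr; have [r0 _] := hr; have X0 : (- fX : fps k) 0%N = 0 by rewrite fpsN /fX oppr0.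
rewrite vexpT_sum vmap_sum ?vexpT_sum ?vser_sum; last exact: act_lin.
under eq_bigr => m _ do rewrite (lin_sum (Piz_linear R m hr)).
rewrite exchange_big; apply: eq_bigr => i _ /=.
have -> : (svec (F i) (a i) : vser V) = F i *: (svec (1 : fps k) (a i) : vser V) by rewrite svecZ mulr1.
rewrite vexpTZ // vmapZ ?vexpTZ //; last exact: act_lin.
rewrite -Piz_vexp // vserZ (reindex_inj rev_ord_inj) /=; apply: eq_bigr => m _.
rewrite (linZ (Piz_linear R _ hr)) subSS; congr (F i _ *: _).
by have := ltn_ord m; lia.
Qed.

Lemma expansion_of U sg q : open U -> E U sg -> U (apt q) ->
  expansion R (apt q) (acoord q) sg (vexpT A (- fX) (Jet R sg q)).
Proof.
move=> oU hsg Uq; have [W [t [N [a [f [oW Wq WU ht [tr t0]]]]]]] := frame hS oU hsg Uq.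
exists W, t, N, a, f; split=> // n.
have [qs hqs] := coord_sec hS ht.
have gt := coord_germ oW ht Wq.
have E1 : acoord q t = muq q t by rewrite (muqE hS gt) t0 rmorph0 subr0.
rewrite (JetE hS oU hsg Uq oW Wq ht tr) E1.
exact/esym/(piz_sum a (fun i => acoord q (f i)) n (muq_AutO hS oW ht hqs Wq)).
Qed.

Lemma expansion_inv U sg q S : open U -> E U sg -> U (apt q) ->
  expansion R (apt q) (acoord q) sg S -> S = vexpT A (- fX) (Jet R sg q).
Proof.
move=> oU hsg Uq [W [t [N [a [f [oW Wq [ht t0] tr hE]]]]]].
have [qs hqs] := coord_sec hS ht.
have gt := coord_germ oW ht Wq.
have E1 : acoord q t = muq q t by rewrite (muqE hS gt) t0 rmorph0 subr0.
apply: funext => n; rewrite hE (JetE hS oU hsg Uq oW Wq ht tr) E1.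
exact: (piz_sum a (fun i => acoord q (f i)) n (muq_AutO hS oW ht hqs Wq)).
Qed.

Lemma jrep_ext n P W Phi Psi J : open W -> W P ->
  (forall q y, W (apt q) -> W y -> Phi q y = Psi q y) -> jrep R n P Phi J -> jrep R n P Psi J.
Proof.
move=> oW WP e h; have [W' [oW' W'P W'W h1 h2]] := jrep_res hS oW WP h.
exists W'; split=> //; first by apply: (tens_ext h1) => q y /W'W ? /W'W ?; exact: e.
move=> q W'q; have [S hS1 SE] := h2 q W'q; exists S => //.
apply: (HE_ext hS1); have Wn := open_near oW' W'q; near=> y.
by apply: e; [exact: W'W | apply: W'W; near: y].
Unshelve. all: by end_near.
Qed.

Lemma jrep_sub n m P Phi J : (m <= n)%N -> jrep R n P Phi J -> jrep R m P Phi J.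
Proof.
move=> mn [W [oW WP h1 h2]]; exists W; split=> // q /h2 [S hS1 e]; exists S => // j jm.
by apply: e; exact: leq_trans mn.
Qed.

Lemma jrep_pow n P W r (w : nat -> autTorsor X -> V) : open W -> W P -> reg W r ->
  (forall x, W x -> r x != 0) -> (forall j, (j <= n)%N -> E W (w j)) ->
  jrep R n P (fun q y => \sum_(j < n.+1) (r y / r (apt q) - 1) ^+ j *: w j q)
    (fun q => \sum_(j < n.+1) (svec ((fcst (r (apt q))^-1 * muq q r) ^+ j) (w j q) : vser V)).
Proof.
move=> oW WP rr r0 hw.
have rV j : reg W (fun x => (r x)^-1 ^+ j).
  apply: (reg_germ hX oW) => x Wx; apply: (germX hX); apply: (germ_inv hX _ (r0 x Wx)).
  exact: (germ_of oW Wx rr).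
exists W; split=> //.
  apply: tensO_sum => j.
  have tw : tensO ap E W (fun q _ => w j q).
    by apply: (tens_ext (tens_gen ap (hw j (ltn_ord j)) (reg_c hS 1 oW))) => q y _ _; rewrite scale1r.
  have := tens_mulx (VsheafZ hS) oW (rV j) (tens_delta hS (VsheafZ hS) j oW rr tw).
  move/tens_ext; apply => q y Wq _; rewrite scalerA -exprMn mulrBr mulVf ?(r0 _ Wq) //.
  by rewrite mulrC.
move=> q Wq; have H := acoordP q; have gr := germ_of oW Wq rr.
have gq : germ (apt q) (fun y => r y / r (apt q) - 1).
  apply: (germB hX); last exact: germ_c.
  by apply: (germM hX gr); exact: germ_c.
have E1 : (acoord q (fun y => r y / r (apt q) - 1) : fps k) = fcst (r (apt q))^-1 * muq q r.
  rewrite (fcB hX H _ (germ_c hX _ 1)); last by apply: (germM hX gr); exact: germ_c.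
  rewrite (fcM H gr (germ_c hX _ _)) !(fc_c H) (muqE hS gr) mulrBr -rmorphM mulVf ?(r0 _ Wq) //.
  by rewrite mulrC.
exists (\sum_(j < n.+1) (svec (acoord q (fun y => (r y / r (apt q) - 1) ^+ j)) (w j q) : vser V)).
  by apply: HE_sum => j; apply: HE_g; exact: (germX hX).
move=> i _; rewrite !vser_sum; apply: eq_bigr => j _.
by rewrite (fcX hX H) // E1.
Qed.

Section WithCoord.
Variables (W : set X) (t : X -> k) (qs : X -> autTorsor X).
Hypotheses (oW : open W) (ht : coordinate W t).
Hypothesis hqs : forall x, W x -> apt (qs x) = x /\ centred t x (acoord (qs x)).
Variables (U : set X) (sg : autTorsor X -> V).
Hypotheses (oU : open U) (hsg : E U sg) (WU : W `<=` U).
Local Notation w := (wsec R t qs sg).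

Lemma Jet_w q n i : W (apt q) -> (i <= n)%N ->
  Jet R sg q i = \sum_(j < n.+1) (muq q t ^+ j) i *: w j q.
Proof.
move=> Wq ile; rewrite (Jet_equiv hS oW ht hqs oU hsg WU Wq) /vmap (vcompE (N := n.+1)) //.
rewrite (lin_sum (aut_lin R hS oW ht Wq)); apply: eq_bigr => j _.
by rewrite (linZ (aut_lin R hS oW ht Wq)).
Qed.

Lemma jrep_w n P : W P ->
  jrep R n P (fun q y => \sum_(j < n.+1) (t y - t (apt q)) ^+ j *: w j q) (Jet R sg).
Proof.
move=> WP; have [rt _] := ht.
have hw j : E W (w j) by exact: (wsec_V hS oW ht hqs oU hsg WU).
exists W; split=> //.
  apply: tensO_sum => j.
  have tw : tensO ap E W (fun q _ => w j q).
    by apply: (tens_ext (tens_gen ap (hw j) (reg_c hS 1 oW))) => q y _ _; rewrite scale1r.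
  exact: (tens_delta hS (VsheafZ hS) j oW rt tw).
move=> q Wq; have H := acoordP q; have gt := germ_of oW Wq rt.
have gj j : germ (apt q) (fun y => (t y - t (apt q)) ^+ j).
  by apply: (germX hX); exact: (germ_sub hS).
have E1 j : (acoord q (fun y => (t y - t (apt q)) ^+ j) : fps k) = muq q t ^+ j.
  by rewrite (fcX hX H) ?(fc_sub hS H gt) ?(muqE hS gt) //; exact: (germ_sub hS).
exists (\sum_(j < n.+1) (svec (acoord q (fun y => (t y - t (apt q)) ^+ j)) (w j q) : vser V)).
  by apply: HE_sum => j; exact: HE_g.
move=> i ile; rewrite (Jet_w Wq ile) vser_sum; apply: eq_bigr => j _.
by rewrite /svec E1.
Qed.

Variable q : autTorsor X.
Hypotheses (Wq : W (apt q)) (tq : t (apt q) = 0).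
Local Notation mu := (muq q t).
Let S : vser V := vexpT A (- fX) (Jet R sg q).
Let X0 : (- fX : fps k) 0%N = 0. Proof. by rewrite fpsN /fX oppr0. Qed.

Lemma acoord0E : acoord q t = mu.
Proof. by rewrite (muqE hS (coord_germ oW ht Wq)) tq rmorph0 subr0. Qed.

Definition logsec j : autTorsor X -> V := fun q => t (apt q) ^+ j *: w j q.

Lemma logsec_V j : E W (logsec j).
Proof.
apply: (VsheafZ hS (f := fun x => t x ^+ j) oW); last exact: (wsec_V hS oW ht hqs oU hsg WU).
by apply: (reg_germ hX oW) => x Wx; apply: (germX hX); exact: (coord_germ oW ht).
Qed.

Definition logexp j : vser V := vexpT A (- fX) (Jet R (logsec j) q).

Lemma logexpE j : logexp j = mu ^+ j *: vexpT A (- fX) (Jet R (w j) q).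
Proof.
rewrite /logexp (JetZ (f := fun x => t x ^+ j) hS oW _ _ Wq); last 2 first.
- by apply: (reg_germ hX oW) => x Wx; apply: (germX hX); exact: (coord_germ oW ht).
- exact: (wsec_V hS oW ht hqs oU hsg WU).
rewrite vexpTZ //; congr (_ *: _).
by rewrite (fcX hX (acoordP q)) ?acoord0E //; exact: (coord_germ oW ht Wq).
Qed.

Lemma lg_logexp l : lg A l S = \sum_(j < l.+1) lcf mu j l *: logexp j.
Proof.
have hmu := muq_AutO hS oW ht hqs Wq.
have [e c] := hqs Wq.
have lin := aut_lin R hS oW ht Wq.
rewrite lgE /S vexpTNK ?fXnE //.
rewrite (Jet_equiv hS oW ht hqs oU hsg WU Wq) -vmap_hasse // vhasse_comp // vmap_sum //.
rewrite vexpT_sum scaler_sumr; apply: eq_bigr => j _.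
rewrite vmapZ // vexpTZ // scalerA lcfP // -scalerA logexpE; congr (_ *: (_ *: vexpT A _ _)).
rewrite (Jet_equiv hS oW ht hqs oW (wsec_V hS oW ht hqs oU hsg WU j) (fun x h => h) Wq).
by rewrite (Jet_wsec hS oW ht hqs oU hsg WU).
Qed.

Lemma logexp_lat l : lat A 0 S -> lat A 0 (logexp l) /\ lat A 1 (logexp l - lg A l S).
Proof.
move=> hl; have hmu := muq_AutO hS oW ht hqs Wq.
elim/ltn_ind: l => l IH; set u := lcf mu l l.
have u0 : u 0%N = 1 by rewrite /u (lcf0 hmu) eqxx.
have uV : (sinv u : fps k) * u = 1 by apply: sinvM; rewrite u0 oner_eq0.
set x := \sum_(j < l) lcf mu j l *: logexp j.
have hx : lat A 1 x.
  apply: lat_sum => j _; apply: latZ1; first by rewrite (lcf0 hmu) ltn_eqF.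
  by case: (IH j (ltn_ord j)).
have Eo : logexp l = (sinv u : fps k) *: (lg A l S - x).
  by rewrite lg_logexp big_ord_recr /= -/u -/x [x + _]addrC addrK scalerA uV scale1r.
have hlg := lat_lg l hl.
have h1 : lat A 1 (logexp l - lg A l S).
  have -> : logexp l - lg A l S = ((sinv u : fps k) - 1) *: lg A l S - (sinv u : fps k) *: x.
    by rewrite Eo scalerBr scalerBl scale1r addrAC.
  apply: lat_add; last by apply: latN; exact: latZ.
  apply: latZ1 => //; rewrite fpsD fpsN fps1 eqxx sinv0 u0 invr1; exact: subrr.
split=> //; have -> : logexp l = (logexp l - lg A l S) + lg A l S by rewrite subrK.
by apply: lat_add => //; exact: lat1_lat0.
Qed.
End WithCoord.

Lemma canonical_Th : canonical_connection R (Th R (X := X)).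
Proof.
move=> n U sg oU hsg; split; first exact: (Th_section hS n oU hsg).
move=> W t N a f oW WU ht tr; have [qs hqs] := coord_sec hS ht.
exists (wsec R t qs sg) => [j jn|P WP].
  split; first exact: (wsec_V hS oW ht hqs oU hsg WU).
  move=> q Wq cq; have [e c] := hqs _ Wq.
  rewrite {1}(qs_uniq hS oW ht hqs Wq cq) (wsec_qs R hS oW ht hqs) //.
  have Wq' : W (apt (qs (apt q))) by rewrite e.
  have h := triv_HE hS oW ht hqs Wq' tr; rewrite e in h.
  rewrite (Jet_coef (fa := fun i => (f i, a i)) hS oW ht hqs oU hsg WU j Wq h) /hd.
  by rewrite -(qs_uniq hS oW ht hqs Wq cq).
apply: (jrep_crit hS oU (WU _ WP) (fun q _ j _ => erefl (Jet R sg q j))).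
  exact: (ThP hS n oU hsg (WU _ WP)).
exact: (jrep_w oW ht hqs oU hsg WU).
Qed.
End Expand.

Lemma gam_solve (k : fieldType) (d e : fps k) : d 0%N = 0 -> (1 + d) * (1 + e) = 1 ->
  e = scomp (sgamma k : fps k) d.
Proof.
move=> d0 h; set g : fps k := scomp _ d.
have hg : g * (1 + d) = - d.
  have := congr1 (fun f : fps k => scomp f d : fps k) (sgammaX k).
  rewrite scompM // scompD scompN scomp_X //.
  by have -> : scomp (1 : fps k) d = 1 :> fps k := scomp_c 1 d.
have : (e - g) * (1 + d) = 0.
  have e1 : e * (1 + d) + d = (1 + d) * (1 + e) - 1 by ring.
  by rewrite mulrBl hg opprK e1 h subrr.
move/(congr1 (fun x => x * (1 + e))); rewrite mul0r -mulrA h mulr1 => /eqP.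
by rewrite subr_eq0 => /eqP.
Qed.

Lemma gam_pow (k : fieldType) (d e : fps k) n j i : d 0%N = 0 -> e = scomp (sgamma k : fps k) d ->
  (i <= n)%N -> (e ^+ j) i = \sum_(l < n.+1) ((sgamma k : fps k) ^+ j) l * (d ^+ l) i.
Proof.
move=> d0 -> ile; rewrite -scompX // (scomp_svec _ d0 (n := i) (N := n.+1)) // fps_sum.
by apply: eq_bigr => l _; rewrite fcstM.
Qed.

Lemma pow_uniq (k : fieldType) (V : lmodType k) (d : fps k) n (c : nat -> V) : d 0%N = 0 -> d 1%N != 0 ->
  (forall i, (i <= n)%N -> \sum_(l < n.+1) (d ^+ l) i *: c l = 0) ->
  forall l, (l <= n)%N -> c l = 0.
Proof.
move=> d0 d1 h; elim/ltn_ind => l IH ln; apply/eqP.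
have := h l ln; rewrite (bigD1 (Ordinal (ln : l < n.+1)%N)) //= big1 ?addr0 => [|j jl].
  by rewrite pow_low // => /eqP; rewrite scaler_eq0 expf_eq0 (negbTE d1) andbF.
have [lj|jl'] := ltnP l j; first by rewrite ordX ?scale0r.
by rewrite IH ?scaler0 //; [move: jl; rewrite -val_eqE /=; lia | lia].
Qed.

Section LogExp.
Variables (k : fieldType) (X : funSpace k).
Hypothesis hS : smooth_curve X.
Let hX : variety X := hS.1.
Implicit Types (P x : X) (U W : set X) (q : autTorsor X).

Lemma open_punct W P : open W -> open (W `\ P).
Proof.
move=> oW; apply: openN => x [Wx xP].
have nW := open_near oW Wx; have nP := near_neq hX xP; near=> y.
by split; [near: y | move=> e; have : y <> P by near: y].
Unshelve. all: by end_near.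
Qed.

Lemma regX W f n : open W -> reg (f := X) W f -> reg (f := X) W (fun x => f x ^+ n).
Proof. by move=> oW rf; apply: (reg_germ hX oW) => x Wx; apply: (germX hX); exact: (germ_of oW Wx rf). Qed.
Lemma regV W f : open W -> reg (f := X) W f -> (forall x, W x -> f x != 0) -> reg (f := X) W (fun x => (f x)^-1).
Proof.
move=> oW rf f0; apply: (reg_germ hX oW) => x Wx.
by apply: (germ_inv hX _ (f0 x Wx)); exact: (germ_of oW Wx rf).
Qed.

Lemma gbin_shift (g : fps k) D l :
  (fun m => (gbin (m%:Z - D%:Z) l)%:~R * (fX ^+ D * g) m) =
  fX ^+ D * (fX ^+ l * (shasse l g : fps k)) :> fps k.
Proof.
apply: funext => m; rewrite !fXnM; case: leqP => h; last by rewrite mulr0.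
have -> : m%:Z - D%:Z = (m - D)%N%:Z by rewrite subzn.
rewrite [gbin _ _]/= -pmulrn; case: leqP => h2; last by rewrite bin_small // mul0r.
by rewrite /shasse subnK.
Qed.

Lemma log_expansion_of W r q n p (b : nat -> k) : open W -> W (apt q) -> coordinate W r -> r (apt q) = 0 ->
  (forall x, W x -> x <> apt q -> r x != 0) ->
  (forall P, W P -> P <> apt q -> modJ (M := k^o) id (@reg _ X) n P (p P)
     (fun x y => \sum_(j < n.+1) b j * (r y / r x - 1) ^+ j)) ->
  log_expansion (apt q) (acoord q) n p
    (fun l => \sum_(j < n.+1) fcst (b j) * lcf (muq q r) j l).
Proof.
move=> oW Wq hr r0 rn hp; have [rr _] := hr; have [qr hqr] := coord_sec hS hr.
have H := acoordP q; have gr := germ_of oW Wq rr.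
have hmu := muq_AutO hS oW hr hqr Wq.
have Er : acoord q r = muq q r by rewrite (muqE hS gr) r0 rmorph0 subr0.
set mu := muq q r in hmu Er *; set Hu := unitpart mu.
have HV : (sinv Hu : fps k) * Hu = 1 by apply: sinvM; apply/eqP; case: hmu.
have muE : mu = fX * Hu by apply: funext => -[|m]; rewrite fXM //; case: hmu.
have oP := open_punct (apt q) oW.
have sP : W `\ apt q `<=` W by move=> x [].
have rP := reg_res hX oW oP sP rr.
have rPn x : (W `\ apt q) x -> r x != 0 by move=> [] /rn.
pose be i : k := \sum_(j < n.+1) b j * ((-1) ^+ (j - i) *+ 'C(j, i)).
exists W, n, n.+1, (fun i x => be i * (r x)^-1 ^+ i), (fun i y => r y ^+ i),
  (fun i => fcst (be i) * (fX ^+ (n - i) * (sinv Hu : fps k) ^+ i)), (fun i => fX ^+ n * mu ^+ i).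
have mun i : (mu : fps k) ^+ i <> 0.
  move=> e; have := pow_low i (hmu.1 : (mu : fps k) 0%N = 0); rewrite e fps0 => /esym/eqP.
  by rewrite expf_eq0 => /andP[_ /eqP]; case: hmu.
split=> //.
- move=> i; split.
  + apply: (regM hS) => //; first exact: (reg_c hS).
    by apply: (regX i oP); exact: regV.
  + exact: regX.
  + exists (fun x => r x ^+ i), (fun=> be i), W; split=> //.
    * by split; [exact: regX | exact: (reg_c hS)].
    * by move=> x Wx xq; rewrite exprVn mulfVK // expf_neq0 // rn.
    * rewrite (fcX hX H) // Er (fc_c H); split; first exact: mun.
      rewrite sshiftE -[smul _ _]/(mu ^+ i * (fcst (be i) * (fX ^+ (n - i) * (sinv Hu : fps k) ^+ i))).
      rewrite (lcf_alg1 fX HV (fcst (be i)) (ltn_ord i : i <= n)%N) -muE.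
      by rewrite mulrC mulrA [fcst (be i) * fX ^+ _]mulrC.
  + exists (fun=> 1), (fun x => r x ^+ i), W; split=> //.
    * by split; [exact: (reg_c hS) | exact: regX].
    * by move=> x Wx xq; rewrite mulr1.
    * rewrite (fcX hX H) // Er (fc_c H) rmorph1 sshiftE; split; last first.
        by rewrite -[smul _ _]/((1 : fps k) * (fX ^+ n * mu ^+ i)) mul1r.
      by have /eqP nz := oner_neq0 (fps k).
- move=> P WP Pq; have [W1 [D [oW1 W1P h1 h2]]] := hp P WP Pq.
  have oI := openI oW1 oP.
  have sI : W1 `&` (W `\ apt q) `<=` W1 by move=> x [].
  exists (W1 `&` (W `\ apt q)), D; split=> //.
    elim: h1 {h2} => [|D1 D2 [s [g [F [es eg hF ->]]]] _ IH]; first exact: zspan0.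
    apply: zspanD => //; exists s, g, F; split=> //; try exact: (reg_res hX oW1).
    move=> l; have [N [f [f' [ff E0 F0]]]] := hF l; exists N, f, f'; split=> //.
      by move=> i; split; apply: (reg_res hX oW1) => //; case: (ff i).
    by move=> x [? _]; exact: F0.
  move=> x y Ix Iy; rewrite -h2; [|by case: Ix|by case: Iy]; congr (_ - _).
  have rx : r x != 0 by apply: rPn; case: Ix.
  rewrite /be; under eq_bigr => i _ do rewrite !mulr_suml.
  rewrite exchange_big; apply: eq_bigr => j _ /=.
  rewrite addrC exprDn mulr_sumr.
  rewrite -(sum_widen0 (n := j.+1) (F := fun i => b j * ((-1) ^+ (j - i) *+ 'C(j, i)) * (r x)^-1 ^+ i * r y ^+ i)); last 2 first.
  - exact: ltn_ord.
  - by move=> m jm; rewrite bin_small // mulr0n mulr0 !mul0r.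
  apply: eq_bigr => i _; rewrite exprMn -mulrA -mulrA; congr (_ * _).
  by rewrite -mulrnAl [_ ^+ i * r y ^+ i]mulrC.
move=> l ln m; under eq_bigr => i _ do rewrite (gbin_shift (mu ^+ i) n l).
rewrite -[LHS](fps_sum (index_enum _) xpredT (fun i : 'I_n.+1 => fcst (be i) * (fX ^+ (n - i) * (sinv Hu : fps k) ^+ i) *
  (fX ^+ n * (fX ^+ l * (shasse l (mu ^+ i) : fps k))))) sshiftE.
congr (_ m); rewrite exprD -mulrA mulr_sumr.
under [in RHS]eq_bigr => j _ do rewrite mulrCA (lcf_sum hmu _ (ltn_ord j : j <= n)%N) mulr_sumr.
rewrite exchange_big mulr_sumr /=; apply: eq_bigr => i _.
rewrite /be rmorph_sum !mulr_suml mulr_sumr; apply: eq_bigr => j _.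
rewrite rmorphM -/mu -/Hu -!mulrA.
by rewrite ![fX ^+ n * (_ * _)]mulrCA.
Qed.

Lemma kcrit n P W0 t qs W (Phi Psi : X -> X -> k) : open W0 -> W0 P -> coordinate W0 t ->
  (forall x, W0 x -> apt (qs x) = x /\ centred t x (acoord (qs x))) ->
  open W -> W P -> tensO id (M := k^o) (@reg _ X) W Phi -> tensO id (M := k^o) (@reg _ X) W Psi ->
  (forall x, W0 x -> W x -> forall j, (j <= n)%N -> acoord (qs x) (Phi x) j = acoord (qs x) (Psi x) j) ->
  modJ (M := k^o) id (@reg _ X) n P Phi Psi.
Proof.
move=> oW0 W0P ht hqs oW WP t1 t2 hj.
have EZ W' f (s : X -> k^o) : open W' -> reg (f := X) W' f -> reg (f := X) W' s -> reg (f := X) W' (fun z => f z *: s z).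
  by move=> oW' rf rs; exact: (regM hS).
have Er U' W' (s : X -> k^o) : open U' -> open W' -> W' `<=` U' -> reg (f := X) U' s -> reg (f := X) W' s.
  by move=> oU oW' UW; exact: (reg_res hX).
have [N [sg [g [hg hD]]]] := tensB hS EZ oW t1 t2.
apply: (modJ_of_coefs hS EZ Er oW WP oW0 W0P ht hqs hg _ hD).
move=> x Wx W0x j jn; have [e [H _]] := hqs _ W0x.
have gP Phi0 : tensO id (M := k^o) (@reg _ X) W Phi0 -> germ x (Phi0 x).
  move=> [N' [s' [g' [h1 h2]]]]; apply: (germ_ext hX (f := fun y => \sum_i g' i y * s' i x)).
    apply: (germ_sum hX) => i _; apply: (germM hX); last exact: germ_c.
    exact: (germ_of oW Wx (h1 i).2).
  have Wn := open_near oW Wx; near=> y; rewrite h2 //; near: y => //.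
have gi i : germ x (g i) := germ_of oW Wx (hg i).2.
have E1 : acoord (qs x) (fun y => \sum_i g i y * sg i x) = acoord (qs x) (fun y => Phi x y - Psi x y).
  apply: (fc_ext hX H).
    by apply: (germ_sum hX) => i _; apply: (germM hX); [exact: gi | exact: germ_c].
  have Wn := open_near oW Wx; near=> y; have Wy : W y by near: y.
  exact: (esym (hD x y Wx Wy)).
have := congr1 (fun f : fps k => f j) E1.
rewrite (fcB hX H) ?fpsD ?fpsN; [|exact: gP|exact: gP].
rewrite hj // subrr => E0; apply: etrans E0.
rewrite (fc_sum hX H); last first.
  by move=> i _; apply: (germM hX); [exact: gi | exact: germ_c].
rewrite fps_sum.
suff E2 i : (acoord (qs x) (fun y => g i y * sg i x) : fps k) j = hd qs (g i) j x * sg i x.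
  by apply: eq_bigr => i _; rewrite E2.
by rewrite (fcM H (gi i) (germ_c hX _ _)) (fc_c H) mulrC fcstM mulrC.
Unshelve. all: by end_near.
Qed.

Lemma tens_pow W r l : open W -> reg (f := X) W r -> (forall x, W x -> r x != 0) ->
  tensO id (M := k^o) (@reg _ X) W (fun x y => (r y / r x - 1) ^+ l).
Proof.
move=> oW rr r0.
have EZ W' f (s : X -> k^o) : open W' -> reg (f := X) W' f -> reg (f := X) W' s -> reg (f := X) W' (fun z => f z *: s z).
  by move=> oW' rf rs; exact: (regM hS).
have t1 : tensO id (M := k^o) (@reg _ X) W (fun _ _ => 1).
  apply: (tens_ext (tens_gen id (reg_c hS 1 oW) (reg_c hS 1 oW))) => x y _ _.
  by rewrite scale1r.
have := tens_mulx EZ oW (regX l oW (regV oW rr r0)) (tens_delta hS EZ l oW rr t1).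
move/tens_ext; apply => x y Wx _ /=.
have -> : forall c d : k, c *: (d *: (1 : k^o)) = c * d by move=> c d; rewrite scalerA -[LHS]/(_ * _) mulr1.
by rewrite -exprMn mulrBr mulVf ?r0 // mulrC.
Qed.

Lemma pow_swap n P W t r l : open W -> W P -> coordinate W t -> reg (f := X) W r -> (forall x, W x -> r x != 0) ->
  (l <= n)%N ->
  modJ (M := k^o) id (@reg _ X) n P (fun x y => (r y / r x - 1) ^+ l)
    (fun x y => \sum_(j < n.+1) ((sgamma k : fps k) ^+ l) j * ((r y)^-1 / (r x)^-1 - 1) ^+ j).
Proof.
move=> oW WP hr rr r0 ln; have [qr hqr] := coord_sec hS hr.
have rV := regV oW rr r0.
have EZ W' f (s : X -> k^o) : open W' -> reg (f := X) W' f -> reg (f := X) W' s -> reg (f := X) W' (fun z => f z *: s z).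
  by move=> oW' rf rs; exact: (regM hS).
apply: (kcrit oW WP hr hqr oW WP (tens_pow l oW rr r0)).
  apply: tensO_sum => j.
  have rV0 x : W x -> (r x)^-1 != 0 by move=> Wx; rewrite invr_neq0 ?r0.
  exact: (tens_ext (tensZ hS EZ (((sgamma k : fps k) ^+ l) j) oW (tens_pow j oW rV rV0))).
move=> x Wx _ i ile; have [e [H c]] := hqr x Wx.
have gr := germ_of oW Wx rr; have gV := germ_of oW Wx rV.
have gd : germ x (fun y => r y / r x - 1) by apply: (germB hX); [apply: (germM hX gr)|]; exact: germ_c.
have ge : germ x (fun y => (r y)^-1 / (r x)^-1 - 1) by apply: (germB hX); [apply: (germM hX gV)|]; exact: germ_c.
set d := acoord (qr x) (fun y => r y / r x - 1); set e' := acoord (qr x) (fun y => (r y)^-1 / (r x)^-1 - 1).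
have d0 : (d : fps k) 0%N = 0 by rewrite /d (fc0 hX H gd) divff ?r0 // subrr.
have e0 : (e' : fps k) 0%N = 0 by rewrite /e' (fc0 hX H ge) divff ?subrr // invr_neq0 ?r0.
have h : (1 + (e' : fps k)) * (1 + (d : fps k)) = 1.
  have Ed f : germ x f -> (1 + (acoord (qr x) f : fps k) : fps k) = acoord (qr x) (fun y => 1 + f y).
    by move=> gf; rewrite (fcD H (germ_c hX x 1) gf) (fc_c H) rmorph1.
  have g1 f : germ x f -> germ x (fun y => 1 + f y) by move=> gf; apply: (germD hX) => //; exact: germ_c.
  rewrite (Ed _ ge) (Ed _ gd) -(fcM H (g1 _ ge) (g1 _ gd)).
  transitivity (acoord (qr x) (fun=> 1) : fps k); last by rewrite (fc_c H) rmorph1.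
  apply: (fc_ext hX H); first by apply: (germM hX); exact: g1.
  have Wn := open_near oW Wx; near=> y; have ry : r y != 0 by apply: r0; near: y.
  have rx := r0 x Wx; field.
  by rewrite rx ry oner_neq0.
rewrite (fcX hX H) // -/d (gam_pow (n := n) l e0 (gam_solve e0 h)) //.
rewrite (fc_sum hX H) ?fps_sum; last by move=> j _; apply: (germZ hX); exact: (germX hX).
apply: eq_bigr => j _; rewrite (fcZ hX H) ?fcstM ?(fcX hX H) //; exact: (germX hX).
Unshelve. all: by end_near.
Qed.
End LogExp.

Section Local.
Variables (k : fieldType) (X : funSpace k).
Hypothesis hS : smooth_curve X.
Let hX : variety X := hS.1.
Implicit Types (P x : X) (U W : set X) (f r t : X -> k).

Lemma coord_zero P tau t : formal_coord P tau -> germ P t -> t P = 0 -> (tau t : fps k) 1%N != 0 ->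
  \forall x \near P, t x = 0 -> x = P.
Proof.
move=> H gt t0 t1; have [U [aU UP]] := affine_at hX P; have [oU _ _ _ _] := aU.
have [N [s [rs gen]]] := affine_gen aU.
have Hs i : exists b : 'I_1 -> X -> k, (forall l, germ P (b l)) /\
   \forall y \near P, s i y - s i P = \sum_l b l y * (t y - t P).
  exact: (max_gen hX aU UP rs gen (uniformizer_hu hX H gt t1) (germ_of oU UP (rs i))).
have nU := open_near oU UP.
have nA : \forall y \near P, forall i, t y = 0 -> s i y = s i P.
  apply: filter_forall => i; have [b [_ hb]] := Hs i; near=> y => ty.
  have h : s i y - s i P = \sum_l b l y * (t y - t P) by near: y.
  apply/eqP; rewrite -subr_eq0 h big1 // => l _.
  by rewrite ty t0 subrr mulr0.
near=> y => ty; apply: (affine_inj aU _ UP gen); first by near: y.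
have h : forall i, t y = 0 -> s i y = s i P by near: y.
by move=> i; exact: h.
Unshelve. all: by end_near.
Qed.

Lemma unif_nbhd P tau t (A : set X) : formal_coord P tau -> germ P t -> t P = 0 ->
  (tau t : fps k) 1%N != 0 -> (\forall x \near P, A x) ->
  exists W, [/\ open W, W P, W `<=` A, coordinate W t & forall x, W x -> x <> P -> t x != 0].
Proof.
move=> H gt t0 t1 nA; have nz := coord_zero H gt t0 t1.
have nc := coord_near hX hS.2 H gt t1.
have : \forall x \near P, [/\ A x, t x = 0 -> x = P & germ x t /\ exists tau', centred t x tau'].
  by near=> x; split; near: x.
move/nearP => [W [oW WP hW]]; exists W; split=> //.
- by move=> x /hW[].
- by split; [apply: (reg_germ hX oW) => x /hW[_ _ []] | move=> x /hW[_ _ []]].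
- by move=> x /hW[_ h _] xP; apply/eqP => /h.
Unshelve. all: by end_near.
Qed.

(* If e is 0 at Q_+ and 1 at Q_-, and u is a coordinate vanishing at both points, then
   sepn e u / sepn (1 - e) u is a coordinate at Q_+ and its inverse is one at Q_-. *)
Definition sepn (e u : X -> k) : X -> k := fun y => e y ^+ 2 + u y * (1 - e y).

Lemma sepn_coord P tau e u : formal_coord P tau -> germ P e -> germ P u -> e P = 0 -> u P = 0 ->
  (tau u : fps k) 1%N = 1 ->
  let a := sepn e u in let b := sepn (fun y => 1 - e y) u in
  [/\ germ P a, germ P b, a P = 0, b P = 1 &
      germ P (fun y => a y / b y) /\ (tau (fun y => a y / b y) : fps k) 1%N = 1].
Proof.
move=> H ge gu e0 u0 u1 a b.
have g1 : germ P (fun y => 1 - e y) by apply: (germB hX) => //; exact: germ_c.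
have g2 : germ P (fun y => 1 - (1 - e y)) by apply: (germB hX) => //; exact: germ_c.
have ga : germ P a by apply: (germD hX); [exact: (germX hX) | exact: (germM hX)].
have gb : germ P b by apply: (germD hX); [exact: (germX hX) | exact: (germM hX)].
have a0 : a P = 0 by rewrite /a /sepn e0 u0 expr2 !mul0r addr0.
have b0 : b P = 1 by rewrite /b /sepn e0 u0 subr0 mul0r addr0 expr1n.
have bn : b P != 0 by rewrite b0 oner_eq0.
have gr : germ P (fun y => a y / b y) by exact: (germ_div hX).
split=> //; split=> //.
have D f g : germ P f -> germ P g -> (tau (fun x => f x * g x) : fps k) 1%N = f P * (tau g : fps k) 1%N + g P * (tau f : fps k) 1%N.
  exact: (cmD1 hX H.1 tt).
have a1 : (tau a : fps k) 1%N = 1.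
  rewrite /a /sepn; under [fun y => _]funext => y do rewrite expr2.
  rewrite (fcD H); [|exact: (germM hX)|exact: (germM hX)].
  by rewrite fpsD !D // e0 u0 u1 subr0 !mul0r !add0r mulr1.
have nb := near_neq0 hX gb bn.
have Ea : tau (fun y => (a y / b y) * b y) = tau a :> fps k.
  apply: (fc_ext hX H); first exact: (germM hX).
  near=> y; rewrite divfK //; near: y => //.
have := congr1 (fun f : fps k => f 1%N) Ea; rewrite D // a1 a0 mul0r mul0r add0r b0 mul1r.
by [].
Unshelve. all: by end_near.
Qed.

Section ModJ.
Variables (B : Type) (pi : B -> X) (M : lmodType k) (E : set X -> set (B -> M)).
Lemma modJ_ext n P W Phi Psi : open W -> W P ->
  (forall q y, W (pi q) -> W y -> Phi q y = Psi q y) -> modJ pi E n P Phi Psi.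
Proof.
move=> oW WP e; exists W, 0; split=> //; first exact: zspan0.
by move=> q y Wq Wy; rewrite e // subrr.
Qed.
Lemma pp_const n W (Phi : B -> X -> M) : open W -> tensO pi E W Phi -> pp_section pi E n W (fun _ => Phi).
Proof.
move=> oW t P WP; exists W; split=> // x Wx; by apply: (modJ_ext _ oW Wx).
Qed.
End ModJ.

Variables (V : lmodType k) (A : gradedVA V) (R : autOAction A).
Local Notation E := (Vsheaf R (X := X)).
Implicit Types (q : autTorsor X) (sg : autTorsor X -> V).

Definition dlg q r : fps k := fcst (r (apt q))^-1 * muq q r.

Lemma dlg1 q r : germ (apt q) r -> r (apt q) != 0 -> 1 + dlg q r = fcst (r (apt q))^-1 * acoord q r.
Proof. by move=> gr r0; rewrite /dlg (muqE hS gr) mulrBr -rmorphM mulVf // rmorph1 addrC subrK. Qed.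

Lemma dlg_inv q r : germ (apt q) r -> r (apt q) != 0 ->
  (1 + dlg q r) * (1 + dlg q (fun x => (r x)^-1)) = 1.
Proof.
move=> gr r0; have gV := germ_inv hX gr r0; have H := acoordP q.
rewrite dlg1 // dlg1 ?invr_neq0 // invrK mulrACA -rmorphM mulVf // rmorph1 mul1r mulrC.
exact: (fc_inv hX H gr r0).
Qed.

Section WithCoord.
Variables (W : set X) (t : X -> k) (qs : X -> autTorsor X).
Hypotheses (oW : open W) (ht : coordinate W t).
Hypothesis hqs : forall x, W x -> apt (qs x) = x /\ centred t x (acoord (qs x)).
Variables (U : set X) (sg : autTorsor X -> V).
Hypotheses (oU : open U) (hsg : E U sg) (WU : W `<=` U).

Lemma Jet_logsec q n i : W (apt q) -> t (apt q) != 0 -> (i <= n)%N ->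
  Jet R sg q i = \sum_(j < n.+1) (dlg q t ^+ j) i *: logsec R t qs sg j q.
Proof.
move=> Wq t0 ile; rewrite (Jet_w hS oW ht hqs oU hsg WU Wq ile); apply: eq_bigr => j _.
rewrite /logsec scalerA /dlg exprMn -rmorphXn fcstM mulrAC -exprMn mulVf //.
by rewrite expr1n mul1r.
Qed.

Lemma jrep_logsec n P : W P -> t P != 0 ->
  jrep R n P (fun q y => \sum_(j < n.+1) (t y / t (apt q) - 1) ^+ j *: logsec R t qs sg j q) (Jet R sg).
Proof.
move=> WP tP; have h := jrep_w hS oW ht hqs oU hsg WU n WP.
have /nearP [W' [oW' W'P W't]] := near_neq0 hX (coord_germ oW ht WP) tP.
apply: (jrep_ext hS oW' W'P _ h) => q y /W't t0 _; apply: eq_bigr => j _.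
by rewrite /logsec scalerA -exprMn mulrBl divfK // mul1r.
Qed.
End WithCoord.

End Local.

(** * Curves with nodes *)

Section Nodal.
Variables (k : closedFieldType) (V : lmodType k) (A : gradedVA V).
Variables (R : autOAction A) (L : moebius A).
Variables (C Ct : funSpace k) (eta : Ct -> C).
Hypotheses (hC : nodal_curve C) (heta : normalization eta).
Variable br : branches eta.
Let hS : smooth_curve Ct. Proof. by case: heta. Qed.
Let hX : variety Ct := hS.1.
Let hV : variety C := hC.1.
Let hm : morphism_of_varieties eta. Proof. by case: heta. Qed.
Let hf : finite_morphism eta. Proof. by case: heta. Qed.
Local Notation E := (Vsheaf R (X := Ct)).
Local Notation ap := (@apt k Ct).
Local Notation gam := (sgamma k : fps k).
Implicit Types (Q : C) (P : Ct) (b : bool) (sg : autTorsor Ct -> V).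

Definition bpt b Q := if b then brp br Q else brm br Q.
Definition btau b Q := if b then scp br Q else scm br Q.
Lemma btauP b Q : node Q -> formal_coord (bpt b Q) (btau b Q).
Proof. by move=> /(br_coord br) [h1 h2]; case: b. Qed.
Lemma bptE b Q : node Q -> eta (bpt b Q) = Q.
Proof. by move=> /(br_fiber br) [_ h]; case: b; apply/h; [left | right]. Qed.
Lemma bpt_inj b b' Q : node Q -> bpt b Q = bpt b' Q -> b = b'.
Proof. by move=> /(br_fiber br) [h _]; case: b; case: b' => // e; case: h. Qed.
Lemma fib_bpt Q P : node Q -> eta P = Q -> exists b, P = bpt b Q.
Proof. by move=> /(br_fiber br) [_ h] /h [->|->]; [exists true | exists false]. Qed.
Definition bq b Q (hQ : node Q) := AutTorsor (btauP b hQ).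
Lemma over_nodeP P tau : over_node br P tau -> exists b Q (hQ : node Q), P = apt (bq b hQ) /\ tau = acoord (bq b hQ).
Proof.
by move=> [Q hQ [[-> ->]|[-> ->]]]; [exists true, Q, hQ | exists false, Q, hQ].
Qed.
Lemma over_bq b Q (hQ : node Q) : over_node br (apt (bq b hQ)) (acoord (bq b hQ)).
Proof. by exists Q => //; case: b; [left | right]. Qed.

Lemma nonnode_near Q : ~ node Q -> \forall x \near Q, ~ node x.
Proof. by move=> nQ; have [/(smooth_near hV)|] := hC.2 Q. Qed.

Lemma near_eta P (B : set C) : (\forall x \near eta P, B x) -> \forall y \near P, B (eta y).
Proof.
move=> /nearP [W [oW WP WB]]; have [oW' _] := hm oW.
by apply/nearP; exists (eta @^-1` W); split=> // y /WB.
Qed.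

Lemma open_off U : open U -> open (off_nodes eta U).
Proof.
move=> oU; apply: openN => P [UP nP]; have n1 := open_near oU UP.
have n2 := near_eta (nonnode_near nP); near=> y; split; near: y => //.
Unshelve. all: by end_near.
Qed.
Lemma off_sub U : off_nodes eta U `<=` U. Proof. by move=> x []. Qed.

Lemma fib_near Q (B : set Ct) : (forall y, eta y = Q -> \forall z \near y, B z) ->
  \forall x \near Q, forall y, eta y = x -> B y.
Proof.
move=> h; pose N : set Ct := [set y | nbhs y B].
have oN : open N.
  apply: openN => y /nearP [W [oW Wy WB]]; apply/nearP; exists W; split=> // z Wz.
  by apply/nearP; exists W.
have n1 := fib_closed hV hX hm hf oN h; near=> x => y ey.
have h1 : forall y, eta y = x -> N y by near: x.
exact: near_pt (h1 y ey).
Unshelve. all: by end_near.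
Qed.

Lemma nonnode_nbhd Q U : ~ node Q -> open U -> U Q ->
  exists W t, [/\ open W, W Q, W `<=` U, coordinate (eta @^-1` W) t & forall x, W x -> ~ node x].
Proof.
move=> nQ oU UQ; have [U0 [aU0 U0Q]] := affine_at hV Q.
have [aU' _] := hf aU0; have [l hl] := fib_finite hV hX hm hf Q.
have [tauY hY] := choice (fun y : Ct => formal_of_smooth hX (hS.2 y)).
have oU' : open (eta @^-1` U0) by case: aU'.
have [|u ru hu] := unif_seq (l := [seq y <- l | `[< eta y = Q >]]) hX aU' hY.
  by move=> y; rewrite mem_filter => /andP[/asboolP ey _]; rewrite /= ey.
have n1 : \forall x \near Q, forall y, eta y = x -> germ y u /\ exists tau', centred u y tau'.
  apply: fib_near => y ey; apply: (coord_near hX hS.2 (hY y)).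
    by apply: (germ_of oU' _ ru); rewrite /= ey.
  by apply: hu; rewrite mem_filter hl // andbT; apply/asboolP.
have n2 := open_near oU UQ; have n3 := nonnode_near nQ.
have : \forall x \near Q, [/\ U x, ~ node x & forall y, eta y = x -> germ y u /\ exists tau', centred u y tau'].
  by near=> x; split; near: x.
move=> /nearP [W [oW WQ hW]]; have [oW' _] := hm oW.
exists W, u; split=> //.
- by move=> x /hW[].
- split; first by apply: (reg_germ hX oW') => y /hW[_ _ /(_ y erefl) []].
  by move=> y /hW[_ _ /(_ y erefl) []].
- by move=> x /hW[].
Unshelve. all: by end_near.
Qed.

Lemma node_nbhd Q U : node Q -> open U -> U Q -> exists W r Wp Wm,
  [/\ open W, W Q, W `<=` U, forall x, W x -> node x -> x = Q & forall y, W (eta y) -> Wp y \/ Wm y] /\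
  [/\ open Wp, Wp (bpt true Q), Wp `<=` eta @^-1` U, coordinate Wp r &
      r (bpt true Q) = 0 /\ forall x, Wp x -> x <> bpt true Q -> r x != 0] /\
  [/\ open Wm, Wm (bpt false Q), Wm `<=` eta @^-1` U, coordinate Wm (fun x => (r x)^-1) &
      (r (bpt false Q))^-1 = 0 /\ forall x, Wm x -> x <> bpt false Q -> (r x)^-1 != 0] /\
  forall x, Wp x -> Wm x -> r x != 0.
Proof.
move=> hQ oU UQ; set Qp := bpt true Q; set Qm := bpt false Q.
have [U0 [aU0 U0Q]] := affine_at hV Q; have [aU' _] := hf aU0.
have oU' : open (eta @^-1` U0) by case: aU'.
have Up b : (eta @^-1` U0) (bpt b Q) by rewrite /= bptE.
have [f rf fn] := affine_sep aU' (Up true) (Up false) (fun e => ltac:(by have := bpt_inj hQ e)).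
have fn' : f Qm - f Qp != 0 by rewrite subr_eq0 eq_sym.
pose e y := (f y - f Qp) / (f Qm - f Qp).
have ge b : germ (bpt b Q) e.
  apply: (germM hX); last exact: germ_c; apply: (germB hX); last exact: germ_c.
  exact: (germ_of oU' (Up b) rf).
have [_ _ _ _ sur] := br_formal br hQ.
have [u0 gu0 hu0] := sur 2 (fun=> fX) (fun _ _ => erefl).
pose u := u0 \o eta.
have gu b : germ (bpt b Q) u.
  have [W [oW WQ rW]] := gu0; have [oW' hW'] := hm oW.
  by apply: (germ_of oW' _ (hW' _ rW)); rewrite /= bptE.
have tu b i : (i < 2)%N -> (btau b Q u : fps k) i = fX i.
  by move=> /(hu0 b); case: b.
have u_0 b : u (bpt b Q) = 0 by rewrite -(fc0 hX (btauP b hQ) (gu b)) tu.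
have [ga gb a0 b0 [gr r1]] := sepn_coord hS (btauP true hQ) (ge true) (gu true)
  (ltac:(by rewrite /e subrr mul0r)) (u_0 true) (tu true 1%N isT).
set a := sepn e u in ga a0 gr r1; set b := sepn (fun y => 1 - e y) u in gb b0 gr r1.
have Ea : sepn (fun y => 1 - (1 - e y)) u = a.
  by congr (sepn _ u); apply: funext => y; rewrite opprB addrC subrK.
have gm1 : germ Qm (fun y => 1 - e y) by apply: (germB hX); [exact: germ_c | exact: (ge false)].
have em : 1 - e Qm = 0 by rewrite /e divff // subrr.
have := sepn_coord hS (btauP false hQ) gm1 (gu false) em (u_0 false) (tu false 1%N isT).
rewrite Ea -/b => -[gb' ga' bm am [gr' r1']].
pose r y := a y / b y.
have E1 : (fun y => b y / a y) = (fun y => (r y)^-1) by apply: funext => y; rewrite /r invf_div.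
rewrite E1 in gr' r1'.
have n1 := open_near oU UQ.
have np : \forall x \near Qp, U (eta x) /\ b x != 0.
  have m1 : \forall x \near Qp, U (eta x) by apply: near_eta; rewrite bptE.
  have m2 : \forall x \near Qp, b x != 0 by apply: (near_neq0 hX gb); rewrite b0 oner_eq0.
  by near=> x; split; near: x.
have nm : \forall x \near Qm, U (eta x) /\ a x != 0.
  have m1 : \forall x \near Qm, U (eta x) by apply: near_eta; rewrite bptE.
  have m2 : \forall x \near Qm, a x != 0 by apply: (near_neq0 hX ga'); rewrite am oner_eq0.
  by near=> x; split; near: x.
have rp0 : r Qp = 0 by rewrite /r a0 mul0r.
have rm0 : (r Qm)^-1 = 0 by rewrite /r bm invr0 mulr0 invr0.
have rpn : (btau true Q r : fps k) 1%N != 0 by rewrite [X in X != 0]r1 oner_eq0.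
have rmn : (btau false Q (fun y => (r y)^-1) : fps k) 1%N != 0 by rewrite [X in X != 0]r1' oner_eq0.
have [Wp [oWp WpQ Wps cp pn]] := unif_nbhd hS (btauP true hQ) gr rp0 rpn np.
have [Wm [oWm WmQ Wms cm mn]] := unif_nbhd hS (btauP false hQ) gr' rm0 rmn nm.
have n2 : \forall x \near Q, forall y, eta y = x -> Wp y \/ Wm y.
  apply: fib_near => y /(fib_bpt hQ) [[] ->].
    have m := open_near oWp WpQ; near=> z; left; near: z => //.
  have m := open_near oWm WmQ; near=> z; right; near: z => //.
have n3 := node_isolated hV hQ.
have : \forall x \near Q, [/\ U x, node x -> x = Q & forall y, eta y = x -> Wp y \/ Wm y].
  by near=> x; split; near: x.
move=> /nearP [W [oW WQ hW]].
exists W, r, Wp, Wm; split; last split; last split.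
- split=> //; first by move=> x /hW[].
    by move=> x /hW[].
  by move=> y /hW[_ _ h]; exact: h.
- by split=> // x /Wps[].
- by split=> // x /Wms[].
- move=> x /Wps [_ bx] /Wms [_ ax]; by rewrite mulf_neq0 ?invr_neq0.
Unshelve. all: by end_near.
Qed.

Lemma lat_at U sg b Q (hQ : node Q) : open U -> Vtilde R br U sg -> U (bpt b Q) ->
  lat A 0 (vexpT A (- fX) (Jet R sg (bq b hQ))).
Proof.
move=> oU [hsg h] UP; have [S hE hL] := h _ _ UP (over_bq b hQ).
by rewrite -(expansion_inv (q := bq b hQ) hS oU hsg UP hE); apply/latticeE.
Qed.

Lemma Vt_intro W v : open W -> E W v -> (forall b Q (hQ : node Q), W (bpt b Q) ->
  lat A 0 (vexpT A (- fX) (Jet R v (bq b hQ)))) -> Vtilde R br W v.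
Proof.
move=> oW hv h; split=> // P tau WP /over_nodeP [b [Q [hQ [eP et]]]].
rewrite eP in WP *; rewrite et.
exists (vexpT A (- fX) (Jet R v (bq b hQ))); first exact: (expansion_of hS oW hv WP).
by apply/latticeE; exact: h.
Qed.

Lemma nonnode_local n U sg W t : open U -> E U sg -> open W -> W `<=` U -> coordinate W t ->
  exists v p, [/\ forall i : 'I_n.+1, E W (v i),
     forall i m W', open W' -> W' `<=` W -> pp_section (M := k^o) id (@reg _ Ct) m W' (p i) &
     forall P, W P -> modJ ap E n P (Th R n sg P) (tens_sum v p P)].
Proof.
move=> oU hsg oW WU ht; have [qs hqs] := coord_sec hS ht; have [rt _] := ht.
exists (fun i : 'I_n.+1 => wsec R t qs sg i), (fun (i : 'I_n.+1) (_ : Ct) x y => (t y - t x) ^+ i); split.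
- by move=> i; exact: (wsec_V hS oW ht hqs oU hsg WU).
- move=> i m W' oW' W'W; apply: (pp_const m oW').
  have EZ W1 f (s : Ct -> k^o) : open W1 -> reg (f := Ct) W1 f -> reg (f := Ct) W1 s -> reg (f := Ct) W1 (fun z => f z *: s z).
    by move=> oW1 rf rs; exact: (regM hS).
  have t1 : tensO id (M := k^o) (@reg _ Ct) W' (fun _ _ => 1).
    apply: (tens_ext (tens_gen id (reg_c hS 1 oW') (reg_c hS 1 oW'))) => x y _ _.
    by rewrite scale1r.
  apply: (tens_ext (tens_delta hS EZ i oW' (reg_res hX oW oW' W'W rt) t1)) => x y _ _.
  by rewrite -[LHS]/(_ * _) mulr1.
- move=> P WP; apply: (jrep_crit hS oU (WU _ WP) (fun q _ j _ => erefl (Jet R sg q j))).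
    exact: (ThP hS n oU hsg (WU _ WP)).
  exact: (jrep_w hS oW ht hqs oU hsg WU).
Qed.

Lemma log_delta (W : set Ct) r (q : autTorsor Ct) n j : open W -> W (apt q) -> coordinate W r -> r (apt q) = 0 ->
  (forall x, W x -> x <> apt q -> r x != 0) -> (j <= n)%N ->
  log_expansion (apt q) (acoord q) n (fun _ x y => (r y / r x - 1) ^+ j) (lcf (muq q r) j).
Proof.
move=> oW Wq hr r0 rn jn.
have -> : lcf (muq q r) j = (fun l => \sum_(i < n.+1) fcst ((i == j :> nat)%:R : k) * lcf (muq q r) i l).
  apply: funext => l; rewrite (bigD1 (Ordinal (jn : j < n.+1)%N)) //= eqxx rmorph1 mul1r big1 ?addr0 //.
  by move=> i; rewrite -val_eqE /= => /negbTE ->; rewrite rmorph0 mul0r.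
apply: (log_expansion_of (b := fun i => (i == j)%:R) hS oW Wq hr r0 rn) => P WP _.
apply: (modJ_ext (M := k^o) _ n oW WP) => x y _ _.
rewrite (bigD1 (Ordinal (jn : j < n.+1)%N)) //= eqxx mul1r big1 ?addr0 //.
by move=> i; rewrite -val_eqE /= => /negbTE ->; rewrite mul0r.
Qed.

Lemma branch_nbhd b Q U : node Q -> open U -> U (bpt b Q) -> exists W r,
  [/\ open W, W (bpt b Q), W `<=` U, coordinate W r & r (bpt b Q) = 0 /\
   [/\ forall x, W x -> x <> bpt b Q -> r x != 0, forall x, W x -> node (eta x) -> eta x = Q &
     forall b', W (bpt b' Q) -> b' = b]].
Proof.
move=> hQ oU UP; have [W0 [r [oW0 W0P W0U hr r0]]] := coord_ex hS oU UP.
have [qs hqs] := coord_sec hS hr.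
have gr := coord_germ oW0 hr W0P.
have r1 : (btau b Q r : fps k) 1%N != 0.
  by have [_ /eqP] := muq_AutO (q := bq b hQ) hS oW0 hr hqs W0P.
have n1 := open_near oU UP.
have n2 : \forall x \near bpt b Q, node (eta x) -> eta x = Q.
  by apply: (near_eta (B := fun x => node x -> x = Q)); rewrite bptE //; exact: (node_isolated hV hQ).
have n3 : \forall x \near bpt b Q, x <> bpt (~~ b) Q.
  by apply: (near_neq hX) => /(bpt_inj hQ); case: b {r1 UP W0P n1 n2 gr r0}.
have nA : \forall x \near bpt b Q, [/\ U x, node (eta x) -> eta x = Q & x <> bpt (~~ b) Q].
  by near=> x; split; near: x.
have [W [oW WP WA hr' rn]] := unif_nbhd hS (btauP b hQ) gr r0 r1 nA.
exists W, r; split=> //; first by move=> x /WA[].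
split=> //; split=> //; first by move=> x /WA[].
move=> b' /WA[_ _ h]; case: b b' h {r1 UP W0P n1 n2 n3 gr r0 nA rn WP WA} => [] [] // h; by case: h.
Unshelve. all: by end_near.
Qed.

Lemma Vtilde_tens_log n (U : set Ct) sg : open U -> Vtilde R br U sg ->
  tens_log R eta id (Vtilde R br) (PCt_log br) n U (Th R n sg).
Proof.
move=> oU hsg; have [hE _] := hsg; split.
  by apply: (Th_section hS); [exact: open_off | exact: (Vsheaf_res (@off_sub U))].
move=> P UP; have [nP|nP] := pselect (node (eta P)); last first.
  have oO := open_off oU.
  have [W [t [oW WP WO ht _]]] := coord_ex hS oO (conj UP nP : off_nodes eta U P).
  have WU : W `<=` U by move=> x /WO[].
  have [v [p [h1 h2 h3]]] := nonnode_local n oU hE oW WU ht.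
  have noov P' tau : W P' -> ~ over_node br P' tau.
    by move=> /WO [_ no] /over_nodeP [b [Q [hQ [eP' _]]]]; apply: no; rewrite eP' /= bptE.
  exists W, n.+1, v, p; split=> //.
    move=> i; split; first by split=> // P' tau WP' /(noov _ _ WP').
    split; last by move=> P' tau WP' /(noov _ _ WP').
    by apply: h2; [exact: open_off | exact: off_sub].
  by move=> P' [] WP' _; exact: h3.
have [b eP] := fib_bpt nP (erefl (eta P)).
move: (eta P) nP eP UP => Q hQ -> {P} UP.
have [W [r [oW WP WU hr [r0 [rn iso1 iso2]]]]] := branch_nbhd hQ oU UP.
have [qs hqs] := coord_sec hS hr; have [rr _] := hr.
have ov b' Q' (hQ' : node Q') : W (bpt b' Q') -> Q' = Q /\ b' = b.
  move=> W'; have e : Q' = Q by have := iso1 _ W'; rewrite bptE //; exact.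
  by split=> //; apply: iso2; rewrite -e.
exists W, n.+1, (fun i : 'I_n.+1 => logsec R r qs sg i), (fun (i : 'I_n.+1) (_ : Ct) x y => (r y / r x - 1) ^+ i).
split=> //.
  move=> i; split.
    apply: Vt_intro => //; first exact: (logsec_V hS oW hr hqs oU hE WU).
    move=> b' Q' hQ' W'; have [eQ eb] := ov _ _ hQ' W'; subst Q' b'.
    apply: (logexp_lat (q := bq b hQ') hS oW hr hqs oU hE WU WP r0 i _).1.
    exact: (lat_at hQ' oU hsg UP).
  have oO := open_off oW.
  have rO x : off_nodes eta W x -> r x != 0.
    by move=> [Wx nx]; apply: rn => // e; apply: nx; rewrite e bptE.
  split.
    by apply: (pp_const n oO); apply: (tens_pow hS i oO (reg_res hX oW oO (@off_sub W) rr) rO).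
  move=> P' tau W' /over_nodeP [b' [Q' [hQ' [eP' ->]]]]; rewrite eP' in W' *.
  have [eQ eb] := ov _ _ hQ' W'; subst Q' b'.
  exists (lcf (muq (bq b hQ') r) i).
  by apply: (log_delta (q := bq b hQ') oW WP hr r0 rn); rewrite -ltnS.
move=> P [WP' nP]; have rP : r P != 0 by apply: rn => // e; apply: nP; rewrite e bptE.
apply: (jrep_crit hS oU (WU _ WP') (fun q _ j _ => erefl (Jet R sg q j))).
  exact: (ThP hS n oU hE (WU _ WP')).
exact: (jrep_logsec hS oW hr hqs oU hE WU n WP' rP).
Qed.
End Nodal.

Section NodalC.
Variables (k : closedFieldType) (V : lmodType k) (A : gradedVA V).
Variables (R : autOAction A) (L : moebius A).
Variables (C Ct : funSpace k) (eta : Ct -> C).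
Hypotheses (hC : nodal_curve C) (heta : normalization eta).
Variable br : branches eta.
Let hS : smooth_curve Ct. Proof. by case: heta. Qed.
Let hX : variety Ct := hS.1.
Let hm : morphism_of_varieties eta. Proof. by case: heta. Qed.
Local Notation E := (Vsheaf R (X := Ct)).
Local Notation ap := (@apt k Ct).
Local Notation gam := (sgamma k : fps k).
Implicit Types (Q : C) (P : Ct) (b : bool) (sg : autTorsor Ct -> V) (q : autTorsor Ct).

Section AtNode.
Variables (n : nat) (U : set C) (sg : autTorsor Ct -> V).
Hypotheses (oU : open U) (hsg : VC R L br U sg).
Variables (Q : C) (hQ : node Q) (UQ : U Q).
Variables (W : set C) (r : Ct -> k) (Wp Wm : set Ct).
Hypotheses (oW : open W) (WQ : W Q) (WU : W `<=` U).
Hypothesis iso : forall x, W x -> node x -> x = Q.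
Hypothesis cov : forall y, W (eta y) -> Wp y \/ Wm y.
Hypotheses (oWp : open Wp) (WpQ : Wp (bpt br true Q)) (Wps : Wp `<=` eta @^-1` U).
Hypotheses (cp : coordinate Wp r) (rp0 : r (bpt br true Q) = 0).
Hypothesis rpn : forall x, Wp x -> x <> bpt br true Q -> r x != 0.
Local Notation r' := (fun x => (r x)^-1).
Hypotheses (oWm : open Wm) (WmQ : Wm (bpt br false Q)) (Wms : Wm `<=` eta @^-1` U).
Hypotheses (cm : coordinate Wm r') (rm0 : (r (bpt br false Q))^-1 = 0).
Hypothesis rmn : forall x, Wm x -> x <> bpt br false Q -> (r x)^-1 != 0.
Hypothesis rpm : forall x, Wp x -> Wm x -> r x != 0.
Variables (qp qm : Ct -> autTorsor Ct).
Hypothesis hqp : forall x, Wp x -> apt (qp x) = x /\ centred r x (acoord (qp x)).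
Hypothesis hqm : forall x, Wm x -> apt (qm x) = x /\ centred r' x (acoord (qm x)).

Let oU' : open (eta @^-1` U). Proof. by case: (hm oU). Qed.
Let hE : E (eta @^-1` U) sg. Proof. by case: hsg => -[]. Qed.
Let oW' : open (eta @^-1` W). Proof. by case: (hm oW). Qed.
Let wp l := logsec R r qp sg l.
Let wm l := logsec R r' qm sg l.
Let wpV l : E Wp (wp l). Proof. exact: (logsec_V hS oWp cp hqp oU' hE Wps). Qed.
Let wmV l : E Wm (wm l). Proof. exact: (logsec_V hS oWm cm hqm oU' hE Wms). Qed.

Lemma dlg_swap q l i : germ (apt q) r -> r (apt q) != 0 -> (i <= n)%N ->
  (dlg q r' ^+ l) i = \sum_(j < n.+1) (gam ^+ l) j * (dlg q r ^+ j) i.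
Proof.
move=> gr r0 ile; apply: gam_pow => //; last first.
  by apply: gam_solve; [rewrite /dlg fcstM muq0 mulr0 | exact: (dlg_inv hS)].
by rewrite /dlg fcstM muq0 mulr0.
Qed.

(* dlog s_+ = gamma(dlog s_-), hence the coefficient of (dlog s_+)^l is the sum over j
   of (gamma^j)_l times that of (dlog s_-)^j. *)
Definition wnode l q := if `[< Wp (apt q) >] then wp l q else
  \sum_(j < n.+1) (gam ^+ j) l *: wm j q.

Lemma wnode_p l q : Wp (apt q) -> wnode l q = wp l q.
Proof. by rewrite /wnode => /asboolT ->. Qed.

Lemma wnode_m l q : (l <= n)%N -> Wm (apt q) -> wnode l q = \sum_(j < n.+1) (gam ^+ j) l *: wm j q.
Proof.
move=> ln Wq; rewrite /wnode; case: asboolP => // Wpq; apply/eqP; rewrite -subr_eq0; apply/eqP.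
have r0 := rpm Wpq Wq; have gr := coord_germ oWp cp Wpq.
have d1 : dlg q r 1%N != 0.
  rewrite /dlg fcstM mulf_neq0 ?invr_neq0 //.
  by have [_ /eqP] := muq_AutO hS oWp cp hqp Wpq.
apply: (pow_uniq (d := dlg q r) (n := n) (c := fun l => wp l q - \sum_(j < n.+1) (gam ^+ j) l *: wm j q)) => //.
  by rewrite /dlg fcstM muq0 mulr0.
move=> i ile; under eq_bigr do rewrite scalerBr.
rewrite sumrB -(Jet_logsec hS oWp cp hqp oU' hE Wps Wpq r0 ile).
rewrite (Jet_logsec hS oWm cm hqm oU' hE Wms (q := q) Wq _ ile) ?invr_neq0 //.
apply/eqP; rewrite subr_eq0; apply/eqP.
under [RHS]eq_bigr do rewrite scaler_sumr.
rewrite exchange_big; apply: eq_bigr => j _ /=.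
rewrite (dlg_swap _ gr r0 ile) scaler_suml; apply: eq_bigr => l' _.
by rewrite [RHS]scalerA mulrC.
Qed.

Let WpI : open (eta @^-1` W `&` Wp). Proof. exact: openI. Qed.
Let WmI : open (eta @^-1` W `&` Wm). Proof. exact: openI. Qed.

Let wmsV l : E Wm (fun q => \sum_(j < n.+1) (gam ^+ j) l *: wm j q).
Proof.
apply: (Vsheaf_sum hS oWm) => j.
exact: (VsheafZ hS oWm (reg_c hS ((gam ^+ j) l) oWm) (wmV j)).
Qed.

Lemma wnode_V l : (l <= n)%N -> E (eta @^-1` W) (wnode l).
Proof.
move=> ln; apply: Vsheaf_glue => y Wy; have [Wpy|Wmy] := cov Wy.
  exists Wp; split=> //; apply: (Vsheaf_ext hS _ oWp (wpV l)) => q Wq.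
  by rewrite wnode_p.
exists Wm; split=> //; apply: (Vsheaf_ext hS _ oWm (wmsV l)) => q Wq.
by rewrite wnode_m.
Qed.

Let Wb b : (eta @^-1` W) (bpt br b Q). Proof. by rewrite /= bptE. Qed.
Let eJ (h : node Q) b sg' := vexpT A (- fX) (Jet R sg' (bq br b h)).

Lemma logexp_wnode_p (h : node Q) l : (l <= n)%N -> eJ h true (wnode l) = logexp R r qp sg (bq br true h) l.
Proof.
move=> ln; rewrite /eJ /logexp; congr vexpT; apply: (Jet_ext hS WpI).
- by apply: (Vsheaf_res _ (wnode_V ln)) => x [].
- by apply: (Vsheaf_res _ (wpV l)) => x [].
- by split; [exact: Wb | exact: WpQ].
- by move=> q [_ Wq]; rewrite wnode_p.
Qed.

Lemma logexp_wnode_m (h : node Q) l : (l <= n)%N -> eJ h false (wnode l) =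
  \sum_(j < n.+1) fcst ((gam ^+ j) l) *: logexp R r' qm sg (bq br false h) j.
Proof.
move=> ln; have X0 : (- fX : fps k) 0%N = 0 by rewrite fpsN /fX oppr0.
have WmQ' : Wm (apt (bq br false h)) by exact: WmQ.
rewrite /eJ; transitivity (vexpT A (- fX) (Jet R (fun q => \sum_(j < n.+1) (gam ^+ j) l *: wm j q) (bq br false h))).
  congr vexpT; apply: (Jet_ext hS WmI).
  - by apply: (Vsheaf_res _ (wnode_V ln)) => x [].
  - by apply: (Vsheaf_res _ (wmsV l)) => x [].
  - by split; [exact: Wb | exact: WmQ].
  - by move=> q [_ Wq]; rewrite wnode_m.
rewrite (Jet_sum hS oWm (F := fun j q => (gam ^+ j) l *: wm j q)) //; last first.
  by move=> j; exact: (VsheafZ hS oWm (reg_c hS ((gam ^+ j) l) oWm) (wmV j)).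
rewrite vexpT_sum; apply: eq_bigr => j _.
rewrite (JetZ (f := fun=> (gam ^+ j) l) hS oWm (reg_c hS _ oWm) (wmV j) WmQ').
by rewrite (fc_c (acoordP _)) vexpTZ.
Qed.

Let lat0 b (h : node Q) : lat A 0 (eJ h b sg).
Proof. by case: hsg => hVt _; apply: (lat_at heta h oU' hVt); rewrite /= bptE. Qed.

Let omp (h : node Q) l := logexp_lat (q := bq br true h) hS oWp cp hqp oU' hE Wps WpQ rp0 l (lat0 true h).
Let omm (h : node Q) l := logexp_lat (q := bq br false h) hS oWm cm hqm oU' hE Wms WmQ rm0 l (lat0 false h).

Lemma wnode_VC l : (l <= n)%N -> VC R L br W (wnode l).
Proof.
move=> ln; split.
  apply: (Vt_intro heta oW' (wnode_V ln)) => b Q' hQ' WQ'.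
  have e : Q' = Q by apply: iso => //; move: WQ'; rewrite /= bptE.
  subst Q'; case: b WQ' => WQ'; rewrite -/(eJ hQ' _ _).
    by rewrite (logexp_wnode_p hQ' ln); case: (omp hQ' l).
  rewrite (logexp_wnode_m hQ' ln); apply: lat_sum => j _; apply: latZ.
  by case: (omm hQ' j).
move=> Q' hQ' WQ'; have e := iso WQ' hQ'; subst Q'.
have Wt : (eta @^-1` W) (apt (bq br true hQ')) by exact: (Wb true).
have Wf : (eta @^-1` W) (apt (bq br false hQ')) by exact: (Wb false).
exists (eJ hQ' true (wnode l)), (eJ hQ' false (wnode l)); split.
- exact: (expansion_of hS oW' (wnode_V ln) Wt).
- exact: (expansion_of hS oW' (wnode_V ln) Wf).
have [_ hN] := hsg; have [Sp [Sm [e1 e2 hl]]] := hN Q hQ' UQ.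
have Ut : (eta @^-1` U) (apt (bq br true hQ')) by rewrite /= (bptE br true hQ').
have Uf : (eta @^-1` U) (apt (bq br false hQ')) by rewrite /= (bptE br false hQ').
rewrite (expansion_inv (q := bq br true hQ') hS oU' hE Ut e1) in hl.
rewrite (expansion_inv (q := bq br false hQ') hS oU' hE Uf e2) in hl.
have h1 := node_lg l hl; rewrite (logexp_wnode_p hQ' ln) (logexp_wnode_m hQ' ln).
have h2 : node_lattice L (logexp R r qp sg (bq br true hQ') l - lg A l (eJ hQ' true sg),
  \sum_(j < l.+1) fcst ((gam ^+ j) l) *: (logexp R r' qm sg (bq br false hQ') j - lg A j (eJ hQ' false sg))).
  apply: node_lat1; first by case: (omp hQ' l).
  by apply: lat_sum => j _; apply: latZ; case: (omm hQ' j).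
have := zspan_add h1 h2; rewrite /GRing.add /=; congr (zspan _ (_, _)).
  by rewrite -[LHS]/(_ + _ : vser V) addrC subrK.
rewrite -[LHS]/(_ + _ : vser V) -big_split /=.
rewrite -(sum_widen0 (n := l.+1) (N := n.+1) (F := fun j => fcst ((gam ^+ j) l) *: logexp R r' qm sg (bq br false hQ') j)) //.
  by apply: eq_bigr => j _; rewrite -scalerDr addrC subrK.
by move=> m lm; rewrite ordX // rmorph0 scale0r.
Qed.

Definition pnode l (P x y : Ct) : k := (r y / r x - 1) ^+ l.

Lemma off_r x : W (eta x) -> ~ node (eta x) -> germ x r /\ r x != 0.
Proof.
move=> Wx nx; have [Wpx|Wmx] := cov Wx.
  split; first exact: (coord_germ oWp cp).
  by apply: rpn => // e; apply: nx; rewrite e bptE.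
have gV := coord_germ oWm cm Wmx.
have r0 : (r x)^-1 != 0 by apply: rmn => // e; apply: nx; rewrite e bptE.
split; last by rewrite -invr_eq0.
apply: (germ_ext hX (germ_inv hX gV r0)); apply: nearW => y; exact: invrK.
Qed.

Lemma pnode_PC l : (l <= n)%N -> PC_log br n W (pnode l).
Proof.
move=> ln; have oO := open_off hC heta oW'.
have rO : reg (off_nodes eta (eta @^-1` W)) r.
  by apply: (reg_germ hX oO) => x [Wx nx]; case: (off_r Wx nx).
have r0 x : off_nodes eta (eta @^-1` W) x -> r x != 0 by move=> [Wx nx]; case: (off_r Wx nx).
split; first by apply: (pp_const n oO); exact: (tens_pow hS l oO rO r0).
move=> Q' hQ' WQ'; have e := iso WQ' hQ'; subst Q'.
set qP := bq br true hQ'; set qM := bq br false hQ'.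
have WpQ' : Wp (apt qP) by exact: WpQ.
have WmQ' : Wm (apt qM) by exact: WmQ.
have hmu := muq_AutO hS oWp cp hqp WpQ'; have hmu' := muq_AutO hS oWm cm hqm WmQ'.
pose cm' l' : fps k := \sum_(j < n.+1) fcst ((gam ^+ l) j) * lcf (muq qM r') j l'.
exists (lcf (muq qP r) l), cm', (fun j => \sum_(l' < n.+1) fcst ((gam ^+ l') j) * cm' l' : fps k).
have cm0 l' : (l' <= n)%N -> cm' l' 0%N = (gam ^+ l) l'.
  move=> l'n; rewrite /cm' fps_sum (bigD1 (Ordinal (l'n : l' < n.+1)%N)) //= fcstM (lcf0 hmu') eqxx mulr1.
  rewrite big1 ?addr0 // => i; rewrite -val_eqE /= => /negbTE h.
  by rewrite fcstM (lcf0 hmu') h mulr0.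
split.
- exact: (log_delta heta (q := qP) oWp WpQ' cp rp0 rpn).
- apply: (log_expansion_of (b := fun j => (gam ^+ l) j) hS oWm WmQ' cm rm0 rmn) => P WP PQ.
  have rV0 := rmn WP PQ.
  have [W1 [oW1 W1P hW1]] : exists W1, [/\ open W1, W1 P & W1 `<=` [set x | Wm x /\ r x != 0]].
    have gV := coord_germ oWm cm WP.
    have := near_neq0 hX gV rV0 => /nearP [W2 [oW2 W2P h2]].
    exists (W2 `&` Wm); split=> //; first exact: openI.
    by move=> x [/h2 h Wx]; split=> //; rewrite -invr_eq0.
  have oWm1 : W1 `<=` Wm by move=> x /hW1[].
  have cV := coord_res hS oWm oW1 oWm1 cm.
  have rW1 : reg W1 r.
    apply: (reg_germ hX oW1) => x /hW1 [Wmx rx0]; have gV := coord_germ oWm cm Wmx.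
    have rx : (r x)^-1 != 0 by rewrite invr_eq0.
    by apply: (germ_ext hX (germ_inv hX gV rx)); apply: nearW => y; exact: invrK.
  apply: (pow_swap hS oW1 W1P cV rW1 _ ln) => x /hW1[//].
- move=> j jn; rewrite (lcf0 hmu) fps_sum.
  under eq_bigr => l' _ do rewrite fcstM (cm0 l' (ltn_ord l')) mulrC.
  by rewrite (sgamma_orth _ _ (jn : j < n.+1)%N) eq_sym.
- move=> l' l'n i; under [RHS]eq_bigr => j _ do rewrite sexpE fps_sum mulr_sumr.
  rewrite exchange_big /=.
  have -> : cm' l' i = \sum_(l2 < n.+1) (l' == l2 :> nat)%:R * cm' l2 i.
    rewrite (bigD1 (Ordinal (l'n : l' < n.+1)%N)) //= eqxx mul1r big1 ?addr0 //.
    by move=> j; rewrite -val_eqE /= eq_sym => /negbTE ->; rewrite mul0r.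
  apply: eq_bigr => l2 _.
  under [RHS]eq_bigr => j _ do rewrite fcstM mulrA [_ * (gam ^+ l2) j]mulrC.
  by rewrite -mulr_suml (sgamma_orth _ _ (l'n : l' < n.+1)%N).
Qed.

Lemma node_pp P : W (eta P) -> ~ node (eta P) ->
  modJ ap E n P (Th R n sg P) (fun q y => \sum_(i < n.+1) pnode i P (apt q) y *: wnode i q).
Proof.
move=> WP nP; have [gr r0] := off_r WP nP.
have UP : (eta @^-1` U) P by apply: WU.
have oO := open_off hC heta oW'.
have [Wpx|Wmx] := cov WP.
  apply: (jrep_crit hS oU' UP (fun q _ j _ => erefl (Jet R sg q j))).
    exact: (ThP hS n oU' hE UP).
  have h := jrep_logsec hS oWp cp hqp oU' hE Wps n Wpx r0.
  apply: (jrep_ext hS oWp Wpx _ h) => q y Wq _; apply: eq_bigr => j _.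
  by rewrite wnode_p.
pose W1 := off_nodes eta (eta @^-1` W) `&` Wm.
have oW1 : open W1 by exact: openI.
have W1P : W1 P by [].
have rW1 : reg W1 r by apply: (reg_germ hX oW1) => x [[Wx nx] _]; case: (off_r Wx nx).
have rn x : W1 x -> r x != 0 by move=> [[Wx nx] _]; case: (off_r Wx nx).
have hw j : (j <= n)%N -> E W1 (wnode j).
  by move=> jn; apply: (Vsheaf_res _ (wnode_V jn)) => x [[]].
apply: (jrep_crit hS oW1 W1P _ _ (jrep_pow hS oW1 W1P rW1 rn hw)); last exact: (ThP hS n oU' hE UP).
move=> q W1q i ile; have [[Wq nq] Wmq] := W1q.
have [grq rq] := off_r Wq nq.
rewrite (Jet_logsec hS oWm cm hqm oU' hE Wms (q := q) Wmq _ ile) ?invr_neq0 // vser_sum.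
under eq_bigr => j _ do rewrite (dlg_swap _ grq rq ile) scaler_suml.
rewrite exchange_big; apply: eq_bigr => j _ /=.
rewrite (wnode_m (ltn_ord j) Wmq) -[svec _ _ _]/((dlg q r ^+ j) i *: _) scaler_sumr.
by apply: eq_bigr => l _; rewrite [RHS]scalerA mulrC.
Qed.
End AtNode.

Lemma VC_tens_log n (U : set C) sg : open U -> VC R L br U sg ->
  tens_log R eta eta (VC R L br) (PC_log br) n U (Th R n sg).
Proof.
move=> oU hsg; have oU' : open (eta @^-1` U) by case: (hm oU).
have hE : E (eta @^-1` U) sg by case: hsg => -[].
split.
  by apply: (Th_section hS); [exact: (open_off hC heta) | exact: (Vsheaf_res (@off_sub _ _ _ _ _) hE)].
move=> Q UQ; have [hQ|nQ] := pselect (node Q).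
  have [W [r [Wp [Wm [[oW WQ WU iso cov] [[oWp WpQ Wps cp [rp0 rpn]] [[oWm WmQ Wms cm [rm0 rmn]] rpm]]]]]]]
    := node_nbhd hC heta br hQ oU UQ.
  have [qp hqp] := coord_sec hS cp; have [qm hqm] := coord_sec hS cm.
  exists W, n.+1, (fun i : 'I_n.+1 => wnode n sg r Wp qp qm i), (fun i : 'I_n.+1 => pnode r i).
  split=> //.
    move=> i; have hi : (i <= n)%N by rewrite -ltnS.
    split.
      exact: (wnode_VC oU hsg hQ UQ oW WQ iso cov oWp WpQ Wps cp rp0 oWm WmQ Wms cm rm0 rpm hqp hqm hi).
    exact: (pnode_PC hQ oW iso cov oWp WpQ cp rp0 rpn oWm WmQ cm rm0 rmn hqp hqm hi).
  move=> P [WP nP].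
  exact: (node_pp n oU hsg hQ oW WU cov oWp Wps cp rpn oWm Wms cm rmn rpm hqp hqm WP nP).
have [W [t [oW WQ WU ht nW]]] := nonnode_nbhd hC heta nQ oU UQ.
have oW' : open (eta @^-1` W) by case: (hm oW).
have WU' : eta @^-1` W `<=` eta @^-1` U by move=> x; exact: WU.
have [v [p [h1 h2 h3]]] := nonnode_local heta n oU' hE oW' WU' ht.
exists W, n.+1, v, p; split=> //.
  move=> i; split.
    split; last by move=> Q' hQ' /nW /(_ hQ').
    apply: (Vt_intro heta oW' (h1 i)) => b Q' hQ'; rewrite /= bptE // => /nW /(_ hQ') [].
  split; last by move=> Q' hQ' /nW /(_ hQ').
  by apply: h2; [exact: (open_off hC heta) | exact: off_sub].
by move=> P [WP _]; exact: h3.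
Qed.

End NodalC.

(** * The cocycle condition *)

Section Triple.
Variables (k : fieldType) (V : lmodType k) (A : gradedVA V) (R : autOAction A).
Variable X : funSpace k.
Hypothesis hS : smooth_curve X.
Let hX : variety X := hS.1.
Implicit Types (P x y z : X) (f g h t : X -> k) (U W : set X) (q : autTorsor X).
Implicit Types (sg : autTorsor X -> V).
Local Notation E := (Vsheaf R (X := X)).
Local Notation ap := (@apt k X).
Local Notation EZ := (VsheafZ (R := R) hS).
Local Notation Eres := (@Vsheaf_sub k V A R X).

Definition JJgen m n W : set (autTorsor X -> X -> X -> V) := [set D |
  exists sg g h, [/\ E W sg, reg W g, reg W h &
    (exists2 F : 'I_m.+1 -> X -> X -> k, forall l, Jker W (F l) &
       D = fun q y z => (g y * h z * \prod_l F l (ap q) y) *: sg q) \/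
    (exists2 F : 'I_n.+1 -> X -> X -> k, forall l, Jker W (F l) &
       D = fun q y z => (g y * h z * \prod_l F l y z) *: sg q)]].

Definition JJnul m n W (Xi : autTorsor X -> X -> X -> V) := exists2 D, zspan (JJgen m n W) D &
  forall q y z, W (ap q) -> W y -> W z -> Xi q y z = D q y z.

Lemma JJnul0 m n W : JJnul m n W (fun _ _ _ => 0).
Proof. by exists 0; [exact: zspan0|]. Qed.
Lemma JJnulD m n W Xi Xi' : JJnul m n W Xi -> JJnul m n W Xi' ->
  JJnul m n W (fun q y z => Xi q y z + Xi' q y z).
Proof.
move=> [D h e] [D' h' e']; exists (D + D'); first exact: zspan_add.
by move=> q y z Wq Wy Wz; rewrite e // e'.
Qed.
Lemma JJnul_ext m n W Xi Xi' : JJnul m n W Xi ->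
  (forall q y z, W (ap q) -> W y -> W z -> Xi q y z = Xi' q y z) -> JJnul m n W Xi'.
Proof. by move=> [D h e] e'; exists D => // q y z *; rewrite -e' // e. Qed.
Lemma JJnul_sum m n W N (F : 'I_N -> autTorsor X -> X -> X -> V) : (forall i, JJnul m n W (F i)) ->
  JJnul m n W (fun q y z => \sum_i F i q y z).
Proof.
elim: N F => [|N IH] F h.
  by apply: (JJnul_ext (JJnul0 m n W)) => q y z *; rewrite big_ord0.
apply: (JJnul_ext (JJnulD (h ord0) (IH _ (fun i => h (lift ord0 i))))) => q y z *.
by rewrite big_ord_recl.
Qed.

Lemma JJnul_modJJ m n P W Phi Psi : open W -> W P ->
  JJnul m n W (fun q y z => Phi q y z - Psi q y z) -> modJJ ap E m n P Phi Psi.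
Proof. by move=> oW WP [D h e]; exists W, D; split. Qed.

Lemma Jker_res W W' F : open W -> open W' -> W' `<=` W -> Jker W F -> Jker W' F.
Proof.
move=> oW oW' s [N [f [g [h1 h2 h3]]]]; exists N, f, g; split=> //.
  by move=> i; split; apply: (reg_res hX oW) => //; case: (h1 i).
by move=> x /s; exact: h3.
Qed.

Lemma JJnul_fst m n W W' t l D : open W -> open W' -> W' `<=` W -> reg W' t ->
  zspan (pgens ap E m.+1 W) D -> JJnul m n W' (fun q y z => (t z - t y) ^+ l *: D q y).
Proof.
move=> oW oW' s rt; elim=> [|_ D' [sg [g [F [h1 h2 h3 ->]]]] _ IH].
  by apply: (JJnul_ext (JJnul0 m n W')) => q y z *; rewrite scaler0.
have h i : JJnul m n W' (fun q y z => (((-1) ^+ i * 'C(l, i)%:R * g y * t y ^+ i) * t z ^+ (l - i) * \prod_l F l (ap q) y) *: sg q).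
  exists (fun q y z => (((-1) ^+ i * 'C(l, i)%:R * g y * t y ^+ i) * t z ^+ (l - i) * \prod_l F l (ap q) y) *: sg q) => //.
  apply: zspan_gen; exists sg, (fun y => (-1) ^+ i * 'C(l, i)%:R * g y * t y ^+ i), (fun z => t z ^+ (l - i)); split.
  - exact: (Vsheaf_res s h1).
  - apply: (regM hS oW'); last exact: (regX hS).
    apply: (regM hS oW' (reg_c hS ((-1) ^+ i * 'C(l, i)%:R) oW')); exact: (reg_res hX oW).
  - exact: (regX hS).
  - by left; exists F => // j; exact: (Jker_res oW).
apply: (JJnul_ext (JJnulD (JJnul_sum (fun i : 'I_l.+1 => h i)) IH)) => q y z _ _ _.
rewrite scalerDr; congr (_ + _); rewrite -scaler_suml scalerA; congr (_ *: _).
rewrite -mulr_suml mulrA; congr (_ * _).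
rewrite exprDn mulr_suml; apply: eq_bigr => i _.
by rewrite (exprNn (t y)); ring.
Qed.

Lemma JJnul_snd m n P h t qs W0 W T : open W0 -> coordinate W0 t ->
  (forall x, W0 x -> apt (qs x) = x /\ centred t x (acoord (qs x))) ->
  W0 P -> germ P h -> open W -> W P -> tensO ap E W T ->
  exists W1, [/\ open W1, W1 P & forall W', open W' -> W' `<=` W1 -> W' `<=` W ->
    JJnul m n W' (fun q y z => (h z - \sum_(l < n.+1) hd qs h l y * (t z - t y) ^+ l) *: T q y)].
Proof.
move=> oW0 ht hqs W0P gh oW WP tT.
pose E' (W' : set X) : set (autTorsor X * X -> V) := [set T | tensO ap E W' (fun q y => T (q, y))].
have EZ' W' f (s : autTorsor X * X -> V) : open W' -> reg W' f -> E' W' s -> E' W' (fun p => f p.2 *: s p).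
  by move=> oW' rf ts; exact: (tens_muly (Phi := fun q y => s (q, y)) hS oW' rf ts).
have [W1 [oW1 W1P hW1]] := JnE hS (pi := snd) EZ' (taylor hS oW0 ht hqs n W0P gh).
exists W1; split=> // W' oW' s1 s2.
have [|D hz hD] := hW1 W' (fun p => T p.1 p.2) oW' s1.
  exact: (tens_res hS Eres oW oW' s2 tT).
have : JJnul m n W' (fun q y z => D (q, y) z).
  elim: hz {hD} => [|_ D' [s [g [F [hs rg hF ->]]]] _ IH]; first exact: JJnul0.
  have [N [sg [g' [h1 h2]]]] := hs.
  have hi i : JJnul m n W' (fun q y z => (g' i y * g z * \prod_l F l y z) *: sg i q).
    exists (fun q y z => (g' i y * g z * \prod_l F l y z) *: sg i q) => //.
    apply: zspan_gen; exists (sg i), (g' i), g; case: (h1 i) => hE hr; split=> //.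
    by right; exists F.
  apply: (JJnul_ext (JJnulD (JJnul_sum hi) IH)) => q y z Wq Wy Wz.
  rewrite -[RHS]/(_ + D' (q, y) z); congr (_ + _).
  rewrite [s (q, y)](h2 q y Wq Wy) scaler_sumr; apply: eq_bigr => i _.
  by rewrite [RHS]scalerA -mulrA mulrC.
move/JJnul_ext; apply => q y z Wq Wy Wz.
exact: (esym (hD (q, y) z Wy Wz)).
Qed.

Definition JJrep W (Xi : autTorsor X -> X -> X -> V) := exists N (h : 'I_N -> X -> k) (T : 'I_N -> autTorsor X -> X -> V),
  (forall i, reg W (h i) /\ tensO ap E W (T i)) /\
  forall q y z, W (ap q) -> W y -> W z -> Xi q y z = \sum_i h i z *: T i q y.

Lemma JJrepD W Xi Xi' : JJrep W Xi -> JJrep W Xi' -> JJrep W (fun q y z => Xi q y z + Xi' q y z).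
Proof.
move=> [N [h [T [h1 h2]]]] [N' [h' [T' [h1' h2']]]].
exists (N + N')%N, (fun i => (ocat (fun i => (h i, T i)) (fun i => (h' i, T' i)) i).1),
  (fun i => (ocat (fun i => (h i, T i)) (fun i => (h' i, T' i)) i).2); split.
  exact: (ocatP (Q := fun p => reg W p.1 /\ tensO ap E W p.2)).
move=> q y z Wq Wy Wz; rewrite h2 // h2' //.
by rewrite (ocat_sum _ _ (fun p : (X -> k) * (autTorsor X -> X -> V) => p.1 z *: p.2 q y)).
Qed.

Lemma JJrep_ext W Xi Xi' : JJrep W Xi ->
  (forall q y z, W (ap q) -> W y -> W z -> Xi q y z = Xi' q y z) -> JJrep W Xi'.
Proof. by move=> [N [h [T [h1 h2]]]] e; exists N, h, T; split=> // q y z *; rewrite -e // h2. Qed.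

Lemma JJrep_gen W h T : reg W h -> tensO ap E W T -> JJrep W (fun q y z => h z *: T q y).
Proof.
move=> rh tT; exists 1%N, (fun=> h), (fun=> T); split=> // q y z *.
by rewrite big_ord1.
Qed.

Lemma JJrep_sum W N (F : 'I_N -> autTorsor X -> X -> X -> V) : (forall i, JJrep W (F i)) ->
  JJrep W (fun q y z => \sum_i F i q y z).
Proof.
elim: N F => [|N IH] F h.
  exists 0%N, (fun _ _ => 0), (fun _ _ _ => 0); split=> [[]//|q y z *].
  by rewrite !big_ord0.
apply: (JJrep_ext (JJrepD (h ord0) (IH _ (fun i => h (lift ord0 i))))) => q y z *.
by rewrite big_ord_recl.
Qed.

Lemma JJ_crit m n P W t qs Phi Psi (Phil Psil : nat -> autTorsor X -> X -> V) : open W -> W P ->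
  coordinate W t -> (forall x, W x -> apt (qs x) = x /\ centred t x (acoord (qs x))) ->
  JJrep W (fun q y z => Phi q y z - Psi q y z) ->
  (forall l, (l <= n)%N -> modJ ap E m P (Phil l) (Psil l)) ->
  (forall l, (l <= n)%N -> forall q y, W (ap q) -> W y -> exists S,
     HE y (acoord (qs y)) (fun z => Phi q y z - Psi q y z) S /\ S l = Phil l q y - Psil l q y) ->
  modJJ ap E m n P Phi Psi.
Proof.
move=> oW WP ht hqs [N [h [T [hT hX0]]]] hJ hl; have [rt _] := ht.
have H1 (i : 'I_N) := JJnul_snd m n oW ht hqs WP (germ_of oW WP (hT i).1) oW WP (hT i).2.
have [W1 hW1] := choice H1.
have H2 (l : 'I_n.+1) : exists WD : set X * (autTorsor X -> X -> V), [/\ open WD.1, WD.1 P,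
    zspan (pgens ap E m.+1 WD.1) WD.2 & forall q y, WD.1 (ap q) -> WD.1 y -> Phil l q y - Psil l q y = WD.2 q y].
  by have [W2 [D [a b c d]]] := hJ l (ltn_ord l); exists (W2, D).
have [WD hWD] := choice H2.
have : \forall x \near P, [/\ W x, forall i, W1 i x & forall l, (WD l).1 x].
  near=> x; split; near: x.
  - exact: open_near.
  - by apply: filter_forall => i; have [a b _] := hW1 i; exact: open_near.
  - by apply: filter_forall => i; have [a b _ _] := hWD i; exact: open_near.
move=> /nearP [W' [oW' W'P hW']].
have sW : W' `<=` W by move=> x /hW'[].
apply: (JJnul_modJJ oW' W'P).
have A1 i : JJnul m n W' (fun q y z => (h i z - \sum_(l < n.+1) hd qs (h i) l y * (t z - t y) ^+ l) *: T i q y).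
  by have [_ _ c] := hW1 i; apply: c => // x /hW'[].
have A2 (l : 'I_n.+1) : JJnul m n W' (fun q y z => (t z - t y) ^+ l *: (Phil l q y - Psil l q y)).
  have [a b c d] := hWD l.
  have s2 : W' `<=` (WD l).1 by move=> x /hW'[].
  apply: (JJnul_ext (JJnul_fst n l a oW' s2 (reg_res hX oW oW' sW rt) c)) => q y z Wq Wy _.
  by rewrite d //; exact: s2.
apply: (JJnul_ext (JJnulD (JJnul_sum A1) (JJnul_sum A2))) => q y z /sW Wq /sW Wy /sW Wz.
rewrite hX0 //.
under eq_bigr do rewrite scalerBl.
rewrite sumrB -[RHS]addr0 -addrA; congr (_ + _); apply/eqP.
rewrite addrC subr_eq0; apply/eqP.
under [RHS]eq_bigr do rewrite scaler_suml.
rewrite exchange_big; apply: eq_bigr => l _ /=.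
have [S [hS1 <-]] := hl l (ltn_ord l) q y Wq Wy.
have [e [H _]] := hqs y Wy.
have hS2 : HE y (acoord (qs y)) (fun z => Phi q y z - Psi q y z)
    (\sum_i (svec (acoord (qs y) (h i)) (T i q y) : vser V)).
  apply: (HE_ext (F := fun z => \sum_i h i z *: T i q y)).
    by apply: HE_sum => i; apply: HE_g; exact: (germ_of oW Wy (hT i).1).
  have Wn := open_near oW Wy; near=> z'; have Wz' : W z' by near: z'.
  by rewrite hX0.
rewrite (HE_uniq hX H hS1 hS2) vser_sum scaler_sumr; apply: eq_bigr => i _.
by rewrite /svec scalerA mulrC.
Unshelve. all: by end_near.
Qed.
End Triple.

Section Cocycle.
Variables (k : fieldType) (V : lmodType k) (A : gradedVA V) (R : autOAction A).
Variable X : funSpace k.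
Hypothesis hS : smooth_curve X.
Let hX : variety X := hS.1.
Implicit Types (P x y z : X) (f g h t : X -> k) (U W : set X) (q : autTorsor X).
Implicit Types (sg : autTorsor X -> V).
Local Notation E := (Vsheaf R (X := X)).
Local Notation ap := (@apt k X).
Local Notation Eres := (@Vsheaf_sub k V A R X).

Lemma tensk_germ W F x : open W -> tensO id (M := k^o) (@reg _ X) W F -> W x -> germ x (F x).
Proof.
move=> oW [N [f [g [h1 h2]]]] Wx.
apply: (germ_ext hX (f := fun y => \sum_i g i y * f i x)).
  apply: (germ_sum hX) => i _; apply: (germM hX); last exact: germ_c.
  exact: (germ_of oW Wx (h1 i).2).
have Wn := open_near oW Wx; near=> y; have Wy : W y by near: y.
exact: (esym (h2 x y Wx Wy)).
Unshelve. all: by end_near.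
Qed.

Lemma tensk_reg W t qs F l : open W -> coordinate W t ->
  (forall x, W x -> apt (qs x) = x /\ centred t x (acoord (qs x))) ->
  tensO id (M := k^o) (@reg _ X) W F -> reg W (fun x => acoord (qs x) (F x) l).
Proof.
move=> oW ht hqs tF; have [N [f [g [h1 h2]]]] := tF.
apply: (reg_germ hX oW) => x0 Wx0.
apply: (germ_ext hX (f := fun x => \sum_i hd qs (g i) l x * f i x)).
  apply: (germ_sum hX) => i _; apply: (germM hX); last exact: (germ_of oW Wx0 (h1 i).1).
  exact: (hd_germ hS oW ht hqs l Wx0 (germ_of oW Wx0 (h1 i).2)).
have Wn := open_near oW Wx0; near=> x; have Wx : W x by near: x.
have [e [H _]] := hqs x Wx.
have gi i : germ x (g i) := germ_of oW Wx (h1 i).2.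
have -> : acoord (qs x) (F x) = acoord (qs x) (fun y => \sum_i g i y * f i x).
  apply: (fc_ext hX H); first exact: (tensk_germ oW tF Wx).
  have Wn2 := open_near oW Wx; near=> y; have Wy : W y by near: y.
  exact: (h2 x y Wx Wy).
rewrite (fc_sum hX H) ?fps_sum; last first.
  by move=> i _; apply: (germM hX); [exact: gi | exact: germ_c].
suff E2 i : (acoord (qs x) (fun y => g i y * f i x) : fps k) l = hd qs (g i) l x * f i x.
  by apply: eq_bigr => i _; rewrite E2.
by rewrite (fcM H (gi i) (germ_c hX _ _)) (fc_c H) mulrC fcstM mulrC.
Unshelve. all: by end_near.
Qed.

Lemma Th_cocycle m n O sg N (v : 'I_N -> autTorsor X -> V) (p : 'I_N -> X -> X -> X -> k) :
  open O -> E O sg -> (forall i, E O (v i)) ->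
  (forall i, pp_section (M := k^o) id (@reg _ X) n O (p i)) ->
  (forall P, O P -> modJ ap E n P (Th R n sg P) (fun q y => \sum_i p i P (ap q) y *: v i q)) ->
  forall P, O P -> modJJ ap E m n P
    (fun q y z => \sum_i p i P y z *: Th R m (v i) P q y)
    (fun q y z => Th R (m + n)%N sg P q z).
Proof.
move=> oO hE hv hp heq P OP.
have [W0 [t [oW0 W0P W0O ht0 _]]] := coord_ex hS oO OP.
have [qs hqs0] := coord_sec hS ht0.
have P1 i : exists W, [/\ open W, W P & tensO id (M := k^o) (@reg _ X) W (p i P)].
  by have [W [a b _ c _]] := hp i P OP; exists W.
have [WA hWA] := choice P1.
have P2 i : exists W', [/\ open W', W' P, W' `<=` O, tensO ap E W' (Th R m (v i) P) & forall q, W' (apt q) ->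
    exists2 S, HE (apt q) (acoord q) (Th R m (v i) P q) S & forall j, (j <= m)%N -> S j = Jet R (v i) q j].
  exact: (jrep_res hS oO OP (ThP hS m oO (hv i) OP)).
have [WB hWB] := choice P2.
have [W1 [oW1 W1P _ tT hT]] := jrep_res hS oO OP (ThP hS (m + n) oO hE OP).
have [W2 [oW2 W2P _ _ hTn]] := jrep_res hS oO OP (ThP hS n oO hE OP).
have [W3 [oW3 W3P hD]] := modJ_HE hS (heq P OP).
have : \forall x \near P, [/\ W0 x, W1 x, W2 x, W3 x & forall i, WA i x /\ WB i x].
  have n0 := open_near oW0 W0P; have n1 := open_near oW1 W1P; have n2 := open_near oW2 W2P.
  have n3 := open_near oW3 W3P.
  have nA : \forall x \near P, forall i, WA i x.
    by apply: filter_forall => i; have [a b _] := hWA i; exact: open_near.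
  have nB : \forall x \near P, forall i, WB i x.
    by apply: filter_forall => i; have [a b _ _ _] := hWB i; exact: open_near.
  near=> x; split; try by near: x.
  have hA : forall i, WA i x by near: x.
  have hB : forall i, WB i x by near: x.
  by move=> i.
move=> /nearP [W [oW WP hW]].
have s0 : W `<=` W0 by move=> x /hW[].
have s1 : W `<=` W1 by move=> x /hW[].
have WO : W `<=` O by move=> x /s0; exact: W0O.
have sA i : W `<=` WA i by move=> x /hW[_ _ _ _ /(_ i)[]].
have sB i : W `<=` WB i by move=> x /hW[_ _ _ _ /(_ i)[]].
have ht := coord_res hS oW0 oW s0 ht0.
have hqs x : W x -> apt (qs x) = x /\ centred t x (acoord (qs x)) by move/s0; exact: hqs0.
have Er U' W' (s : X -> k^o) : open U' -> open W' -> W' `<=` U' -> reg (f := X) U' s -> reg (f := X) W' s.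
  by move=> oU oW' UW; exact: (reg_res hX).
have tp i : tensO id (M := k^o) (@reg _ X) W (p i P).
  by have [a b c] := hWA i; exact: (tens_res hS Er a oW (sA i) c).
have tB i : tensO ap E W (Th R m (v i) P).
  by have [a b _ c _] := hWB i; exact: (tens_res hS Eres a oW (sB i) c).
have [M [s [h [hs hTE]]]] := tens_res hS Eres oW1 oW s1 tT.
have Es i := (hs i).1; have rh i := (hs i).2.
pose pil i l y := acoord (qs y) (p i P y) l.
have rpil i l : reg W (pil i l) by exact: (tensk_reg l oW ht hqs (tp i)).
have hvW i : E W (v i) := Vsheaf_res WO (hv i).
have jetv l x : (l <= n)%N -> W x -> Jet R sg (qs x) l = \sum_i pil i l x *: v i (qs x).
  move=> ln Wx; have [e [H _]] := hqs x Wx.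
  have Wx' : W (apt (qs x)) by rewrite e.
  have [S hS1 S0] := hD (qs x) (ltac:(by have [] := hW _ Wx')).
  have [S1 hS2 S1E] := hTn (qs x) (ltac:(by have [] := hW _ Wx')).
  rewrite e in hS1 hS2.
  have hS3 : HE x (acoord (qs x)) (fun y => \sum_i p i P x y *: v i (qs x))
      (\sum_i (svec (acoord (qs x) (p i P x)) (v i (qs x)) : vser V)).
    by apply: HE_sum => i; apply: HE_g; exact: (tensk_germ oW (tp i) Wx).
  have : S1 = S + \sum_i (svec (acoord (qs x) (p i P x)) (v i (qs x)) : vser V).
    apply: (HE_uniq hX H hS2); apply: (HE_ext (HED hS1 hS3)); apply: nearW => y.
    by rewrite /= subrK.
  by move/(congr1 (fun S : vser V => S l)); rewrite S1E // vserD S0 // add0r vser_sum.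
pose sv l q := \sum_i pil i l (apt q) *: v i q.
have svE l : E W (sv l).
  by apply: (Vsheaf_sum hS oW) => i; exact: (VsheafZ hS oW (rpil i l) (hvW i)).
have svw l q : (l <= n)%N -> W (apt q) -> sv l q = wsec R t qs sg l q.
  move=> ln Wq; have [e c] := hqs _ Wq.
  have Wq' : W (apt (qs (apt q))) by rewrite e.
  rewrite (sg_Pi hS oW ht hqs (svE l) Wq Wq).
  rewrite /wsec (jetv l _ ln Wq); congr (Pi R _ _).
  by rewrite /sv e.
pose Phil l q y := \sum_i pil i l y *: Th R m (v i) P q y.
pose Psil l q y := \sum_a hd qs (h a) l y *: s a q.
apply: (JJ_crit (W := W) (t := t) (qs := qs) (Phil := Phil) (Psil := Psil) hS oW WP ht hqs).
- have j1 : JJrep R W (fun q y z => \sum_i p i P y z *: Th R m (v i) P q y).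
    apply: JJrep_sum => i; have [Ni [fi [gi [hi1 hi2]]]] := tp i.
    have j3 : JJrep R W (fun q y z => \sum_a gi a z *: (fi a y *: Th R m (v i) P q y)).
      apply: JJrep_sum => a; apply: JJrep_gen; first exact: (hi1 a).2.
      by apply: (tens_muly hS oW _ (tB i)); exact: (hi1 a).1.
    apply: (JJrep_ext j3) => q y z Wq Wy Wz.
    have -> : p i P y z = \sum_a gi a z * fi a y by exact: (hi2 y z Wy Wz).
    by rewrite scaler_suml; apply: eq_bigr => a _; rewrite scalerA.
  have j2 : JJrep R W (fun q y z => \sum_a h a z *: (-1 *: s a q)).
    apply: JJrep_sum => a; apply: JJrep_gen; first exact: rh.
    apply: (tensZ hS (VsheafZ hS) (-1) oW (Phi := fun q _ => s a q)).
    by apply: (tens_ext (tens_gen ap (Es a) (reg_c hS 1 oW))) => q y _ _; rewrite scale1r.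
  apply: (JJrep_ext (JJrepD j1 j2)) => q y z Wq Wy Wz; congr (_ + _).
  rewrite hTE // -sumrN; apply: eq_bigr => a _.
  by rewrite scaleN1r scalerN.
- move=> l ln; apply: (tens_crit hS oW WP ht hqs oW WP).
  + apply: tensO_sum => i; exact: (tens_muly hS oW (rpil i l) (tB i)).
  + apply: tensO_sum => a; apply: (tens_gen ap (Es a)); exact: (hd_reg hS oW ht hqs l (rh a)).
  move=> x Wx _; have [e [H _]] := hqs x Wx.
  have Wx' : W (apt (qs x)) by rewrite e.
  have HB i : exists S, HE x (acoord (qs x)) (Th R m (v i) P (qs x)) S /\
      forall j, (j <= m)%N -> S j = Jet R (v i) (qs x) j.
    have [_ _ _ _ hB] := hWB i; have [S a b] := hB (qs x) (sB i _ Wx').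
    by exists S; rewrite -{1}e.
  have [SB hSB] := choice HB.
  have [S1 hS1 S1E] := hT (qs x) (s1 _ Wx'); rewrite e in hS1.
  have ES1 : S1 = \sum_a (svec (acoord (qs x) (h a)) (s a (qs x)) : vser V).
    apply: (HE_uniq hX H hS1).
    by have := tens_HE (q := qs x) oW Wx' hs hTE; rewrite e.
  exists (\sum_i (acoord (qs x) (pil i l) : fps k) *: SB i), (vhasse l S1); split.
  + by apply: HE_sum => i; apply: (HEZ hX H (germ_of oW Wx (rpil i l))); case: (hSB i).
  + rewrite ES1 vhasse_sum; apply: HE_sum => a; rewrite vhasse_svec.
    have ga := germ_of oW Wx (rh a).
    rewrite -(hd_comp hS oW ht hqs l Wx ga); apply: HE_g; exact: (hd_germ hS oW ht hqs l Wx ga).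
  + move=> j jm.
    have hl : S1 (j + l)%N = Jet R sg (qs x) (j + l)%N by apply: S1E; lia.
    rewrite /vhasse hl -[RHS]/(vhasse l (Jet R sg (qs x)) j).
    rewrite -(Jet_wsec hS oW ht hqs oO hE WO l Wx).
    rewrite -(Jet_ext hS oW (svE l) (wsec_V hS oW ht hqs oO hE WO l) Wx' (fun q Wq => svw l q ln Wq)).
    rewrite (Jet_sum hS oW (F := fun i q => pil i l (apt q) *: v i q)) //; last first.
      by move=> i; exact: (VsheafZ hS oW (rpil i l) (hvW i)).
    rewrite !vser_sum; apply: eq_bigr => i _.
    rewrite (JetZ hS oW (rpil i l) (hvW i) Wx') !vserZ; apply: eq_bigr => a _.
    by congr (_ *: _); apply: (hSB i).2; lia.
- move=> l ln q y Wq Wy; have [e [H _]] := hqs y Wy.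
  exists (\sum_i (svec (acoord (qs y) (p i P y)) (Th R m (v i) P q y) : vser V) -
     \sum_a (svec (acoord (qs y) (h a)) (s a q) : vser V)); split; last first.
    by rewrite vserD vserN !vser_sum.
  have h1 : HE y (acoord (qs y)) (fun z => \sum_i p i P y z *: Th R m (v i) P q y)
      (\sum_i (svec (acoord (qs y) (p i P y)) (Th R m (v i) P q y) : vser V)).
    by apply: HE_sum => i; apply: HE_g; exact: (tensk_germ oW (tp i) Wy).
  have h2 : HE y (acoord (qs y)) (fun z => \sum_a h a z *: s a q)
      (\sum_a (svec (acoord (qs y) (h a)) (s a q) : vser V)).
    by apply: HE_sum => a; apply: HE_g; exact: (germ_of oW Wy (rh a)).
  have h3 := HED h1 (HEZ hX H (germ_c hX y (-1)) h2).
  rewrite (fc_c H) rmorphN1 scaleN1r in h3.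
  apply: (HE_ext h3); have Wn := open_near oW Wy; near=> z; have Wz : W z by near: z.
  by rewrite hTE // scaleN1r.
Unshelve. all: by end_near.
Qed.
End Cocycle.

Theorem proposition6p23
    (k : closedFieldType) (V : lmodType k) (A : gradedVA V)
    (R : autOAction A) (L : moebius A) (hRL : compatible R L)
    (C Ct : funSpace k) (eta : Ct -> C)
    (hC : nodal_curve C) (heta : normalization eta) (br : branches eta) :
  exists Th : nat -> (autTorsor Ct -> V) -> Ct -> autTorsor Ct -> Ct -> V,
    [/\ canonical_connection R Th,
        forall n (U : set Ct) sg, open U -> Vtilde R br U sg ->
          tens_log R eta id (Vtilde R br) (PCt_log br) n U (Th n sg)
      & log_PD_connection R br (VC R L br) Th].
Proof.
have hS : smooth_curve Ct by case: heta.
have hX := hS.1; have hm : morphism_of_varieties eta by case: heta.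
exists (@Th k V A R Ct); split.
- exact: canonical_Th.
- by move=> n U sg; exact: (Vtilde_tens_log hC heta).
have oeta (U : set C) : open U -> open (eta @^-1` U) by case/hm.
have EV U sg : VC R L br U sg -> Vsheaf R (eta @^-1` U) sg by move=> [[]].
have crit n m n' (U : set C) P Phi Psi (J J' : autTorsor Ct -> vser V) : open U -> (eta @^-1` U) P ->
    (n <= m)%N -> (n <= n')%N ->
    (forall q, U (eta (apt q)) -> forall j, (j <= n)%N -> J q j = J' q j) ->
    jrep R m P Phi J -> jrep R n' P Psi J' -> modJ (@apt _ Ct) (Vsheaf R (X := Ct)) n P Phi Psi.
  move=> oU UP nm nn' e h h'.
  exact: (jrep_crit hS (oeta _ oU) UP e (jrep_sub nm h) (jrep_sub nn' h')).
split.
- split; first by move=> n U sg; exact: (VC_tens_log hC heta).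
  move=> n U sg sg' oU h h' e P [UP _].
  apply: (crit n n n U P _ _ _ _ oU UP _ _ _ (ThP hS n (oeta _ oU) (EV _ _ h) UP) (ThP hS n (oeta _ oU) (EV _ _ h') UP)) => //.
  by move=> q Uq j _; rewrite (Jet_ext hS (oeta _ oU) (EV _ _ h) (EV _ _ h') Uq).
- split.
    move=> n U sg sg' oU h h' P [UP _].
    have oU' := oeta _ oU; have [hE hE'] := (EV _ _ h, EV _ _ h').
    have [W [oW WP WU t1 j1]] := jrep_res hS oU' UP (ThP hS n oU' hE UP).
    have [W' [oW' W'P W'U t2 j2]] := jrep_res hS oU' UP (ThP hS n oU' hE' UP).
    have oI := openI oW oW'.
    apply: (crit n n n U P _ _ _ (fun q => Jet R sg q + Jet R sg' q) oU UP _ _ _ (ThP hS n oU' (VsheafD hS oU' hE hE') UP)) => //.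
      by move=> q Uq j _; rewrite (JetD hS oU' hE hE' Uq).
    exists (W `&` W'); split=> //.
      apply: tensD.
        by apply: (tens_res hS (@Vsheaf_sub k V A R Ct) oW oI _ t1) => x [].
      by apply: (tens_res hS (@Vsheaf_sub k V A R Ct) oW' oI _ t2) => x [].
    move=> q [Wq W'q]; have [S hS1 SE] := j1 q Wq; have [S' hS1' SE'] := j2 q W'q.
    exists (S + S'); first exact: HED.
    by move=> j jn; rewrite !vserD SE // SE'.
  move=> n U sg f oU h rf P [UP _].
  have oU' := oeta _ oU; have hE := EV _ _ h.
  have rf' : reg (eta @^-1` U) (f \o eta) by have [_ h2] := hm U oU; exact: h2.
  have [W [oW WP WU t1 j1]] := jrep_res hS oU' UP (ThP hS n oU' hE UP).
  apply: (crit n n n U P _ _ _ (fun q => (acoord q (f \o eta) : fps k) *: Jet R sg q) oU UP _ _ _ (ThP hS n oU' (VsheafZ hS oU' rf' hE) UP)) => //.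
    by move=> q Uq j _; rewrite (JetZ hS oU' rf' hE Uq).
  exists W; split=> //; first exact: (tens_muly hS oW (reg_res hX oU' oW WU rf') t1).
  move=> q Wq; have [S hS1 SE] := j1 q Wq.
  exists ((acoord q (f \o eta) : fps k) *: S); first exact: (HEZ hX (acoordP q) (germ_of oU' (WU _ Wq) rf') hS1).
  move=> j jn; rewrite !vserZ; apply: eq_bigr => i _; congr (_ *: _); apply: SE; lia.
- move=> U sg oU h P [UP _]; have oU' := oeta _ oU; have hE := EV _ _ h.
  apply: (crit 0%N 0%N 0%N U P _ _ _ (fun q => svec (1 : fps k) (sg q)) oU UP _ _ _ (ThP hS 0%N oU' hE UP)) => //.
    by move=> q Uq [|//] _; rewrite (Jet0E hS oU' hE Uq) /svec scale1r.
  exists (eta @^-1` U); split=> //.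
    by apply: (tens_ext (tens_gen _ hE (reg_c hS 1 oU'))) => q y _ _; rewrite scale1r.
  move=> q Uq; exists (svec (1 : fps k) (sg q)) => //.
  have := @HE_g k V Ct (apt q) (acoord q) (fun=> 1) (sg q) (germ_c hX _ _).
  rewrite (fc_c (acoordP q)) rmorph1 => hh; apply: (HE_ext hh); apply: nearW => y.
  by rewrite scale1r.
- move=> m n U sg mn oU h P [UP _]; have oU' := oeta _ oU; have hE := EV _ _ h.
  exact: (crit m n m U P _ _ _ _ oU UP mn (leqnn m) (fun q _ j _ => erefl) (ThP hS n oU' hE UP) (ThP hS m oU' hE UP)).
- move=> m n U sg N v p oU h hvp heq P UP nP.
  have oO : open (off_nodes eta (eta @^-1` U)) by exact: (open_off hC heta (oeta _ oU)).
  apply: (Th_cocycle (O := off_nodes eta (eta @^-1` U)) hS m oO) => //.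
  + exact: (Vsheaf_res (@off_sub _ _ _ _ _) (EV _ _ h)).
  + by move=> i; apply: (Vsheaf_res (@off_sub _ _ _ _ _)); apply: EV; case: (hvp i).
  + by move=> i; case: (hvp i) => _ [].
Qed.
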